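(* Let $A:=(V,m_2,\omega)$ be a strictly graded commutative Frobenius algebra and let $m$ and $m'$ be two minimal symplectic $C_{n+1}$-structures ($n\ge3$) on $V$ whose underlying Frobenius algebra is $A$. Then the assignment sending a pointed symplectic $C_n$-morphism $\phi$ from $\bar m$ to $\bar m'$ to the 0-form of order $n+1$ and degree $1+|\omega|$ $$\mathrm{obs}(\phi):=\Upsilon_{\mathrm{Lie}}^{-1}\left(\phi\circ m\circ\phi^{-1}-m'\right)\mod(n+2)$$ induces a map $$\mathrm{obs}_n:\mathcal{SM}_n(\bar m;\bar m')\to HC^{n+1,|\omega|}_{\mathrm{Harr}}(A),\qquad\phi\mapsto\mathrm{obs}(\phi).$$ The kernel of this map (the preimage of $0$) consists of precisely those symplectic $C_n$-morphisms which are extendable: $$\{\phi\in\mathcal{SM}_n(\bar m;\bar m'):\phi\text{ is extendable}\}=\ker(\mathrm{obs}_n).$$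
   Context: Conventions. $\mathbb K$ is an evenly graded commutative ring containing $\mathbb Q$; modules are graded $\mathbb K$-modules, cohomologically graded, with the Koszul sign rule. $(\Sigma V)^i=V^{i+1}$, $(\Sigma^{-1}V)^i=V^{i-1}$; $\Sigma V^*$ means $\mathrm{Hom}_{\mathbb K}(\Sigma V,\mathbb K)$. Profinite modules are inverse limits of free modules of finite rank. For $W$ profinite, $\widehat TW=\prod_{i\ge0}W^{\hat\otimes i}$ and $\widehat LW\subset\widehat TW$ is the Lie subalgebra of convergent (possibly infinite) linear combinations of Lie monomials. Vector field = continuous derivation; diffeomorphism = invertible continuous homomorphism; $\mathrm{Der}(X)$, $\mathrm{Aut}(X)$ are the Lie algebra and group of these. Elements of $W^{\hat\otimes n}$ have order $n$; an endomorphism of $\widehat LW$ has order $n$ if it takes elements of order $i$ to elements of order $i+n-1$. $(n)$ denotes the module of continuous endomorphisms of $\widehat L\Sigma V^*$ of order $\ge n$; for 0-forms, $\mathrm{mod}\,(k)$ means modulo 0-forms of order $\ge k$, so that $\mathrm{obs}(\phi)$ is the order $n+1$ component. A diffeomorphism is pointed if it is of the form $\mathrm{id}+\phi_2+\phi_3+\cdots$ with $\phi_i$ an endomorphism of order $i$. Lie de Rham complex. For $g=\widehat LW$ with $\widehat{\mathcal U}(g)=\widehat TW$: $\Omega^1_{\mathrm{Lie}}(g)$ is the quotient of $\widehat{\mathcal U}(g)\hat\otimes g$ (elements written $x\otimes dy$) by $x\otimes d[y,z]=xy\otimes dz-(-1)^{|z||y|}xz\otimes dy$, with $g$ acting by left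 multiplication. $\Omega^\bullet_{\mathrm{Lie}}(g)=g\ltimes\widehat L(\Sigma^{-1}\Omega^1_{\mathrm{Lie}}(g))$ with the unique differential $d$ extending $y\mapsto dy=1\otimes dy$ to a differential graded Lie algebra structure. $DR^\bullet_{\mathrm{Lie}}(g)$ is the quotient of $\Omega^\bullet_{\mathrm{Lie}}(g)\hat\otimes\Omega^\bullet_{\mathrm{Lie}}(g)$ by $x\otimes y=(-1)^{|x||y|}y\otimes x$ and $x\otimes[y,z]=[x,y]\otimes z$, with $d(x\otimes y)=dx\otimes y+(-1)^{|x|}x\otimes dy$. $i$-forms $DR^i$ are the $i$-fold suspension of the part of form-degree $i$ (so the degree of $dx\otimes dy\in DR^2$ is $|x|+|y|$). The order of a form is its tensor degree in $W$ minus its form degree. For a vector field $\xi$, $L_\xi$ and $i_\xi$ are the derivations of $\Omega^\bullet_{\mathrm{Lie}}(g)$ with $L_\xi(x)=\xi(x)$, $L_\xi(dx)=(-1)^{|\xi|}d(\xi(x))$, $i_\xi(x)=0$, $i_\xi(dx)=\xi(x)$; they induce operators on $DR^\bullet_{\mathrm{Lie}}(g)$ by the Leibniz rule. A diffeomorphism $\phi$ induces $\phi^*$ on forms. A homogeneous 2-form $\omega$ is symplectic if $d\omega=0$ and $\Phi:\mathrm{Der}(g)\to DR^1_{\mathrm{Lie}}(g)$, $\Phi(\xi)=i_\xi(\omega)$, is bijective. $\xi$ is symplectic if $L_\xi\omega=0$; $\phi$ is a symplectomorphism if $\phi^*\omega=\omega$. Frobenius algebras and cyclic Harrison cohomology.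 A strictly graded commutative Frobenius algebra $A=(V,m_2,\omega)$ consists of a free graded module $V$ of finite rank, a symplectic form $\omega\in DR^2_{\mathrm{Lie}}(\widehat L\Sigma V^* )$ of order zero and a symplectic vector field $m_2$ on $\widehat L\Sigma V^*$ of order 2 and degree one with $m_2^2=0$. $CC^\bullet_{\mathrm{Harr}}(A)=\Sigma DR^0_{\mathrm{Lie}}(\widehat L\Sigma V^* )$ with differential $L_{m_2}$; a 0-form has bidegree $(i,j)$ if it has order $i$ and degree $j$ in $\Sigma DR^0_{\mathrm{Lie}}$ (i.e. degree $j+1$ as a 0-form); $HC^{ij}_{\mathrm{Harr}}(A)$ is the bigraded cohomology. $\Upsilon_{\mathrm{Lie}}(\alpha):=(-1)^{|\alpha|}\Phi^{-1}(d\alpha)$ is an isomorphism from $CC^\bullet_{\mathrm{Harr}}(A)$ (suitably shifted by $|\omega|-2$) onto the complex of symplectic vector fields (with differential $[m_2,-]$, inside $\Sigma^{-1}\mathrm{Der}(\widehat L\Sigma V^* )$); it takes 0-forms of order $k+1$ to symplectic vector fields of order $k$. Minimal symplectic $C_n$-structures ($n\ge3$). With $V$ free of finite rank and $\omega$ symplectic of order zero, these are symplectic vector fields $m=m_2+\dots+m_{n-1}$ on $\widehat L\Sigma V^*$ of degree one, $m_i$ of order $i$, with $m^2=0\mod(n+1)$; the underlying Frobenius algebra is $(V,m_2,\omega)$. For a symplectic $C_{n+1}$-structure $m=m_2+\dots+m_n$, $\bar m:=m_2+\dots+m_{n-1}$. Morphisms. A minimal symplectic $C_n$-morphism from $m$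 to $m'$ is a symplectomorphism $\phi$ of $\widehat L\Sigma V^*$ of degree zero with $\phi\circ m=m'\circ\phi\mod(n)$; two such, $\phi,\phi'$, are homotopic if $\phi=\phi'\circ\exp([m,\eta])\mod(n-1)$ for a symplectic vector field $\eta$ of degree $-1$. $\mathcal{SM}_n(m;m')$ (for $m,m'$ with the same underlying Frobenius algebra) is the set of pointed minimal symplectic $C_n$-morphisms modulo homotopy. For minimal symplectic $C_{n+1}$-structures $m,m'$ with the same underlying Frobenius algebra, a pointed symplectic $C_n$-morphism $\phi$ from $\bar m$ to $\bar m'$ is extendable if there is a symplectic vector field $\gamma$ of order $n-1$ and degree zero such that $\exp(\gamma)\circ\phi$ is a symplectic $C_{n+1}$-morphism from $m$ to $m'$. *)

(* Defs.v *)
From HB Require Import structures.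
From mathcomp Require Import all_boot all_order all_algebra.
From mathcomp Require Import boolp classical_sets functions.

Set Implicit Arguments.
Unset Strict Implicit.
Unset Printing Implicit Defensive.

Import GRing.Theory.

Local Open Scope classical_set_scope.
Local Open Scope ring_scope.

(* An evenly graded commutative ring containing the rationals: [gpart i] is the
   homogeneous part of degree [i] of an internal direct sum decomposition. A
   nonzero commutative algebra over [rat] is a commutative ring containing the
   rationals. *)
Record evenRing := EvenRing {
  ering :> comAlgType rat;
  gpart : int -> set ering;
  gpart0 : forall i, gpart i 0;
  gpartB : forall i a b, gpart i a -> gpart i b -> gpart i (a - b);
  gpart1 : gpart 0 1;
  gpartM : forall i j a b, gpart i a -> gpart j b -> gpart (i + j) (a * b);
  gpart_odd : forall i a, odd (absz i) -> gpart i a -> a = 0;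
  gpart_span : forall a, exists (s : seq int) (c : int -> ering),
    (forall i, gpart i (c i)) /\ a = \sum_(i <- s) c i;
  gpart_direct : forall (s : seq int) (c : int -> ering), uniq s ->
    (forall i, gpart i (c i)) -> \sum_(i <- s) c i = 0 ->
    forall i, i \in s -> c i = 0
}.

Section Modules.
Variable K : evenRing.

(* [ksgn n] is (-1)^n. *)
Definition ksgn (n : int) : K := (-1) ^+ absz n.

Inductive span (X : Type) (A : set (X -> K)) : set (X -> K) :=
| span_nil : span A (fun=> 0)
| span_cons a x y : A x -> span A y -> span A (fun i => a * x i + y i).

(* A profinite graded module is presented as a subquotient of a module of
   functions [X -> K], that is, of (possibly infinite) linear combinations of
   the elements of a set [X] of homogeneous symbols of degree [dg] and weight
   [wt]: the closed span of [gen] modulo the closed span of [rel]. The weight is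
   the tensor degree; it defines the topology, the functions vanishing on the
   symbols of weight < n being a basis of neighbourhoods of 0. *)
Record pmod := PMod {
  sym : Type;
  dg : sym -> int;
  wt : sym -> nat;
  gen : set (sym -> K);
  rel : set (sym -> K)
}.

Definition cspan (X : Type) (w : X -> nat) (A : set (X -> K)) : set (X -> K) :=
  [set x | forall n, exists2 y, span A y & forall i, (w i <= n)%N -> x i = y i].

Definition pmem (M : pmod) : set (sym M -> K) := cspan (@wt M) (@gen M).
Definition prel (M : pmod) : set (sym M -> K) := cspan (@wt M) (@rel M).

Definition coset (M : pmod) (x : sym M -> K) : set (sym M -> K) :=
  [set y | pmem y /\ prel (fun i => y i - x i)].

Definition pcar (M : pmod) : Type :=
  {C : set (sym M -> K) | exists2 x, pmem x & C = coset x}.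

Lemma span_lin (X : Type) (A : set (X -> K)) a x y :
  span A x -> span A y -> span A (fun i => a * x i + y i).
Proof.
move=> Ax Ay; elim: Ax => [|b u v Au _ IH].
  have -> : (fun i => a * 0 + y i) = y by apply: funext => i; rewrite mulr0 add0r.
  by [].
have -> : (fun i => a * (b * u i + v i) + y i) =
          (fun i => (a * b) * u i + (a * v i + y i)).
  by apply: funext => i; rewrite mulrDr mulrA addrA.
exact: span_cons.
Qed.

Lemma cspan0 (X : Type) w (A : set (X -> K)) : cspan w A (fun=> 0).
Proof. by move=> n; exists (fun=> 0) => //; exact: span_nil. Qed.

Lemma cspan_lin (X : Type) w (A : set (X -> K)) a x y :
  cspan w A x -> cspan w A y -> cspan w A (fun i => a * x i + y i).
Proof.
move=> Ax Ay n; have [x' Ax' ex] := Ax n; have [y' Ay' ey] := Ay n.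
exists (fun i => a * x' i + y' i); first exact: span_lin.
by move=> i wi; rewrite ex // ey.
Qed.

Section Carrier.
Variable M : pmod.
Implicit Types (x y : sym M -> K) (u v : pcar M).

Lemma pmem_lin a x y : pmem x -> pmem y -> pmem (fun i => a * x i + y i).
Proof. exact: cspan_lin. Qed.

Lemma prel_lin a x y : prel x -> prel y -> prel (fun i => a * x i + y i).
Proof. exact: cspan_lin. Qed.

Definition cls x : pcar M :=
  match pselect (pmem x) with
  | left Mx => exist _ (coset x) (ex_intro2 _ _ x Mx erefl)
  | right _ => exist _ (coset (fun=> 0)) (ex_intro2 _ _ _ (cspan0 _ _) erefl)
  end.

Definition rep u : sym M -> K := xget (fun=> 0) (sval u).

Lemma cosetxx x : pmem x -> coset x x.
Proof.
move=> Mx; split=> //.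
have -> : (fun i => x i - x i) = fun=> 0 by apply: funext => i; rewrite subrr.
exact: cspan0.
Qed.

Lemma coset_eq x y : prel (fun i => y i - x i) -> coset x = coset y.
Proof.
move=> Rxy; apply/seteqP; split=> z [Mz Rz]; split=> //.
  have -> : (fun i => z i - y i) = (fun i => -1 * (y i - x i) + (z i - x i)).
    by apply: funext => i; rewrite mulN1r opprB [RHS]addrC addrA subrK.
  exact: prel_lin.
have -> : (fun i => z i - x i) = (fun i => 1 * (y i - x i) + (z i - y i)).
  by apply: funext => i; rewrite mul1r [RHS]addrC addrA subrK.
exact: prel_lin.
Qed.

Lemma svalcls x : pmem x -> sval (cls x) = coset x.
Proof. by move=> Mx; rewrite /cls; case: pselect. Qed.

Lemma pcarP u v : sval u = sval v -> u = v.
Proof.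
case: u v => [C pC] [D pD] /= eCD; case: _ / eCD in pD *.
by congr exist; exact: Prop_irrelevance.
Qed.

Lemma rep_in u : sval u (rep u).
Proof.
rewrite /rep; apply: xgetPex; case: u => C /= [x Mx ->].
by exists x; exact: cosetxx.
Qed.

Lemma pmem_rep u : pmem (rep u).
Proof. by have := rep_in u; case: {1}u => C /= [x _ ->] []. Qed.

Lemma clsP x y : pmem x -> pmem y -> prel (fun i => y i - x i) -> cls x = cls y.
Proof. by move=> Mx My Rxy; apply: pcarP; rewrite !svalcls //; exact: coset_eq. Qed.

Lemma repK u : cls (rep u) = u.
Proof.
apply: pcarP; rewrite svalcls; last exact: pmem_rep.
have [x Mx eC] := proj2_sig u; have := rep_in u; rewrite eC => -[_ Rr].
by rewrite (coset_eq Rr).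
Qed.

Lemma rep_cls x : pmem x -> prel (fun i => rep (cls x) i - x i).
Proof. by move=> Mx; have := rep_in (cls x); rewrite svalcls // => -[]. Qed.

Definition plin (a : K) u v : pcar M := cls (fun i => a * rep u i + rep v i).

Lemma plin_cls a x y : pmem x -> pmem y ->
  plin a (cls x) (cls y) = cls (fun i => a * x i + y i).
Proof.
move=> Mx My; apply: clsP; [exact/pmem_lin/pmem_rep/pmem_rep|exact: pmem_lin|].
have -> : (fun i => a * x i + y i - (a * rep (cls x) i + rep (cls y) i)) =
  (fun i => - a * (rep (cls x) i - x i) +
            (-1 * (rep (cls y) i - y i) + 0)).
  apply: funext => i.
  by rewrite addr0 mulN1r opprB mulNr -mulrN opprB mulrBr opprD addrACA.
apply: prel_lin; first exact: rep_cls.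
apply: (@prel_lin (-1) (fun i => _) (fun=> 0)); first exact: rep_cls.
exact: cspan0.
Qed.

Definition pzero : pcar M := cls (fun=> 0).
Definition padd u v := plin 1 u v.
Definition popp u := plin (-1) u pzero.
Definition pscale (a : K) u := plin a u pzero.

Lemma pmem0 : @pmem M (fun=> 0).
Proof. exact: cspan0. Qed.

Ltac pm := repeat apply: pmem_lin; first [exact: pmem_rep | exact: pmem0].
Ltac plins := repeat (rewrite plin_cls; [|by pm|by pm]).

Lemma paddA : associative padd.
Proof.
move=> u v w; rewrite -(repK u) -(repK v) -(repK w) /padd.
plins; congr cls; apply: funext => i.
by rewrite !mul1r addrA.
Qed.

Lemma paddC : commutative padd.
Proof.
move=> u v; rewrite -(repK u) -(repK v) /padd.
by plins; congr cls; apply: funext => i; rewrite !mul1r addrC.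
Qed.

Lemma padd0 : left_id pzero padd.
Proof.
move=> u; rewrite -(repK u) /padd /pzero; plins.
by congr cls; apply: funext => i; rewrite mulr0 add0r.
Qed.

Lemma paddN : left_inverse pzero popp padd.
Proof.
move=> u; rewrite -(repK u) /padd /popp /pzero; plins.
by congr cls; apply: funext => i; rewrite addr0 mul1r mulN1r addNr.
Qed.

HB.instance Definition _ := gen_eqMixin (pcar M).
HB.instance Definition _ := gen_choiceMixin (pcar M).
HB.instance Definition _ := GRing.isZmodule.Build (pcar M) paddA paddC padd0 paddN.

Lemma pscaleA a b u : pscale a (pscale b u) = pscale (a * b) u.
Proof.
rewrite -(repK u) /pscale /pzero; plins.
by congr cls; apply: funext => i; rewrite !addr0 mulrA.
Qed.

Lemma pscale1 : left_id 1 pscale.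
Proof.
move=> u; rewrite -(repK u) /pscale /pzero; plins.
by congr cls; apply: funext => i; rewrite addr0 mul1r.
Qed.

Lemma pscaleDr : right_distributive pscale +%R.
Proof.
move=> a u v; rewrite -[u]repK -[v]repK; rewrite -[_ + _]/(plin 1 _ _).
rewrite -[RHS]/(plin 1 _ _) /pscale /pzero; plins.
by congr cls; apply: funext => i; rewrite !addr0 !mul1r mulrDr.
Qed.

Lemma pscaleDl u : {morph pscale^~ u : a b / a + b}.
Proof.
move=> a b; rewrite -[u]repK.
rewrite -[RHS]/(plin 1 _ _) /pscale /pzero; plins.
by congr cls; apply: funext => i; rewrite !addr0 !mul1r mulrDl.
Qed.

HB.instance Definition _ := GRing.Zmodule_isLmodule.Build K (pcar M)
  pscaleA pscale1 pscaleDr pscaleDl.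

(* [x] has a representative all of whose coefficients satisfy [Q]. *)
Definition supp (Q : sym M -> K -> Prop) (u : pcar M) : Prop :=
  exists x, [/\ pmem x, u = cls x & forall i, Q i (x i)].

Definition homog (j : int) : set (pcar M) :=
  supp (fun i a => gpart (j - dg i) a).
Definition ordr (n : nat) : set (pcar M) :=
  supp (fun i a => wt i != n -> a = 0).
Definition ordge (n : nat) : set (pcar M) :=
  supp (fun i a => (wt i < n)%N -> a = 0).

Definition converges (u_ : nat -> pcar M) (l : pcar M) : Prop :=
  forall n, exists N, forall k, (N <= k)%N -> ordge n (u_ k - l).

End Carrier.

Definition clinear (M N : pmod) (f : pcar M -> pcar N) : Prop :=
  linear f /\ forall n, exists m, forall u, ordge m u -> ordge n (f u).

(* [shift k M] is the module M with all degrees raised by k; hence the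
   suspension is the shift by -1. *)
Definition shift (k : int) (M : pmod) : pmod :=
  @PMod (sym M) (fun i => dg i + k) (@wt M) (@gen M) (@rel M).

Definition quo (M : pmod) (R : set (sym M -> K)) : pmod :=
  @PMod (sym M) (@dg M) (@wt M) (@gen M) (@rel M `|` R).

Definition inl0 (X Y : Type) (x : X -> K) : X + Y -> K :=
  fun i => if i is inl j then x j else 0.
Definition inr0 (X Y : Type) (y : Y -> K) : X + Y -> K :=
  fun i => if i is inr j then y j else 0.

Definition dsum (M N : pmod) : pmod :=
  @PMod (sym M + sym N)%type
    (fun i => match i with inl j => dg j | inr j => dg j end)
    (fun i => match i with inl j => wt j | inr j => wt j end)
    [set z : sym M + sym N -> K | @pmem M (z \o inl) /\ @pmem N (z \o inr)]
    [set z : sym M + sym N -> K | @prel M (z \o inl) /\ @prel N (z \o inr)].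

Definition tens0 (X Y : Type) (x : X -> K) (y : Y -> K) : X * Y -> K :=
  fun i => x i.1 * y i.2.

Definition tens (M N : pmod) : pmod :=
  @PMod (sym M * sym N)%type
    (fun i => dg i.1 + dg i.2) (fun i => (wt i.1 + wt i.2)%N)
    [set z | exists (x : sym M -> K) (y : sym N -> K), [/\ pmem x, pmem y & z = tens0 x y]]
    [set z | exists (x : sym M -> K) (y : sym N -> K),
       [/\ pmem x, pmem y, prel x \/ prel y & z = tens0 x y]].

(* (x, y) |-> (-1)^{|x||y|} f(y, x), for f bilinear. As K is evenly graded, an
   element of degree j is a combination of symbols of degree congruent to j
   modulo 2. *)
Definition kswap (X Y Z : Type) (dX : X -> int) (dY : Y -> int)
    (f : (Y -> K) -> (X -> K) -> Z -> K) (x : X -> K) (y : Y -> K) : Z -> K :=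
  fun k => f y (fun i => if odd (absz (dX i)) then 0 else x i) k
         + f (fun j => ksgn (dY j) * y j)
             (fun i => if odd (absz (dX i)) then x i else 0) k.

Section FreeAlgebras.
Variable W : pmod.

Definition wdg (s : seq (sym W)) : int := \sum_(i <- s) dg i.
Definition wwt (s : seq (sym W)) : nat := (\sum_(i <- s) wt i)%N.

Definition one0 : seq (sym W) -> K := fun s => (nilp s)%:R.
Definition letter0 (b : sym W -> K) : seq (sym W) -> K :=
  fun s => if s is [:: i] then b i else 0.
Definition mul0 (x y : seq (sym W) -> K) : seq (sym W) -> K :=
  fun s => \sum_(k < (size s).+1) x (take k s) * y (drop k s).
Definition brk0 (x y : seq (sym W) -> K) : seq (sym W) -> K :=
  fun s => mul0 x y s - kswap wdg wdg mul0 x y s.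

Inductive tmonomial : set (seq (sym W) -> K) :=
| tmon_one : tmonomial one0
| tmon_cons b x : pmem b -> tmonomial x -> tmonomial (mul0 (letter0 b) x).

Inductive lmonomial : set (seq (sym W) -> K) :=
| lmon_letter b : pmem b -> lmonomial (letter0 b)
| lmon_brk x y : lmonomial x -> lmonomial y -> lmonomial (brk0 x y).

(* The two-sided ideal by which the tensor algebra on the functions on
   [sym W] must be divided when W is itself a quotient. *)
Definition tideal : set (seq (sym W) -> K) :=
  [set z | exists x r y, [/\ tmonomial x, pmem r /\ prel r, tmonomial y
                           & z = mul0 x (mul0 (letter0 r) y)]].

Definition talg : pmod := @PMod (seq (sym W)) wdg wwt tmonomial tideal.
Definition lalg : pmod := @PMod (seq (sym W)) wdg wwt lmonomial tideal.

Definition brk (x y : pcar lalg) : pcar lalg := @cls lalg (brk0 (rep x) (rep y)).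

End FreeAlgebras.

Section DeRham.
Variable W : pmod.

Notation g := (pcar (lalg W)).

Definition Om1 : pmod :=
  @quo (tens (talg W) (lalg W))
    [set z | exists (i j : int) (x y t : seq (sym W) -> K),
       [/\ @pmem (talg W) x,
           @pmem (lalg W) y /\ (forall s, gpart (i - wdg s) (y s)),
           @pmem (lalg W) t /\ (forall s, gpart (j - wdg s) (t s))
         & z = fun k => tens0 x (brk0 y t) k - tens0 (mul0 x y) t k
                        + ksgn (j * i) * tens0 (mul0 x t) y k]].

Definition sOm1 : pmod := shift 1 Om1.

(* The action of x in g on the completed tensor algebra of [sOm1] by
   derivations: on [sOm1], it is the left multiplication x.(a (x) dy) = xa (x) dy
   with the Koszul sign (-1)^{|x|} coming from the desuspension. *)
Fixpoint act0 (s : seq (sym sOm1)) (x : seq (sym W) -> K)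
    (l : seq (sym sOm1) -> K) : K :=
  match s with
  | [::] => 0
  | p :: s' =>
      \sum_(k < (size p.1).+1)
         ksgn (wdg (take k p.1)) * x (take k p.1) * l ((drop k p.1, p.2) :: s')
      + act0 s' (fun w => ksgn (wdg w * @dg sOm1 p) * x w) (fun w => l (p :: w))
  end.

Definition act (x : seq (sym W) -> K) (l : seq (sym sOm1) -> K) :
  seq (sym sOm1) -> K := fun s => act0 s x l.

(* The underlying module of the semidirect product of g and the completed free
   Lie algebra on [sOm1]; the latter is an ideal. *)
Definition Om : pmod := dsum (lalg W) (lalg sOm1).

Definition brkOm0 (z z' : sym Om -> K) : sym Om -> K := fun i =>
  match i with
  | inl s => brk0 (z \o inl) (z' \o inl) s
  | inr s => act (z \o inl) (z' \o inr) s
           - kswap (@wdg sOm1) (@wdg W) act (z \o inr) (z' \o inl) s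
           + @brk0 sOm1 (z \o inr) (z' \o inr) s
  end.

Definition brkOm (z z' : pcar Om) : pcar Om := @cls Om (brkOm0 (rep z) (rep z')).

(* y |-> y and y |-> 1 (x) dy, from g to the de Rham algebra. *)
Definition inOm (y : g) : pcar Om := @cls Om (inl0 (rep y)).
Definition dOm (y : g) : pcar Om :=
  @cls Om (inr0 (@letter0 sOm1 (tens0 (@one0 W) (rep y)))).

Definition derOm (k : int) (D : pcar Om -> pcar Om) : Prop :=
  [/\ clinear D,
      forall j z, homog j z -> homog (j + k) (D z)
    & forall j z z', homog j z ->
        D (brkOm z z') = brkOm (D z) z' + ksgn (k * j) *: brkOm z (D z')].

Definition fdOm (i : sym Om) : nat := if i is inr s then size s else 0%N.

Definition DR : pmod :=
  @quo (tens Om Om)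
    ([set z | exists (i j : int) (x y : sym Om -> K),
        [/\ pmem x /\ (forall s, gpart (i - dg s) (x s)),
            pmem y /\ (forall s, gpart (j - dg s) (y s))
          & z = fun k => tens0 x y k - ksgn (i * j) * tens0 y x k]] `|`
     [set z | exists x y t : sym Om -> K,
        [/\ pmem x, pmem y, pmem t
          & z = fun k => tens0 x (brkOm0 y t) k - tens0 (brkOm0 x y) t k]]).

Definition tensDR (x y : pcar Om) : pcar DR := @cls DR (tens0 (rep x) (rep y)).

Definition fdDR (i : sym DR) : nat := (fdOm i.1 + fdOm i.2)%N.

(* p-forms of degree a. The p-forms being suspended p times, their degree is the
   degree in [DR] minus p. *)
Definition form (p : nat) (a : int) : set (pcar DR) :=
  supp (fun i c => (fdDR i != p -> c = 0) /\ gpart (a + p%:Z - dg i) c).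

(* p-forms of degree a and order n, the order being the tensor degree minus the
   form degree. *)
Definition formo (p : nat) (a : int) (n : nat) : set (pcar DR) :=
  supp (fun i c => [/\ fdDR i != p -> c = 0, gpart (a + p%:Z - dg i) c
                     & wt i != (n + p)%N -> c = 0]).

Definition comp0 (n : nat) (u : pcar DR) : pcar DR :=
  cls (fun i => if wt i == n then rep u i else 0).

Definition vfield (k : int) (xi : g -> g) : Prop :=
  [/\ clinear xi,
      forall j x, homog j x -> homog (j + k) (xi x)
    & forall j x y, homog j x ->
        xi (brk x y) = brk (xi x) y + ksgn (k * j) *: brk x (xi y)].

Definition endo_ord (n : nat) (f : g -> g) : Prop :=
  forall i x, ordr i x -> ordr (i + n).-1%N (f x).

(* The module (n) of continuous endomorphisms of order at least n; "f = f' mod (n)"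
   is rendered as [endo_ge n (f - f')]. *)
Definition endo_ge (n : nat) (f : g -> g) : Prop :=
  clinear f /\ forall i x, ordr i x -> ordge (i + n).-1%N (f x).

Definition ebrk (k l : int) (f h : g -> g) : g -> g :=
  fun x => f (h x) - ksgn (k * l) *: h (f x).

Definition lie_hom (f : g -> g) : Prop :=
  clinear f /\ forall x y, f (brk x y) = brk (f x) (f y).

Definition diffeo (f : g -> g) : Prop :=
  lie_hom f /\ exists2 h, lie_hom h & cancel f h /\ cancel h f.

Definition finv (f : g -> g) : g -> g :=
  xget (fun=> 0) [set h | cancel f h /\ cancel h f].

Definition pointed (f : g -> g) : Prop :=
  exists f_ : nat -> g -> g,
    (forall i, (2 <= i)%N -> clinear (f_ i) /\ endo_ord i (f_ i)) /\
    forall x, converges (fun N => x + \sum_(2 <= i < N) f_ i x) (f x).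

Definition fexp (f : g -> g) : g -> g := fun x =>
  xget 0 [set y | converges
    (fun N => \sum_(0 <= k < N) ((k`!)%:R^-1 : rat)%:A *: iter k f x) y].

(* The operators below are characterized uniquely by the listed conditions; [xget]
   picks the function satisfying them. *)
Definition dd : pcar Om -> pcar Om :=
  xget (fun=> 0) [set D | [/\ derOm 1 D, forall z, D (D z) = 0
                            & forall y, D (inOm y) = dOm y]].

Definition lieOm (k : int) (xi : g -> g) : pcar Om -> pcar Om :=
  xget (fun=> 0) [set D | [/\ derOm k D,
    forall x, D (inOm x) = inOm (xi x)
  & forall x, D (dd (inOm x)) = ksgn k *: dd (inOm (xi x))]].

Definition contrOm (k : int) (xi : g -> g) : pcar Om -> pcar Om :=
  xget (fun=> 0) [set D | [/\ derOm (k - 1) D,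
    forall x, D (inOm x) = 0
  & forall x, D (dd (inOm x)) = inOm (xi x)]].

Definition pullOm (f : g -> g) : pcar Om -> pcar Om :=
  xget (fun=> 0) [set F | [/\ clinear F,
    forall z z', F (brkOm z z') = brkOm (F z) (F z'),
    forall x, F (inOm x) = inOm (f x)
  & forall z, F (dd z) = dd (F z)]].

Definition leibniz (k : int) (D : pcar Om -> pcar Om) : pcar DR -> pcar DR :=
  xget (fun=> 0) [set E | clinear E /\ forall j x y, homog j x ->
    E (tensDR x y) = tensDR (D x) y + ksgn (k * j) *: tensDR x (D y)].

Definition dDR : pcar DR -> pcar DR := leibniz 1 dd.
Definition lieDR (k : int) (xi : g -> g) := leibniz k (lieOm k xi).
Definition contrDR (k : int) (xi : g -> g) := leibniz (k - 1) (contrOm k xi).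
Definition pullDR (f : g -> g) : pcar DR -> pcar DR :=
  xget (fun=> 0) [set E | clinear E /\ forall x y,
    E (tensDR x y) = tensDR (pullOm f x) (pullOm f y)].

(* Phi on vector fields of degree k. *)
Definition Phi (om : pcar DR) (k : int) (xi : g -> g) : pcar DR :=
  contrDR k xi om.

(* Symplectic forms of degree w; the map Phi raises degrees by w, and it is
   bijective iff it is in each degree. *)
Definition symplectic_form (w : int) (om : pcar DR) : Prop :=
  [/\ form 2 w om, dDR om = 0
    & forall k : int, set_bij (vfield k) (form 1 (k + w)) (Phi om k)].

Definition symplectic_vfield (om : pcar DR) (k : int) (xi : g -> g) : Prop :=
  vfield k xi /\ lieDR k xi om = 0.

(* Symplectomorphisms of degree zero. *)
Definition symplecto (om : pcar DR) (f : g -> g) : Prop :=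
  [/\ diffeo f, forall j x, homog j x -> homog j (f x) & pullDR f om = om].

Definition Phi_inv (om : pcar DR) (k : int) (b : pcar DR) : g -> g :=
  xget (fun=> 0) [set xi | vfield k xi /\ Phi om k xi = b].

(* Upsilon on 0-forms of degree k + w, w being the degree of the symplectic form;
   its values are vector fields of degree k. *)
Definition Upsilon (w : int) (om : pcar DR) (k : int) (al : pcar DR) : g -> g :=
  fun x => ksgn (k + w) *: Phi_inv om k (dDR al) x.

Definition Upsilon_inv (w : int) (om : pcar DR) (k : int) (xi : g -> g) : pcar DR :=
  xget 0 [set al | form 0 (k + w) al /\ Upsilon w om k al = xi].

End DeRham.
End Modules.

(* A free graded module V of finite rank, given by the degrees of the elements of
   a homogeneous basis. *)
Record fgmod := FGMod { bas : finType; bdeg : bas -> int }.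

(* The module dual to the suspension of V, on the dual basis: the suspension
   lowers the degrees by 1 and dualizing changes their sign. *)
Definition susp_dual (K : evenRing) (V : fgmod) : pmod K :=
  @PMod K (bas V) (fun i => - (bdeg i - 1)) (fun=> 1%N) setT set0.

Record frobenius (K : evenRing) := Frobenius {
  frob_mod : fgmod;
  frob_deg : int;
  frob_form : pcar (DR (susp_dual K frob_mod));
  frob_m2 : pcar (lalg (susp_dual K frob_mod)) ->
            pcar (lalg (susp_dual K frob_mod));
  frob_symplectic : symplectic_form frob_deg frob_form;
  frob_order : formo 2 frob_deg 0 frob_form;
  frob_m2_symplectic : symplectic_vfield frob_form 1 frob_m2;
  frob_m2_order : endo_ord 2 frob_m2;
  frob_m2_square : forall x, frob_m2 (frob_m2 x) = 0
}.

Arguments frob_m2 [K] A _ : rename.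

Definition frob_W (K : evenRing) (A : frobenius K) : pmod K :=
  susp_dual K (frob_mod A).

Section Structures.
Variables (K : evenRing) (A : frobenius K).

Notation g := (pcar (lalg (frob_W A))).
Notation DRA := (pcar (DR (frob_W A))).
Notation om := (frob_form A).
Notation w := (frob_deg A).
Notation m2 := (frob_m2 A).

(* The components are those of order 2, ..., n - 1. *)
Definition total (n : nat) (m : nat -> g -> g) : g -> g :=
  fun x => \sum_(2 <= i < n) m i x.

(* Minimal symplectic C_n-structures with underlying Frobenius algebra A, given by
   their components (those of order at least n being irrelevant). *)
Definition Cn_structure (n : nat) (m : nat -> g -> g) : Prop :=
  [/\ forall i, (2 <= i < n)%N -> vfield 1 (m i) /\ endo_ord i (m i),
      symplectic_vfield om 1 (total n m),
      endo_ge n.+1 (fun x => total n m (total n m x))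
    & m 2%N = m2].

Definition Cn_morphism (n : nat) (mu mu' phi : g -> g) : Prop :=
  symplecto om phi /\ endo_ge n (fun x => phi (mu x) - mu' (phi x)).

Definition homotopic (n : nat) (mu phi phi' : g -> g) : Prop :=
  exists2 eta, symplectic_vfield om (-1) eta &
    endo_ge n.-1 (fun x => phi x - phi' (fexp (ebrk 1 (-1) mu eta) x)).

(* [classes S r] is the quotient of the set S by the equivalence relation r. *)
Definition classes (T : Type) (S : set T) (r : T -> T -> Prop) : Type :=
  {C : set T | exists2 x, S x & C = [set y | S y /\ r y x]}.

Definition classof (T : Type) (S : set T) (r : T -> T -> Prop) (x : T) (Sx : S x) :
  classes S r := exist _ [set y | S y /\ r y x] (ex_intro2 _ _ x Sx erefl).

Definition pointed_Cn_morphism (n : nat) (m m' : nat -> g -> g) : set (g -> g) :=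
  [set phi | pointed phi /\ Cn_morphism n (total n m) (total n m') phi].

(* The set SM_n, for the structures with components m_2, ..., m_{n-1} and
   m'_2, ..., m'_{n-1}. *)
Definition SM (n : nat) (m m' : nat -> g -> g) : Type :=
  classes (pointed_Cn_morphism n m m') (homotopic n (total n m)).

Definition SMclass (n : nat) (m m' : nat -> g -> g) (phi : g -> g)
    (hphi : pointed_Cn_morphism n m m' phi) : SM n m m' :=
  classof (homotopic n (total n m)) hphi.

(* The structures have components m_2, ..., m_n and m'_2, ..., m'_n; phi is a
   C_n-morphism. *)
Definition extendable (n : nat) (m m' : nat -> g -> g) (phi : g -> g) : Prop :=
  exists gamma, [/\ symplectic_vfield om 0 gamma, endo_ord n.-1 gamma
    & Cn_morphism n.+1 (total n.+1 m) (total n.+1 m') (fexp gamma \o phi)].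

(* The complex is the suspension of the module of 0-forms, whence the shift of the
   degree by 1; its bidegree is (order, degree). *)
Definition CCHarr (i : nat) (j : int) : set DRA := formo 0 (j + 1) i.

Definition ZHarr (i : nat) (j : int) : set DRA :=
  [set al | CCHarr i j al /\ lieDR 1 m2 al = 0].

(* For i = 0 the only cochain is 0. *)
Definition BHarr (i : nat) (j : int) : set DRA :=
  [set lieDR 1 m2 be | be in CCHarr i.-1 (j - 1)].

Definition cohomologous (i : nat) (j : int) (al be : DRA) : Prop :=
  BHarr i j (al - be).

(* The cohomology in bidegree (i, j), as a set of cosets of coboundaries. *)
Definition HCHarr (i : nat) (j : int) : Type :=
  classes (ZHarr i j) (cohomologous i j).

Lemma ZHarr0 i j : ZHarr i j 0.
Proof.
split.
  exists (fun=> 0); split=> [||s]; [exact: cspan0|by []|].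
  by split=> //; exact: gpart0.
rewrite /lieDR /leibniz; case: xgetP => // E _ [[linE _] _].
by have := linE (-1) 0 0; rewrite scaler0 addr0 scaleN1r addNr.
Qed.

Definition HCclass (i : nat) (j : int) (al : DRA) (hal : ZHarr i j al) :
  HCHarr i j := classof (cohomologous i j) hal.

(* m and m' are C_{n+1}-structures, so that the components m_n and m'_n occur. *)
Definition obs (n : nat) (m m' : nat -> g -> g) (phi : g -> g) : DRA :=
  comp0 n.+1 (Upsilon_inv w om 1
    (fun x => phi (total n.+1 m (finv phi x)) - total n.+1 m' x)).

End Structures.

(* Main.v *)
(* Write psi = phi m phi^-1 - m'. It is a symplectic vector field of order at least
   n, and obs(phi) is the Hamiltonian of its component psi_n of order n. Comparing
   orders in (m' + psi)^2 = phi m^2 phi^-1 gives [m_2, psi_n] = 0, that is, obs(phi)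
   is a cocycle. If phi and phi' are homotopic by eta, the component delta of order
   n - 1 of phi - phi' exp[m, eta] is a symplectic vector field, because a difference
   of automorphisms is a derivation to leading order, and psi'_n - psi_n =
   [m_2, delta]; thus the cohomology class is homotopy invariant. Finally, for gamma
   of order n - 1, exp(gamma) phi intertwines m and m' modulo (n + 1) if and only if
   psi_n = [m_2, gamma], and every cochain of order n is the Hamiltonian of such a
   gamma.

   All operators of the calculus are specified by conditions whose satisfiability has
   to be proved. For d, the contractions and the Lie derivatives on the free algebra
   it follows from the bijectivity of Phi (applied to the Euler field, or to
   zero), together with Cartan's formula; the descent of d to DR uses homogeneous
   generating families in every weight, which for a free Lie algebra come from
   Dynkin's formula. The inverse of Upsilon is explicit: the Lie derivative along the
   Euler field multiplies by the weight, which gives the Poincare lemma. *)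

Require Import Defs.
From mathcomp Require Import all_boot all_order all_algebra.
From mathcomp Require Import boolp classical_sets functions.
From mathcomp Require Import zify ring.

Set Implicit Arguments.
Unset Strict Implicit.
Unset Printing Implicit Defensive.

Import GRing.Theory.

Local Open Scope classical_set_scope.
Local Open Scope ring_scope.

(** Elements are classes of functions on symbols, and free Lie algebras and completed tensor
    products come without a universal property, so a map cannot be prescribed on generators. Two
    devices replace this. Every operation is a finite sum of products of coefficients whose degrees
    add up ([splitop]). Every module involved has a [frame], a finite homogeneous family in each
    weight whose coordinates are values at symbols; a map is defined on representatives and then
    shown to kill the relations. An operator chosen by [xget] is the zero map if its specification
    is inconsistent. Nondegeneracy excludes this, since such a default would put nonzero fields into
    the kernel of [Phi]. Pullbacks are controlled in this way only if [om <> 0]; for [om = 0]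
    injectivity of [Phi] makes all modules collapse. Orders are converted to weights: a map of order
    k raises weights by k - 1, a 0-form of order k has weight k, and [om] has weight 2, so a field
    of order k has a Hamiltonian of weight k + 1. The bound [3 <= n] is used, for instance, to
    discard psi^2, which raises weights by 2(n - 1). *)

Section BigList.

(* Membership in a list over a type without decidable equality. *)
Inductive inseq (T : Type) (p : T) : seq T -> Prop :=
| inseq_head l : inseq p (p :: l)
| inseq_tail q l : inseq p l -> inseq p (q :: l).

Lemma inseq_cons (T : Type) (p q : T) l : inseq p (q :: l) -> p = q \/ inseq p l.
Proof. by move=> H; inversion H; [left|right]. Qed.

Lemma inseq_nil (T : Type) (p : T) : ~ inseq p [::].
Proof. by move=> H; inversion H. Qed.

Lemma big_In (V : nmodType) (T : Type) (l : seq T) (F G : T -> V) :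
  (forall p, inseq p l -> F p = G p) -> \sum_(p <- l) F p = \sum_(p <- l) G p.
Proof.
elim: l => [|q l IH] H; first by rewrite !big_nil.
by rewrite !big_cons H ?IH //=; [move=> p lp; apply: H; right | left].
Qed.

Lemma big_In_ind (V : nmodType) (T : Type) (P : V -> Prop) (l : seq T) (F : T -> V) :
  P 0 -> (forall a b, P a -> P b -> P (a + b)) -> (forall p, inseq p l -> P (F p)) ->
  P (\sum_(p <- l) F p).
Proof.
move=> P0 PD; elim: l => [|q l IH] H; first by rewrite big_nil.
by rewrite big_cons; apply: PD; [apply: H; left | apply: IH => p lp; apply: H; right].
Qed.

Lemma In_map (S T : Type) (f : S -> T) (l : seq S) q :
  inseq q (map f l) -> exists2 p, inseq p l & q = f p.
Proof.
elim: l => [|p l IH] /= H; first by case: (inseq_nil H).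
have [->|/IH[r lr ->]] := inseq_cons H; first by exists p => //; left.
by exists r => //; right.
Qed.

Lemma In_cat (T : Type) (l l' : seq T) q :
  inseq q (l ++ l') -> inseq q l \/ inseq q l'.
Proof.
elim: l => [|p l IH] /= H; first by right.
by have [->|/IH[]] := inseq_cons H; [left; left|left; right|right].
Qed.

Lemma In_flatten (T : Type) (ll : seq (seq T)) q :
  inseq q (flatten ll) -> exists2 l, inseq l ll & inseq q l.
Proof.
elim: ll => [|l ll IH] /= H; first by case: (inseq_nil H).
by have [lq|/IH[l' ? ?]] := In_cat H; [exists l; [left|]|exists l'; [right|]].
Qed.

Lemma In_allpairs (S T U : Type) (f : S -> T -> U) (l : seq S) (l' : seq T) q :
  inseq q (allpairs f l l') ->
  exists p p', [/\ inseq p l, inseq p' l' & q = f p p'].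
Proof.
move=> H; have [l'' H1 H2] := In_flatten H.
have [p lp e] := In_map H1; rewrite e in H2; have [p' lp' ->] := In_map H2.
by exists p, p'.
Qed.

Lemma In_mem (T : eqType) (l : seq T) q : inseq q l -> q \in l.
Proof.
by elim=> [l'|p l' _ IH]; rewrite in_cons ?eqxx ?IH ?orbT.
Qed.

Lemma big_flatten_map (V : nmodType) (S T : Type) (l : seq S) (f : S -> seq T) (F : T -> V) :
  \sum_(q <- flatten (map f l)) F q = \sum_(p <- l) \sum_(q <- f p) F q.
Proof. by rewrite big_flatten big_map. Qed.

End BigList.

(** * The coefficient ring: signs, rational scalars, degrees *)

Section Coefficients.
Variable K : evenRing.
Implicit Types a b c : K.

Lemma gpartN i a : gpart i a -> gpart i (- a).
Proof. by move=> ga; rewrite -[- a]add0r; apply: gpartB => //; exact: gpart0. Qed.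

Lemma gpartD i a b : gpart i a -> gpart i b -> gpart i (a + b).
Proof. by move=> ga gb; rewrite -[b]opprK; apply: gpartB => //; exact: gpartN. Qed.

Lemma gpart_sum (T : Type) (l : seq T) (F : T -> K) i :
  (forall p, inseq p l -> gpart i (F p)) -> gpart i (\sum_(p <- l) F p).
Proof.
apply: (@big_In_ind _ _ (fun a => @gpart K i a)); [exact: gpart0|exact: gpartD].
Qed.

Lemma gpart_nat n : @gpart K 0 n%:R.
Proof.
by elim: n => [|n IH]; [exact: gpart0|rewrite mulrS; apply: gpartD => //; exact: gpart1].
Qed.

Lemma gpart0M i a b : gpart 0 a -> gpart i b -> gpart i (a * b).
Proof. by move=> ga gb; rewrite -[i]add0r; exact: gpartM. Qed.

Lemma ksgnE (n : int) : ksgn K n = (-1) ^+ odd (absz n).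
Proof. by rewrite /ksgn signr_odd. Qed.

Lemma odd_abszD (m n : int) : odd (absz (m + n)) = odd (absz m) (+) odd (absz n).
Proof. lia. Qed.

Lemma odd_abszB (m n : int) : odd (absz (m - n)) = odd (absz m) (+) odd (absz n).
Proof. lia. Qed.

Lemma odd_abszM (m n : int) : odd (absz (m * n)) = odd (absz m) && odd (absz n).
Proof. by rewrite abszM oddM. Qed.

Lemma odd_abszN (m : int) : odd (absz (- m)) = odd (absz m).
Proof. by rewrite abszN. Qed.

Lemma ksgnD m n : ksgn K (m + n) = ksgn K m * ksgn K n.
Proof. by rewrite !ksgnE odd_abszD signr_addb. Qed.

Lemma ksgn_sq m : ksgn K m * ksgn K m = 1.
Proof. by rewrite ksgnE -signr_addb addbb. Qed.

Lemma ksgnN m : ksgn K (- m) = ksgn K m.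
Proof. by rewrite !ksgnE odd_abszN. Qed.

Lemma ksgn0 : ksgn K 0 = 1.
Proof. by []. Qed.

Lemma ksgn1 : ksgn K 1 = -1.
Proof. by []. Qed.

Lemma gpart_ksgn n : @gpart K 0 (ksgn K n).
Proof.
rewrite ksgnE; case: (odd _) => /=; last exact: gpart1.
by rewrite expr1; apply: gpartN; exact: gpart1.
Qed.

(** The rational number 1/n inside K. For n = 0 the value is 0, by the convention for inverses in
    [rat]. *)
Definition kinv (n : nat) : K := ((n%:R)^-1 : rat)%:A.

Lemma kinvK n : (0 < n)%N -> kinv n * n%:R = 1.
Proof.
move=> n0; rewrite /kinv -[n%:R : K]scaler_nat -scalerAl mul1r.
rewrite scaler_nat -scaler_nat scalerA mulVf ?scale1r //.
by rewrite Num.Theory.pnatr_eq0 -lt0n.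
Qed.

Lemma natK0 n a : (0 < n)%N -> n%:R * a = 0 -> a = 0.
Proof. by move=> n0 e; rewrite -[a]mul1r -(kinvK n0) -mulrA e mulr0. Qed.

(** That rational scalars have degree zero is derived here from the axioms of [evenRing]. Split a
    into homogeneous components; directness, applied to the relation between n a as an element of
    degree i and the sum of n times the components, kills n times every component of degree other
    than i, and n is invertible. *)
Lemma gpart_divn i n a : (0 < n)%N -> gpart i (n%:R * a) -> gpart i a.
Proof.
move=> n0 gna; have [s [c [gc ea]]] := gpart_span a.
pose m j := count_mem j s.
(* [gpart_span] allows repeated indices, while [gpart_direct] asks for a duplicate-free list;
   repetitions are merged into multiplicities. *)
have ea' : a = \sum_(j <- undup s) c j *+ m j.
  rewrite ea -big_undup_iterop_count; apply: eq_bigr => j _.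
  by rewrite /m.
have gc' j : gpart j (c j *+ m j).
  by elim: (m j) => [|k IH]; [exact: gpart0|rewrite mulrS; exact: gpartD].
pose b j := n%:R * (c j *+ m j) - (if j == i then n%:R * a else 0).
pose s' := undup (i :: s).
pose c' j := c j *+ m j.
have es' : a = \sum_(j <- s') c' j.
  rewrite ea' /s' /=; case: ifP => si //.
  rewrite big_cons /c' /m (count_memPn _) ?si // mulr0n add0r //.
have gb j : gpart j (b j).
  apply: gpartB; first exact/gpart0M/gc'/gpart_nat.
  by case: eqP => [->//|_]; exact: gpart0.
have us' : uniq s' by exact: undup_uniq.
have is' : i \in s' by rewrite mem_undup mem_head.
have sb : \sum_(j <- s') b j = 0.
  rewrite sumrB -mulr_sumr -es' -big_mkcond -big_filter /=.
  rewrite (_ : [seq j <- s' | j == i] = [:: i]) ?big_seq1 ?subrr //.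
  by rewrite filter_pred1_uniq.
have bz := gpart_direct us' gb sb.
have -> : a = c' i.
  rewrite es' (bigD1_seq i) //= big_seq_cond big1 ?addr0 // => j /andP[js' ji].
  have := bz j js'; rewrite /b (negPf ji) subr0; exact: natK0.
exact: gc'.
Qed.

Lemma gpart_kinv i n a : (0 < n)%N -> gpart i a -> gpart i (kinv n * a).
Proof.
by move=> n0 ga; apply: (@gpart_divn i n) => //; rewrite mulrA [n%:R * _]mulrC kinvK ?mul1r.
Qed.

(** K vanishes in odd degrees, so a homogeneous element lives on symbols of a single parity, and the
    sign operator acts on it by one sign. *)
Lemma gpart_odd_eq i j a : gpart (i - j) a -> odd (absz i) != odd (absz j) -> a = 0.
Proof.
move=> ga ij; apply: gpart_odd ga; rewrite odd_abszB.
by case: (odd _) (odd _) ij => [] [].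
Qed.

End Coefficients.

(* Sealing a definition keeps unification from unfolding it. *)
Lemma seal (T : Type) (x : T) : {y | y = x}.
Proof. by exists x. Qed.

Lemma sealE (T : Type) (x : T) : sval (seal x) = x.
Proof. exact: (svalP (seal x)). Qed.

Notation span := Defs.span.
Notation mdeg := (int * nat * nat)%type.

(** * Sums of products of coefficients *)

Section Split.
Variable K : evenRing.

Definition eqw (X : Type) (w : X -> nat) n (x x' : X -> K) :=
  forall i, (w i <= n)%N -> x i = x' i.
Definition wc (X : Type) (w : X -> nat) n (x : X -> K) : X -> K :=
  fun i => if w i == n then x i else 0.
(** Linear substitute for the sign (-1)^|x|, which makes sense for homogeneous x only. *)
Definition sg (X : Type) (d : X -> int) (x : X -> K) : X -> K :=
  fun i => ksgn K (d i) * x i.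
Definition par (X : Type) (d : X -> int) b (x : X -> K) : X -> K :=
  fun i => if odd (absz (d i)) == b then x i else 0.
Definition homf (X : Type) (d : X -> int) j (x : X -> K) :=
  forall i, gpart (j - d i) (x i).
Definition supq (X : Type) (A : eqType) (q : X -> A) n (x : X -> K) :=
  forall i, q i != n -> x i = 0.
Definition int0 (X : Type) (x : X -> K) := forall i, gpart 0 (x i).

(* A scalar-valued bilinear operation which is a finite sum of products of
   coefficients whose degrees (degree, weight, form degree) add up to [g]. *)
Definition spl (X Y : Type) (mX : X -> mdeg) (mY : Y -> mdeg) (g : mdeg)
    (F : (X -> K) -> (Y -> K) -> K) : Prop :=
  exists l : seq (K * (X * Y)),
    (forall p, inseq p l -> gpart 0 p.1 /\ mX p.2.1 + mY p.2.2 = g) /\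
    forall x y, F x y = \sum_(p <- l) p.1 * (x p.2.1 * y p.2.2).

(** Products, brackets, tensors and the action of the Lie algebra all have this form. Bilinearity,
    continuity, additivity of degree, weight and form degree, and compatibility with signs then
    follow once and for all. *)
Definition splitop (X Y Z : Type) (mX : X -> mdeg) (mY : Y -> mdeg) (mZ : Z -> mdeg)
    (f : (X -> K) -> (Y -> K) -> Z -> K) : Prop :=
  forall z, spl mX mY (mZ z) (fun x y => f x y z).

Section Closure.
Variables (X Y : Type) (mX : X -> mdeg) (mY : Y -> mdeg).

Lemma spl0 g : spl mX mY g (fun _ _ => 0).
Proof. by exists [::]; split=> [p Hp|x y]; [have := inseq_nil Hp|rewrite big_nil]. Qed.

Lemma splD g F G : spl mX mY g F -> spl mX mY g G ->
  spl mX mY g (fun x y => F x y + G x y).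
Proof.
move=> [l [Hl El]] [l' [Hl' El']]; exists (l ++ l'); split.
  by move=> p Hp; have [/Hl|/Hl'] := In_cat Hp.
by move=> x y; rewrite big_cat /= El El'.
Qed.

Lemma splZ g c F : gpart 0 c -> spl mX mY g F -> spl mX mY g (fun x y => c * F x y).
Proof.
move=> gc [l [Hl El]]; exists [seq (c * p.1, p.2) | p <- l]; split.
  move=> p Hp; have [q /Hl[gq eq] ->] := In_map Hp; split=> //; exact: gpart0M.
by move=> x y; rewrite El big_map mulr_sumr; apply: eq_bigr => p _; rewrite -mulrA.
Qed.

Lemma splN g F : spl mX mY g F -> spl mX mY g (fun x y => - F x y).
Proof.
move=> H; have -> : (fun x y => - F x y) = (fun x y => -1 * F x y).
  by apply: funext => x; apply: funext => y; rewrite mulN1r.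
apply: splZ H; exact/gpartN/gpart1.
Qed.

Lemma spl_sum g (T : Type) (l : seq T) F : (forall t, inseq t l -> spl mX mY g (F t)) ->
  spl mX mY g (fun x y => \sum_(t <- l) F t x y).
Proof.
elim: l => [|t l IH] H.
  rewrite (_ : (fun x y => _) = fun _ _ => 0); first exact: spl0.
  by apply: funext => x; apply: funext => y; rewrite big_nil.
rewrite (_ : (fun x y => _) = fun x y => F t x y + \sum_(t <- l) F t x y).
  by apply: splD; [apply: H; left|apply: IH => u lu; apply: H; right].
by apply: funext => x; apply: funext => y; rewrite big_cons.
Qed.

Lemma spl1 g a b c : gpart 0 c -> mX a + mY b = g -> spl mX mY g (fun x y => c * (x a * y b)).
Proof.
move=> gc ab; exists [:: (c, (a, b))]; split=> [p Hp|x y].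
  by have [->//|Hp'] := inseq_cons Hp; have := inseq_nil Hp'.
by rewrite big_seq1.
Qed.

Lemma spl_ext g F G : (forall x y, F x y = G x y) -> spl mX mY g F -> spl mX mY g G.
Proof. by move=> FG [l [Hl El]]; exists l; split=> // x y; rewrite -FG. Qed.

(** Serves operations defined by recursion on words: prefixing a letter shifts the multidegree by a
    constant, and the signs [s], [t] that come along have degree zero. *)
Lemma spl_map (X' Y' : Type) (mX' : X' -> mdeg) (mY' : Y' -> mdeg) g g' h k F
    (u : X -> X') (v : Y -> Y') (s : X -> K) (t : Y -> K) :
  (forall a, gpart 0 (s a)) -> (forall b, gpart 0 (t b)) ->
  (forall a, mX' (u a) = h + mX a) -> (forall b, mY' (v b) = k + mY b) ->
  h + k + g = g' -> spl mX mY g F ->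
  spl mX' mY' g' (fun x y => F (fun a => s a * x (u a)) (fun b => t b * y (v b))).
Proof.
move=> gs gt eu ev <- [l [Hl El]].
exists [seq (p.1 * (s p.2.1 * t p.2.2), (u p.2.1, v p.2.2)) | p <- l]; split.
  move=> p Hp; have [q /Hl[gq <-] ->] := In_map Hp; rewrite /=; split.
    by apply: gpart0M => //; exact: gpart0M.
  by rewrite eu ev addrACA.
move=> x y; rewrite El big_map; apply: eq_bigr => p _ /=; ring.
Qed.

End Closure.

(** In each product the Koszul sign depends only on the parities of the two symbols, so it can be
    absorbed into the constant factor. *)
Lemma spl_kswap (X Y Z : Type) (mX : X -> mdeg) (mY : Y -> mdeg) g
   (dX : X -> int) (dY : Y -> int) (f : (Y -> K) -> (X -> K) -> Z -> K) z :
  spl mY mX g (fun y x => f y x z) -> spl mX mY g (fun x y => kswap dX dY f x y z).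
Proof.
move=> [l [Hl El]].
exists [seq (p.1 * (if odd (absz (dX p.2.2)) then ksgn K (dY p.2.1) else 1),
             (p.2.2, p.2.1)) | p <- l]; split.
  move=> p Hp; have [q /Hl[gq <-] ->] := In_map Hp; rewrite /=; split; last by rewrite addrC.
  by apply: gpart0M => //; case: ifP => _; [exact: gpart_ksgn|exact: gpart1].
move=> x y; rewrite /kswap !El -big_split big_map; apply: eq_bigr => p _ /=.
by case: ifP => _; ring.
Qed.

Section Consequences.
Variables (X Y Z : Type) (mX : X -> mdeg) (mY : Y -> mdeg) (mZ : Z -> mdeg).
Variable f : (X -> K) -> (Y -> K) -> Z -> K.
Hypothesis fS : splitop mX mY mZ f.

Let wX a := (mX a).1.2. Let wY a := (mY a).1.2. Let wZ a := (mZ a).1.2.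
Let dX a := (mX a).1.1. Let dY a := (mY a).1.1. Let dZ a := (mZ a).1.1.

Lemma split_linl a x x' y :
  f (fun i => a * x i + x' i) y = fun i => a * f x y i + f x' y i.
Proof.
apply: funext => z; have [l [_ El]] := fS z; rewrite !El mulr_sumr -big_split.
by apply: eq_bigr => p _ /=; ring.
Qed.

Lemma split_linr a x y y' :
  f x (fun i => a * y i + y' i) = fun i => a * f x y i + f x y' i.
Proof.
apply: funext => z; have [l [_ El]] := fS z; rewrite !El mulr_sumr -big_split.
by apply: eq_bigr => p _ /=; ring.
Qed.

Lemma split_0l y : f (fun=> 0) y = fun=> 0.
Proof.
apply: funext => z; have [l [_ El]] := fS z; rewrite El big1 // => p _.
by rewrite mul0r mulr0.
Qed.

Lemma split_0r x : f x (fun=> 0) = fun=> 0.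
Proof.
apply: funext => z; have [l [_ El]] := fS z; rewrite El big1 // => p _.
by rewrite !mulr0.
Qed.

Lemma split_eqw n x x' y y' : eqw wX n x x' -> eqw wY n y y' ->
  eqw wZ n (f x y) (f x' y').
Proof.
move=> ex ey z wz; have [l [Hl El]] := fS z; rewrite !El.
apply: big_In => p /Hl[_ ep]; congr (_ * (_ * _)).
  by apply: ex; apply: leq_trans wz; rewrite /wZ -ep leq_addr.
by apply: ey; apply: leq_trans wz; rewrite /wZ -ep leq_addl.
Qed.

(** Weights add up in every product of coefficients, so the component of weight n is a Cauchy
    product. *)
Lemma split_wc n x y :
  wc wZ n (f x y) = fun z => \sum_(k < n.+1) f (wc wX k x) (wc wY (n - k)%N y) z.
Proof.
apply: funext => z; have [l [Hl El]] := fS z; rewrite /wc El.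
rewrite [RHS](eq_bigr (fun k : 'I_n.+1 => \sum_(p <- l)
   p.1 * (wc wX k x p.2.1 * wc wY (n - k)%N y p.2.2))); last by move=> k _; rewrite El.
rewrite exchange_big /=; case: eqP => [ez|nz]; last first.
  rewrite [RHS](big_In (G := fun=> 0)) ?big1 // => p /Hl[_ ep].
  apply: big1 => k _; rewrite /wc.
  case: eqP => [e1|_]; last by rewrite mul0r mulr0.
  case: eqP => [e2|_]; last by rewrite !mulr0.
  case: nz; rewrite /wZ -ep; rewrite /wX in e1; rewrite /wY in e2.
  change ((mX p.2.1).1.2 + (mY p.2.2).1.2 = n)%N.
  by rewrite e1 e2; apply: subnKC; rewrite -ltnS.
apply: big_In => p /Hl[_ ep].
have en : ((mX p.2.1).1.2 + (mY p.2.2).1.2 = n)%N by rewrite -ez /wZ -ep.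
have lt : (wX p.2.1 < n.+1)%N by rewrite ltnS -en leq_addr.
(* For a given pair of symbols, only the summand whose index is the weight of the left symbol
   survives. *)
rewrite (bigD1 (Ordinal lt)) //= big1 => [|k kn].
  rewrite addr0 /wc eqxx; have -> : wY p.2.2 == (n - wX p.2.1)%N.
    by rewrite -en addKn.
  by [].
rewrite /wc; case: eqP => [e1|_]; last by rewrite mul0r mulr0.
by case/eqP: kn; apply: val_inj => /=.
Qed.

Lemma split_sg x y : sg dZ (f x y) = f (sg dX x) (sg dY y).
Proof.
apply: funext => z; have [l [Hl El]] := fS z; rewrite /sg !El mulr_sumr.
apply: big_In => p /Hl[_ ep].
have -> : dZ z = dX p.2.1 + dY p.2.2 by rewrite /dZ -ep.
rewrite ksgnD; ring.
Qed.

Lemma split_homf j k x y : homf dX j x -> homf dY k y -> homf dZ (j + k) (f x y).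
Proof.
move=> hx hy z; have [l [Hl El]] := fS z; rewrite !El.
apply: gpart_sum => p /Hl[gp ep]; apply: gpart0M => //.
have -> : j + k - dZ z = (j - dX p.2.1) + (k - dY p.2.2).
  by rewrite /dZ -ep /= opprD addrACA.
exact: gpartM.
Qed.

Lemma split_int0 x y : int0 x -> int0 y -> int0 (f x y).
Proof.
move=> hx hy z; have [l [Hl El]] := fS z; rewrite !El.
apply: gpart_sum => p /Hl[gp ep]; apply: gpart0M => //; exact: gpart0M.
Qed.

Lemma split_supq (A : eqType) (q : mdeg -> A) (op : A -> A -> A) n k x y :
  (forall g h, q (g + h) = op (q g) (q h)) ->
  supq (q \o mX) n x -> supq (q \o mY) k y -> supq (q \o mZ) (op n k) (f x y).
Proof.
move=> qop hx hy z /= nz; have [l [Hl El]] := fS z; rewrite !El.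
rewrite (big_In (G := fun=> 0)) ?big1 // => p /Hl[gp ep].
have [e1|n1] := eqVneq (q (mX p.2.1)) n; last by rewrite (hx _ n1) mul0r mulr0.
have [e2|n2] := eqVneq (q (mY p.2.2)) k; last by rewrite (hy _ n2) !mulr0.
by rewrite -ep qop e1 e2 eqxx in nz.
Qed.

End Consequences.
End Split.

(** * Closed spans and parity parts *)

Section Spans.
Variable K : evenRing.

Lemma span_in (X : Type) (A : set (X -> K)) x : A x -> span A x.
Proof.
move=> Ax; rewrite (_ : x = fun i => 1 * x i + 0); first exact/Defs.span_cons/Defs.span_nil.
by apply: funext => i; rewrite mul1r addr0.
Qed.

Lemma cspan_span (X : Type) w (A : set (X -> K)) x : span A x -> cspan w A x.
Proof. by move=> Ax n; exists x. Qed.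

Lemma cspan_in (X : Type) w (A : set (X -> K)) x : A x -> cspan w A x.
Proof. by move=> Ax; exact/cspan_span/span_in. Qed.

Lemma cspan_close (X : Type) w (A : set (X -> K)) x :
  (forall n, exists2 y, cspan w A y & eqw w n x y) -> cspan w A x.
Proof.
move=> H n; have [y /(_ n)[z Az yz] xy] := H n.
by exists z => // i wi; rewrite xy // yz.
Qed.

Lemma span_cspan (X : Type) w (A B : set (X -> K)) :
  (forall x, A x -> cspan w B x) -> forall x, span A x -> cspan w B x.
Proof.
by move=> AB x; elim=> [|a u v /AB Bu _ IH]; [exact: cspan0|exact: cspan_lin].
Qed.

Lemma cspan_sub (X : Type) w (A B : set (X -> K)) :
  (forall x, A x -> cspan w B x) -> forall x, cspan w A x -> cspan w B x.
Proof.
move=> AB x Ax; apply: cspan_close => n; have [y Ay xy] := Ax n.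
by exists y => //; exact: span_cspan AB _ Ay.
Qed.

Lemma cspanD (X : Type) w (A : set (X -> K)) x y :
  cspan w A x -> cspan w A y -> cspan w A (fun i => x i + y i).
Proof.
move=> Ax Ay; rewrite (_ : (fun i => _) = fun i => 1 * x i + y i); first exact: cspan_lin.
by apply: funext => i; rewrite mul1r.
Qed.

Lemma cspanZ (X : Type) w (A : set (X -> K)) a x :
  cspan w A x -> cspan w A (fun i => a * x i).
Proof.
move=> Ax; rewrite (_ : (fun i => _) = fun i => a * x i + 0).
  exact/cspan_lin/cspan0.
by apply: funext => i; rewrite addr0.
Qed.

Lemma cspanB (X : Type) w (A : set (X -> K)) x y :
  cspan w A x -> cspan w A y -> cspan w A (fun i => x i - y i).
Proof.
move=> Ax Ay; rewrite (_ : (fun i => _) = fun i => -1 * y i + x i); first exact: cspan_lin.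
by apply: funext => i; rewrite mulN1r addrC.
Qed.

Lemma cspan_sum (X : Type) w (A : set (X -> K)) (T : Type) (l : seq T) F :
  (forall t, inseq t l -> cspan w A (F t)) ->
  cspan w A (fun i => \sum_(t <- l) F t i).
Proof.
elim: l => [|t l IH] H.
  rewrite (_ : (fun i => _) = fun=> 0); first exact: cspan0.
  by apply: funext => x; rewrite big_nil.
rewrite (_ : (fun i => _) = fun i => F t i + \sum_(t <- l) F t i).
  by apply: cspanD; [apply: H; left|apply: IH => u lu; apply: H; right].
by apply: funext => x; rewrite big_cons.
Qed.

Lemma cspan_sum_ord (X : Type) w (A : set (X -> K)) n (F : 'I_n -> X -> K) :
  (forall t, cspan w A (F t)) -> cspan w A (fun i => \sum_(t < n) F t i).
Proof.
by move=> H; apply: (@cspan_sum X w A _ (index_enum 'I_n) F) => t _.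
Qed.

(** The condition on [eqw] is continuity: up to weight n the image depends only on the argument up
    to weight n, so approximations by finite combinations are carried over. *)
Lemma cspan_map (X Y : Type) wX wY (A : set (X -> K)) (B : set (Y -> K))
    (T : (X -> K) -> Y -> K) :
  (forall a x y, T (fun i => a * x i + y i) = fun i => a * T x i + T y i) ->
  (forall n x y, eqw wX n x y -> eqw wY n (T x) (T y)) ->
  (forall x, A x -> cspan wY B (T x)) -> forall x, cspan wX A x -> cspan wY B (T x).
Proof.
move=> Tlin Tloc AB x Ax; apply: cspan_close => n; have [y Ay xy] := Ax n.
exists (T y); last exact: Tloc.
elim: Ay => [|a u v Au _ IH]; last by rewrite Tlin; apply: cspan_lin => //; exact: AB.
have := Tlin (-1) (fun=> 0) (fun=> 0).
rewrite (_ : (fun i : X => _) = fun=> 0); last by apply: funext => i; rewrite mulr0 add0r.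
move=> {1}->; rewrite (_ : (fun i : Y => _) = fun=> 0); first exact: cspan0.
by apply: funext => i; rewrite mulN1r addNr.
Qed.

Lemma cspan_bil (X Y Z : Type) mX mY mZ wX wY wZ (f : (X -> K) -> (Y -> K) -> Z -> K)
    (A : set (X -> K)) (B : set (Y -> K)) (C : set (Z -> K)) :
  splitop mX mY mZ f ->
  (forall i, (mX i).1.2 = wX i) -> (forall i, (mY i).1.2 = wY i) ->
  (forall i, (mZ i).1.2 = wZ i) ->
  (forall x y, A x -> B y -> cspan wZ C (f x y)) ->
  forall x y, cspan wX A x -> cspan wY B y -> cspan wZ C (f x y).
Proof.
move=> fS eX eY eZ AB x y Ax By.
have loc n u u' v v' : eqw wX n u u' -> eqw wY n v v' -> eqw wZ n (f u v) (f u' v').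
  move=> eu ev i wi; apply: (split_eqw fS (n := n)) => [j|j|].
  - by rewrite eX; exact: eu.
  - by rewrite eY; exact: ev.
  - by rewrite eZ.
apply: (@cspan_map X Z wX wZ A C (f^~ y)) Ax => [a u v|n u v uv|u Au] /=.
- by rewrite (split_linl fS).
- exact: loc.
apply: (@cspan_map Y Z wY wZ B C (f u)) By => [a v v'|n v v' uv|v Bv] /=.
- by rewrite (split_linr fS).
- exact: loc.
exact: AB.
Qed.

Lemma wc_lin (X : Type) (w : X -> nat) n a (x y : X -> K) :
  wc w n (fun i => a * x i + y i) = fun i => a * wc w n x i + wc w n y i.
Proof. by apply: funext => i; rewrite /wc; case: ifP => // _; rewrite mulr0 addr0. Qed.

Lemma sg_lin (X : Type) (d : X -> int) a (x y : X -> K) :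
  sg d (fun i => a * x i + y i) = fun i => a * sg d x i + sg d y i.
Proof. by apply: funext => i; rewrite /sg; ring. Qed.

Lemma cspan_wc (X : Type) w (A : set (X -> K)) n :
  (forall x, A x -> cspan w A (wc w n x)) -> forall x, cspan w A x -> cspan w A (wc w n x).
Proof.
move=> H; apply: cspan_map => // [|k x y xy i wi]; first exact: wc_lin.
by rewrite /wc xy.
Qed.

Lemma cspan_sg (X : Type) w (d : X -> int) (A : set (X -> K)) :
  (forall x, A x -> cspan w A (sg d x)) -> forall x, cspan w A x -> cspan w A (sg d x).
Proof.
move=> H; apply: cspan_map => // [|k x y xy i wi]; first exact: sg_lin.
by rewrite /sg xy.
Qed.

(** As 2 is invertible, closure under the sign operator yields closure under parity parts, which is
    what the signed exchange [kswap] requires. *)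
Lemma parE (X : Type) (d : X -> int) b (x : X -> K) :
  par d b x = fun i => kinv K 2 * (x i + (-1) ^+ b * sg d x i).
Proof.
apply: funext => i; rewrite /par /sg ksgnE mulrA -signr_addb.
have -> : (odd `|d i| == b) = ~~ (b (+) odd `|d i|) by case: b (odd _) => [] [].
case: (b (+) _) => /=; first by rewrite expr1 mulN1r subrr mulr0.
by rewrite expr0 mul1r -mulr2n -mulr_natl mulrA kinvK // mul1r.
Qed.

Lemma par_sum (X : Type) (d : X -> int) (x : X -> K) :
  x = fun i => par d false x i + par d true x i.
Proof.
by apply: funext => i; rewrite /par; case: (odd _); rewrite ?addr0 ?add0r.
Qed.

End Spans.

(** * Words, free associative and free Lie algebras *)

Section Words.
Variables (K : evenRing) (M : pmod K) (f : sym M -> nat).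
Notation X := (sym M).
Notation S := (seq X).
Implicit Types (b : X -> K) (x y z u v : S -> K).

Definition mg (i : X) : mdeg := (dg i, wt i, f i).
Definition wmg (s : S) : mdeg := (wdg s, wwt s, \sum_(i <- s) f i)%N.

Lemma wmg_cat s t : wmg (s ++ t) = wmg s + wmg t.
Proof. by rewrite /wmg /wdg /wwt !big_cat. Qed.

Lemma wmg_nil : wmg [::] = 0.
Proof. by rewrite /wmg /wdg /wwt !big_nil. Qed.

Lemma wmg_cons i s : wmg (i :: s) = mg i + wmg s.
Proof. by rewrite /wmg /wdg /wwt !big_cons. Qed.

Lemma wmg1 i : wmg [:: i] = mg i.
Proof. by rewrite wmg_cons wmg_nil addr0. Qed.

(** [letter0 b] vanishes on words of length other than one, so the products reading such words are
    dropped. *)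
Lemma spl_letter (Y : Type) (mY : Y -> mdeg) g (F : (S -> K) -> (Y -> K) -> K) :
  spl wmg mY g F -> spl mg mY g (fun (b : X -> K) (u : Y -> K) => F (@letter0 K M b) u).
Proof.
move=> [l [Hl El]].
exists (flatten [seq if p.2.1 is [:: i] then [:: (p.1, (i, p.2.2))] else [::] | p <- l]).
split=> [q Hq|b u].
  have [l' Hl' lq] := In_flatten Hq; have [p lp ep] := In_map Hl'.
  move: (Hl _ lp); move: lq; rewrite ep.
  case: p.2.1 => [|i [|j s]] /= lq; try by have := inseq_nil lq.
  by have [-> /=|h] := inseq_cons lq; [rewrite wmg1|have := inseq_nil h].
rewrite El big_flatten_map; apply: eq_bigr => p _.
case: p.2.1 => [|i [|j s]] /=; rewrite ?big_nil ?big_seq1 //; by rewrite mul0r mulr0.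
Qed.

Lemma mul0_split : splitop wmg wmg wmg (@mul0 K M).
Proof.
move=> s; apply: (@spl_ext _ _ _ _ _ _ (fun x y => \sum_(k <- index_enum 'I_(size s).+1)
    1 * (x (take k s) * y (drop k s)))) => [x y|].
  by rewrite /mul0; apply: eq_bigr => k _; rewrite mul1r.
apply: spl_sum => k _; apply: spl1; first exact: gpart1.
by rewrite -wmg_cat cat_take_drop.
Qed.

Lemma brk0_split : splitop wmg wmg wmg (@brk0 K M).
Proof.
move=> s; apply: splD; first exact: mul0_split.
apply: splN; apply: spl_kswap; exact: mul0_split.
Qed.

Lemma mul0_nil x y : mul0 x y [::] = x [::] * y [::].
Proof. by rewrite /mul0 big_ord_recl big_ord0 addr0. Qed.

Lemma mul0_cons x y i s :
  mul0 x y (i :: s) = x [::] * y (i :: s) + mul0 (fun w => x (i :: w)) y s.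
Proof. by rewrite /mul0 big_ord_recl. Qed.

Lemma mul0_letter_nil b y : mul0 (@letter0 K M b) y [::] = 0.
Proof. by rewrite mul0_nil mul0r. Qed.

Lemma mul0_letter_cons b y i s : mul0 (@letter0 K M b) y (i :: s) = b i * y s.
Proof.
rewrite mul0_cons mul0r add0r; case: s => [|j s]; first by rewrite mul0_nil.
rewrite mul0_cons /= /mul0 big1 ?addr0 // => k _; by rewrite mul0r.
Qed.

Lemma mul0_1l y : mul0 (@one0 K M) y = y.
Proof.
apply: funext => -[|i s]; first by rewrite mul0_nil mul1r.
rewrite mul0_cons mul1r /mul0 big1 ?addr0 // => k _; by rewrite mul0r.
Qed.

Lemma mul0_linl a x x' y :
  mul0 (fun i => a * x i + x' i) y = fun i => a * mul0 x y i + mul0 x' y i.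
Proof. exact: (split_linl mul0_split). Qed.

Lemma mul0_linr a x y y' :
  mul0 x (fun i => a * y i + y' i) = fun i => a * mul0 x y i + mul0 x y' i.
Proof. exact: (split_linr mul0_split). Qed.

Lemma mul0A x y z : mul0 (mul0 x y) z = mul0 x (mul0 y z).
Proof.
apply: funext => s; elim: s x => [|i s IH] x; first by rewrite !mul0_nil mulrA.
rewrite [LHS]mul0_cons [RHS]mul0_cons mul0_nil -IH mul0_cons.
have -> : (fun w => mul0 x y (i :: w)) =
          fun w => x [::] * y (i :: w) + mul0 (fun w => x (i :: w)) y w.
  by apply: funext => w; rewrite mul0_cons.
by rewrite mul0_linl mulrDr addrA mulrA.
Qed.

Notation pw := (supq (fun s : S => odd (absz (wdg s)))).

(** On elements of pure parity the parity split inside [kswap] is trivial and the usual signed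
    commutator appears; bracket identities are verified in this form. *)
Lemma brk0E p q x y : pw p x -> pw q y ->
  brk0 x y = fun s => - (-1) ^+ (p && q) * mul0 y x s + mul0 x y s.
Proof.
move=> px qy; rewrite /brk0 /kswap; apply: funext => s; rewrite addrC; congr (_ + _).
case: p px => px.
  have -> : (fun i => if odd `|wdg i| then 0 else x i) = fun=> 0.
    by apply: funext => i; case: ifP => // h; apply: px; rewrite h.
  have -> : (fun i => if odd `|wdg i| then x i else 0) = x.
    by apply: funext => i; case: ifP => // h; rewrite px ?h.
  have -> : (fun j => ksgn K (wdg j) * y j) = fun j => (-1) ^+ q * y j + 0.
    apply: funext => j; rewrite ksgnE addr0.
    by have [->//|h] := eqVneq (odd `|wdg j|) q; rewrite qy // !mulr0.
  by rewrite mul0_linl (split_0l mul0_split) (split_0r mul0_split) add0r addr0 mulNr.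
have -> : (fun i => if odd `|wdg i| then 0 else x i) = x.
  by apply: funext => i; case: ifP => // h; rewrite px ?h.
have -> : (fun i => if odd `|wdg i| then x i else 0) = fun=> 0.
  by apply: funext => i; case: ifP => // h; apply: px; rewrite h.
by rewrite (split_0r mul0_split) addr0 expr0 mulN1r.
Qed.

Lemma pw_op x y p q (op : (S -> K) -> (S -> K) -> S -> K) : splitop wmg wmg wmg op ->
  pw p x -> pw q y -> pw (p (+) q) (op x y).
Proof.
move=> opS; apply: (split_supq opS (q := fun g : mdeg => odd (absz g.1.1))) => g h.
exact: odd_abszD.
Qed.

Lemma jacobi_pure p q r u v y : pw p u -> pw q v -> pw r y ->
  brk0 (brk0 u v) y =
  fun s => - (-1) ^+ (p && q) * brk0 v (brk0 u y) s + brk0 u (brk0 v y) s.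
Proof.
move=> pu qv ry.
have uv := pw_op brk0_split pu qv; have uy := pw_op brk0_split pu ry.
have vy := pw_op brk0_split qv ry.
rewrite (brk0E uv ry) (brk0E qv uy) (brk0E pu vy).
rewrite (brk0E pu qv) (brk0E pu ry) (brk0E qv ry) !(mul0_linl, mul0_linr) !mul0A.
apply: funext => s.
have sgb (c d : bool) : (-1) ^+ (c && d) = (if c && d then -1 else 1 : K).
  by case: (c && d).
rewrite !sgb; case: p {pu uv uy} => /=; case: q {qv vy} => /=; case: r {ry} => /=; ring.
Qed.

Lemma brk0_linl a x x' y :
  brk0 (fun i => a * x i + x' i) y = fun i => a * brk0 x y i + brk0 x' y i.
Proof. exact: (split_linl brk0_split). Qed.

Lemma brk0_linr a x y y' :
  brk0 x (fun i => a * y i + y' i) = fun i => a * brk0 x y i + brk0 x y' i.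
Proof. exact: (split_linr brk0_split). Qed.

Lemma pw_par p x : pw p (par (@wdg K M) p x).
Proof. by move=> s h; rewrite /par (negPf h). Qed.

Lemma par_sum1 (d : S -> int) x : x = fun s => 1 * par d false x s + par d true x s.
Proof. by rewrite {1}[x](par_sum d); apply: funext => s; rewrite mul1r. Qed.

Lemma jacobi p q u v y : pw p u -> pw q v ->
  brk0 (brk0 u v) y =
  fun s => - (-1) ^+ (p && q) * brk0 v (brk0 u y) s + brk0 u (brk0 v y) s.
Proof.
move=> pu qv; rewrite [y](par_sum1 (@wdg K M)) !brk0_linr.
rewrite (jacobi_pure pu qv (@pw_par false y)) (jacobi_pure pu qv (@pw_par true y)).
apply: funext => s; ring.
Qed.

Lemma brk0_anti p q u v : pw p u -> pw q v ->
  brk0 v u = fun s => - (-1) ^+ (p && q) * brk0 u v s.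
Proof.
move=> pu qv; rewrite (brk0E pu qv) (brk0E qv pu); apply: funext => s.
rewrite andbC; case: (p && q); rewrite ?expr0 ?expr1; ring.
Qed.

(** Lie monomials in letters of pure parity, indexed by parity and length. The parity fixes the
    Koszul signs, and the length is the eigenvalue in Dynkin's formula. *)
Inductive hlm : bool -> nat -> (S -> K) -> Prop :=
| hlm_letter p b : pmem b -> supq (fun i => odd (absz (dg i))) p b -> hlm p 1 (letter0 b)
| hlm_brk p q k l x y : hlm p k x -> hlm q l y -> hlm (p (+) q) (k + l)%N (brk0 x y).

Lemma hlm_pw p k x : hlm p k x -> pw p x.
Proof.
elim=> [q b _ qb|p1 q1 k1 l1 x1 y1 _ px _ py]; last exact: pw_op brk0_split px py.
by move=> [|i [|j s]] //= h; apply: qb; rewrite /wdg big_seq1 in h.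
Qed.

Lemma hlm_gt0 p k x : hlm p k x -> (0 < k)%N.
Proof. by elim=> // p1 q1 k1 l1 x1 y1 _ h _ _; rewrite addn_gt0 h. Qed.

Hypothesis pmem_sg : forall b, pmem b -> pmem (sg (@dg K M) b).

Lemma pmem_par p b : pmem b -> pmem (par (@dg K M) p b).
Proof. by move=> Mb; rewrite parE; apply: cspanZ; apply: cspanD => //; exact/cspanZ/pmem_sg. Qed.

Notation wS := (@wwt K M).
Definition hlm_set : set (S -> K) := [set x | exists p k, hlm p k x].

Lemma lmon_hlm x : lmonomial x -> cspan wS hlm_set x.
Proof.
elim=> [b Mb|u v _ Hu _ Hv].
  rewrite [b](par_sum (@dg K M)).
  have -> (b1 b2 : X -> K) : @letter0 K M (fun i => b1 i + b2 i) =
    fun s => @letter0 K M b1 s + @letter0 K M b2 s.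
    by apply: funext => -[|i [|j s]] /=; rewrite ?addr0.
  apply: cspanD; apply: cspan_in.
    by exists false, 1%N; constructor; [exact: pmem_par|move=> i h; rewrite /par (negPf h)].
  by exists true, 1%N; constructor; [exact: pmem_par|move=> i h; rewrite /par (negPf h)].
apply: (cspan_bil brk0_split) Hu Hv => // x1 y1 [p [k Hx]] [q [l Hy]].
by apply: cspan_in; exists (p (+) q), (k + l)%N; constructor.
Qed.

Lemma pmem_hlm x : @pmem K (lalg M) x -> cspan wS hlm_set x.
Proof. exact: cspan_sub lmon_hlm _. Qed.

Lemma hlm_lmon p k x : hlm p k x -> lmonomial x.
Proof. by elim=> *; constructor. Qed.

Section Frame.
Variable F : nat -> seq (X * (X -> K)).

Definition fpure (T : Type) (m : T -> mdeg) (n : nat) (p : T * (T -> K)) :=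
  [/\ (m p.1).1.2 = n, supq m (m p.1) p.2 & int0 p.2].

(** A substitute for a homogeneous basis with its dual basis: the coefficient of [p.2] in an element
    x is the value of x at the symbol [p.1]. Linear independence is not part of it, so Dynkin's
    idempotent provides such a family for the free Lie algebra. Since the [p.2] have coefficients of
    degree zero, the coordinates of a homogeneous element are homogeneous. *)
Definition frame (T : Type) (m : T -> mdeg) (A : set (T -> K))
    (G : nat -> seq (T * (T -> K))) :=
  [/\ forall n p, inseq p (G n) -> fpure m n p,
      forall n p, inseq p (G n) -> A p.2
    & forall x : T -> K, A x -> forall i, x i = \sum_(p <- G (m i).1.2) x p.1 * p.2 i].

Hypothesis FF : frame mg (@pmem K M) F.
Hypothesis F0 : F 0 = [::].

Variables (B0 : nat -> seq (S * (S -> K))) (c : (X -> K) -> (S -> K) -> S -> K).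
Hypothesis cS : splitop mg wmg wmg c.

(** Right-nested products of [k] letters of the frame with an element of [B0], each paired with the
    word at which its coordinate is read. For multiplication these are tensor monomials, for the
    bracket right-normed Lie monomials. *)
Fixpoint Fc k n : seq (S * (S -> K)) :=
  if k is k'.+1 then
    flatten [seq allpairs (fun p q => (p.1 :: q.1, c p.2 q.2)) (F a) (Fc k' (n - a)%N)
            | a <- iota 0 n.+1]
  else B0 n.

Lemma FcS k n : Fc k.+1 n =
  flatten [seq allpairs (fun p q => (p.1 :: q.1, c p.2 q.2)) (F a) (Fc k (n - a)%N)
          | a <- iota 0 n.+1].
Proof. by []. Qed.

(** The linear operator replacing a word by the corresponding nested product. For the bracket this
    is Dynkin's operator, for multiplication the projection to words of length [k]. *)
Definition Sc k x : S -> K := fun t => \sum_(q <- Fc k (wwt t)) x q.1 * q.2 t.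

Lemma Fc_ind (Q : nat -> S * (S -> K) -> Prop) :
  (forall n q, inseq q (B0 n) -> Q n q) ->
  (forall a n p q, inseq p (F a) -> Q n q -> Q (a + n)%N (p.1 :: q.1, c p.2 q.2)) ->
  forall k n q, inseq q (Fc k n) -> Q n q.
Proof.
move=> Q0 QS; elim=> [|k IH] n q Hq; first exact: Q0.
have [l Hl lq] := In_flatten Hq; have [a Ha el] := In_map Hl; rewrite el in lq.
have [p [q' [pF qF ->]]] := In_allpairs lq.
have /In_mem := Ha; rewrite mem_iota add0n ltnS => /andP[_ an].
rewrite -(subnKC an); apply: QS => //; exact: IH.
Qed.

Hypothesis B0p : forall n q, inseq q (B0 n) -> fpure wmg n q.

Lemma Fc_pure k n q : inseq q (Fc k n) -> fpure wmg n q.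
Proof.
have [F1 _ _] := FF; apply: (@Fc_ind (fpure wmg)) => // a m p r /F1[ep sp ip] [er sr ir].
split; last exact: split_int0 cS _ _ ip ir.
  by rewrite wmg_cons -ep -er.
by rewrite /= wmg_cons; apply: (split_supq cS (q := id)) sp sr.
Qed.

Lemma fpure_wt (T : Type) (m : T -> mdeg) n p i :
  fpure m n p -> (m i).1.2 != n -> p.2 i = 0.
Proof. by move=> [ep sp _] h; apply: sp; apply: contraNneq h => ->; rewrite ep. Qed.

Lemma wc_frame (T : Type) (m : T -> mdeg) (A : set (T -> K)) G (b : T -> K) n : frame m A G ->
  A b -> wc (fun i => (m i).1.2) n b = fun i => \sum_(p <- G n) b p.1 * p.2 i.
Proof.
move=> [G1 _ GE] Ab; apply: funext => i; rewrite /wc; case: eqP => [<-|/eqP h].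
  exact: GE.
rewrite (big_In (G := fun=> 0)) ?big1 // => p /G1 gp.
by rewrite (fpure_wt gp h) mulr0.
Qed.

Lemma wc_Sc k x n : wc wS n (Sc k x) = fun t => \sum_(q <- Fc k n) x q.1 * q.2 t.
Proof.
apply: funext => t; rewrite /wc; case: eqP => [<-//|/eqP h].
rewrite (big_In (G := fun=> 0)) ?big1 // => q /Fc_pure gq.
by rewrite (fpure_wt gq h) mulr0.
Qed.

Lemma split_sum (Y1 Y2 Z T1 T2 : Type) (m1 : Y1 -> mdeg) (m2 : Y2 -> mdeg) (m3 : Z -> mdeg)
    (g : (Y1 -> K) -> (Y2 -> K) -> Z -> K) (l1 : seq T1) (l2 : seq T2)
    (c1 : T1 -> K) (c2 : T2 -> K) (x1 : T1 -> Y1 -> K) (x2 : T2 -> Y2 -> K) (z : Z) :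
  splitop m1 m2 m3 g ->
  g (fun i => \sum_(p <- l1) c1 p * x1 p i) (fun i => \sum_(q <- l2) c2 q * x2 q i) z =
  \sum_(p <- l1) \sum_(q <- l2) (c1 p * c2 q) * g (x1 p) (x2 q) z.
Proof.
move=> gS; elim: l1 => [|p l1 IH].
  rewrite (_ : (fun i : Y1 => _) = fun=> 0) ?(split_0l gS) ?big_nil //.
  by apply: funext => i; rewrite big_nil.
rewrite (_ : (fun i : Y1 => _) = fun i => c1 p * x1 p i + \sum_(p <- l1) c1 p * x1 p i);
  last by apply: funext => i; rewrite big_cons.
rewrite (split_linl gS) IH big_cons; congr (_ + _).
elim: l2 {IH} => [|q l2 IH].
  rewrite (_ : (fun i : Y2 => _) = fun=> 0) ?(split_0r gS) ?big_nil ?mulr0 //.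
  by apply: funext => i; rewrite big_nil.
rewrite (_ : (fun i : Y2 => _) = fun i => c2 q * x2 q i + \sum_(p <- l2) c2 p * x2 p i);
  last by apply: funext => i; rewrite big_cons.
by rewrite (split_linr gS) big_cons mulrDr IH mulrA.
Qed.

(** In the weight of [t] the right-hand side is a Cauchy product; expanding [b] in its frame turns
    it into the recursion that defines [Fc]. *)
Lemma Sc_step k b y : pmem b -> Sc k.+1 (mul0 (letter0 b) y) = c b (Sc k y).
Proof.
move=> Mb; apply: funext => t.
have -> : c b (Sc k y) t = wc (fun s => (wmg s).1.2) (wwt t) (c b (Sc k y)) t.
  by rewrite /wc /= eqxx.
rewrite (split_wc cS) -(big_mkord xpredT (fun a => c (wc _ a b) (wc _ (wwt t - a)%N _) t)).
rewrite /index_iota subn0 {1}/Sc FcS big_flatten_map.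
apply: eq_bigr => a _.
rewrite [wc _ a b](wc_frame a FF Mb) (wc_Sc k y) (split_sum _ _ _ _ _ _ _ cS).
rewrite big_allpairs_dep; apply: eq_bigr => p _; apply: eq_bigr => q _ /=.
by rewrite mul0_letter_cons.
Qed.

Lemma Sc_lin k a x y : Sc k (fun i => a * x i + y i) = fun i => a * Sc k x i + Sc k y i.
Proof.
apply: funext => t; rewrite /Sc mulr_sumr -big_split; apply: eq_bigr => q _ /=; ring.
Qed.

Lemma Fc_size s0 k n q : (forall n q, inseq q (B0 n) -> size q.1 = s0) ->
  inseq q (Fc k n) -> size q.1 = (s0 + k)%N.
Proof.
move=> Hs; elim: k n q => [|k IH] n q Hq; first by rewrite addn0 (Hs n).
have [l Hl lq] := In_flatten Hq; have [a Ha el] := In_map Hl; rewrite el in lq.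
by have [p [q' [pF qF ->]]] := In_allpairs lq; rewrite /= (IH _ _ qF) addnS.
Qed.

(** Letters have positive weight, as [F 0] is empty, so a word is never longer than its weight. This
    keeps the generating families finite. *)
Lemma Fc_nil s0 k n : (forall n, (n < s0)%N -> B0 n = [::]) ->
  (n < s0 + k)%N -> Fc k n = [::].
Proof.
move=> Hs; elim: k n => [|k IH] n; first by rewrite addn0 => /Hs.
move=> nk; rewrite FcS.
have: {subset iota 0 n.+1 <= [pred a | a <= n]%N}.
  by move=> a; rewrite mem_iota add0n ltnS.
elim: (iota 0 n.+1) => //= a l IHl Hl.
rewrite IHl ?cats0; last by move=> d dl; apply: Hl; rewrite in_cons dl orbT.
have [->|a0] := posnP a; first by rewrite F0.
have an : (a <= n)%N by apply: (Hl a); rewrite mem_head.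
rewrite IH; last by move: nk a0 an; lia.
by elim: (F a) => //= p l' ->.
Qed.

End Frame.

Section Frames.
Variable F : nat -> seq (X * (X -> K)).
Hypothesis FF : frame mg (@pmem K M) F.
Hypothesis F0 : F 0 = [::].

Definition Bt n : seq (S * (S -> K)) := if n is 0%N then [:: ([::], @one0 K M)] else [::].
Definition ct b y := mul0 (@letter0 K M b) y.

Lemma ctS : splitop mg wmg wmg ct.
Proof. by move=> s; exact: (spl_letter (mul0_split s)). Qed.

Lemma one0_pure n q : inseq q (Bt n) -> fpure wmg n q.
Proof.
case: n => [|n] H; last by have := inseq_nil H.
have [->|h] := inseq_cons H; last by have := inseq_nil h.
split=> [|s|s] /=; first by rewrite /wwt big_nil.
  by case: s => //; rewrite wmg_nil eqxx.
by rewrite /one0; exact: gpart_nat.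
Qed.

Definition Ft n := flatten [seq Fc F Bt ct k n | k <- iota 0 n.+1].

Lemma Ft_frame : frame wmg (@pmem K (talg M)) Ft.
Proof.
have [F1 F2 F3] := FF; split=> [n p Hp|n p Hp|x Mx t].
- have [l Hl lp] := In_flatten Hp; have [k _ el] := In_map Hl; rewrite el in lp.
  exact: (Fc_pure FF ctS one0_pure) lp.
- have [l Hl lp] := In_flatten Hp; have [k _ el] := In_map Hl; rewrite el in lp.
  have : tmonomial (p.2); last exact: cspan_in.
  move: lp; apply: (@Fc_ind F Bt ct (fun _ q => tmonomial q.2)) => {Hp Hl} [m q Hq|a m r q rF Hq].
    case: m Hq => [|m] H; last by have := inseq_nil H.
    by have [->|h] := inseq_cons H; [constructor|have := inseq_nil h].
  by constructor=> //; exact: F2 rF.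
pose T x := fun t => \sum_(p <- Ft (wwt t)) x p.1 * p.2 t.
(* Both sides are linear in x, and at [t] they depend on x only up to the weight of [t]; hence
   tensor monomials suffice. *)
suff H : forall x, tmonomial x -> x = T x.
  have [y Ay xy] := Mx (wwt t); rewrite xy // -[RHS]/(T x t).
  have -> : T x t = T y t.
    apply: big_In => q Hq; rewrite xy //.
    have [l Hl lp] := In_flatten Hq; have [k _ el] := In_map Hl; rewrite el in lp.
    by have [e _ _] := Fc_pure FF ctS one0_pure lp; rewrite -[X in (_ <= X)%N]e.
  elim: Ay => [|a u v /H hu _ IH].
    by rewrite /T big1 // => q _; rewrite mul0r.
  rewrite IH {1}hu /T mulr_sumr -big_split; apply: eq_bigr => q _ /=; ring.
move=> {t Mx}x Mx; have [k [ks kx]] : exists k, supq (@size X) k x /\ Sc F Bt ct k x = x.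
  elim: Mx => [|b y Mb My [k [ks ky]]].
    exists 0%N; split=> [[|i s]//|]; apply: funext => s; rewrite /Sc /=.
    case: s => [|i s]; first by rewrite /wwt big_nil /= big_seq1 /one0 /= mulr1.
    case: (wwt _) => [|n]; last by rewrite big_nil.
    by rewrite big_seq1 /one0 /= mulr0.
  exists k.+1; split; last by rewrite (Sc_step FF ctS one0_pure) // ky.
  move=> [|i s] /= h; first by rewrite mul0_letter_nil.
  by rewrite mul0_letter_cons ks ?mulr0.
apply: funext => t; rewrite /T /Ft big_flatten_map.
have Hj j : j != k -> \sum_(q <- Fc F Bt ct j (wwt t)) x q.1 * q.2 t = 0.
  move=> jk; rewrite (big_In (G := fun=> 0)) ?big1 // => q Hq; rewrite ks ?mul0r //.
  rewrite (Fc_size (s0 := 0) _ Hq) // => n q' H.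
  case: n H => [|n] H; last by have := inseq_nil H.
  by have [->|h] := inseq_cons H; last by have := inseq_nil h.
have [kt|kt] := leqP k (wwt t).
  rewrite (bigD1_seq k) ?iota_uniq ?mem_iota //=.
  rewrite [X in _ + X]big1 ?addr0; last by move=> j jk; exact: Hj.
  by rewrite -[in LHS]kx.
rewrite big_seq_cond big1; last first.
  move=> j; rewrite mem_iota andbT add0n ltnS => /andP[_ jt]; apply: Hj.
  by rewrite neq_ltn (leq_ltn_trans jt kt).
rewrite -kx /Sc (@Fc_nil _ F0 Bt ct 0) ?big_nil //.
Qed.

Definition Bl n : seq (S * (S -> K)) := [seq ([:: p.1], @letter0 K M p.2) | p <- F n].
Definition cl b y := brk0 (@letter0 K M b) y.

Lemma clS : splitop mg wmg wmg cl.
Proof. by move=> s; exact: (spl_letter (brk0_split s)). Qed.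

Lemma Bl_pure n q : inseq q (Bl n) -> fpure wmg n q.
Proof.
have [F1 _ _] := FF; move=> H; have [p /F1[ep sp ip] ->] := In_map H.
split=> [|s|s] /=; first by rewrite /wwt big_seq1.
  by case: s => [|i [|j s]] //=; rewrite !wmg1; exact: sp.
by case: s => [|i [|j s]] /=; [exact: gpart0|exact: ip|exact: gpart0].
Qed.

Notation SL := (Sc F Bl cl).

(** Dynkin's operator turns left multiplication by a Lie element into the adjoint action: by
    construction for letters, by the Jacobi identity for brackets. *)
Lemma SL_mul p l x : hlm p l x -> forall k y, SL (l + k)%N (mul0 x y) = brk0 x (SL k y).
Proof.
elim=> [q b Mb _ k y|p1 q1 k1 l1 u v hu IHu hv IHv k y].
  exact: (Sc_step FF clS Bl_pure).
rewrite (brk0E (hlm_pw hu) (hlm_pw hv)) mul0_linl Sc_lin !mul0A.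
rewrite -{1}addnA addnCA IHv IHu -addnA IHu IHv.
by rewrite -(jacobi _ (hlm_pw hu) (hlm_pw hv)) (brk0E (hlm_pw hu) (hlm_pw hv)).
Qed.

(** The Dynkin-Specht-Wever lemma. For u, v of lengths k and l the product uv is sent to l[u,v] and
    vu to k[v,u], so the signed commutator is multiplied by k + l. *)
Lemma SL_hlm p l x : hlm p l x -> SL l.-1 x = fun t => l%:R * x t.
Proof.
elim=> [q b Mb _|p1 q1 k1 l1 u v hu IHu hv IHv].
  have [_ _ F3] := FF; apply: funext => t; rewrite mul1r /Sc /= big_map.
  case: t => [|i [|j s]] /=; try by rewrite big1 // => r _; rewrite mulr0.
  by rewrite [RHS](F3 _ Mb) /wwt big_seq1.
have k0 := hlm_gt0 hu; have l0 := hlm_gt0 hv.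
rewrite {1}(brk0E (hlm_pw hu) (hlm_pw hv)) Sc_lin.
rewrite {1}(_ : (k1 + l1).-1 = l1 + k1.-1)%N; last by move: k0 l0; lia.
rewrite {1}(_ : (k1 + l1).-1 = k1 + l1.-1)%N; last by move: k0 l0; lia.
rewrite (SL_mul hu) (SL_mul hv) IHu IHv.
have E (n : nat) (w y : S -> K) : brk0 w (fun t => n%:R * y t) = fun t => n%:R * brk0 w y t.
  have -> : (fun t => n%:R * y t) = fun t => n%:R * y t + 0.
    by apply: funext => t; rewrite addr0.
  by rewrite brk0_linr (split_0r brk0_split); apply: funext => t; rewrite addr0.
rewrite !E (brk0_anti (hlm_pw hu) (hlm_pw hv)); apply: funext => t.
rewrite natrD; case: (p1 && q1); rewrite ?expr1 ?expr0; ring.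
Qed.

(** Dynkin's idempotent: right-normed Lie monomials of length k + 1 divided by their length. Lengths
    do not exceed the weight, whence the range of k. *)
Definition FL n := flatten [seq [seq (q.1, fun t => kinv K k.+1 * q.2 t) | q <- Fc F Bl cl k n]
                           | k <- iota 0 n].

Lemma FL_ind (Q : nat -> S * (S -> K) -> Prop) :
  (forall n p, inseq p (F n) -> Q n ([:: p.1], letter0 p.2)) ->
  (forall a n p q, inseq p (F a) -> Q n q -> Q (a + n)%N (p.1 :: q.1, brk0 (letter0 p.2) q.2)) ->
  forall n q, inseq q (FL n) ->
  exists k q', q = (q'.1, fun t => kinv K k.+1 * q'.2 t) /\ Q n q'.
Proof.
move=> Q0 QS n q Hq; have [l Hl lp] := In_flatten Hq; have [k _ el] := In_map Hl.
rewrite el in lp; have [q' Hq' ->] := In_map lp; exists k, q'; split=> //.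
move: Hq'; apply: (@Fc_ind F Bl cl Q) => [m r Hr|//].
by have [p Hp ->] := In_map Hr; exact: Q0.
Qed.

Lemma FL_frame : frame wmg (@pmem K (lalg M)) FL.
Proof.
have [F1 F2 F3] := FF.
have P n q : inseq q (FL n) -> fpure wmg n q.
  move=> Hq; have [l Hl lp] := In_flatten Hq; have [k _ el] := In_map Hl; rewrite el in lp.
  have [q' Hq' ->] := In_map lp; have [e s i] := Fc_pure FF clS Bl_pure Hq'.
  split=> // t => [h|] /=; first by rewrite s ?mulr0.
  by apply: gpart_kinv => //; exact: i.
split=> // [n q /(@FL_ind (fun _ q => lmonomial q.2))[]|x Mx t].
- by move=> m p /F2 Mp; constructor.
- by move=> a m p r /F2 Mp Mr; constructor=> //; constructor.
- by move=> k [q' [-> Mq]]; apply: cspanZ; exact: cspan_in.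
pose T x := fun t => \sum_(p <- FL (wwt t)) x p.1 * p.2 t.
suff H : forall x, hlm_set x -> x = T x.
  have [y Ay xy] := pmem_hlm Mx (wwt t); rewrite xy // -[RHS]/(T x t).
  have -> : T x t = T y t.
    by apply: big_In => q /P[e _ _]; rewrite xy // -[X in (_ <= X)%N]e.
  elim: Ay => [|a u v /H hu _ IH].
    by rewrite /T big1 // => q _; rewrite mul0r.
  rewrite IH {1}hu /T mulr_sumr -big_split; apply: eq_bigr => q _ /=; ring.
move=> {t Mx}x [p [k Hx]]; apply: funext => t.
have k0 := hlm_gt0 Hx.
(* A Lie monomial of length k is supported on words of length k, so only the operator for that
   length contributes to the sum over all lengths. *)
have ks : supq (@size X) k x.
  elim: Hx {k0} => [q b _ _ [|i [|j s]] //|p1 q1 k1 l1 u v hu IHu hv IHv s h].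
  have h' := h; rewrite (brk0E (hlm_pw hu) (hlm_pw hv)) /mul0 !big1 ?mulr0 ?addr0 // => i _.
    have [e|e] := eqVneq (size (take i s)) k1; last by rewrite IHu ?mul0r.
    rewrite IHv ?mulr0 //; apply: contra h' => /eqP e'.
    by rewrite -[s](cat_take_drop i) size_cat e e'.
  have [e|e] := eqVneq (size (take i s)) l1; last by rewrite IHv ?mul0r.
  rewrite IHu ?mulr0 //; apply: contra h' => /eqP e'.
  by rewrite -[s](cat_take_drop i) size_cat e e' addnC.
rewrite /T /FL big_flatten_map.
have E j : \sum_(q <- [seq (q.1, fun t => kinv K j.+1 * q.2 t) | q <- Fc F Bl cl j (wwt t)])
   x q.1 * q.2 t = kinv K j.+1 * SL j x t.
  rewrite big_map mulr_sumr; apply: eq_bigr => q _ /=; ring.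
have Hj j : j != k.-1 -> SL j x t = 0.
  move=> jk; rewrite /Sc (big_In (G := fun=> 0)) ?big1 // => q Hq; rewrite ks ?mul0r //.
  rewrite (Fc_size (s0 := 1) _ Hq) => [|n q' H]; first by apply: contra jk => /eqP <-.
  by have [r _ ->] := In_map H.
under eq_bigr do rewrite E.
have Hk := SL_hlm Hx.
have [kt|kt] := ltnP k.-1 (wwt t).
  rewrite (bigD1_seq k.-1) ?iota_uniq ?mem_iota //= [X in _ + X]big1 ?addr0; last first.
    by move=> j jk; rewrite Hj ?mulr0.
  by rewrite Hk prednK // mulrA kinvK // mul1r.
have SL0 : SL k.-1 x t = 0.
  rewrite /Sc (@Fc_nil _ F0 Bl cl 1) ?big_nil //.
  by case=> // _; rewrite /Bl F0.
rewrite big1 => [|j _]; last first.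
  by have [->|jk] := eqVneq j k.-1; rewrite ?SL0 ?Hj ?mulr0.
by apply: (natK0 k0); rewrite -[LHS]/((fun t => k%:R * x t) t) -Hk.
Qed.

End Frames.
End Words.

(** * Graded components of the free algebras *)

Section Closures.
Variable K : evenRing.

Lemma kswapE (X Y Z : Type) (dX : X -> int) (dY : Y -> int)
    (f : (Y -> K) -> (X -> K) -> Z -> K) x y :
  kswap dX dY f x y = fun k => f y (par dX false x) k + f (sg dY y) (par dX true x) k.
Proof.
rewrite /kswap; apply: funext => k; congr (f _ _ _ + f _ _ _); apply: funext => i.
  by rewrite /par; case: (odd _).
by rewrite /par; case: (odd _).
Qed.

Section Alg.
Variable M : pmod K.
Notation wS := (@wwt K M).
Notation dS := (@wdg K M).
Notation pt := (@pmem K (talg M)).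
Notation pl := (@pmem K (lalg M)).
Notation rl := (@prel K (lalg M)).
Notation nof := (fun=> 0%N).
Let mulS := @mul0_split K M nof.
Let brkS := @brk0_split K M nof.

Lemma sg_letter (b : sym M -> K) : sg dS (@letter0 K M b) = letter0 (sg (@dg K M) b).
Proof.
apply: funext => -[|i [|j s]]; rewrite /sg /= ?mulr0 //.
by rewrite /wdg big_seq1.
Qed.

Lemma wc_letter n (b : sym M -> K) : wc wS n (@letter0 K M b) = letter0 (wc (@wt K M) n b).
Proof.
apply: funext => -[|i [|j s]]; rewrite /wc /= ?if_same //.
by rewrite /wwt big_seq1.
Qed.

Lemma letter_lin a (b c : sym M -> K) :
  @letter0 K M (fun i => a * b i + c i) = fun s => a * @letter0 K M b s + @letter0 K M c s.
Proof. by apply: funext => -[|i [|j s]] /=; rewrite ?mulr0 ?addr0. Qed.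

Lemma talg_mul x y : pt x -> pt y -> pt (mul0 x y).
Proof.
apply: (cspan_bil mulS) => // u v Hu Hv; apply: cspan_in.
elim: Hu => [|b u' Mb _ IH]; first by rewrite mul0_1l.
by rewrite (mul0A nof); constructor.
Qed.

Lemma talg_letter b : pmem b -> pt (letter0 b).
Proof.
move=> Mb; have -> : @letter0 K M b = mul0 (letter0 b) (@one0 K M).
  apply: funext => -[|i s]; first by rewrite mul0_letter_nil.
  by rewrite mul0_letter_cons; case: s => [|j s]; rewrite /one0 /= ?mulr1 ?mulr0.
by apply: cspan_in; constructor=> //; constructor.
Qed.

Lemma talg_one : pt (@one0 K M).
Proof. by apply: cspan_in; constructor. Qed.

Lemma lalg_letter b : pmem b -> pl (letter0 b).
Proof. by move=> Mb; apply: cspan_in; constructor. Qed.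

Lemma lalg_brk x y : pl x -> pl y -> pl (brk0 x y).
Proof.
by apply: (cspan_bil brkS) => // u v Hu Hv; apply: cspan_in; constructor.
Qed.

Section SgWc.
Hypothesis M_sg : forall b, @pmem K M b -> @pmem K M (sg (@dg K M) b).
Hypothesis M_wc : forall n b, @pmem K M b -> @pmem K M (wc (@wt K M) n b).

Lemma talg_sg x : pt x -> pt (sg dS x).
Proof.
apply: cspan_sg => u; elim=> [|b v Mb _ IH].
  rewrite (_ : sg _ _ = @one0 K M); first exact: talg_one.
  apply: funext => -[|i s]; rewrite /sg /one0 /= ?mulr0 //.
  by rewrite /wdg big_nil mulr1.
rewrite (split_sg mulS); apply: talg_mul => //.
by rewrite -[sg _ _]/(sg dS _) sg_letter; exact/talg_letter/M_sg.
Qed.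

Lemma talg_wc n x : pt x -> pt (wc wS n x).
Proof.
apply: cspan_wc => u Hu; elim: Hu n => [|b v Mb _ IH] n.
  case: n => [|n].
    rewrite (_ : wc _ _ _ = @one0 K M); first exact: talg_one.
    apply: funext => -[|i s]; rewrite /wc /one0 /= ?if_same //.
    by rewrite /wwt big_nil.
  rewrite (_ : wc _ _ _ = fun=> 0); first exact: cspan0.
  apply: funext => -[|i s]; rewrite /wc /one0 /= ?if_same //.
  by rewrite /wwt big_nil.
rewrite (split_wc mulS); apply: cspan_sum_ord => k; apply: talg_mul; last exact: IH.
by rewrite -[wc _ _ _]/(wc wS _ _) wc_letter; exact/talg_letter/M_wc.
Qed.

Lemma lalg_sg x : pl x -> pl (sg dS x).
Proof.
apply: cspan_sg => u; elim=> [b Mb|v w _ Hv _ Hw].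
  by rewrite sg_letter; exact/lalg_letter/M_sg.
by rewrite (split_sg brkS); exact: lalg_brk.
Qed.

Lemma lalg_wc n x : pl x -> pl (wc wS n x).
Proof.
apply: cspan_wc => u Hu; elim: Hu n => [b Mb|v w _ Hv _ Hw] n.
  by rewrite wc_letter; exact/lalg_letter/M_wc.
by rewrite (split_wc brkS); apply: cspan_sum_ord => k; apply: lalg_brk; [exact: Hv|exact: Hw].
Qed.

Lemma talg_par p x : pt x -> pt (par dS p x).
Proof. by move=> Hx; rewrite parE; apply: cspanZ; apply: cspanD => //; exact/cspanZ/talg_sg. Qed.

Lemma lalg_par p x : pl x -> pl (par dS p x).
Proof. by move=> Hx; rewrite parE; apply: cspanZ; apply: cspanD => //; exact/cspanZ/lalg_sg. Qed.

Lemma lalg_talg x : pl x -> pt x.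
Proof.
apply: cspan_sub => u; elim=> [b Mb|v w _ Hv _ Hw]; first exact: talg_letter.
rewrite /brk0; apply: cspanB; first exact: talg_mul.
rewrite kswapE; apply: cspanD; apply: talg_mul => //; try exact: talg_par.
exact: talg_sg.
Qed.

Lemma tidealP x r y : pt x -> pmem r -> prel r -> pt y -> rl (mul0 x (mul0 (letter0 r) y)).
Proof.
move=> Hx Mr Rr Hy.
apply: (@cspan_map _ _ _ wS wS (@tmonomial K M) _
         (fun x => mul0 x (mul0 (letter0 r) y))) Hx => [a u v|n u v uv|u Hu].
- exact: (mul0_linl nof).
- exact: (split_eqw mulS).
apply: (@cspan_map _ _ _ wS wS (@tmonomial K M) _
         (fun y => mul0 u (mul0 (letter0 r) y))) Hy => [a v w|n v w vw|v Hv].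
- by rewrite !(mul0_linr nof).
- by apply: (split_eqw mulS) => //; exact: (split_eqw mulS).
by apply: cspan_in; exists u, r, v; split.
Qed.

Lemma rl_mull x y : pt x -> rl y -> rl (mul0 x y).
Proof.
apply: (cspan_bil mulS) => // u v Hu [x1 [r [y1 [Hx [Mr Rr] Hy ->]]]].
rewrite -(mul0A nof); apply: tidealP => //; last exact: cspan_in.
by apply: talg_mul; exact: cspan_in.
Qed.

Lemma rl_mulr x y : rl x -> pt y -> rl (mul0 x y).
Proof.
apply: (cspan_bil mulS) => // u v [x1 [r [y1 [Hx [Mr Rr] Hy ->]]]] Hv.
rewrite !(mul0A nof); apply: tidealP => //; first exact: cspan_in.
by apply: talg_mul; exact: cspan_in.
Qed.

Lemma rl_letter r : pmem r -> prel r -> rl (letter0 r).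
Proof.
move=> Mr Rr; have -> : letter0 r = mul0 (@one0 K M) (mul0 (letter0 r) (@one0 K M)).
  rewrite mul0_1l; apply: funext => -[|i s]; first by rewrite mul0_letter_nil.
  by rewrite mul0_letter_cons; case: s => [|j s]; rewrite /one0 /= ?mulr1 ?mulr0.
by apply: tidealP => //; exact: talg_one.
Qed.

Hypothesis R_sg : forall b, pmem b -> @prel K M b -> prel (sg (@dg K M) b).
Hypothesis R_wc : forall n b, pmem b -> @prel K M b -> prel (wc (@wt K M) n b).

Lemma rl_sg x : rl x -> rl (sg dS x).
Proof.
apply: cspan_sg => _ [x1 [r [y1 [Hx [Mr Rr] Hy ->]]]].
rewrite !(split_sg mulS); rewrite -![sg _ _]/(sg dS _) sg_letter; apply: tidealP.
- exact/talg_sg/cspan_in.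
- exact: M_sg.
- exact: R_sg.
exact/talg_sg/cspan_in.
Qed.

Lemma rl_wc n x : rl x -> rl (wc wS n x).
Proof.
apply: cspan_wc => _ [x1 [r [y1 [Hx [Mr Rr] Hy ->]]]].
rewrite (split_wc mulS); apply: cspan_sum_ord => k; apply: rl_mull.
  exact/talg_wc/cspan_in.
rewrite (split_wc mulS); apply: cspan_sum_ord => l; apply: rl_mulr.
  by rewrite -[wc _ _ _]/(wc wS _ _) wc_letter; apply: rl_letter; [exact: M_wc|exact: R_wc].
exact/talg_wc/cspan_in.
Qed.

Lemma rl_par p x : rl x -> rl (par dS p x).
Proof. by move=> Hx; rewrite parE; apply: cspanZ; apply: cspanD => //; exact/cspanZ/rl_sg. Qed.

Lemma rl_brkl x y : rl x -> pl y -> rl (brk0 x y).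
Proof.
move=> Hx Hy; rewrite /brk0; apply: cspanB; first exact/rl_mulr/lalg_talg.
rewrite kswapE; apply: cspanD; apply: rl_mull => //; try exact: rl_par; first exact: lalg_talg.
exact/talg_sg/lalg_talg.
Qed.

Lemma rl_brkr x y : pl x -> rl y -> rl (brk0 x y).
Proof.
move=> Hx Hy; rewrite /brk0; apply: cspanB; first exact/rl_mull/Hy/lalg_talg.
rewrite kswapE; apply: cspanD; apply: rl_mulr => //; try exact/talg_par/lalg_talg.
exact: rl_sg.
Qed.

End SgWc.
End Alg.

(** * Tensor products: frames and stability under signs and weight components *)

Section Tens.
Variables (X Y : Type) (mX : X -> mdeg) (mY : Y -> mdeg).

Definition mtens (i : X * Y) : mdeg := mX i.1 + mY i.2.

Lemma tens0_split : splitop mX mY mtens (@tens0 K X Y).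
Proof.
move=> [a b]; apply: (@spl_ext _ _ _ _ _ _ (fun x y => 1 * (x a * y b))) => [x y|].
  by rewrite mul1r.
by apply: spl1 => //; exact: gpart1.
Qed.

Definition Fx (F : nat -> seq (X * (X -> K))) (G : nat -> seq (Y * (Y -> K))) n :=
  flatten [seq allpairs (fun p q => ((p.1, q.1), tens0 p.2 q.2)) (F a) (G (n - a)%N)
          | a <- iota 0 n.+1].

Variables (wX : X -> nat) (wY : Y -> nat) (A : set (X -> K)) (B : set (Y -> K)).
Hypothesis eX : forall i, (mX i).1.2 = wX i.
Hypothesis eY : forall i, (mY i).1.2 = wY i.
Variables (F : nat -> seq (X * (X -> K))) (G : nat -> seq (Y * (Y -> K))).
Hypotheses (FF : frame mX A F) (GG : frame mY B G).

Lemma Fx_ind (Q : nat -> (X * Y) * (X * Y -> K) -> Prop) :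
  (forall a b p q, inseq p (F a) -> inseq q (G b) -> Q (a + b)%N ((p.1, q.1), tens0 p.2 q.2)) ->
  forall n q, inseq q (Fx F G n) -> Q n q.
Proof.
move=> QQ n q Hq; have [l Hl lq] := In_flatten Hq; have [a Ha el] := In_map Hl.
rewrite el in lq; have [p [q' [pF qF ->]]] := In_allpairs lq.
have /In_mem := Ha; rewrite mem_iota add0n ltnS => /andP[_ an].
by rewrite -(subnKC an); apply: QQ.
Qed.

Lemma Fx_frame : frame mtens (cspan (fun i => (wX i.1 + wY i.2)%N)
    [set z | exists x y, [/\ A x, B y & z = tens0 x y]]) (Fx F G).
Proof.
have [F1 F2 F3] := FF; have [G1 G2 G3] := GG; split=> [||x Ax i].
- apply: Fx_ind => a b p q /F1[e1 s1 i1] /G1[e2 s2 i2]; split; last exact: split_int0 tens0_split _ _ i1 i2.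
    by rewrite /mtens /= e1 e2.
  exact: (split_supq tens0_split (q := id)) s1 s2.
- apply: (Fx_ind (Q := fun _ q => cspan _ _ q.2)) => a b p q pF qG; apply: cspan_in.
  by exists p.2, q.2; split; [exact: F2 pF|exact: G2 qG|].
pose T x := fun i => \sum_(p <- Fx F G (mtens i).1.2) x p.1 * p.2 i.
have pure n p : inseq p (Fx F G n) -> (wX p.1.1 + wY p.1.2)%N = n.
  by move: n p; apply: Fx_ind => a b p q /F1[e1 _ _] /G1[e2 _ _]; rewrite /= -eX -eY e1 e2.
suff H x1 y1 : A x1 -> B y1 -> tens0 x1 y1 = T (tens0 x1 y1).
  have [y Ay xy] := Ax (mtens i).1.2; rewrite xy -?eX -?eY // -[RHS]/(T x i).
  have -> : T x i = T y i by apply: big_In => q /pure e; rewrite xy // e.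
  elim: Ay => [|a u v [x1 [y1 [Hx Hy ->]]] _ IH].
    by rewrite /T big1 // => q _; rewrite mul0r.
  rewrite IH {1}H // /T mulr_sumr -big_split; apply: eq_bigr => q _ /=; ring.
move=> Hx Hy; apply: funext => t.
have -> : tens0 x1 y1 t = wc (fun i => (mtens i).1.2) (mtens t).1.2 (tens0 x1 y1) t.
  by rewrite /wc eqxx.
rewrite (split_wc tens0_split).
rewrite -(big_mkord xpredT (fun a => tens0 (wc _ a x1) (wc _ ((mtens t).1.2 - a)%N y1) t)).
rewrite /index_iota subn0 /T /Fx big_flatten_map; apply: eq_bigr => a _.
rewrite (wc_frame a FF Hx) (wc_frame _ GG Hy) (split_sum _ _ _ _ _ _ _ tens0_split).
by rewrite big_allpairs_dep; apply: eq_bigr => p _; apply: eq_bigr => q _ /=.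
Qed.

End Tens.

Section TensClosures.
Variables M N : pmod K.
Notation mM := (mg (fun=> 0%N) : sym M -> mdeg).
Notation mN := (mg (fun=> 0%N) : sym N -> mdeg).
Let tS := tens0_split mM mN.
Notation T := (tens M N).

Lemma pmem_tens x y : pmem x -> pmem y -> @pmem K T (tens0 x y).
Proof. by move=> Mx My; apply: cspan_in; exists x, y. Qed.

Lemma prel_tensl x y : pmem x -> prel x -> pmem y -> @prel K T (tens0 x y).
Proof. by move=> Mx Rx My; apply: cspan_in; exists x, y; split=> //; left. Qed.

Lemma prel_tensr x y : pmem x -> pmem y -> prel y -> @prel K T (tens0 x y).
Proof. by move=> Mx My Ry; apply: cspan_in; exists x, y; split=> //; right. Qed.

Lemma sg_tens (x : sym M -> K) (y : sym N -> K) : sg (@dg K T) (tens0 x y) = tens0 (sg (@dg K M) x) (sg (@dg K N) y).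
Proof. exact: (split_sg tS). Qed.

Lemma wc_tens n (x : sym M -> K) (y : sym N -> K) : wc (@wt K T) n (tens0 x y) =
  fun z => \sum_(k < n.+1) tens0 (wc (@wt K M) k x) (wc (@wt K N) (n - k)%N y) z.
Proof. exact: (split_wc tS). Qed.

Hypothesis M_sg : forall b, @pmem K M b -> @pmem K M (sg (@dg K M) b).
Hypothesis M_wc : forall n b, @pmem K M b -> @pmem K M (wc (@wt K M) n b).
Hypothesis N_sg : forall b, @pmem K N b -> @pmem K N (sg (@dg K N) b).
Hypothesis N_wc : forall n b, @pmem K N b -> @pmem K N (wc (@wt K N) n b).

Lemma tens_sg x : @pmem K T x -> @pmem K T (sg (@dg K T) x).
Proof.
apply: cspan_sg => _ [u [v [Mu Mv ->]]]; rewrite sg_tens.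
by apply: pmem_tens; [exact: M_sg|exact: N_sg].
Qed.

Lemma tens_wc n x : @pmem K T x -> @pmem K T (wc (@wt K T) n x).
Proof.
apply: cspan_wc => _ [u [v [Mu Mv ->]]]; rewrite wc_tens.
by apply: cspan_sum_ord => k; apply: pmem_tens; [exact: M_wc|exact: N_wc].
Qed.

Hypothesis RM_sg : forall b, @pmem K M b -> @prel K M b -> @prel K M (sg (@dg K M) b).
Hypothesis RM_wc : forall n b, @pmem K M b -> @prel K M b -> @prel K M (wc (@wt K M) n b).
Hypothesis RN_sg : forall b, @pmem K N b -> @prel K N b -> @prel K N (sg (@dg K N) b).
Hypothesis RN_wc : forall n b, @pmem K N b -> @prel K N b -> @prel K N (wc (@wt K N) n b).

End TensClosures.
End Closures.

Section Reduce.
Variable K : evenRing.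

(** A property seeing only weights up to n may be tested on the finite sum of the components of
    those weights. *)
Lemma wc_reduce (X : Type) (w : X -> nat) n (P : (X -> K) -> Prop) x :
  P (fun=> 0) -> (forall y z, P y -> P z -> P (fun i => y i + z i)) ->
  (forall y z, eqw w n y z -> P z -> P y) -> (forall k, P (wc w k x)) -> P x.
Proof.
move=> P0 PD Pn Pk; apply: (Pn _ (fun i => \sum_(k < n.+1) wc w k x i)).
  move=> i wi; rewrite (bigD1 (Ordinal (wi : (w i < n.+1)%N))) //= big1 => [|k kn].
    by rewrite addr0 /wc eqxx.
  by rewrite /wc; case: eqP => // e; case/eqP: kn; apply: val_inj.
elim: n.+1 => [|m IH].
  rewrite (_ : (fun i => _) = fun=> 0) //; by apply: funext => i; rewrite big_ord0.
rewrite (_ : (fun i => _) = fun i => \sum_(k < m) wc w k x i + wc w m x i); first exact: PD.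
by apply: funext => i; rewrite big_ord_recr.
Qed.

Lemma wc_supq (X : Type) (w : X -> nat) n k (x : X -> K) : supq w k x ->
  wc w n x = if k == n then x else fun=> 0.
Proof.
move=> xk; apply: funext => i; rewrite /wc; case: eqP => [<-|/eqP h].
  by case: eqP => // /eqP h; apply: xk; rewrite eq_sym.
case: eqP => // e; apply/esym/xk; by rewrite e.
Qed.

Lemma supq_wc (X : Type) (w : X -> nat) n (x : X -> K) : supq w n (wc w n x).
Proof. by move=> i h; rewrite /wc (negPf h). Qed.

Lemma spl_map1 (X Y X' Y' : Type) (mX : X -> mdeg) (mY : Y -> mdeg)
    (mX' : X' -> mdeg) (mY' : Y' -> mdeg) g (F : (X -> K) -> (Y -> K) -> K)
    (u : X -> X') (v : Y -> Y') :
  (forall a, mX' (u a) = mX a) -> (forall b, mY' (v b) = mY b) ->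
  spl mX mY g F -> spl mX' mY' g (fun x y => F (x \o u) (y \o v)).
Proof.
move=> eu ev H; apply: (@spl_ext K _ _ _ _ _ (fun x y =>
  F (fun a => 1 * x (u a)) (fun b => 1 * y (v b)))) => [x y|].
  by congr F; apply: funext => i; rewrite mul1r.
apply: (@spl_map _ _ _ _ _ _ _ _ _ _ _ 0 0) H => //.
- by move=> a; exact: gpart1.
- by move=> a; exact: gpart1.
- by move=> a; rewrite add0r ?eu ?ev.
- by move=> a; rewrite add0r ?eu ?ev.
by rewrite !add0r.
Qed.

Lemma homf_sg (X : Type) (d d' : X -> int) j (x : X -> K) : homf d j x -> homf d j (sg d' x).
Proof. by move=> hx i; apply: gpart0M => //; exact: gpart_ksgn. Qed.

Lemma homf_wc (X : Type) (d : X -> int) w n j (x : X -> K) : homf d j x -> homf d j (wc w n x).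
Proof. by move=> hx i; rewrite /wc; case: ifP => // _; exact: gpart0. Qed.

Section Trilinear.
Variables (X1 X2 X3 Z : Type) (w1 : X1 -> nat) (w2 : X2 -> nat) (w3 : X3 -> nat)
  (wZ : Z -> nat) (T : (X1 -> K) -> (X2 -> K) -> (X3 -> K) -> Z -> K).
Hypothesis T1 : forall a x x' y t,
  T (fun i => a * x i + x' i) y t = fun k => a * T x y t k + T x' y t k.
Hypothesis T2 : forall a x y y' t,
  T x (fun i => a * y i + y' i) t = fun k => a * T x y t k + T x y' t k.
Hypothesis T3 : forall a x y t t',
  T x y (fun i => a * t i + t' i) = fun k => a * T x y t k + T x y t' k.
Hypothesis Te : forall n x x' y y' t t', eqw w1 n x x' -> eqw w2 n y y' -> eqw w3 n t t' ->
  eqw wZ n (T x y t) (T x' y' t').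
Hypothesis Ts : forall k l m x y t, supq w1 k x -> supq w2 l y -> supq w3 m t ->
  supq wZ (k + l + m)%N (T x y t).
Variables (A1 : set (X1 -> K)) (A2 : set (X2 -> K)) (A3 : set (X3 -> K)) (S : set (Z -> K)).
Hypothesis A1w : forall n x, A1 x -> A1 (wc w1 n x).
Hypothesis A2w : forall n x, A2 x -> A2 (wc w2 n x).
Hypothesis A3w : forall n x, A3 x -> A3 (wc w3 n x).
Hypothesis TS : forall x y t, A1 x -> A2 y -> A3 t -> cspan wZ S (T x y t).

Let lin_case (X : Type) (w : X -> nat) n (P : (X -> K) -> Z -> K) x :
  (forall a x y, P (fun i => a * x i + y i) = fun k => a * P x k + P y k) ->
  (forall x y, eqw w n x y -> eqw wZ n (P x) (P y)) ->
  (forall k, cspan wZ S (wc wZ n (P (wc w k x)))) -> cspan wZ S (wc wZ n (P x)).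
Proof.
move=> PL PE; apply: (@wc_reduce _ w n (fun x => cspan wZ S (wc wZ n (P x)))).
- have := PL (-1) (fun=> 0) (fun=> 0).
  rewrite (_ : (fun i : X => _) = fun=> 0); last by apply: funext => k; rewrite mulr0 add0r.
  move=> ->; rewrite (_ : wc _ _ _ = fun=> 0); first exact: cspan0.
  by apply: funext => k; rewrite /wc mulN1r addNr if_same.
- move=> y z Hy Hz; rewrite (_ : (fun i => y i + z i) = fun i => 1 * y i + z i).
    by rewrite PL wc_lin; exact: cspan_lin.
  by apply: funext => k; rewrite mul1r.
- move=> y z yz Hz; rewrite (_ : wc wZ n (P y) = wc wZ n (P z)) //.
  by apply: funext => k; rewrite /wc; case: eqP => // h; rewrite (PE y z) ?h.
Qed.

(** A weight component of a defining relation need not be the relation for the same data, but it is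
    a sum of relations for weight components of the data, and these are admissible data again. *)
Lemma tri_wc n (x : X1 -> K) (y : X2 -> K) (t : X3 -> K) : A1 x -> A2 y -> A3 t -> cspan wZ S (wc wZ n (T x y t)).
Proof.
move=> Ax Ay At.
apply: (lin_case (w := w1) (P := fun x => T x y t)) => // [x1 x2 e|k1]; first exact: Te.
apply: (lin_case (w := w2) (P := fun y => T (wc w1 k1 x) y t)) => // [x1 x2 e|k2]; first exact: Te.
apply: (lin_case (w := w3) (P := T (wc w1 k1 x) (wc w2 k2 y))) => // [x1 x2 e|k3]; first exact: Te.
rewrite (@wc_supq _ _ _ (k1 + k2 + k3)%N); last by apply: Ts; exact: supq_wc.
case: eqP => _; last exact: cspan0.
by apply: TS; [exact: A1w|exact: A2w|exact: A3w].
Qed.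
End Trilinear.

End Reduce.

(** * One-forms and the action of the Lie algebra on their free Lie algebra *)

Section Concrete.
Variables (K : evenRing) (V : fgmod).
Notation W := (susp_dual K V).
Notation SW := (seq (sym W)).
Notation nof := (fun=> 0%N).
Notation onef := (fun=> 1%N).
Notation tW := (talg W).
Notation lW := (lalg W).

Lemma pmem_W b : @pmem K W b.
Proof. by apply: cspan_in. Qed.

Lemma prel_W b : @prel K W b -> b = fun=> 0.
Proof.
move=> H; apply: funext => i; have [y Ay ->] := H 1%N => //.
by case: Ay => // a x z [].
Qed.

Definition FW n : seq (sym W * (sym W -> K)) :=
  if n == 1%N then [seq (i, fun j => (j == i)%:R) | i <- enum (bas V)] else [::].

Lemma FW_frame : frame (@mg K W nof) (@pmem K W) FW.
Proof.
split=> [n p|n p _|x _ i]; last 2 first.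
- exact: pmem_W.
- rewrite /FW /= big_map big_enum /= (bigD1 i) //= big1 ?addr0 => [|j ji].
    by rewrite eqxx mulr1.
  by rewrite eq_sym (negPf ji) mulr0.
rewrite /FW; case: eqP => [-> H|_ H]; last by have := inseq_nil H.
have [j _ ->] := In_map H; split=> // i /=; last exact: gpart_nat.
by move=> h; case: eqP => // e; rewrite e eqxx in h.
Qed.

Lemma W_sg b : @pmem K W b -> @pmem K W (sg (@dg K W) b).
Proof. by move=> _; exact: pmem_W. Qed.
Lemma W_wc n b : @pmem K W b -> @pmem K W (wc (@wt K W) n b).
Proof. by move=> _; exact: pmem_W. Qed.

(** [W] has no relations, so the ideal dividing its tensor algebra is zero. Elements of the Lie
    algebra are thus functions on words, with unique representatives. *)
Lemma rl_W x : @prel K lW x -> x = fun=> 0.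
Proof.
move=> H; apply: funext => i; have [y Ay ->] := H (@wwt K W i) => //.
suff -> : y = fun=> 0 by [].
elim: Ay => // a u v [x1 [r [y1 [_ [_ /prel_W ->] _ ->]]]] _ ->.
have -> : @letter0 K W (fun=> 0) = fun=> 0 by apply: funext => -[|j [|k s]].
have mS := @mul0_split K W nof.
by rewrite (split_0l mS) (split_0r mS); apply: funext => j; rewrite mulr0 addr0.
Qed.

Lemma rt_W x : @prel K tW x -> x = fun=> 0.
Proof. exact: rl_W. Qed.

Lemma tW_sg x : @pmem K tW x -> @pmem K tW (sg (@dg K tW) x).
Proof. exact: (talg_sg W_sg). Qed.
Lemma tW_wc n x : @pmem K tW x -> @pmem K tW (wc (@wt K tW) n x).
Proof. exact: (talg_wc W_wc). Qed.
Lemma lW_sg x : @pmem K lW x -> @pmem K lW (sg (@dg K lW) x).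
Proof. exact: (lalg_sg W_sg). Qed.
Lemma lW_wc n x : @pmem K lW x -> @pmem K lW (wc (@wt K lW) n x).
Proof. exact: (lalg_wc W_wc). Qed.

Notation O1 := (Om1 W).
Notation sO := (sOm1 W).
Notation TO := (tens tW lW).

Lemma O1_sg x : @pmem K O1 x -> @pmem K O1 (sg (@dg K O1) x).
Proof. exact: (tens_sg tW_sg lW_sg). Qed.
Lemma O1_wc n x : @pmem K O1 x -> @pmem K O1 (wc (@wt K O1) n x).
Proof. exact: (tens_wc tW_wc lW_wc). Qed.

Lemma rel_TO z : @Defs.rel K TO z -> z = fun=> 0.
Proof.
move=> [x [y [_ _ [/rt_W|/rl_W] -> ->]]]; apply: funext => i; rewrite /tens0.
  by rewrite mul0r.
by rewrite mulr0.
Qed.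

(** The defining relation of [Om1] with its sign freed from the degrees of [y] and [t]; in this form
    it is trilinear. *)
Definition relO (c : K) (x y t : SW -> K) : sym O1 -> K :=
  fun k => tens0 x (brk0 y t) k - tens0 (mul0 x y) t k + c * tens0 (mul0 x t) y k.

Notation wW := (@wmg K W nof).
Let mulS := @mul0_split K W nof.
Let brkS := @brk0_split K W nof.
Let tenS := @tens0_split K SW SW wW wW.

Lemma tens0_linl a (x x' y : SW -> K) :
  tens0 (fun i => a * x i + x' i) y = fun i => a * tens0 x y i + tens0 x' y i.
Proof. exact: (split_linl tenS). Qed.
Lemma tens0_linr a (x y y' : SW -> K) :
  tens0 x (fun i => a * y i + y' i) = fun i => a * tens0 x y i + tens0 x y' i.
Proof. exact: (split_linr tenS). Qed.

Lemma relO_lin1 c a x x' y t :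
  relO c (fun i => a * x i + x' i) y t = fun k => a * relO c x y t k + relO c x' y t k.
Proof.
rewrite /relO !(mul0_linl nof) !tens0_linl; apply: funext => k; ring.
Qed.
Lemma relO_lin2 c a x y y' t :
  relO c x (fun i => a * y i + y' i) t = fun k => a * relO c x y t k + relO c x y' t k.
Proof.
rewrite /relO (brk0_linl nof) !(mul0_linr nof) !(tens0_linl, tens0_linr).
apply: funext => k; ring.
Qed.
Lemma relO_lin3 c a x y t t' :
  relO c x y (fun i => a * t i + t' i) = fun k => a * relO c x y t k + relO c x y t' k.
Proof.
rewrite /relO (brk0_linr nof) !(mul0_linr nof) !(tens0_linl, tens0_linr).
apply: funext => k; ring.
Qed.

Lemma relO_eqw c n x x' y y' t t' :
  eqw (@wwt K W) n x x' -> eqw (@wwt K W) n y y' -> eqw (@wwt K W) n t t' ->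
  eqw (@wt K O1) n (relO c x y t) (relO c x' y' t').
Proof.
move=> ex ey et i wi; congr (_ - _ + _ * _); apply: (split_eqw tenS (n := n)) => //.
- exact: (split_eqw brkS).
- exact: (split_eqw mulS).
- exact: (split_eqw mulS).
Qed.

Lemma relO_supq c k l m x y t :
  supq (@wwt K W) k x -> supq (@wwt K W) l y -> supq (@wwt K W) m t ->
  supq (@wt K O1) (k + l + m)%N (relO c x y t).
Proof.
pose q (g : mdeg) := g.1.2; have qD (g h : mdeg) : q (g + h) = (q g + q h)%N by [].
move=> hx hy ht.
have h1 := split_supq tenS qD hx (split_supq brkS qD hy ht).
have h2 := split_supq tenS qD (split_supq mulS qD hx hy) ht.
have h3 := split_supq tenS qD (split_supq mulS qD hx ht) hy.
move=> i h; rewrite /relO h2 ?h1 ?h3 ?mulr0 ?subr0 ?addr0 //.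
- by rewrite addnAC.
- by rewrite addnA.
Qed.

Lemma relO_sg c x y t : sg (@dg K O1) (relO c x y t) =
  relO c (sg (@wdg K W) x) (sg (@wdg K W) y) (sg (@wdg K W) t).
Proof.
have -> : sg (@dg K O1) (relO c x y t) = fun k =>
   sg (@dg K O1) (tens0 x (brk0 y t)) k - sg (@dg K O1) (tens0 (mul0 x y) t) k +
   c * sg (@dg K O1) (tens0 (mul0 x t) y) k.
  by apply: funext => k; rewrite /sg /relO; ring.
rewrite /relO -(split_sg mulS) -(split_sg mulS) -(split_sg brkS).
by have E := split_sg tenS; rewrite -[sg (@dg K O1)]/(sg (fun a => (mtens wW wW a).1.1)) !E.
Qed.

Lemma prel_relO i j x y t : @pmem K tW x -> @pmem K lW y -> homf (@wdg K W) i y ->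
  @pmem K lW t -> homf (@wdg K W) j t -> @prel K O1 (relO (ksgn K (j * i)) x y t).
Proof. by move=> Hx Hy yi Ht tj; apply: cspan_in; right; exists i, j, x, y, t. Qed.

Lemma prelO_ind (T : (sym O1 -> K) -> sym O1 -> K) :
  (forall a x y, T (fun i => a * x i + y i) = fun i => a * T x i + T y i) ->
  (forall n x y, eqw (@wt K O1) n x y -> eqw (@wt K O1) n (T x) (T y)) ->
  (forall i j x y t, @pmem K tW x -> @pmem K lW y -> homf (@wdg K W) i y ->
  @pmem K lW t -> homf (@wdg K W) j t -> @prel K O1 (T (relO (ksgn K (j * i)) x y t))) ->
  forall z, @prel K O1 z -> @prel K O1 (T z).
Proof.
move=> Tl Te H; apply: cspan_map => // z [/rel_TO ->|].
  have := Tl (-1) (fun=> 0) (fun=> 0).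
  rewrite (_ : (fun i : sym O1 => _) = fun=> 0); last by apply: funext => i; rewrite mulr0 add0r.
  move=> {1}->; rewrite (_ : (fun i : sym O1 => _) = fun=> 0); first exact: cspan0.
  by apply: funext => i; rewrite mulN1r addNr.
by move=> [i [j [x [y [t [Hx [Hy hy] [Ht ht] ->]]]]]]; exact: H.
Qed.

Lemma O1r_sg x : @prel K O1 x -> @prel K O1 (sg (@dg K O1) x).
Proof.
apply: prelO_ind => [a u v|n u v uv k h|i j u v t Hu Hv hv Ht ht].
- exact: sg_lin.
- by rewrite /sg uv.
rewrite relO_sg; apply: prel_relO; try exact: homf_sg; [exact: tW_sg|exact: lW_sg|exact: lW_sg].
Qed.

Lemma O1r_wc n x : @prel K O1 x -> @prel K O1 (wc (@wt K O1) n x).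
Proof.
apply: prelO_ind => [a u v|k u v uv l h|i j u v t Hu Hv hv Ht ht].
- exact: wc_lin.
- by rewrite /wc uv.
apply: (@tri_wc K _ _ _ _ (@wwt K W) (@wwt K W) (@wwt K W) _ (relO _) _ _ _ _ _
  (@pmem K tW) [set y | @pmem K lW y /\ homf (@wdg K W) i y]
  [set t | @pmem K lW t /\ homf (@wdg K W) j t]) => //.
- by move=> *; exact: relO_lin1.
- by move=> *; exact: relO_lin2.
- by move=> *; exact: relO_lin3.
- by move=> *; exact: relO_eqw.
- by move=> *; exact: relO_supq.
- by move=> k y; exact: tW_wc.
- by move=> k y [Hy hy]; split; [exact: lW_wc|exact: homf_wc].
- by move=> k y [Hy hy]; split; [exact: lW_wc|exact: homf_wc].
- by move=> x1 y1 t1 Hx1 [Hy1 hy1] [Ht1 ht1]; exact: prel_relO.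
Qed.

Lemma sg_shift (x : sym sO -> K) : sg (@dg K sO) x = fun p => -1 * sg (@dg K O1) x p.
Proof. by apply: funext => p; rewrite /sg /= ksgnD ksgn1; ring. Qed.

Lemma sO_sg x : @pmem K sO x -> @pmem K sO (sg (@dg K sO) x).
Proof. by move=> H; rewrite sg_shift; apply: cspanZ; exact: O1_sg. Qed.
Lemma sO_wc n x : @pmem K sO x -> @pmem K sO (wc (@wt K sO) n x).
Proof. exact: O1_wc. Qed.
Lemma sOr_sg x : @pmem K sO x -> @prel K sO x -> @prel K sO (sg (@dg K sO) x).
Proof. by move=> _ H; rewrite sg_shift; apply: cspanZ; exact: O1r_sg. Qed.
Lemma sOr_wc n x : @pmem K sO x -> @prel K sO x -> @prel K sO (wc (@wt K sO) n x).
Proof. by move=> _; exact: O1r_wc. Qed.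

Notation lS := (lalg sO).
Notation SO := (seq (sym sO)).
Notation wO := (@wmg K sO onef).
Let mulO := @mul0_split K sO onef.
Let brkO := @brk0_split K sO onef.

Lemma lS_sg x : @pmem K lS x -> @pmem K lS (sg (@dg K lS) x).
Proof. exact: (lalg_sg sO_sg). Qed.
Lemma lS_wc n x : @pmem K lS x -> @pmem K lS (wc (@wt K lS) n x).
Proof. exact: (lalg_wc sO_wc). Qed.
Lemma lSr_sg x : @prel K lS x -> @prel K lS (sg (@dg K lS) x).
Proof. exact: (rl_sg sO_sg sOr_sg). Qed.
Lemma lSr_wc n x : @prel K lS x -> @prel K lS (wc (@wt K lS) n x).
Proof. exact: (rl_wc sO_wc sOr_wc). Qed.

(* The action of [x] on a single letter, and its extension by one letter. *)
Definition lact (x : SW -> K) (b : sym sO -> K) : sym sO -> K := fun p =>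
  \sum_(k < (size p.1).+1)
    ksgn K (wdg (take k p.1)) * x (take k p.1) * b (drop k p.1, p.2).
Definition hact (x : SW -> K) (l : SO -> K) (p : sym sO) (s : SO) : K :=
  lact x (fun q => l (q :: s)) p.

Lemma wmg0 (M : pmod K) (s : seq (sym M)) : wmg nof s = (wdg s, wwt s, 0%N).
Proof. by rewrite /wmg big1. Qed.
Lemma wmgS1 (M : pmod K) (s : seq (sym M)) : wmg onef s = (wdg s, wwt s, size s).
Proof. by rewrite /wmg sum1_size. Qed.

Lemma lact_split : splitop wW (@mg K sO onef) (@mg K sO onef) lact.
Proof.
move=> p; apply: (@spl_ext _ _ _ _ _ _ (fun x b => \sum_(k <- index_enum 'I_(size p.1).+1)
  ksgn K (wdg (take k p.1)) * (x (take k p.1) * b (drop k p.1, p.2)))) => [x b|].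
  by rewrite /lact; apply: eq_bigr => k _; rewrite mulrA.
apply: spl_sum => k _; apply: spl1; first exact: gpart_ksgn.
rewrite wmg0 /mg /=.
have -> : wdg p.1 = wdg (take k p.1) + wdg (drop k p.1).
  by rewrite /wdg -big_cat cat_take_drop.
have -> : wwt p.1 = (wwt (take k p.1) + wwt (drop k p.1))%N.
  by rewrite /wwt -big_cat cat_take_drop.
by rewrite -!addrA -addnA.
Qed.

Lemma act_cons x l p s :
  act x l (p :: s) = hact x l p s +
    act (fun w => ksgn K (wdg w * @dg K sO p) * x w) (fun w => l (p :: w)) s.
Proof. by []. Qed.

Lemma act_split : splitop wW wO wO (@act K W).
Proof.
move=> s; elim: s => [|p s IH]; first exact: spl0.
apply: (@spl_ext _ _ _ _ _ _ (fun x l => hact x l p s +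
    act (fun w => ksgn K (wdg w * @dg K sO p) * x w) (fun w => l (p :: w)) s)) => //.
apply: splD.
  have := lact_split p; move=> H.
  apply: (@spl_ext _ _ _ _ _ _ (fun x l => lact (fun a => 1 * x a)
    (fun q => 1 * l (q :: s)) p)) => [x l|].
    by rewrite /hact; congr (lact _ _ p); apply: funext => i; rewrite mul1r.
  apply: (@spl_map _ _ _ _ _ _ _ _ _ _ _ 0 (wmg onef s)) H => //.
  - by move=> a; exact: gpart1.
  - by move=> a; exact: gpart1.
  - by move=> a; rewrite add0r.
  - by move=> q; rewrite wmg_cons addrC.
  by rewrite add0r wmg_cons addrC.
apply: (@spl_ext _ _ _ _ _ _ (fun x l => act (fun w => ksgn K (wdg w * @dg K sO p) * x w)
    (fun w => 1 * l (p :: w)) s)) => [x l|].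
  by congr (act _ _ s); apply: funext => w; rewrite mul1r.
apply: (@spl_map _ _ _ _ _ _ _ _ _ _ _ 0 (mg onef p)) IH => //.
- by move=> a; exact: gpart_ksgn.
- by move=> a; exact: gpart1.
- by move=> a; rewrite add0r.
- by move=> q; rewrite wmg_cons.
by rewrite add0r wmg_cons.
Qed.

Lemma act_letter x b : act x (letter0 b) = letter0 (lact x b).
Proof.
apply: funext => -[|p s] //; rewrite act_cons; case: s => [|p' s].
  by rewrite /act /= addr0.
rewrite (_ : hact _ _ _ _ = 0) ?add0r; last first.
  by rewrite /hact /lact big1 // => k _; rewrite mulr0.
elim: s p p' x => [|q s IH] p p' x.
  by rewrite act_cons /act /= addr0 /hact /lact big1 // => k _; rewrite mulr0.
rewrite act_cons (_ : hact _ _ _ _ = 0) ?add0r; last first.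
  by rewrite /hact /lact big1 // => k _; rewrite mulr0.
set x' := (fun w => _); rewrite (_ : (fun w => _) = fun=> 0).
  by rewrite (split_0r act_split).
exact: funext.
Qed.

(** Left multiplication only changes the first tensor factor, hence it carries the relations of
    [Om1] to relations of the same kind. *)
Lemma lact_tens x u v : lact x (tens0 u v) = tens0 (mul0 (sg (@wdg K W) x) u) v.
Proof.
apply: funext => p; rewrite /lact /tens0 /mul0 mulr_suml; apply: eq_bigr => k _ /=.
by rewrite /sg mulrA.
Qed.

Notation pw := (supq (fun s : SW => odd (absz (wdg s)))).
Notation pO := (supq (fun s : SO => odd (absz (wdg s)))).

Definition sga (a : bool) (u : SO -> K) : SO -> K :=
  fun s => (-1) ^+ (a && odd (absz (wdg s))) * u s.

Lemma act_pure a x l p s : pw a x ->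
  act x l (p :: s) = hact x l p s +
     (-1) ^+ (a && odd (absz (@dg K sO p))) * act x (fun w => l (p :: w)) s.
Proof.
move=> xa; rewrite act_cons; congr (_ + _).
set c := (-1) ^+ _; have -> : (fun w => ksgn K (wdg w * @dg K sO p) * x w) =
   fun w => c * x w + 0.
  apply: funext => w; rewrite addr0; have [e|e] := eqVneq (odd (absz (wdg w))) a.
    by rewrite ksgnE odd_abszM e.
  by rewrite xa // !mulr0.
by rewrite (split_linl act_split) (split_0l act_split) addr0.
Qed.

(** [act0] moves x across the letters of a word one at a time, picking up a sign for each; this is
    the graded Leibniz rule, by induction on the word. *)
Lemma act_mul a x u v : pw a x ->
  act x (mul0 u v) = fun s => mul0 (act x u) v s + mul0 (sga a u) (act x v) s.
Proof.
move=> xa; apply: funext => s; elim: s u v => [|p s IH] u v.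
  by rewrite !mul0_nil /= mul0r mulr0 addr0.
rewrite (act_pure _ _ _ xa) !mul0_cons mul0r add0r.
set c := (-1) ^+ _.
have e1 : (fun w => mul0 u v (p :: w)) =
   fun w => u [::] * v (p :: w) + mul0 (fun w => u (p :: w)) v w.
  by apply: funext => w; rewrite mul0_cons.
rewrite e1 (split_linr act_split) IH.
have -> : hact x (mul0 u v) p s = u [::] * hact x v p s + mul0 (hact x u p) v s.
  rewrite /hact.
  have -> : (fun q => mul0 u v (q :: s)) =
     fun q => u [::] * v (q :: s) + mul0 (fun w => u (q :: w)) v s.
    by apply: funext => q; rewrite mul0_cons.
  rewrite (split_linr lact_split); congr (_ + _).
  rewrite /lact /mul0.
  under eq_bigr do rewrite mulr_sumr.
  rewrite exchange_big; apply: eq_bigr => k _ /=.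
  by rewrite mulr_suml; apply: eq_bigr => m _; rewrite mulrA.
have -> : (fun w => act x u (p :: w)) =
    fun w => c * act x (fun w => u (p :: w)) w + hact x u p w.
  by apply: funext => w; rewrite (act_pure _ _ _ xa) addrC.
have -> : (fun w => sga a u (p :: w)) = fun w => c * sga a (fun w => u (p :: w)) w + 0.
  apply: funext => w; rewrite addr0 /sga /c mulrA -signr_addb; congr (_ ^+ _ * _).
  by rewrite /wdg big_cons odd_abszD; case: a {xa c e1 IH} => //=.
rewrite !(mul0_linl onef) (split_0l mulO) (act_pure _ _ _ xa) -/c.
rewrite /sga /wdg big_nil andbF /=; ring.
Qed.

Lemma act_pO a b x u : pw a x -> pO b u -> pO (a (+) b) (act x u).
Proof.
apply: (split_supq act_split (q := fun g : mdeg => odd (absz g.1.1))) => g h.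
exact: odd_abszD.
Qed.

Lemma sgaE a b u : pO b u -> sga a u = fun s => (-1) ^+ (a && b) * u s + 0.
Proof.
move=> ub; apply: funext => s; rewrite addr0 /sga.
by have [->//|h] := eqVneq (odd `|wdg s|) b; rewrite ub // !mulr0.
Qed.

Lemma act_brk a b c x u v : pw a x -> pO b u -> pO c v ->
  act x (brk0 u v) = fun s => brk0 (act x u) v s + (-1) ^+ (a && b) * brk0 u (act x v) s.
Proof.
move=> xa ub vc; have xu := act_pO xa ub; have xv := act_pO xa vc.
rewrite (brk0E onef ub vc) (brk0E onef xu vc) (brk0E onef ub xv).
rewrite (split_linr act_split) !(act_mul _ _ xa).
rewrite (sgaE a ub) (sgaE a vc) !(mul0_linl onef) !(split_0l mulO).
apply: funext => s; clear; by case: a; case: b; case: c => /=; ring.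
Qed.

Lemma lact_pmem x b : @pmem K lW x -> @pmem K sO b -> @pmem K sO (lact x b).
Proof.
move=> Hx; apply: (@cspan_map K _ _ (@wt K sO) (@wt K sO)) => [a u v|n u v uv|].
- exact: (split_linr lact_split).
- by move=> i wi; apply: (split_eqw lact_split (n := n)).
move=> _ [u [v [Hu Hv ->]]]; rewrite lact_tens; apply: cspan_in.
exists (mul0 (sg (@wdg K W) x) u), v; split=> //.
by apply: talg_mul => //; exact/tW_sg/(lalg_talg W_sg).
Qed.

Lemma lact_prel x b : @pmem K lW x -> @prel K sO b -> @prel K sO (lact x b).
Proof.
move=> Hx; apply: prelO_ind => [a u v|n u v uv|i j u v t Hu Hv hv Ht ht].
- exact: (split_linr lact_split).
- by move=> k wk; apply: (split_eqw lact_split (n := n)).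
have -> : lact x (relO (ksgn K (j * i)) u v t) =
   relO (ksgn K (j * i)) (mul0 (sg (@wdg K W) x) u) v t.
  have -> : relO (ksgn K (j * i)) u v t = fun k => ksgn K (j * i) * tens0 (mul0 u t) v k +
     (-1 * tens0 (mul0 u v) t k + tens0 u (brk0 v t) k).
    by apply: funext => k; rewrite /relO; ring.
  rewrite !(split_linr lact_split) !lact_tens /relO !(mul0A nof).
  apply: funext => k; ring.
apply: prel_relO => //; apply: talg_mul => //.
exact/tW_sg/(lalg_talg W_sg).
Qed.

Lemma act_hlm a x p k u : @pmem K lW x -> pw a x -> hlm p k u -> @pmem K lS (act x u).
Proof.
move=> Hx xa; elim=> [q b Mb _|p1 q1 k1 l1 v w hv IHv hw IHw].
  by rewrite act_letter; apply: lalg_letter; exact: lact_pmem.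
rewrite (act_brk xa (hlm_pw onef hv) (hlm_pw onef hw)).
apply: cspanD; [|apply: cspanZ]; apply: lalg_brk => //.
  exact/cspan_in/(hlm_lmon hw).
exact/cspan_in/(hlm_lmon hv).
Qed.

Lemma par_split (x : SW -> K) l : act x l =
  fun s => 1 * act (par (@wdg K W) false x) l s + act (par (@wdg K W) true x) l s.
Proof. by rewrite {1}[x](par_sum1 (@wdg K W)) (split_linl act_split). Qed.

(** Reduced to x of pure parity and u a Lie monomial, where the derivation rule for brackets leads
    back to letters. *)
Lemma pmem_act x u : @pmem K lW x -> @pmem K lS u -> @pmem K lS (act x u).
Proof.
move=> Hx Hu.
have H a : @pmem K lS (act (par (@wdg K W) a x) u).
  have := pmem_hlm onef sO_sg Hu.
  apply: (@cspan_map K _ _ (@wwt K sO) (@wt K lS)) => [b v w|n v w vw|v [p [k hv]]].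
  - exact: (split_linr act_split).
  - by move=> i wi; apply: (split_eqw act_split (n := n)).
  apply: (act_hlm (a := a)) hv; first exact: (lalg_par W_sg a Hx).
  by move=> s h; rewrite /par (negPf h).
by rewrite par_split; apply: cspan_lin; exact: H.
Qed.

Lemma act_tmon x a u : @pmem K lW x -> pw a x -> tmonomial u -> @pmem K (talg sO) (act x u).
Proof.
move=> Hx xa; elim=> [|b v Mb Hv IH].
  rewrite (_ : act _ _ = fun=> 0); first exact: cspan0.
  apply: funext => -[|p s] //; rewrite (act_pure _ _ _ xa).
  rewrite (_ : (fun w => one0 (p :: w)) = fun=> 0); last exact: funext.
  rewrite (split_0r act_split) mulr0 addr0 /hact.
  by rewrite /lact big1 // => k _; rewrite mulr0.
rewrite (act_mul _ _ xa) act_letter; apply: cspanD.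
  apply: talg_mul; last exact: cspan_in.
  exact/talg_letter/lact_pmem.
apply: talg_mul => //; case: a {xa}; last first.
  have -> : sga false (letter0 b) = letter0 b.
    by apply: funext => s; rewrite /sga /= mul1r.
  exact: talg_letter.
have -> : sga true (letter0 b) = sg (@wdg K sO) (letter0 b).
  by apply: funext => s; rewrite /sga /sg ksgnE.
exact/(talg_sg sO_sg)/talg_letter.
Qed.

Lemma prel_act x u : @pmem K lW x -> @prel K lS u -> @prel K lS (act x u).
Proof.
move=> Hx Hu.
have H a : @prel K lS (act (par (@wdg K W) a x) u).
  move: Hu; apply: (@cspan_map K _ _ (@wt K lS) (@wt K lS)) => [b v w|n v w vw|v].
  - exact: (split_linr act_split).
  - by move=> i wi; apply: (split_eqw act_split (n := n)).
  have Hx' := lalg_par W_sg a Hx; have xa : pw a (par (@wdg K W) a x).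
    by move=> s h; rewrite /par (negPf h).
  have sgaP y : tmonomial y -> @pmem K (talg sO) (sga a y).
    move=> Hy; case: a {xa Hx'}; last first.
      have -> : sga false y = y by apply: funext => s; rewrite /sga /= mul1r.
      exact: cspan_in.
    have -> : sga true y = sg (@wdg K sO) y.
      by apply: funext => s; rewrite /sga /sg ksgnE.
    exact/(talg_sg sO_sg)/cspan_in.
  move=> [y [r [z [Hy [Mr Rr] Hz ->]]]]; rewrite (act_mul _ _ xa); apply: cspanD.
    apply: tidealP => //; last exact: cspan_in.
    exact: act_tmon xa Hy.
  rewrite (act_mul _ _ xa) act_letter (_ : (fun s => _) = fun s => 1 *
    mul0 (letter0 (lact (par (@wdg K W) a x) r)) z s +
    mul0 (sga a (letter0 r)) (act (par (@wdg K W) a x) z) s); last first.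
    by apply: funext => s; rewrite mul1r.
  rewrite (mul0_linr onef); apply: cspan_lin.
    apply: tidealP; [exact: sgaP|exact: lact_pmem|exact: lact_prel|exact: cspan_in].
  apply: rl_mull; first exact: sgaP.
  apply: rl_mulr; last exact: act_tmon xa Hz.
  case: a {sgaP xa Hx'}; last first.
    have -> : sga false (letter0 r) = letter0 r by apply: funext => s; rewrite /sga /= mul1r.
    exact: rl_letter.
  have -> : sga true (letter0 r) = sg (@wdg K sO) (letter0 r).
    by apply: funext => s; rewrite /sga /sg ksgnE.
  exact/(rl_sg sO_sg sOr_sg)/rl_letter.
by rewrite par_split; apply: cspan_lin; exact: H.
Qed.

End Concrete.

(** * Weights and continuous linear maps *)

Section Lin.
Variables (K : nzRingType) (U V : lmodType K) (f : U -> V).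
Hypothesis fl : linear f.

Lemma linD u v : f (u + v) = f u + f v.
Proof. by have := fl 1 u v; rewrite !scale1r. Qed.
Lemma lin0 : f 0 = 0.
Proof. by apply: (addrI (f 0)); rewrite -linD !addr0. Qed.
Lemma linZ a u : f (a *: u) = a *: f u.
Proof. by have := fl a u 0; rewrite lin0 !addr0. Qed.
Lemma linN u : f (- u) = - f u.
Proof. by rewrite -scaleN1r linZ scaleN1r. Qed.
Lemma linB u v : f (u - v) = f u - f v.
Proof. by rewrite linD linN. Qed.
Lemma lin_sum (T : Type) (l : seq T) (F : T -> U) :
  f (\sum_(t <- l) F t) = \sum_(t <- l) f (F t).
Proof.
by elim: l => [|t l IH]; rewrite ?big_nil ?lin0 // !big_cons linD IH.
Qed.
End Lin.

Section Pcar.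
Variables (K : evenRing) (M : pmod K).
Implicit Types (u v : pcar M) (x y : sym M -> K).
Notation wM := (@wt K M).

Lemma cls_lin a x y : pmem x -> pmem y -> cls (fun i => a * x i + y i) = a *: cls x + cls y.
Proof.
move=> Mx My; rewrite -[_ + _]/(plin 1 (plin a (cls x) (pzero M)) (cls y)).
rewrite /pzero !plin_cls //; try exact: pmem0; last by apply: pmem_lin => //; exact: pmem0.
by congr cls; apply: funext => i; rewrite addr0 mul1r.
Qed.

Lemma cls0 : cls (fun=> 0) = 0 :> pcar M.
Proof. by []. Qed.

Lemma clsZ a x : pmem x -> cls (fun i => a * x i) = a *: cls x.
Proof.
move=> Mx; rewrite -[a *: _]addr0 -cls0 -cls_lin //; last exact: pmem0.
by congr cls; apply: funext => i; rewrite addr0.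
Qed.

Lemma clsB x y : pmem x -> pmem y -> cls (fun i => x i - y i) = cls x - cls y.
Proof.
move=> Mx My; rewrite addrC -scaleN1r -cls_lin //.
by congr cls; apply: funext => i; rewrite mulN1r addrC.
Qed.

Lemma cls_sum (T : Type) (l : seq T) (c : T -> K) (X : T -> sym M -> K) :
  (forall t, inseq t l -> pmem (X t)) ->
  cls (fun i => \sum_(t <- l) c t * X t i) = \sum_(t <- l) c t *: cls (X t).
Proof.
elim: l => [|t l IH] H.
  by rewrite big_nil -cls0; congr cls; apply: funext => i; rewrite big_nil.
rewrite big_cons -IH => [|t' lt']; last by apply: H; right.
rewrite -cls_lin; first by congr cls; apply: funext => i; rewrite big_cons.
  by apply: H; left.
by apply: cspan_sum => t' lt'; apply: cspanZ; apply: H; right.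
Qed.

Lemma clsW u : exists2 x, pmem x & u = cls x.
Proof. by exists (rep u); [exact: pmem_rep|rewrite repK]. Qed.

Lemma cls_eq0 x : pmem x -> cls x = 0 -> prel x.
Proof.
move=> Mx e; have := cosetxx Mx; rewrite -svalcls // e svalcls; last exact: pmem0.
move=> -[_]; by rewrite (_ : (fun i => _) = x) //; apply: funext => i; rewrite subr0.
Qed.

Lemma prel_cls0 x : pmem x -> prel x -> cls x = 0.
Proof.
move=> Mx Rx; rewrite -cls0; apply: clsP => //; first exact: pmem0.
rewrite (_ : (fun i => _) = fun i => -1 * x i + 0); first exact/prel_lin/cspan0.
by apply: funext => i; rewrite mulN1r addr0 sub0r.
Qed.

Section Supp.
Variable R : sym M -> K -> Prop.
Hypothesis R0 : forall i, R i 0.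
Hypothesis RB : forall i a b, R i a -> R i b -> R i (a - b).

Lemma supp0 : supp R (0 : pcar M).
Proof. by exists (fun=> 0); split=> //; exact: pmem0. Qed.

Lemma suppB u v : supp R u -> supp R v -> supp R (u - v).
Proof.
move=> [x [Mx -> Rx]] [y [My -> Ry]]; exists (fun i => x i - y i); split.
- exact: cspanB.
- by rewrite clsB.
- by move=> i; exact: RB.
Qed.

Lemma suppN u : supp R u -> supp R (- u).
Proof. by move=> Ru; rewrite -[- u]add0r; apply: suppB => //; exact: supp0. Qed.

Lemma suppD u v : supp R u -> supp R v -> supp R (u + v).
Proof. by move=> Ru Rv; rewrite -[v]opprK; apply: suppB => //; exact: suppN. Qed.

Lemma supp_sum (T : Type) (l : seq T) (F : T -> pcar M) :
  (forall t, inseq t l -> supp R (F t)) -> supp R (\sum_(t <- l) F t).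
Proof. apply: (@big_In_ind _ _ (fun u => supp R u)); [exact: supp0|exact: suppD]. Qed.
End Supp.

Lemma suppZ (R R' : sym M -> K -> Prop) c u : (forall i a, R i a -> R' i (c * a)) ->
  supp R u -> supp R' (c *: u).
Proof.
move=> H [x [Mx -> Rx]]; exists (fun i => c * x i); split.
- exact: cspanZ.
- by rewrite clsZ.
- by move=> i; exact: H.
Qed.

Lemma supp_sub (R R' : sym M -> K -> Prop) u : (forall i a, R i a -> R' i a) ->
  supp R u -> supp R' u.
Proof. by move=> H [x [Mx -> Rx]]; exists x; split=> // i; exact: H. Qed.

(** Exactly what makes weight components of classes well defined. *)
Definition graded := (forall n x, pmem x -> pmem (wc wM n x)) /\
                     (forall n x, prel x -> prel (wc wM n x)).
Hypothesis gM : graded.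

Definition wpart : nat -> pcar M -> pcar M :=
  sval (seal (fun (n : nat) (u : pcar M) => cls (wc wM n (rep u)))).

Lemma wpartE n u : wpart n u = cls (wc wM n (rep u)).
Proof. by rewrite /wpart sealE. Qed.

Lemma comp_cls n x : pmem x -> wpart n (cls x) = cls (wc wM n x).
Proof.
have [gm gr] := gM; move=> Mx; rewrite wpartE; apply: clsP; [exact/gm/pmem_rep|exact: gm|].
rewrite (_ : (fun i => _) = wc wM n (fun i => -1 * (rep (cls x) i - x i) + 0)).
  by apply/gr/prel_lin; [exact: rep_cls|exact: cspan0].
by apply: funext => i; rewrite /wc; case: ifP => _; ring.
Qed.

Lemma comp_lin n : linear (wpart n).
Proof.
have [gm _] := gM => a u v; have [x Mx ->] := clsW u; have [y My ->] := clsW v.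
rewrite -cls_lin // !comp_cls //; last exact: pmem_lin.
by rewrite wc_lin cls_lin //; exact: gm.
Qed.

Lemma comp_comp n m u : wpart n (wpart m u) = if m == n then wpart n u else 0.
Proof.
have [gm _] := gM; have [x Mx ->] := clsW u; rewrite !comp_cls //; last exact: gm.
rewrite (@wc_supq _ _ _ _ m); last exact: supq_wc.
by case: eqP => // ->.
Qed.

Lemma sum_comp_eqw (x : sym M -> K) n : eqw wM n x (fun i => \sum_(k < n.+1) wc wM k x i).
Proof.
move=> i wi; rewrite (bigD1 (Ordinal (wi : (wM i < n.+1)%N))) //= big1 => [|k kn].
  by rewrite addr0 /wc eqxx.
by rewrite /wc; case: eqP => // e; case/eqP: kn; apply: val_inj.
Qed.

(** Separatedness: the relations form a closed set, and a representative is approximated by the sums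
    of its components, all of which are relations. *)
Lemma comp_sep u : (forall n, wpart n u = 0) -> u = 0.
Proof.
have [gm gr] := gM; have [x Mx ->] := clsW u => H; apply: prel_cls0 => //.
apply: cspan_close => n; exists (fun i => \sum_(k < n.+1) wc wM k x i).
  apply: cspan_sum_ord => k; apply: cls_eq0; first exact: gm.
  by rewrite -comp_cls.
exact: sum_comp_eqw.
Qed.

Lemma comp_inj u v : (forall n, wpart n u = wpart n v) -> u = v.
Proof.
move=> H; apply/eqP; rewrite -subr_eq0; apply/eqP/comp_sep => n.
by rewrite (linB (comp_lin n)) H subrr.
Qed.

(** Completeness: the element whose component of weight n is that of [u_ n]. Infinite sums and
    operators defined weight by weight are built with it. *)
Definition wglue : (nat -> pcar M) -> pcar M :=
  sval (seal (fun u_ : nat -> pcar M => cls (fun i => rep (u_ (wM i)) i))).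

Lemma wglueE (u_ : nat -> pcar M) : wglue u_ = cls (fun i => rep (u_ (wM i)) i).
Proof. by rewrite /wglue sealE. Qed.

Lemma glue_pmem (x_ : nat -> sym M -> K) : (forall n, pmem (x_ n)) ->
  pmem (fun i => x_ (wM i) i).
Proof.
have [gm _] := gM => H; apply: cspan_close => n.
exists (fun i => \sum_(k < n.+1) wc wM k (x_ k) i).
  by apply: cspan_sum_ord => k; exact: gm.
move=> i wi; rewrite (bigD1 (Ordinal (wi : (wM i < n.+1)%N))) //= big1 => [|k kn].
  by rewrite addr0 /wc eqxx.
by rewrite /wc; case: eqP => // e; case/eqP: kn; apply: val_inj.
Qed.

Lemma glue_cls (x_ : nat -> sym M -> K) n : (forall n, pmem (x_ n)) ->
  wpart n (cls (fun i => x_ (wM i) i)) = wpart n (cls (x_ n)).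
Proof.
move=> H; rewrite !comp_cls //; last exact: glue_pmem.
by congr cls; apply: funext => i; rewrite /wc; case: eqP => // ->.
Qed.

Lemma comp_glue (u_ : nat -> pcar M) n : wpart n (wglue u_) = wpart n (u_ n).
Proof.
rewrite wglueE (@glue_cls (fun n => rep (u_ n))) ?repK // => k.
exact: pmem_rep.
Qed.

(** [supp] asks for one good representative; good representatives of all components are chosen and
    pasted together along the weight. *)
Lemma supp_glue (R : sym M -> K -> Prop) u : (forall i, R i 0) ->
  (forall n, supp R (wpart n u)) -> supp R u.
Proof.
move=> R0 H; have [x_ Hx] := choice H.
have -> : u = cls (fun i => x_ (wM i) i).
  apply: comp_inj => n; rewrite glue_cls; last by move=> k; have [] := Hx k.
  by have [_ <- _] := Hx n; rewrite comp_comp eqxx.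
exists (fun i => x_ (wM i) i); split=> //; last by move=> i; have [_ _] := Hx (wM i).
by apply: glue_pmem => n; have [] := Hx n.
Qed.

Lemma supp_comp (R : sym M -> K -> Prop) n u : (forall i, R i 0) -> supp R u ->
  supp (fun i a => R i a /\ (wM i != n -> a = 0)) (wpart n u).
Proof.
have [gm _] := gM => R0 [x [Mx -> Rx]]; exists (wc wM n x); split.
- exact: gm.
- by rewrite comp_cls.
- by move=> i; rewrite /wc; case: eqP => _; split.
Qed.

Lemma ordrP n u : ordr n u <-> wpart n u = u.
Proof.
split=> [[x [Mx -> Rx]]|<-].
  rewrite comp_cls //; congr cls; apply: funext => i; rewrite /wc.
  by case: eqP => // /eqP/Rx.
apply: supp_sub (supp_comp (R := fun _ _ => True) n _ _) => //; first by move=> i a [].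
by exists (rep u); split=> //; [exact: pmem_rep|rewrite repK].
Qed.

Lemma ordr_comp n u : ordr n (wpart n u).
Proof. by apply/ordrP; rewrite comp_comp eqxx. Qed.

Lemma ordgeP n u : ordge n u <-> forall k, (k < n)%N -> wpart k u = 0.
Proof.
have [gm _] := gM; split=> [[x [Mx -> Rx]] k kn|H].
  rewrite comp_cls // -cls0; congr cls; apply: funext => i; rewrite /wc.
  by case: eqP => // e; apply: Rx; rewrite e.
apply: supp_glue => // k; have [kn|nk] := ltnP k n.
  by rewrite H //; apply: supp0.
exists (wc wM k (rep u)); split=> //; [exact/gm/pmem_rep|exact: wpartE|].
by move=> i wi; rewrite /wc; case: eqP => // e; rewrite e ltnNge nk in wi.
Qed.

Lemma ordge_comp0 n u : ordge n u -> forall k, (k < n)%N -> wpart k u = 0.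
Proof. exact: (proj1 (ordgeP n u)). Qed.

Lemma ordr_fix n u : ordr n u -> wpart n u = u.
Proof. exact: (proj1 (ordrP n u)). Qed.

Lemma ordr_comp0 n k u : ordr n u -> k != n -> wpart k u = 0.
Proof.
move=> /ordrP <- kn; by rewrite comp_comp eq_sym (negPf kn).
Qed.

Lemma ordr_ordge n u : ordr n u -> ordge n u.
Proof. by move=> H; apply/ordgeP => k kn; apply: (ordr_comp0 H); rewrite ltn_eqF. Qed.

Lemma ordge_le m n u : (m <= n)%N -> ordge n u -> ordge m u.
Proof. by move=> mn /ordgeP H; apply/ordgeP => k km; apply: H; exact: leq_trans mn. Qed.

Lemma ordge0 u : ordge 0 u.
Proof. exact/ordgeP. Qed.

Lemma ordge_sum n (T : Type) (l : seq T) (F : T -> pcar M) :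
  (forall t, inseq t l -> ordge n (F t)) -> ordge n (\sum_(t <- l) F t).
Proof.
move=> H; apply: supp_sum => // i a b Ra Rb wi; by rewrite Ra // Rb // subrr.
Qed.

Lemma ordgeD n u v : ordge n u -> ordge n v -> ordge n (u + v).
Proof. by apply: suppD => // i a b Ra Rb wi; rewrite Ra // Rb // subrr. Qed.

Lemma ordgeB n u v : ordge n u -> ordge n v -> ordge n (u - v).
Proof. by apply: suppB => // i a b Ra Rb wi; rewrite Ra // Rb // subrr. Qed.

Lemma ordgeZ n a u : ordge n u -> ordge n (a *: u).
Proof. by apply: suppZ => i b H wi; rewrite H // mulr0. Qed.

Lemma ordge00 n : ordge n (0 : pcar M).
Proof. exact: supp0. Qed.

Lemma ordrB n u v : ordr n u -> ordr n v -> ordr n (u - v).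
Proof. by apply: suppB => // i a b Ra Rb wi; rewrite Ra // Rb // subrr. Qed.

Lemma ordrD n u v : ordr n u -> ordr n v -> ordr n (u + v).
Proof. by apply: suppD => // i a b Ra Rb wi; rewrite Ra // Rb // subrr. Qed.

Lemma ordrZ n a u : ordr n u -> ordr n (a *: u).
Proof. by apply: suppZ => i b H wi; rewrite H // mulr0. Qed.

Lemma ordr0 n : ordr n (0 : pcar M).
Proof. exact: supp0. Qed.

Definition trunc n u := \sum_(k < n) wpart k u.

Lemma comp_trunc n k u : wpart k (trunc n u) = if (k < n)%N then wpart k u else 0.
Proof.
rewrite /trunc (lin_sum (comp_lin k)); case: ltnP => kn; last first.
  by apply: big1 => i _; rewrite comp_comp; case: eqP => // e; move: (ltn_ord i); rewrite e ltnNge kn.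
rewrite (bigD1 (Ordinal kn)) //= comp_comp eqxx big1 ?addr0 // => i ik.
by rewrite comp_comp; case: eqP => // e; case/eqP: ik; apply: val_inj.
Qed.

Lemma trunc_ordge n u : ordge n (u - trunc n u).
Proof.
by apply/ordgeP => k kn; rewrite (linB (comp_lin k)) comp_trunc kn subrr.
Qed.

Lemma convergesP (u_ : nat -> pcar M) l : converges u_ l <->
  forall n, exists N, forall k, (N <= k)%N -> wpart n (u_ k) = wpart n l.
Proof.
split=> H n.
  have [N HN] := H n.+1; exists N => k kN; have /ordgeP/(_ n (ltnSn n)) := HN k kN.
  by rewrite (linB (comp_lin n)) => /eqP; rewrite subr_eq0 => /eqP.
elim: n => [|n [N HN]]; first by exists 0%N => k _; exact: ordge0.
have [N' HN'] := H n; exists (maxn N N') => k; rewrite geq_max => /andP[Nk Nk'].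
apply/ordgeP => i; rewrite ltnS leq_eqVlt => /orP[/eqP ->|].
  by rewrite (linB (comp_lin n)) HN' // subrr.
by move: i; apply/ordgeP/HN.
Qed.

Lemma converges_unique (u_ : nat -> pcar M) l l' : converges u_ l -> converges u_ l' -> l = l'.
Proof.
move=> /convergesP H /convergesP H'; apply: comp_inj => n.
have [N HN] := H n; have [N' HN'] := H' n.
by rewrite -(HN (maxn N N')) ?leq_maxl // (HN' (maxn N N')) ?leq_maxr.
Qed.

End Pcar.

Arguments ordge_comp0 [K M] gM [n u] _ k _.
Arguments ordgeP [K M] gM n u.
Arguments ordr_comp0 [K M] gM [n k u] _ _.

Section Maps.
Variables (K : evenRing) (M N : pmod K).
Hypotheses (gM : graded M) (gN : graded N).
Implicit Types (f g : pcar M -> pcar N).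

(** For endomorphisms, [raises r] corresponds to [endo_ge r.+1] and [shifts r] to [endo_ord r.+1].
    Counting the added weight makes the index additive under composition. *)
Definition raises r f := forall i u, ordge i u -> ordge (i + r)%N (f u).
Definition shifts r f := forall i u, ordr i u -> ordr (i + r)%N (f u).

Lemma raises_clinear r f : linear f -> raises r f -> clinear f.
Proof.
move=> fl fr; split=> // n; exists n => u /fr; apply: ordge_le => //; exact: leq_addr.
Qed.

Lemma clin_ord f : clinear f -> forall n u, exists m, wpart n (f u) = wpart n (f (trunc m u)).
Proof.
move=> [fl fc] n u; have [m Hm] := fc n.+1; exists m.
have h := ordge_comp0 gN (Hm _ (trunc_ordge gM m u)) n (ltnSn n); move: h.
by rewrite (linB fl) (linB (comp_lin gN n)) => /eqP; rewrite subr_eq0 => /eqP.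
Qed.

(** By continuity, a given weight of the values only sees a finite truncation of the argument. *)
Lemma clin_ext_at f g u : clinear f -> clinear g ->
  (forall n, f (wpart n u) = g (wpart n u)) -> f u = g u.
Proof.
move=> fc gc H; apply: (comp_inj gN) => n.
have [fl1 fc1] := fc; have [gl1 gc1] := gc.
have [m1 Hm1] := fc1 n.+1; have [m2 Hm2] := gc1 n.+1; pose m := maxn m1 m2.
have E (h : pcar M -> pcar N) k : clinear h -> (forall u, ordge k u -> ordge n.+1 (h u)) ->
   (k <= m)%N -> wpart n (h u) = wpart n (h (trunc m u)).
  move=> [hl _] Hk km.
  have h' := ordge_comp0 gN (Hk _ (ordge_le gM km (trunc_ordge gM m u))) n (ltnSn n).
  by move: h'; rewrite (linB hl) (linB (comp_lin gN n)) => /eqP; rewrite subr_eq0 => /eqP.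
rewrite (E f m1) ?leq_maxl // (E g m2) ?leq_maxr //; congr (wpart _ _).
by rewrite /trunc (lin_sum fl1) (lin_sum gl1); apply: eq_bigr => k _.
Qed.

Lemma clin_ext f g : clinear f -> clinear g ->
  (forall n u, ordr n u -> f u = g u) -> forall u, f u = g u.
Proof.
by move=> fc gc H u; apply: clin_ext_at => // n; apply: (H n); exact: ordr_comp.
Qed.

Lemma raisesP r f : clinear f -> (forall i u, ordr i u -> ordge (i + r)%N (f u)) -> raises r f.
Proof.
move=> fc H i u Hu; apply/(ordgeP gN) => k ki.
have [m ->] := clin_ord fc k u; have [fl _] := fc.
rewrite /trunc (lin_sum fl) (lin_sum (comp_lin gN k)); apply: big1 => j _.
have [ij|ji] := leqP i j; last first.
  by rewrite (proj1 (ordgeP gM i u) Hu) // (lin0 fl) (lin0 (comp_lin gN k)).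
apply: (ordge_comp0 gN (H _ _ (ordr_comp gM j u))); apply: leq_trans ki _.
by rewrite leq_add2r.
Qed.

Lemma shifts_raises r f : clinear f -> shifts r f -> raises r f.
Proof.
by move=> fc fs; apply: raisesP => // i u /fs; exact: ordr_ordge.
Qed.

Lemma shifts_comp r f : clinear f -> shifts r f -> forall n u,
  wpart n (f u) = if (r <= n)%N then f (wpart (n - r)%N u) else 0.
Proof.
move=> fc fs n u; have [fl _] := fc; case: leqP => [rn|nr].
  have sH : shifts r (fun u => f u) by [].
  have [m Hm] := clin_ord fc n u.
  pose m' := maxn m (n - r).+1.
  have -> : wpart n (f u) = wpart n (f (trunc m' u)).
    rewrite [in LHS](_ : u = (u - trunc m' u) + trunc m' u); last by rewrite subrK.
    rewrite (linD fl) (linD (comp_lin gN n)) [X in X + _](_ : _ = 0) ?add0r //.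
    apply: (ordge_comp0 gN (shifts_raises fc fs (trunc_ordge gM m' u))).
    by rewrite addnC -ltn_subLR // leq_max ltnSn orbT.
  rewrite /trunc (lin_sum fl) (lin_sum (comp_lin gN n)).
  have nrm : (n - r < m')%N by rewrite leq_max ltnSn orbT.
  rewrite (bigD1 (Ordinal nrm)) //= big1 ?addr0 => [|k kn].
    have := ordr_fix gN (fs _ _ (ordr_comp gM (n - r)%N u)); by rewrite subnK.
  apply: (ordr_comp0 gN (fs _ _ (ordr_comp gM k u))).
  apply: contra kn => /eqP e; apply/eqP/val_inj => /=; by rewrite e addnK.
by apply: (ordge_comp0 gN (shifts_raises fc fs (ordge0 gM u))); rewrite add0n.
Qed.

Lemma raises_le r r' f : (r <= r')%N -> raises r' f -> raises r f.
Proof. by move=> rr H i u /H; apply: ordge_le => //; rewrite leq_add2l. Qed.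

(** Converts congruences into equalities: a map of exact order that vanishes to leading order is
    zero. *)
Lemma shifts_raises0 r f u : clinear f -> shifts r f -> raises r.+1 f -> f u = 0.
Proof.
move=> fc fs fr; apply: (@clin_ext f (fun=> 0)) => //.
  by split=> [a v w|n]; [rewrite scaler0 addr0|exists n => v _; exact: ordge00].
move=> n v Hv; rewrite -(ordr_fix gN (fs _ _ Hv)).
by apply: (ordge_comp0 gN (fr _ _ (ordr_ordge gM Hv))); rewrite addnS.
Qed.

(** The homogeneous component of [f] of order r + 1, that is, the part adding exactly [r] to the
    weight. *)
Definition scomp r f : pcar M -> pcar N := fun u =>
  wglue (fun n => if (r <= n)%N then wpart n (f (wpart (n - r)%N u)) else 0).

Lemma comp_scomp r f n u :
  wpart n (scomp r f u) = if (r <= n)%N then wpart n (f (wpart (n - r)%N u)) else 0.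
Proof.
rewrite comp_glue //; case: ifP => _; first by rewrite comp_comp // eqxx.
exact: (lin0 (comp_lin gN n)).
Qed.

Lemma scomp_shifts r f : linear f -> shifts r (scomp r f).
Proof.
move=> fl i u Hu; apply/(ordrP gN); apply: (comp_inj gN) => n.
rewrite comp_comp //; case: eqP => [<-//|/eqP ne].
rewrite comp_scomp; case: ifP => // rn.
rewrite (ordr_comp0 gM Hu) ?(lin0 fl) ?(lin0 (comp_lin gN n)) //.
by apply: contra ne => /eqP <-; rewrite subnK.
Qed.

Lemma scomp_lin r f : linear f -> linear (scomp r f).
Proof.
move=> fl a u v; apply: (comp_inj gN) => n; rewrite (comp_lin gN) !comp_scomp.
case: ifP => _; last by rewrite scaler0 addr0.
by rewrite (comp_lin gM) fl (comp_lin gN).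
Qed.

Lemma scomp_clin r f : linear f -> clinear (scomp r f).
Proof.
move=> fl; apply: (@raises_clinear r) => [|i u Hu]; first exact: scomp_lin.
apply/(ordgeP gN) => k ki; rewrite comp_scomp; case: ifP => // rk.
rewrite (proj1 (ordgeP gM i u) Hu) ?(lin0 fl) ?(lin0 (comp_lin gN k)) //.
by rewrite ltn_subLR // addnC.
Qed.

Lemma scomp_raises r f : clinear f -> raises r f -> raises r.+1 (fun u => f u - scomp r f u).
Proof.
move=> fc fr; have [fl _] := fc; have [sl _] := scomp_clin r fl.
apply: raisesP => [|i u Hu].
  apply: (@raises_clinear r) => [a u v|i u Hu].
    by rewrite fl sl scalerBr opprD addrACA.
  apply: ordgeB => //; first exact: fr.
  by apply: shifts_raises Hu; [exact: scomp_clin|exact: scomp_shifts].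
apply/(ordgeP gN) => k; rewrite addnS ltnS leq_eqVlt => /orP[/eqP ->|ki].
  rewrite (linB (comp_lin gN _)) comp_scomp leq_addl addnK.
  by rewrite (ordr_fix gM Hu) subrr.
have Hu' := ordr_ordge gM Hu.
have e1 := ordge_comp0 gN (fr _ _ Hu') k ki.
have e2 := ordge_comp0 gN (shifts_raises (scomp_clin r fl) (scomp_shifts r fl) Hu') k ki.
by rewrite (linB (comp_lin gN _)) e1 e2 subrr.
Qed.

End Maps.

Section Compose.
Variables (K : evenRing) (M N P : pmod K).
Implicit Types (f : pcar N -> pcar P) (g : pcar M -> pcar N).

Lemma clin_comp f g : clinear f -> clinear g -> clinear (fun u => f (g u)).
Proof.
move=> [fl fc] [gl gc]; split=> [a u v|n]; first by rewrite gl fl.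
by have [m Hm] := fc n; have [k Hk] := gc m; exists k => u /Hk/Hm.
Qed.

Lemma clin_lin f f' a : clinear f -> clinear f' -> clinear (fun u => a *: f u + f' u).
Proof.
move=> [fl fc] [gl gc]; split=> [b u v|n].
  by rewrite fl gl !scalerDr !scalerA [a * b]mulrC -!scalerA addrACA.
have [m Hm] := fc n; have [k Hk] := gc n; exists (maxn m k) => u Hu.
have E j : (j <= maxn m k)%N -> ordge j u.
  move=> jm; apply: supp_sub Hu => i b H wi; apply: H; exact: leq_trans jm.
apply: suppD => //; first by move=> i b c Hb Hc wi; rewrite Hb // Hc // subrr.
  by apply: suppZ (Hm _ (E _ (leq_maxl _ _))) => i b H wi; rewrite H // mulr0.
exact: Hk (E _ (leq_maxr _ _)).
Qed.

Lemma clinD f f' : clinear f -> clinear f' -> clinear (fun u => f u + f' u).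
Proof.
move=> fc fc'; have := clin_lin 1 fc fc'; congr clinear.
by apply: funext => u; rewrite scale1r.
Qed.

Lemma clinB f f' : clinear f -> clinear f' -> clinear (fun u => f u - f' u).
Proof.
move=> fc fc'; have := clin_lin (-1) fc' fc; congr clinear.
by apply: funext => u; rewrite scaleN1r addrC.
Qed.

Lemma clin0 : clinear (fun _ : pcar M => 0 : pcar N).
Proof.
split=> [a u v|n]; first by rewrite scaler0 addr0.
by exists n => u _; exact: supp0.
Qed.

Lemma clinZ f a : clinear f -> clinear (fun u => a *: f u).
Proof.
move=> fc; have := clin_lin a fc (@clinB (fun u => f u) (fun u => f u) fc fc).
by congr clinear; apply: funext => u; rewrite subrr addr0.
Qed.

Lemma raises_comp r s f g : raises r f -> raises s g -> raises (s + r)%N (fun u => f (g u)).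
Proof. by move=> fr gs i u /gs/fr; rewrite addnA. Qed.

End Compose.

Lemma clin_id (K : evenRing) (M : pmod K) : clinear (fun u : pcar M => u).
Proof. by split=> // n; exists n. Qed.

(** * The de Rham algebra *)

Section BilinearOnClasses.
Variables (K : evenRing) (M N P : pmod K).
Variables (fM : sym M -> nat) (fN : sym N -> nat) (fP : sym P -> nat).
Variable b0 : (sym M -> K) -> (sym N -> K) -> sym P -> K.
Hypothesis bS : splitop (mg fM) (mg fN) (mg fP) b0.
Hypothesis bM : forall x y, pmem x -> pmem y -> pmem (b0 x y).
Hypothesis bl : forall x y, pmem x -> prel x -> pmem y -> prel (b0 x y).
Hypothesis br : forall x y, pmem x -> pmem y -> prel y -> prel (b0 x y).

(** The common pattern of [brk], [brkOm] and [tensDR], all of which are defined through chosen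
    representatives. *)
Definition bop (u : pcar M) (v : pcar N) : pcar P := cls (b0 (rep u) (rep v)).

Lemma bop_cls x y : pmem x -> pmem y -> bop (cls x) (cls y) = cls (b0 x y).
Proof.
move=> Mx My; apply: clsP; [apply: bM; exact: pmem_rep|exact: bM|].
set x' := rep (cls x); set y' := rep (cls y).
have Mx' : pmem x' by exact: pmem_rep.
have My' : pmem y' by exact: pmem_rep.
have Rx : prel (fun i => -1 * x' i + x i).
  rewrite (_ : (fun i => _) = fun i => -1 * (x' i - x i) + 0).
    apply: prel_lin; [exact: rep_cls|exact: cspan0].
  by apply: funext => i; ring.
have Ry : prel (fun i => -1 * y' i + y i).
  rewrite (_ : (fun i => _) = fun i => -1 * (y' i - y i) + 0).
    apply: prel_lin; [exact: rep_cls|exact: cspan0].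
  by apply: funext => i; ring.
have -> : (fun i => b0 x y i - b0 x' y' i) =
   fun i => 1 * b0 (fun i => -1 * x' i + x i) y i + b0 x' (fun i => -1 * y' i + y i) i.
  by rewrite (split_linl bS) (split_linr bS); apply: funext => i; ring.
apply: prel_lin; [apply: bl|apply: br] => //; exact: pmem_lin.
Qed.

Lemma bop_linl a u u' v : bop (a *: u + u') v = a *: bop u v + bop u' v.
Proof.
have [x Mx ->] := clsW u; have [x' Mx' ->] := clsW u'; have [y My ->] := clsW v.
rewrite -cls_lin // !bop_cls //; last exact: pmem_lin.
by rewrite (split_linl bS) cls_lin //; exact: bM.
Qed.

Lemma bop_linr a u v v' : bop u (a *: v + v') = a *: bop u v + bop u v'.
Proof.
have [x Mx ->] := clsW u; have [x' Mx' ->] := clsW v'; have [y My ->] := clsW v.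
rewrite -cls_lin // !bop_cls //; last exact: pmem_lin.
by rewrite (split_linr bS) cls_lin //; exact: bM.
Qed.

Lemma bopl v : linear (bop^~ v).
Proof. by move=> a u u'; exact: bop_linl. Qed.
Lemma bopr u : linear (bop u).
Proof. by move=> a v v'; exact: bop_linr. Qed.

Lemma bop_homog i j u v : homog i u -> homog j v -> homog (i + j) (bop u v).
Proof.
move=> [x [Mx -> Hx]] [y [My -> Hy]]; exists (b0 x y); split; first exact: bM.
  by rewrite bop_cls.
exact: (split_homf bS Hx Hy).
Qed.

Lemma bop_ordr i j u v : ordr i u -> ordr j v -> ordr (i + j)%N (bop u v).
Proof.
move=> [x [Mx -> Hx]] [y [My -> Hy]]; exists (b0 x y); split; first exact: bM.
  by rewrite bop_cls.
exact: (split_supq bS (q := fun g : mdeg => g.1.2) (op := addn)) Hx Hy.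
Qed.

Lemma bop_ordge i j u v : ordge i u -> ordge j v -> ordge (i + j)%N (bop u v).
Proof.
move=> [x [Mx -> Hx]] [y [My -> Hy]]; exists (b0 x y); split; first exact: bM.
  by rewrite bop_cls.
move=> z wz; have [l [Hl El]] := bS z; rewrite El.
rewrite (big_In (G := fun=> 0)) ?big1 // => p /Hl[_ ep].
have [xi|xi] := ltnP (wt p.2.1) i; first by rewrite Hx // mul0r mulr0.
rewrite Hy ?mulr0 //.
have e : (wt p.2.1 + wt p.2.2 = wt z)%N by rewrite -[wt z]/((mg fP z).1.2) -ep.
by move: xi wz e; lia.
Qed.

End BilinearOnClasses.

Section Pure.
Variables (K : evenRing) (M : pmod K) (f : sym M -> nat).

Definition pure d n p : set (pcar M) :=
  supp (fun i c => [/\ gpart (d - dg i) c, wt i != n -> c = 0 & f i != p -> c = 0]).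

Lemma pure_homog d n p u : pure d n p u -> homog d u.
Proof. by apply: supp_sub => i a []. Qed.

Lemma pure_ordr d n p u : pure d n p u -> ordr n u.
Proof. by apply: supp_sub => i a []. Qed.

Lemma pureB d n p u v : pure d n p u -> pure d n p v -> pure d n p (u - v).
Proof.
apply: suppB => i a b [ga wa fa] [gb wb fb]; split; first exact: gpartB.
  by move=> h; rewrite wa // wb // subrr.
by move=> h; rewrite fa // fb // subrr.
Qed.

Lemma pure0 d n p : pure d n p 0.
Proof. by apply: supp0 => i; split=> //; exact: gpart0. Qed.

Lemma pureN d n p u : pure d n p u -> pure d n p (- u).
Proof. by move=> H; rewrite -[- u]add0r; apply: pureB => //; exact: pure0. Qed.

Lemma pureD d n p u v : pure d n p u -> pure d n p v -> pure d n p (u + v).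
Proof. by move=> H H'; rewrite -[v]opprK; apply: pureB => //; exact: pureN. Qed.

Lemma pureZ k d n p c u : gpart k c -> pure d n p u -> pure (k + d) n p (c *: u).
Proof.
move=> gc; apply: suppZ => i a [ga wa fa]; split.
- by rewrite -addrA; exact: gpartM.
- by move=> h; rewrite wa // mulr0.
- by move=> h; rewrite fa // mulr0.
Qed.

Lemma pure_sgn s d n p u : pure d n p u -> pure d n p (ksgn K s *: u).
Proof. by move=> H; rewrite -[d]add0r; apply: pureZ => //; exact: gpart_ksgn. Qed.

Lemma pure_frame n p : pmem p.2 -> fpure (mg f) n p -> pure (dg p.1) n (f p.1) (cls p.2).
Proof.
move=> Mp [ep sp ip]; exists p.2; split=> // i.
have [e|ne] := eqVneq (mg f i) (mg f p.1); last by rewrite sp //; split=> //; exact: gpart0.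
case: e => -> e2 ->; rewrite eqxx subrr; split=> //.
by rewrite e2 -[wt p.1]/((mg f p.1).1.2) ep eqxx.
Qed.

Lemma comp_frame A F n x : graded M -> frame (mg f) A F -> A `<=` @pmem K M -> A x ->
  wpart n (cls x) = \sum_(p <- F n) x p.1 *: cls p.2.
Proof.
move=> gM FF AM Ax; have [F1 F2 _] := FF.
rewrite comp_cls ?(wc_frame n FF Ax) //; last exact: AM.
rewrite (@cls_sum _ _ _ (F n) (fun p => x p.1) (fun p => p.2)) // => p /F2; exact: AM.
Qed.

End Pure.

Lemma bop_pure (K : evenRing) (M N P : pmod K) (fM : sym M -> nat) (fN : sym N -> nat)
    (fP : sym P -> nat) (b0 : (sym M -> K) -> (sym N -> K) -> sym P -> K) :
  splitop (mg fM) (mg fN) (mg fP) b0 ->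
  (forall x y, pmem x -> pmem y -> pmem (b0 x y)) ->
  (forall x y, pmem x -> prel x -> pmem y -> prel (b0 x y)) ->
  (forall x y, pmem x -> pmem y -> prel y -> prel (b0 x y)) ->
  forall d n p d' n' p' u v, pure fM d n p u -> pure fN d' n' p' v ->
  pure fP (d + d') (n + n')%N (p + p')%N (bop b0 u v).
Proof.
move=> bS bM bl br d n p d' n' p' _ _ [x [Mx -> Hx]] [y [My -> Hy]].
exists (b0 x y); split; first exact: bM.
  by rewrite (bop_cls bS).
move=> i; split.
- by apply: (split_homf bS) => j; [case: (Hx j)|case: (Hy j)].
- apply: (split_supq bS (q := fun g : mdeg => g.1.2) (op := addn) (n := n) (k := n')) => // j.
    by case: (Hx j).
  by case: (Hy j).
- apply: (split_supq bS (q := fun g : mdeg => g.2) (op := addn) (n := p) (k := p')) => // j.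
    by case: (Hx j).
  by case: (Hy j).
Qed.

Lemma frame_ext (K : evenRing) (T : Type) (m m' : T -> mdeg) (A : set (T -> K)) F :
  (forall i j, m i = m j -> m' i = m' j) -> (forall i, (m' i).1.2 = (m i).1.2) ->
  frame m A F -> frame m' A F.
Proof.
move=> mm ew [F1 F2 F3]; split=> // [n p /F1[ep sp ip]|x Ax i]; last by rewrite ew; exact: F3.
split=> //; first by rewrite ew.
by move=> i h; apply: sp; apply: contraNneq h => e; apply/eqP/mm.
Qed.

Section OmTheory.
Variables (K : evenRing) (V : fgmod).
Notation W := (susp_dual K V).
Notation SW := (seq (sym W)).
Notation nof := (fun=> 0%N).
Notation onef := (fun=> 1%N).
Notation lW := (lalg W).
Notation sO := (sOm1 W).
Notation lS := (lalg sO).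
Notation O := (Om W).

Lemma lW_graded : graded lW.
Proof.
split=> n x; first exact: lW_wc.
by move=> /rl_W ->; rewrite (_ : wc _ _ _ = fun=> 0); [exact: cspan0|
  apply: funext => i; rewrite /wc if_same].
Qed.

Lemma pmem_Om z : @pmem K O z <-> @pmem K lW (z \o inl) /\ @pmem K lS (z \o inr).
Proof.
split=> [H|[H1 H2]]; last by apply: cspan_in; split.
split.
  move: H; apply: (@cspan_map K _ _ (@wt K O) (@wt K lW) _ _ (fun z => z \o inl)) => //.
    by move=> n x y xy i wi; exact: xy.
  by move=> x [].
move: H; apply: (@cspan_map K _ _ (@wt K O) (@wt K lS) _ _ (fun z => z \o inr)) => //.
  by move=> n x y xy i wi; exact: xy.
by move=> x [].
Qed.

Lemma prel_Om z : @prel K O z <-> @prel K lW (z \o inl) /\ @prel K lS (z \o inr).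
Proof.
split=> [H|[H1 H2]]; last by apply: cspan_in; split.
split.
  move: H; apply: (@cspan_map K _ _ (@wt K O) (@wt K lW) _ _ (fun z => z \o inl)) => //.
    by move=> n x y xy i wi; exact: xy.
  by move=> x [].
move: H; apply: (@cspan_map K _ _ (@wt K O) (@wt K lS) _ _ (fun z => z \o inr)) => //.
  by move=> n x y xy i wi; exact: xy.
by move=> x [].
Qed.

Lemma prel_Oml z : @prel K O z -> z \o inl = fun=> 0.
Proof. by move=> /prel_Om[/rl_W]. Qed.

Lemma O_sg x : @pmem K O x -> @pmem K O (sg (@dg K O) x).
Proof.
move=> /pmem_Om[Hl Hr]; apply/pmem_Om; split; first exact: (lW_sg Hl).
exact: (lS_sg Hr).
Qed.

Lemma O_graded : graded O.
Proof.
split=> n x.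
  move=> /pmem_Om[Hl Hr]; apply/pmem_Om; split; first exact: (lW_wc n Hl).
  exact: (lS_wc n Hr).
move=> /prel_Om[Hl Hr]; apply/prel_Om; split; last exact: (lSr_wc n Hr).
have [_ H] := lW_graded; exact: (H n _ Hl).
Qed.

Lemma Or_sg x : @prel K O x -> @prel K O (sg (@dg K O) x).
Proof.
move=> /prel_Om[Hl Hr]; apply/prel_Om; split; last exact: (lSr_sg Hr).
rewrite (_ : _ \o _ = fun=> 0); first exact: cspan0.
apply: funext => i; rewrite /sg /=; have /(congr1 (@^~ i)) /= -> := rl_W Hl.
by rewrite mulr0.
Qed.

Notation mO := (mg (@fdOm K W)).

Lemma brkOm_split : splitop mO mO mO (@brkOm0 K W).
Proof.
have ml (a : SW) : mO (inl a) = wmg nof a by rewrite wmg0.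
have mr (a : sym lS) : mO (inr a) = wmg onef a by rewrite wmgS1.
move=> [s|s].
  have := brk0_split nof s; rewrite -ml => H.
  exact: (spl_map1 ml ml H).
have H1 := act_split s; have H2 := spl_kswap (@wdg K sO) (@wdg K W) H1.
have H3 := brk0_split onef s; rewrite -mr in H1 H2 H3.
apply: splD; last exact: (spl_map1 mr mr H3).
apply: splD; first exact: (spl_map1 ml mr H1).
apply: splN; exact: (spl_map1 mr ml H2).
Qed.

Lemma lS_par p x : @pmem K lS x -> @pmem K lS (par (@wdg K sO) p x).
Proof. exact: (lalg_par (@sO_sg K V)). Qed.
Lemma lSr_par p x : @prel K lS x -> @prel K lS (par (@wdg K sO) p x).
Proof. exact: (rl_par (@sO_sg K V) (@sOr_sg K V)). Qed.

Lemma pmem_brkOm z z' : @pmem K O z -> @pmem K O z' -> @pmem K O (brkOm0 z z').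
Proof.
move=> /pmem_Om[Hl Hr] /pmem_Om[Hl' Hr']; apply/pmem_Om; split; first exact: lalg_brk.
apply: cspanD; last exact: lalg_brk.
apply: cspanB; first exact: pmem_act.
rewrite (kswapE (@wdg K sO) (@wdg K W) (@act K W)); apply: cspanD; apply: pmem_act => //.
- exact: lS_par.
- exact: lW_sg.
- exact: lS_par.
Qed.

Lemma prel_brkOml z z' : @pmem K O z -> @prel K O z -> @pmem K O z' ->
  @prel K O (brkOm0 z z').
Proof.
move=> /pmem_Om[Hl Hr] Rz /pmem_Om[Hl' Hr']; have ez := prel_Oml Rz.
have /prel_Om[_ Rr] := Rz; apply/prel_Om; split.
  rewrite (_ : _ \o _ = brk0 (z \o inl) (z' \o inl)) // ez.
  by rewrite (split_0l (brk0_split nof)); exact: cspan0.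
apply: cspanD; last exact: (rl_brkl (@sO_sg K V) (@sOr_sg K V)).
apply: cspanB; first by rewrite ez (split_0l (@act_split K V)); exact: cspan0.
rewrite (kswapE (@wdg K sO) (@wdg K W) (@act K W)); apply: cspanD; apply: prel_act => //.
- exact: lSr_par.
- exact: lW_sg.
- exact: lSr_par.
Qed.

Lemma prel_brkOmr z z' : @pmem K O z -> @pmem K O z' -> @prel K O z' ->
  @prel K O (brkOm0 z z').
Proof.
move=> /pmem_Om[Hl Hr] /pmem_Om[Hl' Hr'] Rz; have ez := prel_Oml Rz.
have /prel_Om[_ Rr] := Rz; apply/prel_Om; split.
  rewrite (_ : _ \o _ = brk0 (z \o inl) (z' \o inl)) // ez.
  by rewrite (split_0r (brk0_split nof)); exact: cspan0.
apply: cspanD; last exact: (rl_brkr (@sO_sg K V) (@sOr_sg K V)).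
apply: cspanB; first exact: prel_act.
rewrite (kswapE (@wdg K sO) (@wdg K W) (@act K W)) ez.
rewrite (_ : sg _ (fun=> 0) = fun=> 0); last by apply: funext => i; rewrite /sg mulr0.
by apply: cspanD; rewrite (split_0l (@act_split K V)); exact: cspan0.
Qed.

Notation brkO := (@brkOm K W).

Lemma brkOm_cls x y : @pmem K O x -> @pmem K O y ->
  brkO (cls x) (cls y) = cls (brkOm0 x y).
Proof. exact: (bop_cls brkOm_split pmem_brkOm prel_brkOml prel_brkOmr). Qed.
Lemma brkOm_l v : linear (fun u => brkO u v).
Proof. exact: (bopl brkOm_split pmem_brkOm prel_brkOml prel_brkOmr). Qed.
Lemma brkOm_r u : linear (brkO u).
Proof. exact: (bopr brkOm_split pmem_brkOm prel_brkOml prel_brkOmr). Qed.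
Lemma brkOm_homog i j u v : homog i u -> homog j v -> homog (i + j) (brkO u v).
Proof. exact: (bop_homog brkOm_split pmem_brkOm prel_brkOml prel_brkOmr). Qed.
Lemma brkOm_ordr i j u v : ordr i u -> ordr j v -> ordr (i + j)%N (brkO u v).
Proof. exact: (bop_ordr brkOm_split pmem_brkOm prel_brkOml prel_brkOmr). Qed.
Lemma brkOm_ordge i j u v : ordge i u -> ordge j v -> ordge (i + j)%N (brkO u v).
Proof. exact: (bop_ordge brkOm_split pmem_brkOm prel_brkOml prel_brkOmr). Qed.

Notation pureO := (pure (@fdOm K W)).

Lemma brkOm_pure d n p d' n' p' u v : pureO d n p u -> pureO d' n' p' v ->
  pureO (d + d') (n + n')%N (p + p')%N (brkO u v).
Proof. exact: (bop_pure brkOm_split pmem_brkOm prel_brkOml prel_brkOmr). Qed.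

End OmTheory.

(** * Homogeneous generators of the de Rham algebra *)

Section OmGenerators.
Variables (K : evenRing) (V : fgmod).
Notation W := (susp_dual K V).
Notation SW := (seq (sym W)).
Notation nof := (fun=> 0%N).
Notation onef := (fun=> 1%N).
Notation tW := (talg W).
Notation lW := (lalg W).
Notation sO := (sOm1 W).
Notation lS := (lalg sO).
Notation O := (Om W).
Notation g := (pcar lW).
Notation brkO := (@brkOm K W).
Notation brkg := (@brk K W).
Notation pureO := (pure (@fdOm K W)).
Notation pureg := (pure (M := lW) nof).
Notation clsO := (@cls K O).
Notation clsg := (@cls K lW).
Notation inO := (@inOm K W).
Notation dO := (@dOm K W).

Lemma mg_lW : mg (M := lW) nof = @wmg K W nof.
Proof. by apply: funext => s; rewrite wmg0. Qed.

Lemma brk_split : splitop (mg (M := lW) nof) (mg (M := lW) nof) (mg (M := lW) nof) (@brk0 K W).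
Proof. by rewrite mg_lW; exact: brk0_split. Qed.

Lemma brk_prell x y : @pmem K lW x -> @prel K lW x -> @pmem K lW y -> @prel K lW (brk0 x y).
Proof. by move=> _ /rl_W -> _; rewrite (split_0l brk_split); exact: cspan0. Qed.
Lemma brk_prelr x y : @pmem K lW x -> @pmem K lW y -> @prel K lW y -> @prel K lW (brk0 x y).
Proof. by move=> _ _ /rl_W ->; rewrite (split_0r brk_split); exact: cspan0. Qed.

Lemma brk_cls x y : @pmem K lW x -> @pmem K lW y -> brkg (clsg x) (clsg y) = clsg (brk0 x y).
Proof. exact: (bop_cls brk_split (@lalg_brk K W) brk_prell brk_prelr). Qed.
Lemma brk_l v : linear (fun u => brkg u v).
Proof. exact: (bopl brk_split (@lalg_brk K W) brk_prell brk_prelr). Qed.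
Lemma brk_r u : linear (brkg u).
Proof. exact: (bopr brk_split (@lalg_brk K W) brk_prell brk_prelr). Qed.
Lemma brk_ordr i j u v : ordr i u -> ordr j v -> ordr (i + j)%N (brkg u v).
Proof. exact: (bop_ordr brk_split (@lalg_brk K W) brk_prell brk_prelr). Qed.
Lemma brk_ordge i j u v : ordge i u -> ordge j v -> ordge (i + j)%N (brkg u v).
Proof. exact: (bop_ordge brk_split (@lalg_brk K W) brk_prell brk_prelr). Qed.
Lemma rep_lW x : @pmem K lW x -> rep (cls x : g) = x.
Proof.
move=> Hx; have /rl_W e := rep_cls Hx; apply: funext => i.
by apply/eqP; rewrite -subr_eq0; apply/eqP; exact: (congr1 (@^~ i) e).
Qed.

Lemma pmem_inl x : @pmem K lW x -> @pmem K O (inl0 x).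
Proof. by move=> Hx; apply/pmem_Om; split=> //; exact: cspan0. Qed.
Lemma pmem_inr x : @pmem K lS x -> @pmem K O (inr0 x).
Proof. by move=> Hx; apply/pmem_Om; split=> //; exact: cspan0. Qed.

Definition dlet (y : SW -> K) : seq (sym sO) -> K :=
  @letter0 K sO (tens0 (@one0 K W) y).

Lemma pmem_dlet y : @pmem K lW y -> @pmem K lS (dlet y).
Proof. by move=> Hy; apply: lalg_letter; apply: pmem_tens => //; exact: talg_one. Qed.

Lemma in_cls x : @pmem K lW x -> inO (clsg x) = clsO (inl0 x).
Proof. by move=> Hx; rewrite /inOm rep_lW. Qed.
Lemma d_cls x : @pmem K lW x -> dO (clsg x) = clsO (inr0 (dlet x)).
Proof. by move=> Hx; rewrite /dOm rep_lW. Qed.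

Lemma in_lin : linear inO.
Proof.
move=> a u v; have [x Mx ->] := clsW u; have [y My ->] := clsW v.
rewrite -cls_lin // !in_cls //; last exact: pmem_lin.
rewrite -cls_lin; try exact: pmem_inl.
by congr cls; apply: funext => -[s|s] //=; rewrite mulr0 addr0.
Qed.

Lemma d_lin : linear dO.
Proof.
move=> a u v; have [x Mx ->] := clsW u; have [y My ->] := clsW v.
rewrite -cls_lin // !d_cls //; last exact: pmem_lin.
rewrite -cls_lin; try exact/pmem_inr/pmem_dlet.
congr cls; apply: funext => -[s|s] /=; first by rewrite mulr0 addr0.
by rewrite /dlet tens0_linr letter_lin.
Qed.

Lemma in_pure d n y : pureg d n 0 y -> pureO d n 0 (inO y).
Proof.
move=> [x [Mx -> Hx]]; exists (inl0 x); split; [exact: pmem_inl|by rewrite in_cls|].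
move=> [s|s] /=; first by have [H1 H2 _] := Hx s.
by split=> //; exact: gpart0.
Qed.

Lemma d_pure d n y : pureg d n 0 y -> pureO (d + 1) n 1 (dO y).
Proof.
move=> [x [Mx -> Hx]]; exists (inr0 (dlet x)); split.
- exact/pmem_inr/pmem_dlet.
- by rewrite d_cls.
move=> [s|[|[u t] [|q s]]] /=; try by split=> //; exact: gpart0.
have [H1 H2 _] := Hx t; rewrite /tens0 /one0 /= /wdg /wwt !big_seq1 /=.
case: u => [|i u] /=; last by rewrite mul0r; split=> //; exact: gpart0.
rewrite mul1r /wdg /wwt !big_nil add0r add0n; split=> //.
by rewrite opprD addrACA subrr addr0.
Qed.

Lemma in_ordr n y : ordr n y -> ordr n (inO y).
Proof.
move=> [x [Mx -> Hx]]; exists (inl0 x); split; [exact: pmem_inl|by rewrite in_cls|].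
by move=> [s|s] //= h; exact: Hx.
Qed.

Lemma in_inj y : inO y = 0 -> y = 0.
Proof.
have [x Mx ->] := clsW y; rewrite in_cls // => /(cls_eq0 (pmem_inl Mx))/prel_Oml e.
rewrite -cls0; congr cls; exact: e.
Qed.

Lemma in_wpart n y : wpart n (inO y) = inO (wpart n y).
Proof.
have [x Mx ->] := clsW y; rewrite in_cls // (comp_cls (@lW_graded K V)) //.
rewrite (comp_cls (@O_graded K V)); last exact: pmem_inl.
rewrite in_cls; last exact: lW_wc.
by congr cls; apply: funext => -[s|s]; rewrite /wc //= if_same.
Qed.

(* The indices are the degree, the weight and the form degree. *)
Inductive omon : int -> nat -> nat -> pcar O -> Prop :=
| omon_in d n y : pureg d n 0 y -> omon d n 0 (inO y)
| omon_d d n y : pureg d n 0 y -> omon (d + 1) n 1 (dO y)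
| omon_brk d n p u d' n' p' v : omon d n p u -> omon d' n' p' v ->
    omon (d + d') (n + n') (p + p') (brkO u v).

Lemma omon_pure d n p u : omon d n p u -> pureO d n p u.
Proof.
elim=> [d1 n1 y Hy|d1 n1 y Hy|d1 n1 p1 u1 d2 n2 p2 u2 _ H1 _ H2].
- exact: in_pure.
- exact: d_pure.
- exact: brkOm_pure.
Qed.

Definition FtW := Ft (FW K V).
Definition FlW := FL (FW K V).
Definition FsO : nat -> seq (sym sO * (sym sO -> K)) := Fx FtW FlW.
Definition FlS := FL FsO.

Lemma FW0 : FW K V 0 = [::]. Proof. by []. Qed.

Lemma FtW_frame : frame (@wmg K W nof) (@pmem K tW) FtW.
Proof. exact: (Ft_frame (@FW_frame K V) FW0). Qed.

Lemma FlW_frame : frame (@wmg K W nof) (@pmem K lW) FlW.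
Proof. exact: (FL_frame (@W_sg K V) (@FW_frame K V) FW0). Qed.

Lemma FsO_frame : frame (@mg K sO onef) (@pmem K sO) FsO.
Proof.
apply: (@frame_ext K _ (mtens (@wmg K W nof) (@wmg K W nof))).
- move=> p q; rewrite /mtens !wmg0 => -[e1 e2]; rewrite /mg /=; congr (_ + _, _, _).
    exact: e1.
  exact: e2.
- by move=> p; rewrite /mtens !wmg0.
exact: (Fx_frame (wX := @wwt K W) (wY := @wwt K W) _ _ FtW_frame FlW_frame).
Qed.

Lemma FsO0 : FsO 0 = [::]. Proof. by []. Qed.

Lemma FlS_frame : frame (@wmg K sO onef) (@pmem K lS) FlS.
Proof. exact: (FL_frame (@sO_sg K V) FsO_frame FsO0). Qed.

Definition FO n : seq (sym O * (sym O -> K)) :=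
  [seq (inl p.1, inl0 p.2) | p <- FlW n] ++ [seq (inr p.1, inr0 p.2) | p <- FlS n].

Lemma FO_frame : frame (mg (@fdOm K W)) (@pmem K O) FO.
Proof.
have [F1 F2 F3] := FlW_frame; have [G1 G2 G3] := FlS_frame.
split=> [n p Hp|n p Hp|x /pmem_Om[Ml Mr] [s|s]].
- have [h|h] := In_cat Hp; have [q Hq ->] := In_map h.
    have [e s i] := F1 _ _ Hq; split; first exact: e.
      move=> [t|t] //= h'; apply: s; rewrite !wmg0; apply: contra h' => /eqP[e1 e2].
      by rewrite /mg /= e1 e2.
    by move=> [t|t] /=; [exact: i|exact: gpart0].
  have [e s i] := G1 _ _ Hq; split; first exact: e.
    move=> [t|t] //= h'; apply: s; rewrite !wmgS1; apply: contra h' => /eqP[e1 e2 e3].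
    by rewrite /mg /= e1 e2 e3.
  by move=> [t|t] /=; [exact: gpart0|exact: i].
- have [h|h] := In_cat Hp; have [q Hq ->] := In_map h.
    by apply: pmem_inl; exact: F2 Hq.
  by apply: pmem_inr; exact: G2 Hq.
- rewrite [LHS](F3 _ Ml s) /FO big_cat /= !big_map /= [X in _ = _ + X]big1 ?addr0 // => q _.
  by rewrite mulr0.
- rewrite [LHS](G3 _ Mr s) /FO big_cat /= !big_map /= [X in _ = X + _]big1 ?add0r // => q _.
  by rewrite mulr0.
Qed.

Definition omonZ d n p (u : pcar O) :=
  exists c v, [/\ gpart 0 c, omon d n p v & u = c *: v].

Lemma brkO_inr x y : @pmem K lS x -> @pmem K lS y ->
  brkO (clsO (inr0 x)) (clsO (inr0 y)) = clsO (inr0 (brk0 x y)).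
Proof.
move=> Hx Hy; rewrite brkOm_cls; try exact: pmem_inr.
have e (z : seq (sym sO) -> K) : (inr0 z : sym O -> K) \o inl = fun=> 0 by apply: funext => i.
have e' (z : seq (sym sO) -> K) : (inr0 z : sym O -> K) \o inr = z by apply: funext => i.
congr cls; apply: funext => -[s|s] /=.
  by rewrite !e (split_0l (brk0_split nof)).
rewrite !e !e' (split_0l (@act_split K V)).
rewrite (kswapE (@wdg K sO) (@wdg K W) (@act K W)) (split_0l (@act_split K V)).
rewrite (_ : sg _ (fun=> 0) = fun=> 0); last by apply: funext => i; rewrite /sg mulr0.
by rewrite (split_0l (@act_split K V)) addr0 subrr add0r.
Qed.

Lemma brkO_inl_inr x y : @pmem K lW x -> @pmem K lS y ->
  brkO (clsO (inl0 x)) (clsO (inr0 y)) = clsO (inr0 (act x y)).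
Proof.
move=> Hx Hy; rewrite brkOm_cls; [|exact: pmem_inl|exact: pmem_inr].
have e (z : seq (sym sO) -> K) : (inr0 z : sym O -> K) \o inl = fun=> 0 by apply: funext => i.
have e' (z : seq (sym sO) -> K) : (inr0 z : sym O -> K) \o inr = z by apply: funext => i.
have f (z : SW -> K) : (inl0 z : sym O -> K) \o inr = fun=> 0 by apply: funext => i.
have f' (z : SW -> K) : (inl0 z : sym O -> K) \o inl = z by apply: funext => i.
congr cls; apply: funext => -[s|s] /=.
  by rewrite !e f' (split_0r (brk0_split nof)).
rewrite !e !e' f f' (split_0l (brk0_split onef)) addr0.
rewrite (kswapE (@wdg K sO) (@wdg K W) (@act K W)).
rewrite (_ : sg _ (fun=> 0) = fun=> 0); last by apply: funext => i; rewrite /sg mulr0.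
by rewrite !(split_0l (@act_split K V)) addr0 subr0.
Qed.

Lemma omonZ_brk d n p u d' n' p' v : omonZ d n p u -> omonZ d' n' p' v ->
  omonZ (d + d') (n + n') (p + p') (brkO u v).
Proof.
move=> [c [u1 [gc Hu ->]]] [c' [v1 [gc' Hv ->]]].
exists (c * c'), (brkO u1 v1); split; first exact: gpart0M.
  exact: omon_brk.
by rewrite (linZ (brkOm_l _)) (linZ (@brkOm_r K V u1)) scalerA.
Qed.

Lemma omonZ_Z d n p c u : gpart 0 c -> omonZ d n p u -> omonZ d n p (c *: u).
Proof.
move=> gc [c' [u1 [gc' Hu ->]]]; exists (c * c'), u1; split=> //; first exact: gpart0M.
by rewrite scalerA.
Qed.

(** A one-form x (x) dy with x a product of letters arises from dy, up to sign, by letting the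
    letters act one after the other, and in the semidirect product this action is the bracket. Hence
    the elements y and dy generate under brackets. *)
Lemma omonZ_letter d' n' e' : @pmem K lW e' -> pureg d' n' 0 (clsg e') ->
  forall n q, inseq q (FtW n) ->
  omonZ (wdg q.1 + d' + 1) (n + n') 1 (clsO (inr0 (@letter0 K sO (tens0 q.2 e')))).
Proof.
move=> Me' pe' n q Hq.
have [l Hl lq] := In_flatten Hq; have [k _ el] := In_map Hl; rewrite el in lq.
have [F1 F2 _] := @FW_frame K V.
pose Q m (r : SW * (SW -> K)) := @pmem K tW r.2 /\
  omonZ (wdg r.1 + d' + 1) (m + n') 1 (clsO (inr0 (@letter0 K sO (tens0 r.2 e')))).
suff [] : Q n q by [].
move: lq; apply: Fc_ind => [m r Hr|a m p r Hp [Mr Hr]].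
  case: m Hr => [|m] Hr; last by have := inseq_nil Hr.
  have [->|h] := inseq_cons Hr; last by have := inseq_nil h.
  split; first exact: talg_one.
  rewrite /wdg big_nil add0r add0n; exists 1, (dO (clsg e')); split.
  - exact: gpart1.
  - exact: omon_d.
  - by rewrite scale1r d_cls.
have Mp := pmem_W p.2; have [ep sp ip] := F1 _ _ Hp.
split; first by apply: talg_mul => //; exact: talg_letter.
have Mt : @pmem K lS (@letter0 K sO (tens0 r.2 e')).
  by apply: lalg_letter; exact: pmem_tens.
have -> : @letter0 K sO (tens0 (@ct K W p.2 r.2) e') = fun s => ksgn K (dg p.1) *
     act (@letter0 K W p.2) (@letter0 K sO (tens0 r.2 e')) s.
  rewrite act_letter lact_tens sg_letter.
  have -> : sg (@dg K W) p.2 = fun i => ksgn K (dg p.1) * p.2 i + 0.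
    apply: funext => i; rewrite addr0 /sg.
    have [e|ne] := eqVneq (@mg K W nof i) (mg nof p.1); last by rewrite sp ?mulr0.
    by have -> : dg i = dg p.1 by case: e.
  rewrite letter_lin (mul0_linl nof) tens0_linl letter_lin.
  have -> : @letter0 K W (fun=> 0) = fun=> 0 by apply: funext => -[|i [|j s]].
  rewrite (split_0l (mul0_split nof)).
  have -> : @tens0 K SW SW (fun=> 0) e' = fun=> 0 by apply: funext => i; rewrite /tens0 mul0r.
  have -> : @letter0 K sO (fun=> 0) = fun=> 0 by apply: funext => -[|i [|j s]].
  by apply: funext => s; rewrite addr0 mulrA ksgn_sq mul1r.
rewrite (_ : inr0 _ = fun i => ksgn K (dg p.1) * (inr0
   (act (@letter0 K W p.2) (@letter0 K sO (tens0 r.2 e'))) : sym O -> K) i); last first.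
  by apply: funext => -[s|s] //=; rewrite mulr0.
have Ml : @pmem K lW (@letter0 K W p.2) by exact: lalg_letter.
rewrite clsZ; last exact/pmem_inr/pmem_act.
apply: omonZ_Z; first exact: gpart_ksgn.
rewrite -brkO_inl_inr // /wdg big_cons -/(wdg r.1) -!addrA -addnA (addrA (wdg r.1)).
apply: (@omonZ_brk _ _ 0 _ _ _ 1) => //.
exists 1, (inO (clsg (@letter0 K W p.2))); split; [exact: gpart1| |by rewrite scale1r in_cls].
apply: omon_in; exists (@letter0 K W p.2); split=> // -[|i [|j s]] /=;
  try by split=> //; exact: gpart0.
rewrite /wdg /wwt !big_seq1; split=> //.
- have [e|ne] := eqVneq (@mg K W nof i) (mg nof p.1); last by rewrite sp //; exact: gpart0.
  by have -> : dg i = dg p.1 by [case: e]; rewrite subrr; exact: ip.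
- move=> h; apply: sp; apply: contra h => /eqP e; rewrite -ep -e //.
Qed.

Lemma FlW_pure m p : inseq p (FlW m) -> pureg (wdg p.1) m 0 (clsg p.2).
Proof.
have [F1 F2 _] := FlW_frame => Hp; apply: (@pure_frame K lW nof m p); first exact: F2 Hp.
by rewrite mg_lW; exact: F1.
Qed.

Lemma FsO_omon m r : inseq r (FsO m) -> @pmem K lS (@letter0 K sO r.2) /\
  omonZ (@dg K sO r.1) m 1 (clsO (inr0 (@letter0 K sO r.2))).
Proof.
have [_ F2 _] := FlW_frame; have [_ T2 _] := FtW_frame.
move: m r; apply: (Fx_ind (Q := fun m r => @pmem K lS (@letter0 K sO r.2) /\
  omonZ (@dg K sO r.1) m 1 (clsO (inr0 (@letter0 K sO r.2))))) => a b p1 p2 H1 H2.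
split; first by apply: lalg_letter; apply: pmem_tens; [exact: T2 H1|exact: F2 H2].
by apply: omonZ_letter H1; [exact: F2 H2|exact: FlW_pure].
Qed.

Lemma FO_omon n q : inseq q (FO n) -> omonZ (dg q.1) n (fdOm q.1) (clsO q.2).
Proof.
have [F1 F2 _] := FlW_frame; have [G1 G2 _] := FlS_frame.
move=> Hq; have [h|h] := In_cat Hq; have [p Hp ->] := In_map h => /=.
  exists 1, (inO (clsg p.2)); split; first exact: gpart1.
    by apply: omon_in; exact: FlW_pure.
  by rewrite scale1r in_cls //; exact: F2 Hp.
have [k [q' [ep [Mq Hq']]]] : exists k q', p = (q'.1, fun t => kinv K k.+1 * q'.2 t) /\
    (@pmem K lS q'.2 /\ omonZ (wdg q'.1) n (size q'.1) (clsO (inr0 q'.2))).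
  move: Hp; apply: (FL_ind (F := FsO) (Q := fun n q' => @pmem K lS q'.2 /\
      omonZ (wdg q'.1) n (size q'.1) (clsO (inr0 q'.2)))) => [m|a m] r.
    by move=> /FsO_omon[H1 H2]; split=> //=; rewrite /wdg big_seq1.
  move=> r' /FsO_omon[Ml Hl] [Mr' Hr']; split; first exact: lalg_brk.
  by rewrite -brkO_inr //= /wdg big_cons -[(size _).+1]add1n; apply: omonZ_brk.
rewrite ep /= (_ : inr0 _ = fun i => kinv K k.+1 * (inr0 q'.2 : sym O -> K) i); last first.
  by apply: funext => -[s|s] //=; rewrite mulr0.
rewrite clsZ; last exact: pmem_inr.
apply: omonZ_Z => //; rewrite -[kinv K _]mulr1; apply: gpart_kinv => //; exact: gpart1.
Qed.

Lemma wpart_omon n u : exists l : seq (K * pcar O),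
  (forall t, inseq t l -> exists d p, omon d n p t.2) /\
  wpart n u = \sum_(t <- l) t.1 *: t.2.
Proof.
have [x Mx ->] := clsW u.
rewrite (comp_frame n (@O_graded K V) FO_frame) //.
have : forall q, inseq q (FO n) -> omonZ (dg q.1) n (fdOm q.1) (clsO q.2) by exact: FO_omon.
elim: (FO n) => [|q l IH] H; first by exists [::]; split; [move=> t Ht; have := inseq_nil Ht|rewrite !big_nil].
have [l' [H' E']] : exists l0 : seq (K * pcar O),
  (forall t, inseq t l0 -> exists d p, omon d n p t.2) /\
  \sum_(p <- l) x p.1 *: cls p.2 = \sum_(t <- l0) t.1 *: t.2.
  by apply: IH => r Hr; apply: H; right.
have [c [v [gc Hv ev]]] := H q (inseq_head _ _).
exists ((x q.1 * c, v) :: l'); split.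
  move=> t Ht; have [->|/H'//] := inseq_cons Ht.
  by exists (dg q.1), (fdOm q.1).
by rewrite !big_cons E' ev scalerA.
Qed.

End OmGenerators.

(** * Noncommutative forms *)

Section DRTheory.
Variables (K : evenRing) (V : fgmod).
Notation W := (susp_dual K V).
Notation lW := (lalg W).
Notation O := (Om W).
Notation R := (DR W).
Notation TO := (tens O O).
Notation g := (pcar lW).
Notation brkO := (@brkOm K W).
Notation pureO := (pure (@fdOm K W)).
Notation pureR := (pure (M := R) (@fdDR K W)).
Notation clsO := (@cls K O).
Notation clsR := (@cls K R).
Notation mO := (mg (@fdOm K W)).
Notation mR := (mg (M := R) (@fdDR K W)).
Notation tR := (@tensDR K W).

Lemma tR_split : splitop mO mO mR (@tens0 K (sym O) (sym O)).
Proof. exact: tens0_split. Qed.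

Lemma TO_prel z : @prel K TO z -> @prel K R z.
Proof. by apply: cspan_sub => x Hx; apply: cspan_in; left. Qed.

Lemma pmem_tR x y : @pmem K O x -> @pmem K O y -> @pmem K R (tens0 x y).
Proof. exact: pmem_tens. Qed.
Lemma prel_tRl x y : @pmem K O x -> @prel K O x -> @pmem K O y -> @prel K R (tens0 x y).
Proof. by move=> Hx Rx Hy; apply: TO_prel; exact: prel_tensl. Qed.
Lemma prel_tRr x y : @pmem K O x -> @pmem K O y -> @prel K O y -> @prel K R (tens0 x y).
Proof. by move=> Hx Hy Ry; apply: TO_prel; exact: prel_tensr. Qed.

Lemma prel_sym i j x y : @pmem K O x -> homf (@dg K O) i x -> @pmem K O y ->
  homf (@dg K O) j y -> @prel K R (fun k => tens0 x y k - ksgn K (i * j) * tens0 y x k).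
Proof.
move=> Hx hx Hy hy; apply: cspan_in; right; left.
by exists i, j, x, y; split.
Qed.

Definition inv0 (x y t : sym O -> K) : sym R -> K :=
  fun k => tens0 x (brkOm0 y t) k - tens0 (brkOm0 x y) t k.

Lemma prel_inv x y t : @pmem K O x -> @pmem K O y -> @pmem K O t -> @prel K R (inv0 x y t).
Proof. by move=> Hx Hy Ht; apply: cspan_in; right; right; exists x, y, t; split. Qed.

Lemma prelR_ind (T : (sym R -> K) -> sym R -> K) (B : set (sym R -> K)) :
  (forall a x y, T (fun i => a * x i + y i) = fun i => a * T x i + T y i) ->
  (forall n x y, eqw (@wt K R) n x y -> eqw (@wt K R) n (T x) (T y)) ->
  (forall x y, @pmem K O x -> @prel K O x \/ @prel K O y -> @pmem K O y ->
     cspan (@wt K R) B (T (tens0 x y))) ->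
  (forall i j x y, @pmem K O x -> homf (@dg K O) i x -> @pmem K O y -> homf (@dg K O) j y ->
     cspan (@wt K R) B (T (fun k => tens0 x y k - ksgn K (i * j) * tens0 y x k))) ->
  (forall x y t, @pmem K O x -> @pmem K O y -> @pmem K O t -> cspan (@wt K R) B (T (inv0 x y t))) ->
  forall z, @prel K R z -> cspan (@wt K R) B (T z).
Proof.
move=> Tl Te H1 H2 H3; apply: cspan_map => // z [[x [y [Mx My Rxy ->]]]|[|]].
- exact: H1.
- by move=> [i [j [x [y [[Mx hx] [My hy] ->]]]]]; exact: H2.
- by move=> [x [y [t [Mx My Mt ->]]]]; exact: H3.
Qed.

Lemma wc_tR n (x y : sym O -> K) : wc (@wt K R) n (tens0 x y) =
  fun z => \sum_(k < n.+1) tens0 (wc (@wt K O) k x) (wc (@wt K O) (n - k)%N y) z.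
Proof. exact: (split_wc tR_split). Qed.

Lemma R_graded : graded R.
Proof.
have [OM OR] := @O_graded K V; split=> n x; first by apply: tens_wc; exact: OM.
apply: prelR_ind => [a u v|k u v uv l h|u v Mu [Ru|Rv] Mv|i j u v Mu hu Mv hv|u v t Mu Mv Mt].
- exact: wc_lin.
- by rewrite /wc uv.
- by rewrite wc_tR; apply: cspan_sum_ord => k; apply: prel_tRl; [exact: OM|exact: OR|exact: OM].
- by rewrite wc_tR; apply: cspan_sum_ord => k; apply: prel_tRr; [exact: OM|exact: OM|exact: OR].
- have -> : wc (@wt K R) n (fun k => tens0 u v k - ksgn K (i * j) * tens0 v u k) =
      fun z => \sum_(k < n.+1) (tens0 (wc (@wt K O) k u) (wc (@wt K O) (n - k)%N v) z -
         ksgn K (i * j) * tens0 (wc (@wt K O) (n - k)%N v) (wc (@wt K O) k u) z).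
    have -> : wc (@wt K R) n (fun k => tens0 u v k - ksgn K (i * j) * tens0 v u k) =
      fun z => wc (@wt K R) n (tens0 u v) z - ksgn K (i * j) * wc (@wt K R) n (tens0 v u) z.
      by apply: funext => k; rewrite /wc; case: ifP => // _; rewrite mulr0 subr0.
    apply: funext => z; rewrite !wc_tR sumrB; congr (_ - _); rewrite mulr_sumr.
    (* The Cauchy product of the exchanged tensor is reversed, so that both sums run over the same
       pairs of components. *)
    rewrite (reindex_inj rev_ord_inj) /=; apply: eq_bigr => k _.
    by rewrite !subSS subKn // -ltnS.
  apply: cspan_sum_ord => k; apply: prel_sym; try exact: OM; exact: homf_wc.
apply: (@tri_wc K _ _ _ _ (@wt K O) (@wt K O) (@wt K O) _ inv0 _ _ _ _ _
  (@pmem K O) (@pmem K O) (@pmem K O)) => //.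
- move=> a x1 x2 y t1; rewrite /inv0 !(split_linl (@brkOm_split K V)).
  rewrite !(split_linl tR_split); apply: funext => k; ring.
- move=> a x1 x2 y t1; rewrite /inv0 !(split_linr (@brkOm_split K V)).
  rewrite !(split_linl (@brkOm_split K V)) (split_linl tR_split) (split_linr tR_split).
  apply: funext => k; ring.
- move=> a x1 x2 y t1; rewrite /inv0 !(split_linr (@brkOm_split K V)).
  rewrite !(split_linr tR_split); apply: funext => k; ring.
- move=> k x1 x2 y1 y2 t1 t2 ex ey et l wl; congr (_ - _).
    by apply: (split_eqw tR_split (n := k)) => //; exact: (split_eqw (@brkOm_split K V)).
  by apply: (split_eqw tR_split (n := k)) => //; exact: (split_eqw (@brkOm_split K V)).
- move=> k l m x1 y1 t1 hx hy ht.
  pose q (g : mdeg) := g.1.2; have qD (g h : mdeg) : q (g + h) = (q g + q h)%N by [].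
  have h1 := split_supq tR_split qD hx (split_supq (@brkOm_split K V) qD hy ht).
  have h2 := split_supq tR_split qD (split_supq (@brkOm_split K V) qD hx hy) ht.
  by move=> i h; rewrite /inv0 h1 ?h2 ?subr0 // addnA.
- exact: prel_inv.
Qed.

Lemma tR_cls x y : @pmem K O x -> @pmem K O y -> tR (clsO x) (clsO y) = clsR (tens0 x y).
Proof. exact: (bop_cls tR_split pmem_tR prel_tRl prel_tRr). Qed.
Lemma tR_l v : linear (fun u => tR u v).
Proof. exact: (bopl tR_split pmem_tR prel_tRl prel_tRr). Qed.
Lemma tR_r u : linear (tR u).
Proof. exact: (bopr tR_split pmem_tR prel_tRl prel_tRr). Qed.
Lemma tR_ordr i j u v : ordr i u -> ordr j v -> ordr (i + j)%N (tR u v).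
Proof. exact: (bop_ordr tR_split pmem_tR prel_tRl prel_tRr). Qed.
Lemma tR_ordge i j u v : ordge i u -> ordge j v -> ordge (i + j)%N (tR u v).
Proof. exact: (bop_ordge tR_split pmem_tR prel_tRl prel_tRr). Qed.
Lemma tR_pure d n p d' n' p' u v : pureO d n p u -> pureO d' n' p' v ->
  pureR (d + d') (n + n')%N (p + p')%N (tR u v).
Proof. exact: (bop_pure tR_split pmem_tR prel_tRl prel_tRr). Qed.

Lemma tR_sym i j u v : homog i u -> homog j v -> tR u v = ksgn K (i * j) *: tR v u.
Proof.
move=> [x [Mx -> hx]] [y [My -> hy]]; rewrite !tR_cls //.
apply/eqP; rewrite -subr_eq0 -clsZ; last exact: pmem_tR.
rewrite -clsB; [|exact: pmem_tR|by apply: cspanZ; exact: pmem_tR].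
apply/eqP; apply: prel_cls0; last exact: prel_sym.
by apply: cspanB; [|apply: cspanZ]; exact: pmem_tR.
Qed.

Lemma tR_inv u v w : tR u (brkO v w) = tR (brkO u v) w.
Proof.
have [x Mx ->] := clsW u; have [y My ->] := clsW v; have [t Mt ->] := clsW w.
have M1 := pmem_brkOm Mx My; have M2 := pmem_brkOm My Mt.
rewrite !brkOm_cls // !tR_cls //; apply/eqP; rewrite -subr_eq0 -clsB; try exact: pmem_tR.
apply/eqP; apply: prel_cls0; last exact: prel_inv.
by apply: cspanB; exact: pmem_tR.
Qed.

Definition FR := Fx (FO K V) (FO K V).

Lemma FR_frame : frame mR (@pmem K R) FR.
Proof. exact: (Fx_frame (wX := @wt K O) (wY := @wt K O) _ _ (@FO_frame K V) (@FO_frame K V)). Qed.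

Lemma FR_omon n q : inseq q (FR n) -> exists c d m p u d' m' p' v,
  [/\ gpart 0 c, omon d m p u, omon d' m' p' v, clsR q.2 = c *: tR u v &
      [/\ d + d' = @dg K R q.1, (m + m')%N = n & (p + p')%N = fdDR q.1]].
Proof.
have [_ O2 _] := @FO_frame K V.
move: n q; apply: (Fx_ind (Q := fun n q => _)) => a b p q Hp Hq.
have [c [u [gc Hu eu]]] := FO_omon Hp; have [c' [v [gc' Hv ev]]] := FO_omon Hq.
exists (c * c'), (dg p.1), a, (fdOm p.1), u, (dg q.1), b, (fdOm q.1), v; split=> //.
  exact: gpart0M.
rewrite -tR_cls; [|exact: O2 Hp|exact: O2 Hq].
by rewrite eu ev (linZ (tR_l _)) (linZ (tR_r u)) scalerA.
Qed.

Lemma wpart_cls_R n z : @pmem K R z ->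
  wpart n (clsR z) = \sum_(q <- FR n) z q.1 *: clsR q.2.
Proof. by move=> Mz; apply: (comp_frame n R_graded FR_frame). Qed.

(** Forms start in positive weight, which later allows division by the weight. *)
Lemma wpart0_R u : wpart 0 u = 0 :> pcar R.
Proof. by have [z Mz ->] := clsW u; rewrite wpart_cls_R // /FR /Fx /= big_nil. Qed.

Section Extension.
Variables (N : pmod K).
Hypothesis gN : graded N.

Lemma O_ext (f h : pcar O -> pcar N) : clinear f -> clinear h ->
  (forall d n p u, omon d n p u -> f u = h u) -> forall u, f u = h u.
Proof.
move=> fc hc H; apply: (clin_ext (@O_graded K V) gN fc hc) => n u Hu.
have [l [Hl El]] := wpart_omon n u; rewrite -(ordr_fix (@O_graded K V) Hu) El.
have [fl _] := fc; have [hl _] := hc; rewrite (lin_sum fl) (lin_sum hl).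
by apply: big_In => t /Hl[d [p Ht]]; rewrite (linZ fl) (linZ hl) (H _ _ _ _ Ht).
Qed.

Lemma R_ext (f h : pcar R -> pcar N) : clinear f -> clinear h ->
  (forall d n p u d' n' p' v, omon d n p u -> omon d' n' p' v -> f (tR u v) = h (tR u v)) ->
  forall u, f u = h u.
Proof.
move=> fc hc H; apply: (clin_ext R_graded gN fc hc) => n u Hu.
rewrite -(ordr_fix R_graded Hu); have [z Mz ->] := clsW u; rewrite wpart_cls_R //.
have [fl _] := fc; have [hl _] := hc; rewrite (lin_sum fl) (lin_sum hl).
apply: big_In => q /FR_omon[c [d [m [p [u1 [d' [m' [p' [v1 [_ Hu1 Hv1 -> _]]]]]]]]]].
by rewrite (linZ fl) (linZ hl) (linZ fl) (linZ hl) (H _ _ _ _ _ _ _ _ Hu1 Hv1).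
Qed.

(** Reduces statements on p-forms to products of generators of total form degree p; the frame
    ensures that the coefficient [c] has the complementary degree. *)
Lemma form_wpart (f : pcar R -> pcar N) (p : nat) (a : int) n (S : pcar N -> Prop) (u : pcar R) :
  linear f -> S 0 -> (forall x y, S x -> S y -> S (x + y)) -> @Defs.form K W p a u ->
  (forall c d m q v d' m' q' v', gpart (a + p%:Z - (d + d')) c -> omon d m q v -> omon d' m' q' v' ->
     (m + m' = n)%N -> (q + q' = p)%N -> S (c *: f (tR v v'))) ->
  S (f (wpart n u)).
Proof.
move=> fl S0 SD [z [Mz -> Hz]] H; rewrite wpart_cls_R // (lin_sum fl).
apply: big_In_ind => // q /FR_omon[c [d [m [k [u1 [d' [m' [k' [v1 [gc Hu1 Hv1 -> [ed em ep]]]]]]]]]]].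
have [z1 z2] := Hz q.1; have [ep'|np] := eqVneq (fdDR q.1) p; last first.
  by rewrite z1 // scale0r (lin0 fl).
rewrite (linZ fl) (linZ fl) scalerA; apply: H Hu1 Hv1 em _; last by rewrite ep.
by rewrite mulrC ed; exact: gpart0M.
Qed.

End Extension.

(** The grading involution on classes. It lets the Leibniz rule of an odd derivation be stated for
    arbitrary elements, as an identity of continuous linear maps. *)
Definition sgc (u : pcar O) : pcar O := clsO (sg (@dg K O) (rep u)).

Lemma sgc_cls x : @pmem K O x -> sgc (clsO x) = clsO (sg (@dg K O) x).
Proof.
move=> Mx; apply: clsP; [exact/O_sg/pmem_rep|exact: O_sg|].
rewrite (_ : (fun i => _) = sg (@dg K O) (fun i => -1 * (rep (clsO x) i - x i) + 0)).
  by apply/Or_sg/prel_lin; [exact: rep_cls|exact: cspan0].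
by apply: funext => i; rewrite /sg; ring.
Qed.

Lemma sgc_lin : linear sgc.
Proof.
move=> a u v; have [x Mx ->] := clsW u; have [y My ->] := clsW v.
rewrite -cls_lin // !sgc_cls //; last exact: pmem_lin.
by rewrite sg_lin cls_lin //; exact: O_sg.
Qed.

Lemma sgc_homog j u : homog j u -> sgc u = ksgn K j *: u.
Proof.
move=> [x [Mx -> hx]]; rewrite sgc_cls // -clsZ //; congr clsO; apply: funext => i.
rewrite /sg !ksgnE; have [->//|ne] := eqVneq (odd `|dg i|) (odd `|j|).
by rewrite (gpart_odd_eq (hx i)) ?mulr0 // eq_sym.
Qed.

Lemma sgc_ordr n u : ordr n u -> ordr n (sgc u).
Proof.
move=> [x [Mx -> hx]]; exists (sg (@dg K O) x); split; first exact: O_sg.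
  by rewrite sgc_cls.
by move=> i wi; rewrite /sg hx // mulr0.
Qed.

Lemma sgc_wpart n u : wpart n (sgc u) = sgc (wpart n u).
Proof.
have [x Mx ->] := clsW u; have [OM _] := @O_graded K V.
rewrite sgc_cls // !(comp_cls (@O_graded K V)) //; last exact: O_sg.
rewrite sgc_cls; last exact: OM.
by congr clsO; apply: funext => i; rewrite /wc /sg; case: ifP => // _; rewrite mulr0.
Qed.

Lemma sgc_brk u v : sgc (brkO u v) = brkO (sgc u) (sgc v).
Proof.
have [x Mx ->] := clsW u; have [y My ->] := clsW v.
rewrite brkOm_cls // !sgc_cls //; last exact: pmem_brkOm.
rewrite brkOm_cls; try exact: O_sg.
by congr clsO; exact: (split_sg (@brkOm_split K V)).
Qed.

Lemma brkO_clinl v : clinear (fun u => brkO u v).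
Proof.
apply: (raises_clinear (r := 0) (@O_graded K V)); first exact: brkOm_l.
move=> i u Hu; apply: brkOm_ordge => //; exact: (ordge0 (@O_graded K V)).
Qed.

Lemma tR_clinl v : clinear (fun u => tR u v).
Proof.
apply: (raises_clinear (r := 0) R_graded); first exact: tR_l.
move=> i u Hu; apply: tR_ordge => //; exact: (ordge0 (@O_graded K V)).
Qed.

Lemma sgc_clin : clinear sgc.
Proof.
apply: (raises_clinear (r := 0) (@O_graded K V)); first exact: sgc_lin.
apply: shifts_raises; [exact: O_graded|exact: O_graded| |].
  split; first exact: sgc_lin.
  move=> n; exists n => u [x [Mx -> hx]]; exists (sg (@dg K O) x); split.
  - exact: O_sg.
  - by rewrite sgc_cls.
  - by move=> i wi; rewrite /sg hx // mulr0.
by move=> i u; rewrite addn0; exact: sgc_ordr.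
Qed.

Lemma omon_homog d n p (u : pcar O) : omon d n p u -> homog d u.
Proof. by move=> /omon_pure; exact: pure_homog. Qed.

Lemma omon_ordr d n p (u : pcar O) : omon d n p u -> ordr n u.
Proof. by move=> /omon_pure; exact: pure_ordr. Qed.

(** * Descent of a derivation of degree one to noncommutative forms *)

Section Leibniz.
Variable D : pcar O -> pcar O.
Hypothesis derD : derOm 1 D.
Hypothesis shD : shifts 0 D.

Let Dl : linear D. Proof. by have [[]] := derD. Qed.
Let Dc : clinear D. Proof. by have [] := derD. Qed.

Lemma D_brk u v : D (brkO u v) = brkO (D u) v + brkO (sgc u) (D v).
Proof.
apply: (O_ext (@O_graded K V) (f := fun u => D (brkO u v))
  (h := fun u => brkO (D u) v + brkO (sgc u) (D v))) => [||d n p w Hw].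
- exact: clin_comp Dc (brkO_clinl v).
- apply: clinD; first exact: clin_comp (brkO_clinl v) Dc.
  exact: clin_comp (brkO_clinl _) sgc_clin.
have [_ _ H] := derD; rewrite (H d) ?(sgc_homog (omon_homog Hw)); last exact: omon_homog Hw.
by rewrite (linZ (brkOm_l _)) mul1r.
Qed.

Definition leibB u v := tR (D u) v + tR (sgc u) (D v).

Lemma leibB_l v : linear (fun u => leibB u v).
Proof.
move=> a u u'; rewrite /leibB Dl sgc_lin !(tR_l _) scalerDr addrACA.
by [].
Qed.
Lemma leibB_r u : linear (leibB u).
Proof. by move=> a v v'; rewrite /leibB Dl !(tR_r _) scalerDr addrACA. Qed.

Lemma leibB_ordr i j u v : ordr i u -> ordr j v -> ordr (i + j)%N (leibB u v).
Proof.
move=> Hu Hv; apply: ordrD; apply: tR_ordr => //.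
- by have := shD Hu; rewrite addn0.
- exact: sgc_ordr.
- by have := shD Hv; rewrite addn0.
Qed.

(** The induced operator in weight n, on representatives: a function on pairs of symbols is expanded
    in the frames of the two factors. This is linear on all functions and involves no choice of a
    presentation by pure tensors. *)
Definition leibE n (z : sym R -> K) : pcar R :=
  \sum_(a <- iota 0 n.+1) \sum_(p <- FO K V a) \sum_(q <- FO K V (n - a)%N)
    z (p.1, q.1) *: leibB (clsO p.2) (clsO q.2).

Lemma leibE_lin n a x y : leibE n (fun i => a * x i + y i) = a *: leibE n x + leibE n y.
Proof.
rewrite /leibE scaler_sumr -big_split; apply: eq_bigr => b _ /=.
rewrite scaler_sumr -big_split; apply: eq_bigr => p _ /=.
rewrite scaler_sumr -big_split; apply: eq_bigr => q _ /=.
by rewrite scalerDl scalerA.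
Qed.

Lemma leibE_eqw n x y : eqw (@wt K R) n x y -> leibE n x = leibE n y.
Proof.
have [F1 _ _] := @FO_frame K V.
move=> xy; apply: big_In => a Ha; apply: big_In => p /F1[e1 _ _].
apply: big_In => q /F1[e2 _ _]; rewrite xy //.
have /In_mem := Ha; rewrite mem_iota add0n ltnS => /andP[_ an].
change ((mO p.1).1.2 + (mO q.1).1.2 <= n)%N.
by rewrite e1 e2 subnKC.
Qed.

Lemma leibE_ordr n x : ordr n (leibE n x).
Proof.
have [F1 F2 _] := @FO_frame K V.
rewrite /leibE.
apply: (@big_In_ind _ _ (fun u => ordr n u)); [exact: ordr0|exact: ordrD|] => a Ha.
apply: (@big_In_ind _ _ (fun u => ordr n u)); [exact: ordr0|exact: ordrD|] => p Hp.
apply: (@big_In_ind _ _ (fun u => ordr n u)); [exact: ordr0|exact: ordrD|] => q Hq.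
apply: ordrZ; have /In_mem := Ha; rewrite mem_iota add0n ltnS => /andP[_ an].
rewrite -(subnKC an); apply: leibB_ordr.
  have := pure_frame (F2 _ _ Hp) (F1 _ _ Hp); exact: pure_ordr.
have := pure_frame (F2 _ _ Hq) (F1 _ _ Hq); exact: pure_ordr.
Qed.

Lemma wpart_frame_O n x : @pmem K O x ->
  wpart n (clsO x) = \sum_(p <- FO K V n) x p.1 *: clsO p.2.
Proof. by move=> Mx; apply: (comp_frame n (@O_graded K V) (@FO_frame K V)). Qed.

Lemma leibE_tens n x y : @pmem K O x -> @pmem K O y ->
  leibE n (tens0 x y) = wpart n (leibB (clsO x) (clsO y)).
Proof.
move=> Mx My.
(* Parts of weight above n in either argument do not matter in weight n; among the remaining pairs
   of components only those of total weight n contribute. *)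
have E u v : wpart n (leibB u v) = \sum_(a <- iota 0 n.+1) leibB (wpart a u) (wpart (n - a)%N v).
  have gO := @O_graded K V.
  pose N := n.+1.
  have Z (x1 y1 z1 : pcar R) : z1 = x1 + (y1 - x1 + (z1 - y1)).
    by rewrite addrA [x1 + _]addrC subrK addrC subrK.
  have -> : leibB u v = leibB (trunc N u) (trunc N v) +
     (leibB (u - trunc N u) (trunc N v) + leibB u (v - trunc N v)).
    by rewrite (linB (leibB_r u) v (trunc N v)) (linB (leibB_l (trunc N v)) u (trunc N u)) -Z.
  have B0 w1 w2 : ordge N w1 -> wpart n (leibB w1 w2) = 0.
    move=> H1; rewrite /leibB (linD (comp_lin R_graded n)).
    have rD : raises 0 D by apply: shifts_raises.
    have rs : ordge N (sgc w1).
      apply/(ordgeP gO) => k kN; rewrite sgc_wpart (ordge_comp0 gO H1) // (lin0 sgc_lin) //.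
    have D1 : ordge N (D w1) by have := rD _ _ H1; rewrite addn0.
    rewrite (ordge_comp0 R_graded (tR_ordge D1 (ordge0 gO w2))) ?addn0 //.
    by rewrite (ordge_comp0 R_graded (tR_ordge rs (ordge0 gO (D w2)))) ?addn0 ?addr0.
  have B1 w1 w2 : ordge N w2 -> wpart n (leibB w1 w2) = 0.
    move=> H1; rewrite /leibB (linD (comp_lin R_graded n)).
    have rD : raises 0 D by apply: shifts_raises.
    have D1 : ordge N (D w2) by have := rD _ _ H1; rewrite addn0.
    rewrite (ordge_comp0 R_graded (tR_ordge (ordge0 gO (D w1)) H1)) ?add0n //.
    by rewrite (ordge_comp0 R_graded (tR_ordge (ordge0 gO (sgc w1)) D1)) ?add0n ?addr0.
  rewrite (linD (comp_lin R_graded n) (leibB (trunc N u) (trunc N v))).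
  rewrite (linD (comp_lin R_graded n) (leibB (u - trunc N u) (trunc N v))).
  rewrite (B0 (u - trunc N u)) ?(B1 u (v - trunc N v)) ?addr0; try exact: trunc_ordge.
  rewrite /trunc (lin_sum (leibB_l _)) (lin_sum (comp_lin R_graded n)).
  rewrite -[iota _ _]/(index_iota 0 n.+1) [RHS]big_mkord; apply: eq_bigr => a _.
  rewrite (lin_sum (leibB_r _)) (lin_sum (comp_lin R_graded n)).
  have lt : (n - a < N)%N by rewrite ltnS leq_subr.
  rewrite (bigD1 (Ordinal lt)) //= big1 ?addr0 => [|k kn].
    have an : (a + (n - a))%N = n by rewrite subnKC // -ltnS.
    have := leibB_ordr (ordr_comp gO a u) (ordr_comp gO (n - a)%N v); rewrite an.
    exact: (ordr_fix R_graded).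
  apply: (ordr_comp0 R_graded (leibB_ordr (ordr_comp gO a u) (ordr_comp gO k v))).
  by apply: contra kn => /eqP e; apply/eqP/val_inj => /=; rewrite e addKn.
rewrite E /leibE; apply: eq_bigr => a _; rewrite !wpart_frame_O //.
rewrite (lin_sum (leibB_l _)); apply: eq_bigr => p _; rewrite (linZ (leibB_l _)).
rewrite (lin_sum (leibB_r _)) scaler_sumr; apply: eq_bigr => q _.
by rewrite (linZ (leibB_r _)) scalerA.
Qed.

Lemma leibB_sym i j u v : homog i u -> homog j v -> leibB u v = ksgn K (i * j) *: leibB v u.
Proof.
move=> hu hv; have [_ HD _] := derD; have hu' := HD _ _ hu; have hv' := HD _ _ hv.
rewrite /leibB (sgc_homog hu) (sgc_homog hv) !(linZ (tR_l _)) scalerDr !scalerA.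
rewrite (tR_sym hu' hv) (tR_sym hu hv') !scalerA addrC.
have -> : ksgn K i * ksgn K (i * (j + 1)) = ksgn K (i * j).
  rewrite -ksgnD !ksgnE !(odd_abszD, odd_abszM) /=.
  by case: (odd _); case: (odd _).
have -> // : ksgn K ((i + 1) * j) = ksgn K (i * j) * ksgn K j.
by rewrite -ksgnD mulrDl mul1r.
Qed.

(** The symmetry relations are respected by [leibB_sym], and the invariance relations because [D]
    and [sgc] are compatible with the bracket and [tensDR] is itself invariant. *)
Lemma leibE_prel n z : @prel K R z -> leibE n z = 0.
Proof.
move=> Rz; have [z' Az' zz'] := Rz n; rewrite (leibE_eqw zz').
elim: Az' => [|a u v Au _ IH].
  have := leibE_lin n (-1) (fun=> 0) (fun=> 0).
  rewrite (_ : (fun i : sym R => _) = fun=> 0); last by apply: funext => k; rewrite mulr0 add0r.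
  by move=> {1}->; rewrite scaleN1r addNr.
rewrite leibE_lin IH addr0; suff -> : leibE n u = 0 by rewrite scaler0.
case: Au => [[x [y [Mx My Rxy ->]]]|[|]].
- rewrite leibE_tens //; case: Rxy => Rx; rewrite (prel_cls0 _ Rx) //.
    by rewrite (lin0 (leibB_l _)) (lin0 (comp_lin R_graded n)).
  by rewrite (lin0 (leibB_r _)) (lin0 (comp_lin R_graded n)).
- move=> [i [j [x [y [[Mx hx] [My hy] ->]]]]].
  rewrite (_ : (fun k => _) = fun k => - ksgn K (i * j) * tens0 y x k + tens0 x y k).
    rewrite leibE_lin !leibE_tens // (@leibB_sym i j (clsO x)); [|by exists x|by exists y].
    by rewrite (linZ (comp_lin R_graded n)) scaleNr addNr.
  by apply: funext => k; ring.
- move=> [x [y [t [Mx My Mt ->]]]].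
  have M1 := pmem_brkOm Mx My; have M2 := pmem_brkOm My Mt.
  rewrite (_ : (fun k => _) = fun k => -1 * tens0 (brkOm0 x y) t k + tens0 x (brkOm0 y t) k).
    rewrite leibE_lin !leibE_tens // -!brkOm_cls // /leibB !D_brk sgc_brk.
    rewrite (linD (tR_l _)) (linD (tR_r _)) !tR_inv -!addrA scaleN1r addNr.
    by [].
  by apply: funext => k; ring.
Qed.

Lemma leibniz_ex : exists E : pcar R -> pcar R, clinear E /\ forall u v, E (tR u v) = leibB u v.
Proof.
pose E (u : pcar R) := wglue (fun n => leibE n (rep u)).
have wE n z : @pmem K R z -> wpart n (E (clsR z)) = leibE n z.
  move=> Mz; rewrite (comp_glue R_graded) (ordr_fix R_graded); last exact: leibE_ordr.
  apply/eqP; rewrite -subr_eq0 addrC -scaleN1r -leibE_lin; apply/eqP/leibE_prel.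
  rewrite (_ : (fun i => _) = fun i => 1 * (rep (clsR z) i - z i) + 0).
    by apply: prel_lin; [exact: rep_cls|exact: cspan0].
  by apply: funext => i; ring.
exists E; split=> [|u v].
  apply: (raises_clinear (r := 0) R_graded) => [a u v|i u [z [Mz -> Hz]]].
    have [x Mx ->] := clsW u; have [y My ->] := clsW v; rewrite -cls_lin //.
    apply: (comp_inj R_graded) => n; rewrite (wE n _ (pmem_lin a Mx My)) leibE_lin.
    by rewrite (comp_lin R_graded n a (E (clsR x)) (E (clsR y))) !wE.
  apply/(ordgeP R_graded) => k; rewrite addn0 => ki; rewrite wE //.
  rewrite (leibE_eqw (y := fun=> 0)); last by move=> j wj; apply: Hz; exact: leq_ltn_trans ki.
  exact: leibE_prel (cspan0 _ _).
have [x Mx ->] := clsW u; have [y My ->] := clsW v.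
apply: (comp_inj R_graded) => n; rewrite (tR_cls Mx My) (wE n _ (pmem_tR Mx My)).
exact: leibE_tens.
Qed.

End Leibniz.
End DRTheory.

(** * Exponentials and vector fields *)

Section Triangle.
Variable V : nmodType.

Lemma triangle_sum (a : nat -> nat -> V) N : (forall i j, (N <= i + j)%N -> a i j = 0) ->
  \sum_(i < N) \sum_(j < N) a i j = \sum_(k < N) \sum_(i < k.+1) a i (k - i)%N.
Proof.
move=> H.
transitivity (\sum_(k < N) \sum_(i < N | (i <= k)%N) a i (k - i)%N); last first.
  apply: eq_bigr => k _; rewrite (big_ord_widen N (fun i => a i (k - i)%N)) //.
rewrite [RHS](exchange_big_dep xpredT) //=; apply: eq_bigr => i _.
rewrite -(big_mkord xpredT (a i)) (big_cat_nat (n := N - i)) ?leq_subr //=.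
rewrite [X in _ + X]big1_seq ?addr0 => [|j]; last first.
  by rewrite /= mem_index_iota => /andP[h _]; apply: H; rewrite -leq_subLR.
rewrite [RHS]big_mkcond -(big_mkord xpredT (fun k => if (i <= k)%N then a i (k - i)%N else 0)).
rewrite [RHS](big_cat_nat (n := i)) ?(ltnW (ltn_ord i)) //=.
rewrite [X in _ = X + _]big1_seq ?add0r => [|j]; last first.
  by rewrite mem_index_iota /= => h; rewrite leqNgt h.
rewrite -{3}[nat_of_ord i]add0n big_addn; apply: eq_bigr => j _.
by rewrite leq_addl addnK.
Qed.

Lemma pascal_sum (b : nat -> nat -> V) k :
  \sum_(i < k.+2) b i (k.+1 - i)%N *+ 'C(k.+1, i) =
  \sum_(i < k.+1) (b i.+1 (k - i)%N + b i (k - i).+1) *+ 'C(k, i).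
Proof.
rewrite big_ord_recl /= bin0 mulr1n subn0.
under eq_bigr do rewrite /bump /= add1n subSS binS mulrnDr.
rewrite big_split /= addrA.
under [RHS]eq_bigr do rewrite mulrnDl.
rewrite [RHS]big_split /= addrC; congr (_ + _).
rewrite big_ord_recr /= bin_small // mulr0n addr0.
rewrite [RHS]big_ord_recl /= bin0 mulr1n subn0; congr (_ + _).
apply: eq_bigr => i _; rewrite /bump /= add1n; congr (b _ _ *+ _).
by rewrite subnSK.
Qed.
End Triangle.

(** The sign computation behind the fact that a graded commutator of derivations is a derivation.
    For derivations of degrees k, l and a first argument of degree j, the scalars p, q, r are the
    signs of kj, lj, kl; the mixed terms b and c cancel. *)
Lemma super_commutator (K : comNzRingType) (U : lmodType K) (p q r : K) (a b c d a' d' : U) :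
  r * r = 1 ->
  a + (p * r) *: b + q *: (c + p *: d) - r *: (a' + (q * r) *: c + p *: (b + q *: d')) =
  a - r *: a' + (p * q) *: (d - r *: d').
Proof.
move=> rr; rewrite !scalerDr !scalerA scalerN !scalerA !opprD.
rewrite (_ : r * (q * r) = q); last by rewrite mulrCA rr mulr1.
rewrite (_ : r * p = p * r); last by rewrite mulrC.
rewrite (_ : p * r * q = p * q * r); last by rewrite -!mulrA [r * q]mulrC.
rewrite (_ : q * p = p * q); last by rewrite mulrC.
rewrite !addrA (ACl ((1*5)*(4*8)*(2*7)*(3*6)))%AC /= !subrr !addr0 !addrA.
by [].
Qed.

Section Exponential.
Variable K : evenRing.

Lemma kinv_bin k i : (i <= k)%N ->
  kinv K k`! * ('C(k, i))%:R = kinv K i`! * kinv K (k - i)`!.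
Proof.
move=> ik; have e : (k`!)%:R = ('C(k, i))%:R * ((i`!)%:R * ((k - i)`!)%:R) :> K.
  by rewrite -!natrM bin_fact.
transitivity (kinv K k`! * ('C(k, i)%:R * ((i`!)%:R * ((k - i)`!)%:R)) *
    (kinv K i`! * kinv K (k - i)`!)); last by rewrite -e kinvK ?mul1r // fact_gt0.
rewrite (_ : _ * _ * (_ * _) = kinv K k`! * 'C(k, i)%:R *
    ((kinv K i`! * (i`!)%:R) * (kinv K (k - i)`! * ((k - i)`!)%:R))); last by ring.
by rewrite !kinvK ?fact_gt0 // !mulr1.
Qed.

Section Def.
Variables (M : pmod K) (f : pcar M -> pcar M).
Hypotheses (gM : graded M) (fl : linear f) (f1 : raises 1 f).
Implicit Types u v : pcar M.

(** When [f] raises weights, only powers up to n reach weight n, so the exponential series is a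
    finite sum in each weight. *)
Definition expo u : pcar M :=
  wglue (fun n => \sum_(k < n.+1) kinv K k`! *: iter k f u).
Definition expS N u : pcar M := \sum_(k < N) kinv K k`! *: iter k f u.

Lemma iter_lin k : linear (iter k f).
Proof. by elim: k => [|k IH] a u v //=; rewrite IH fl. Qed.

Lemma iter_raises k : raises k (iter k f).
Proof.
elim: k => [|k IH] i u Hu /=; first by rewrite addn0.
by have := f1 (IH _ _ Hu); rewrite addn1 addnS.
Qed.

Lemma wpart_expo n N u : (n < N)%N -> wpart n (expo u) = wpart n (expS N u).
Proof.
move=> nN; rewrite (comp_glue gM) /expS -(big_mkord xpredT (fun k => kinv K k`! *: iter k f u)).
rewrite -(big_mkord xpredT (fun k => kinv K k`! *: iter k f u)) [in RHS](big_cat_nat (n := n.+1)) //=.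
rewrite (linD (comp_lin gM n)) (lin_sum (comp_lin gM n) (index_iota n.+1 N)).
rewrite [X in _ + X]big1_seq ?addr0 // => k; rewrite /= mem_index_iota => /andP[nk _].
rewrite (linZ (comp_lin gM n)) (ordge_comp0 gM (iter_raises k (ordge0 gM u))) ?scaler0 //.
Qed.

Lemma expS_lin N : linear (expS N).
Proof.
move=> a u v; rewrite /expS scaler_sumr -big_split; apply: eq_bigr => k _ /=.
by rewrite iter_lin scalerDr !scalerA mulrC.
Qed.

Lemma expo_lin : linear expo.
Proof.
move=> a u v; apply: (comp_inj gM) => n.
rewrite (comp_lin gM n a (expo u) (expo v)) !(wpart_expo _ (ltnSn n)) expS_lin.
exact: (comp_lin gM).
Qed.

Lemma expo_raises1 : raises 1 (fun u => expo u - u).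
Proof.
move=> i u Hu; apply/(ordgeP gM) => n ni.
rewrite (linB (comp_lin gM n)) (wpart_expo _ (ltnSn n)) /expS.
rewrite big_ord_recl /= /kinv invr1 !scale1r (linD (comp_lin gM n)) addrC addKr.
rewrite (lin_sum (comp_lin gM n)) big1 // => k _; rewrite (linZ (comp_lin gM n)).
have := f1 (iter_raises k Hu) => h; rewrite (ordge_comp0 gM h) ?scaler0 //.
by apply: leq_trans ni _; rewrite addn1 addn1 ltnS leq_addr.
Qed.

Lemma expo_raises0 : raises 0 expo.
Proof.
move=> i u Hu; rewrite -[expo u](subrK u) addn0; apply: ordgeD => //.
apply: (ordge_le gM (n := i + 1)); first by rewrite leq_addr.
exact: expo_raises1.
Qed.

Lemma expo_clin : clinear expo.
Proof. exact: (raises_clinear gM expo_lin expo_raises0). Qed.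

Lemma expo_fix u : f u = 0 -> expo u = u.
Proof.
move=> fu; apply: (comp_inj gM) => n; rewrite (wpart_expo _ (ltnSn n)) /expS.
rewrite big_ord_recl /= big1 ?addr0 => [|k _]; first by rewrite /kinv invr1 !scale1r.
suff -> : f (iter k f u) = 0 by rewrite scaler0.
by elim: (nat_of_ord k) => //= m ->; rewrite (lin0 fl).
Qed.

Lemma expo_supp (R : sym M -> K -> Prop) u : (forall i, R i 0) ->
  (forall i a b, R i a -> R i b -> R i (a - b)) ->
  (forall i c a, gpart 0 c -> R i a -> R i (c * a)) ->
  (forall v, supp R v -> supp R (f v)) -> supp R u -> supp R (expo u).
Proof.
move=> R0 RB RZ Rf Ru; apply: (supp_glue gM) => // n; rewrite (wpart_expo _ (ltnSn n)).
apply: (supp_sub (R := fun i a => R i a /\ (wt i != n -> a = 0))) => [i a []//|].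
apply: (supp_comp gM) => //; apply: supp_sum => // k _; apply: (suppZ (R := R)) => [i a Ha|].
  by apply: RZ => //; rewrite -[kinv _ _]mulr1; apply: gpart_kinv; [exact: fact_gt0|exact: gpart1].
by elim: (nat_of_ord k) => //= m; exact: Rf.
Qed.

End Def.

Lemma expo_inter (M N : pmod K) (f : pcar M -> pcar M) (h : pcar N -> pcar N)
    (T : pcar M -> pcar N) u :
  graded M -> graded N -> linear f -> linear h -> raises 1 f -> raises 1 h -> linear T ->
  (forall n v, wpart n (T v) = T (wpart n v)) -> (forall v, T (f v) = h (T v)) ->
  T (expo f u) = expo h (T u).
Proof.
move=> gM gN fl hl f1 h1 Tl Tw Tf; apply: (comp_inj gN) => n.
rewrite Tw !(wpart_expo _ _ _ (ltnSn n)) // -Tw; congr (wpart n _).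
rewrite /expS (lin_sum Tl); apply: eq_bigr => k _; rewrite (linZ Tl); congr (_ *: _).
by elim: (nat_of_ord k) => //= m <-.
Qed.

(** The exponential of a derivation is multiplicative. In weight n all series are finite; powers of
    [e] are expanded by the binomial formula, and the square of products of powers reduces to its
    triangle because the other terms have too high a weight. *)
Lemma expo_bil (M N P : pmod K) (B : pcar M -> pcar N -> pcar P)
    (f : pcar M -> pcar M) (h : pcar N -> pcar N) (e : pcar P -> pcar P) u v :
  graded M -> graded N -> graded P -> linear f -> linear h -> linear e ->
  raises 1 f -> raises 1 h -> raises 1 e ->
  (forall v, linear (fun u => B u v)) -> (forall u, linear (B u)) ->
  (forall i j u v, ordge i u -> ordge j v -> ordge (i + j)%N (B u v)) ->
  (forall u v, e (B u v) = B (f u) v + B u (h v)) ->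
  expo e (B u v) = B (expo f u) (expo h v).
Proof.
move=> gM gN gP fl hl el f1 h1 e1 Bl Br Bo Be; apply: (comp_inj gP) => n.
rewrite (wpart_expo gP e1 _ (ltnSn n)).
have B0 (u' u1 : pcar M) v' : ordge n.+1 (u' - u1) -> wpart n (B u' v') = wpart n (B u1 v').
  move=> Hu; rewrite -[u' in LHS](subrK u1) (linD (Bl v') (u' - u1)) (linD (comp_lin gP n)).
  by rewrite (ordge_comp0 gP (Bo _ _ _ _ Hu (ordge0 gN v'))) ?add0r // addn0.
have B1 (v' v1 : pcar N) u' : ordge n.+1 (v' - v1) -> wpart n (B u' v') = wpart n (B u' v1).
  move=> Hv; rewrite -[v' in LHS](subrK v1) (linD (Br u') (v' - v1)) (linD (comp_lin gP n)).
  by rewrite (ordge_comp0 gP (Bo _ _ _ _ (ordge0 gM u') Hv)) ?add0r // add0n.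
have ES (Q : pmod K) (k : pcar Q -> pcar Q) w : graded Q -> raises 1 k ->
    ordge n.+1 (expo k w - expS k n.+1 w).
  move=> gQ k1; apply/(ordgeP gQ) => m mn.
  by rewrite (linB (comp_lin gQ m)) (wpart_expo gQ k1 _ mn) subrr.
rewrite (B0 _ _ _ (ES _ f u gM f1)) (B1 _ _ _ (ES _ h v gN h1)).
have Ek k : iter k e (B u v) = \sum_(i < k.+1) B (iter i f u) (iter (k - i) h v) *+ 'C(k, i).
  elim: k => [|k IH]; first by rewrite big_ord_recl big_ord0 /= addr0.
  rewrite (pascal_sum (fun i j => B (iter i f u) (iter j h v))) /= IH (lin_sum el).
  apply: eq_bigr => i _; rewrite -!scaler_nat (linZ el) Be //.
rewrite /expS.
have -> : \sum_(k < n.+1) kinv K k`! *: iter k e (B u v) =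
   \sum_(k < n.+1) \sum_(i < k.+1)
      (kinv K i`! * kinv K (k - i)`!) *: B (iter i f u) (iter (k - i) h v).
  apply: eq_bigr => k _; rewrite Ek scaler_sumr; apply: eq_bigr => i _.
  by rewrite -scaler_nat scalerA kinv_bin // -ltnS.
rewrite (lin_sum (Bl _)).
under [X in _ = wpart n X]eq_bigr => i _.
  rewrite (linZ (Bl _)) (lin_sum (Br _)) scaler_sumr.
  under eq_bigr do rewrite (linZ (Br _)) scalerA.
  over.
pose a i j := wpart n ((kinv K i`! * kinv K j`!) *: B (iter i f u) (iter j h v)).
have := triangle_sum (a := a) (N := n.+1).
rewrite /a !(lin_sum (comp_lin gP n)) => T.
transitivity (\sum_(k < n.+1) \sum_(i < k.+1) a i (k - i)%N).
  by apply: eq_bigr => k _; rewrite (lin_sum (comp_lin gP n)).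
rewrite -T => [|i j ij]; first by apply: eq_bigr => i _; rewrite (lin_sum (comp_lin gP n)).
rewrite (linZ (comp_lin gP n)).
have H1 := iter_raises f1 i (ordge0 gM u); have H2 := iter_raises h1 j (ordge0 gN v).
by rewrite (ordge_comp0 gP (Bo _ _ _ _ H1 H2)) ?scaler0.
Qed.

(** On the diagonal i + j = k the coefficients add up to (1 - 1)^k / k!, so only k = 0 remains. *)
Lemma expo_inv (M : pmod K) (f : pcar M -> pcar M) u : graded M -> linear f -> raises 1 f ->
  expo (fun v => - f v) (expo f u) = u.
Proof.
move=> gM fl f1.
have hl : linear (fun v => - f v) by move=> a v w; rewrite fl opprD scalerN.
have h1 : raises 1 (fun v => - f v).
  by move=> i v /f1 H; rewrite -scaleN1r; exact: ordgeZ.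
apply: (comp_inj gM) => n; rewrite (wpart_expo gM h1 _ (ltnSn n)).
have ES : ordge n.+1 (expo f u - expS f n.+1 u).
  apply/(ordgeP gM) => m mn.
  by rewrite (linB (comp_lin gM m)) (wpart_expo gM f1 _ mn) subrr.
have -> : wpart n (expS (fun v => - f v) n.+1 (expo f u)) =
          wpart n (expS (fun v => - f v) n.+1 (expS f n.+1 u)).
  apply/eqP; rewrite -subr_eq0 -(linB (comp_lin gM n)) -(linB (expS_lin hl n.+1)).
  rewrite /expS (lin_sum (comp_lin gM n)) big1 // => k _; rewrite (linZ (comp_lin gM n)).
  rewrite (ordge_comp0 gM (iter_raises h1 k ES)) ?scaler0 //; exact: leq_trans (leq_addr _ _).
have itN j w : iter j (fun v => - f v) w = (-1) ^+ j *: iter j f w.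
  elim: j => [|j IH] /=; first by rewrite scale1r.
  by rewrite IH (linZ fl) exprS mulN1r scaleNr.
pose a i j := wpart n (((-1) ^+ i * (kinv K i`! * kinv K j`!)) *: iter (i + j) f u).
transitivity (\sum_(i < n.+1) \sum_(j < n.+1) a i j).
  rewrite /expS (lin_sum (comp_lin gM n)); apply: eq_bigr => i _.
  rewrite (lin_sum (iter_lin hl i)) scaler_sumr (lin_sum (comp_lin gM n)).
  apply: eq_bigr => j _; rewrite (linZ (iter_lin hl i)) itN -iterD !scalerA /a.
  by congr (wpart n (_ *: _)); ring.
rewrite triangle_sum => [|i j ij]; last first.
  rewrite /a (linZ (comp_lin gM n)).
  by rewrite (ordge_comp0 gM (iter_raises f1 (i + j) (ordge0 gM u))) ?scaler0.
rewrite big_ord_recl [X in _ + X]big1 ?addr0 => [|k _].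
  rewrite big_ord_recl big_ord0 addr0 /a /= /kinv invr1 !scale1r !mulr1 expr0 scale1r //.
rewrite /= /bump /= add1n; set k' := k.+1.
transitivity (wpart n ((kinv K k'`! * (1 - 1) ^+ k') *: iter k' f u)); last first.
  by rewrite subrr expr0n /= mulr0 scale0r (lin0 (comp_lin gM n)).
rewrite exprDn mulr_sumr scaler_suml (lin_sum (comp_lin gM n)); apply: eq_bigr => i _.
have ik : (i <= k')%N by rewrite -ltnS.
rewrite /a subnKC //; congr (wpart n (_ *: _)).
by rewrite expr1n mul1r -[_ *+ 'C(_, _)]mulr_natl -(kinv_bin ik); ring.
Qed.

Lemma fexp_expo (V : fgmod) (f : pcar (lalg (susp_dual K V)) -> pcar (lalg (susp_dual K V))) x :
  linear f -> raises 1 f -> @fexp K (susp_dual K V) f x = expo f x.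
Proof.
move=> fl f1; have gM := @lW_graded K V.
have C : converges (fun N => \sum_(0 <= k < N) ((k`!)%:R^-1 : rat)%:A *: iter k f x) (expo f x).
  apply/(convergesP gM) => n; exists n.+1 => N nN.
  by rewrite (wpart_expo gM f1 _ nN) /expS big_mkord.
rewrite /fexp; case: xgetP => [y _ Hy|H]; first exact: (converges_unique gM Hy C).
by have := H (expo f x).
Qed.

End Exponential.

(** * Vector fields on the free Lie algebra *)

Section Fields.
Variables (K : evenRing) (V : fgmod).
Notation W := (susp_dual K V).
Notation lW := (lalg W).
Notation g := (pcar lW).
Notation brkg := (@brk K W).
Notation gg := (@lW_graded K V).
Implicit Types (xi eta : g -> g) (x y : g).

Lemma wpart0_g x : wpart 0 x = 0.
Proof.
have [z Mz ->] := clsW x; have F := @FlW_frame K V; rewrite -mg_lW in F.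
by rewrite (comp_frame 0 gg F) // big_nil.
Qed.

Lemma brk_clinl y : clinear (fun x => brkg x y).
Proof.
apply: (raises_clinear (r := 0) gg); first exact: brk_l.
move=> i u Hu; apply: brk_ordge => //; exact: (ordge0 gg).
Qed.

Lemma brk_clinr x : clinear (brkg x).
Proof.
apply: (raises_clinear (r := 0) gg); first exact: brk_r.
move=> i v Hv; rewrite addn0 -[i]add0n; apply: brk_ordge => //; exact: (ordge0 gg).
Qed.

Lemma homog_wpart j n x : homog j x -> homog j (wpart n x).
Proof.
move=> H; apply: supp_sub (supp_comp gg n _ H) => [i a []//|i]; exact: gpart0.
Qed.

Lemma homogB (M : pmod K) j (u v : pcar M) : homog j u -> homog j v -> homog j (u - v).
Proof. by apply: suppB => i a b; exact: gpartB. Qed.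

Lemma homogD (M : pmod K) j (u v : pcar M) : homog j u -> homog j v -> homog j (u + v).
Proof. by apply: suppD => [i|i a b]; [exact: gpart0|exact: gpartB]. Qed.

Lemma homog0 (M : pmod K) j : homog j (0 : pcar M).
Proof. by apply: supp0 => i; exact: gpart0. Qed.

Lemma homogZ (M : pmod K) j c (u : pcar M) : gpart 0 c -> homog j u -> homog j (c *: u).
Proof. by move=> gc; apply: suppZ => i a; exact: gpart0M. Qed.

Lemma homog_glue j x : (forall n, homog j (wpart n x)) -> homog j x.
Proof. by move=> H; apply: (supp_glue gg) => // i; exact: gpart0. Qed.

(** The Lie algebra starts in weight one, so the value at a letter cannot have smaller weight than
    the letter; the derivation rule extends this to the Lie monomials of the frame. *)
Lemma vfield_raises k xi : vfield k xi -> raises 0 xi.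
Proof.
move=> [xc _ xd]; have [xl _] := xc; apply: (raisesP gg gg) => // i u Hu; rewrite addn0.
have F := @FlW_frame K V; have [F1 F2 _] := F; rewrite -mg_lW in F.
rewrite -(ordr_fix gg Hu); have [z Mz ->] := clsW u.
rewrite (comp_frame i gg F) // (lin_sum xl); apply: ordge_sum => p Hp.
rewrite (linZ xl); apply: ordgeZ.
have [W1 W2 _] := @FW_frame K V.
suff [k' [q' [-> [Mq _ Hq]]]] : exists k q', p = (q'.1, fun t => kinv K k.+1 * q'.2 t) /\
    [/\ @pmem K lW q'.2, ordge i (@cls K lW q'.2) & ordge i (xi (@cls K lW q'.2))].
  by rewrite clsZ // (linZ xl); apply: ordgeZ.
move: Hp; apply: (FL_ind (F := FW K V) (Q := fun i q' =>
  [/\ @pmem K lW q'.2, ordge i (@cls K lW q'.2) & ordge i (xi (@cls K lW q'.2))])).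
  move=> n q Hq; rewrite /FW in Hq; case: eqP Hq => [->|_] Hq; last by have := inseq_nil Hq.
  split; first by apply: lalg_letter; exact: pmem_W.
    by apply/(ordgeP gg) => -[|//] _; exact: wpart0_g.
  by apply/(ordgeP gg) => -[|//] _; exact: wpart0_g.
move=> a n q r Hq [Mr Hr1 Hr2].
have Ml : @pmem K lW (letter0 q.2) by apply: lalg_letter; exact: pmem_W.
have [ep sp ip] := W1 _ _ Hq.
have a1 : a = 1%N by rewrite /FW in Hq; case: eqP Hq => // _ Hq; have := inseq_nil Hq.
have O1 x : ordge a x by rewrite a1; apply/(ordgeP gg) => -[|//] _; exact: wpart0_g.
split; first exact: lalg_brk.
  by rewrite -brk_cls //; exact: brk_ordge.
rewrite -brk_cls // (xd (dg q.1)); last first.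
  exists (letter0 q.2); split=> // -[|j [|j' s]] /=; try exact: gpart0.
  rewrite /wdg big_seq1.
  have [e|ne] := eqVneq (@mg K W (fun=> 0%N) j) (mg (fun=> 0%N) q.1); last by rewrite sp //; exact: gpart0.
  by have -> : dg j = dg q.1 by [case: e]; rewrite subrr; exact: ip.
by apply: ordgeD; [|apply: ordgeZ]; apply: brk_ordge.
Qed.

Lemma vfield0 k : vfield k (fun=> 0 : g).
Proof.
split=> [|j x _|j x y _]; [exact: clin0|exact: homog0|].
by rewrite (lin0 (@brk_l K V y)) (lin0 (@brk_r K V x)) scaler0 addr0.
Qed.

Lemma vfieldZD k c xi eta : gpart 0 c -> vfield k xi -> vfield k eta ->
  vfield k (fun x => c *: xi x + eta x).
Proof.
move=> gc [xc xh xd] [ec eh ed]; split=> [|j x Hx|j x y Hx].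
- exact: clin_lin.
- by apply: homogD; [apply: homogZ => //; exact: xh|exact: eh].
rewrite (xd j) // (ed j) // (linD (brk_l y)) (linD (@brk_r K V x)).
rewrite (linZ (brk_l y)) (linZ (@brk_r K V x)) !scalerDr !scalerA mulrC addrACA.
by [].
Qed.

Lemma vfieldD k xi eta : vfield k xi -> vfield k eta -> vfield k (fun x => xi x + eta x).
Proof.
move=> Hx He; have := vfieldZD (gpart1 K) Hx He; congr vfield; apply: funext => x.
by rewrite scale1r.
Qed.

Lemma vfieldB k xi eta : vfield k xi -> vfield k eta -> vfield k (fun x => xi x - eta x).
Proof.
move=> Hx He; have := vfieldZD (gpartN (gpart1 K)) He Hx; congr vfield; apply: funext => x.
by rewrite scaleN1r addrC.
Qed.

Lemma vfield_ebrk k l xi eta : vfield k xi -> vfield l eta -> vfield (k + l) (ebrk k l xi eta).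
Proof.
move=> [xc xh xd] [ec eh ed]; split=> [|j x Hx|j x y Hx].
- apply: clinB; first exact: clin_comp.
  by apply: clinZ; exact: clin_comp.
- apply: homogB.
    by rewrite [k + l]addrC addrA; apply: xh; exact: eh.
  by apply: homogZ; [exact: gpart_ksgn|rewrite addrA; apply: eh; exact: xh].
have [xl _] := xc; have [el _] := ec.
have hx : homog (k + j) (xi x) by rewrite addrC; exact: xh.
have hy : homog (l + j) (eta x) by rewrite addrC; exact: eh.
rewrite /ebrk (ed j x y Hx) (xd j x y Hx) (linD xl) (linD el) (linZ xl) (linZ el).
rewrite (xd _ _ y hy) (xd _ _ _ Hx) (ed _ _ y hx) (ed _ _ _ Hx).
rewrite (linB (brk_l y)) (linB (@brk_r K V x)) (linZ (brk_l y)) (linZ (@brk_r K V x)).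
rewrite [(k + l) * j]mulrDl !mulrDr !ksgnD [l * k]mulrC.
rewrite [ksgn K (k * l) * ksgn K (k * j)]mulrC [ksgn K (k * l) * ksgn K (l * j)]mulrC.
exact: super_commutator (ksgn_sq _ _).
Qed.

End Fields.

Section WeightOperator.
Variables (K : evenRing) (M : pmod K).
Hypothesis gM : graded M.
Implicit Types u v : pcar M.

Definition wscale : (nat -> K) -> pcar M -> pcar M :=
  sval (seal (fun (c : nat -> K) (u : pcar M) => wglue (fun n => c n *: wpart n u))).

Lemma wscaleE c u : wscale c u = wglue (fun n => c n *: wpart n u).
Proof. by rewrite /wscale sealE. Qed.

Lemma wpart_wscale c n u : wpart n (wscale c u) = c n *: wpart n u.
Proof. by rewrite wscaleE (comp_glue gM) (linZ (comp_lin gM n)) (comp_comp gM) eqxx. Qed.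

Lemma wscale_lin c : linear (wscale c).
Proof.
move=> a u v; apply: (comp_inj gM) => n.
rewrite (comp_lin gM n a (wscale c u) (wscale c v)) !wpart_wscale (comp_lin gM n a u v).
by rewrite scalerDr !scalerA mulrC.
Qed.

Lemma wscale_raises c : raises 0 (wscale c).
Proof.
move=> i u Hu; rewrite addn0; apply/(ordgeP gM) => k ki.
by rewrite wpart_wscale (ordge_comp0 gM Hu) ?scaler0.
Qed.

Lemma wscale_clin c : clinear (wscale c).
Proof. exact: (raises_clinear gM (wscale_lin c) (@wscale_raises c)). Qed.

Lemma wscale_ordr c n u : ordr n u -> wscale c u = c n *: u.
Proof.
move=> Hu; apply: (comp_inj gM) => k; rewrite wpart_wscale (linZ (comp_lin gM k)).
by have [->//|kn] := eqVneq k n; rewrite (ordr_comp0 gM Hu kn) !scaler0.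
Qed.

Lemma wscale_supp (R : sym M -> K -> Prop) c u : (forall i, R i 0) ->
  (forall n i a, R i a -> R i (c n * a)) -> supp R u -> supp R (wscale c u).
Proof.
move=> R0 RZ Ru; apply: (supp_glue gM) => // n; rewrite wpart_wscale.
apply: (suppZ (R := R)) => [i a|]; first exact: RZ.
by apply: supp_sub (supp_comp gM n R0 Ru) => i a [].
Qed.
End WeightOperator.

Section FieldComponents.
Variables (K : evenRing) (V : fgmod).
Notation W := (susp_dual K V).
Notation lW := (lalg W).
Notation g := (pcar lW).
Notation brkg := (@brk K W).
Notation gg := (@lW_graded K V).
Implicit Types (xi eta : g -> g) (x y : g).

Definition euler : g -> g := wscale (fun n => n%:R).

Lemma brk_ext (f h : g -> g -> g) x y :
  (forall y, clinear (fun x => f x y)) -> (forall y, clinear (fun x => h x y)) ->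
  (forall x, clinear (f x)) -> (forall x, clinear (h x)) ->
  (forall a b, f (wpart a x) (wpart b y) = h (wpart a x) (wpart b y)) -> f x y = h x y.
Proof.
move=> fl hl fr hr H; apply: (clin_ext_at gg gg (fl y) (hl y)) => a.
exact: (clin_ext_at gg gg (fr _) (hr _)).
Qed.

Lemma vfield_euler : vfield 0 euler.
Proof.
have ec : clinear euler by exact: wscale_clin gg _.
split=> // [j x Hx|j x y _].
  rewrite addr0; apply: (wscale_supp gg) Hx => [i|n i a]; first exact: gpart0.
  by apply: gpart0M; exact: gpart_nat.
rewrite mul0r ksgn0 scale1r.
apply: (brk_ext (f := fun x y => euler (brkg x y))
    (h := fun x y => brkg (euler x) y + brkg x (euler y))) => [y1|y1|x1|x1|a b].
- exact: clin_comp ec (brk_clinl _).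
- by apply: clinD; [exact: clin_comp (brk_clinl _) ec|exact: brk_clinl].
- exact: clin_comp ec (brk_clinr _).
- by apply: clinD; [exact: brk_clinr|exact: clin_comp (brk_clinr _) ec].
have Ha := ordr_comp gg a x; have Hb := ordr_comp gg b y.
rewrite /euler (wscale_ordr gg _ Ha) (wscale_ordr gg _ Hb) (wscale_ordr gg _ (brk_ordr Ha Hb)).
by rewrite (linZ (brk_l _)) (linZ (@brk_r K V _)) -scalerDl natrD.
Qed.

Lemma scomp_ordr r (f : g -> g) a x : linear f -> ordr a x ->
  scomp r f x = wpart (a + r)%N (f x).
Proof.
move=> fl Hx; have Hs := scomp_shifts gg gg r fl Hx.
by rewrite -(ordr_fix gg Hs) (comp_scomp gg) leq_addl addnK (ordr_fix gg Hx).
Qed.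

Lemma wpart_brkl a b x y : ordr b y -> wpart (a + b)%N (brkg x y) = brkg (wpart a x) y.
Proof.
move=> Hy; have s : shifts b (fun u => brkg u y) by move=> i u Hu; exact: brk_ordr.
by rewrite (shifts_comp gg gg (brk_clinl y) s) leq_addl addnK.
Qed.

Lemma wpart_brkr a b x y : ordr a x -> wpart (a + b)%N (brkg x y) = brkg x (wpart b y).
Proof.
move=> Hx; have s : shifts a (brkg x) by move=> i u Hu; rewrite addnC; exact: brk_ordr.
by rewrite (shifts_comp gg gg (brk_clinr x) s) leq_addr addKn.
Qed.

(** On arguments of weights a and b, the part of weight a + b + r of the Leibniz rule for [xi] is
    the Leibniz rule for its component. *)
Lemma vfield_scomp k r xi : vfield k xi -> vfield k (scomp r xi).
Proof.
move=> [xc xh xd]; have [xl _] := xc; have sc := scomp_clin gg gg r xl.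
split; [exact: sc|move=> j x Hx|move=> j x y Hx].
  apply: homog_glue => n; rewrite (comp_scomp gg); case: ifP => _; last exact: homog0.
  by apply: homog_wpart; apply: xh; exact: homog_wpart.
apply: (brk_ext (f := fun x y => scomp r xi (brkg x y))
    (h := fun x y => brkg (scomp r xi x) y + ksgn K (k * j) *: brkg x (scomp r xi y)))
    => [y1|y1|x1|x1|a b].
- exact: clin_comp sc (brk_clinl _).
- by apply: clinD; [exact: clin_comp (brk_clinl _) sc|apply: clinZ; exact: brk_clinl].
- exact: clin_comp sc (brk_clinr _).
- by apply: clinD; [exact: brk_clinr|apply: clinZ; exact: clin_comp (brk_clinr _) sc].
have Ha := ordr_comp gg a x; have Hb := ordr_comp gg b y.
have Hj := homog_wpart a Hx.
move: (wpart a x) (wpart b y) Ha Hb Hj => {Hx}x1 {}y Ha Hb Hj.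
rewrite (scomp_ordr _ xl (brk_ordr Ha Hb)) (scomp_ordr _ xl Ha) (scomp_ordr _ xl Hb).
rewrite (xd _ _ _ Hj) (linD (comp_lin gg _)) (linZ (comp_lin gg _)).
have -> : wpart (a + b + r)%N (brkg (xi x1) y) = brkg (wpart (a + r)%N (xi x1)) y.
  by rewrite addnAC (wpart_brkl _ _ Hb).
have -> : wpart (a + b + r)%N (brkg x1 (xi y)) = brkg x1 (wpart (b + r)%N (xi y)).
  by rewrite -addnA (wpart_brkr _ _ Ha).
by [].
Qed.
End FieldComponents.

(** * Derivations of the de Rham algebra and the operators they induce on forms *)

Section Derivations.
Variables (K : evenRing) (V : fgmod).
Notation W := (susp_dual K V).
Notation lW := (lalg W).
Notation O := (Om W).
Notation R := (DR W).
Notation g := (pcar lW).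
Notation brkO := (@brkOm K W).
Notation inO := (@inOm K W).
Notation dO := (@dOm K W).
Notation tR := (@tensDR K W).
Notation gO := (@O_graded K V).
Notation gR := (@R_graded K V).
Notation derO := (@derOm K W).
Implicit Types (D : pcar O -> pcar O) (E : pcar R -> pcar R) (y : g).

Lemma tw_ext (F A B : pcar O -> pcar O) (c : int -> K) :
  clinear A -> clinear B ->
  (forall j z z', homog j z -> A (brkO z z') = brkO (A z) (F z') + c j *: brkO (F z) (A z')) ->
  (forall j z z', homog j z -> B (brkO z z') = brkO (B z) (F z') + c j *: brkO (F z) (B z')) ->
  (forall y, A (inO y) = B (inO y)) -> (forall y, A (dO y) = B (dO y)) ->
  forall u, A u = B u.
Proof.
move=> Ac Bc HA HB Hi Hd; apply: (O_ext gO Ac Bc) => d n p u; elim=> //.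
move=> d1 n1 p1 u1 d2 n2 p2 u2 H1 IH1 _ IH2.
by rewrite (HA d1) ?(HB d1) ?IH1 ?IH2 //; exact: omon_homog H1.
Qed.

Lemma der_ext k D D' : derO k D -> derO k D' -> (forall y, D (inO y) = D' (inO y)) ->
  (forall y, D (dO y) = D' (dO y)) -> forall u, D u = D' u.
Proof.
by move=> [Dc _ Db] [Dc' _ Db']; apply: (tw_ext (F := id)) Dc Dc' Db Db'.
Qed.

Definition sbr (k l : int) (U : lmodType K) (D D' : U -> U) : U -> U :=
  fun z => D (D' z) - ksgn K (k * l) *: D' (D z).

Lemma der_sbr k l D D' : derO k D -> derO l D' -> derO (k + l) (sbr k l D D').
Proof.
move=> [xc xh xd] [ec eh ed]; split=> [|j x Hx|j x y Hx].
- apply: clinB; first exact: clin_comp.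
  by apply: clinZ; exact: clin_comp.
- apply: homogB.
    by rewrite [k + l]addrC addrA; apply: xh; exact: eh.
  by apply: homogZ; [exact: gpart_ksgn|rewrite addrA; apply: eh; exact: xh].
have [xl _] := xc; have [el _] := ec.
have hx : homog (k + j) (D x) by rewrite addrC; exact: xh.
have hy : homog (l + j) (D' x) by rewrite addrC; exact: eh.
rewrite /sbr (ed j x y Hx) (xd j x y Hx) (linD xl) (linD el) (linZ xl) (linZ el).
rewrite (xd _ _ y hy) (xd _ _ _ Hx) (ed _ _ y hx) (ed _ _ _ Hx).
rewrite (linB (brkOm_l y)) (linB (@brkOm_r K V x)) (linZ (brkOm_l y)) (linZ (@brkOm_r K V x)).
rewrite [(k + l) * j]mulrDl !mulrDr !ksgnD [l * k]mulrC.
rewrite [ksgn K (k * l) * ksgn K (k * j)]mulrC [ksgn K (k * l) * ksgn K (l * j)]mulrC.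
exact: super_commutator (ksgn_sq _ _).
Qed.

Lemma der0 k : derO k (fun=> 0).
Proof.
split=> [|j x _|j x y _]; [exact: clin0|exact: homog0|].
by rewrite (lin0 (@brkOm_l K V y)) (lin0 (@brkOm_r K V x)) scaler0 addr0.
Qed.

Lemma derZD k c D D' : gpart 0 c -> derO k D -> derO k D' -> derO k (fun z => c *: D z + D' z).
Proof.
move=> gc [xc xh xd] [ec eh ed]; split=> [|j x Hx|j x y Hx].
- exact: clin_lin.
- by apply: homogD; [apply: homogZ => //; exact: xh|exact: eh].
rewrite (xd j x y Hx) (ed j x y Hx) (linD (brkOm_l y)) (linD (@brkOm_r K V x)).
by rewrite (linZ (brkOm_l y)) (linZ (@brkOm_r K V x)) !scalerDr !scalerA mulrC addrACA.
Qed.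

(** The condition by which [leibniz k D] is chosen. It determines [E] by [leib_ext], so identities
    between operators on forms reduce to identities between derivations, and these to the generators
    y and dy. *)
Definition leib k D E := clinear E /\ forall j (x y : pcar O), homog j x ->
  E (tR x y) = tR (D x) y + ksgn K (k * j) *: tR x (D y).

Lemma leib_ext k D D' E E' : leib k D E -> leib k D' E' -> (forall u, D u = D' u) ->
  forall u, E u = E' u.
Proof.
move=> [Ec HE] [Ec' HE'] DD; apply: (R_ext gR Ec Ec') => d n p u d' n' p' v Hu Hv.
by have h := omon_homog Hu; rewrite (HE d u v h) (HE' d u v h) !DD.
Qed.

Lemma leib_sbr k l D D' E E' : derO k D -> derO l D' -> leib k D E -> leib l D' E' ->
  leib (k + l) (sbr k l D D') (sbr k l E E').
Proof.
move=> [_ xh _] [_ eh _] [xc xd] [ec ed]; split=> [|j x y Hx].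
  apply: clinB; first exact: clin_comp.
  by apply: clinZ; exact: clin_comp.
have [xl _] := xc; have [el _] := ec.
have hx : homog (k + j) (D x) by rewrite addrC; exact: xh.
have hy : homog (l + j) (D' x) by rewrite addrC; exact: eh.
rewrite /sbr (ed j x y Hx) (xd j x y Hx) (linD xl) (linD el) (linZ xl) (linZ el).
rewrite (xd _ _ y hy) (xd _ _ _ Hx) (ed _ _ y hx) (ed _ _ _ Hx).
rewrite (linB (tR_l y)) (linB (@tR_r K V x)) (linZ (tR_l y)) (linZ (@tR_r K V x)).
rewrite [(k + l) * j]mulrDl !mulrDr !ksgnD [l * k]mulrC.
rewrite [ksgn K (k * l) * ksgn K (k * j)]mulrC [ksgn K (k * l) * ksgn K (l * j)]mulrC.
exact: super_commutator (ksgn_sq _ _).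
Qed.

Lemma leib0 k : leib k (fun=> 0) (fun=> 0).
Proof.
split=> [|j x y _]; first exact: clin0.
by rewrite (lin0 (@tR_l K V y)) (lin0 (@tR_r K V x)) scaler0 addr0.
Qed.

Lemma leibZD k c D D' E E' : leib k D E -> leib k D' E' ->
  leib k (fun z => c *: D z + D' z) (fun z => c *: E z + E' z).
Proof.
move=> [xc xd] [ec ed]; split=> [|j x y Hx]; first exact: clin_lin.
rewrite (xd j x y Hx) (ed j x y Hx) (linD (tR_l y)) (linD (@tR_r K V x)).
by rewrite (linZ (tR_l y)) (linZ (@tR_r K V x)) !scalerDr !scalerA mulrC addrACA.
Qed.

Lemma leib_eq k D D' E : (forall u, D u = D' u) -> leib k D E -> leib k D' E.
Proof. by move=> DD [Ec H]; split=> // j x y Hx; rewrite (H j x y Hx) !DD. Qed.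

(* [Q n] is one of the filtrations [ordr n], [ordge n]. *)
Section Order.
Variables (QO : nat -> set (pcar O)) (QR : nat -> set (pcar R)).
Hypothesis QOD : forall n u v, QO n u -> QO n v -> QO n (u + v).
Hypothesis QOZ : forall n c u, QO n u -> QO n (c *: u).
Hypothesis QO0 : forall n, QO n 0.
Hypothesis QRD : forall n u v, QR n u -> QR n v -> QR n (u + v).
Hypothesis QRZ : forall n c u, QR n u -> QR n (c *: u).
Hypothesis QR0 : forall n, QR n 0.
Hypothesis QOl : forall m n u v, QO m u -> ordr n v -> QO (m + n)%N (brkO u v).
Hypothesis QOr : forall m n u v, ordr m u -> QO n v -> QO (m + n)%N (brkO u v).
Hypothesis QRl : forall m n u v, QO m u -> ordr n v -> QR (m + n)%N (tR u v).
Hypothesis QRr : forall m n u v, ordr m u -> QO n v -> QR (m + n)%N (tR u v).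

Lemma der_order k r D : derO k D ->
  (forall n y, ordr n y -> QO (n + r)%N (D (inO y))) ->
  (forall n y, ordr n y -> QO (n + r)%N (D (dO y))) ->
  forall n u, ordr n u -> QO (n + r)%N (D u).
Proof.
move=> [Dc _ Db] Hi Hd n u Hu; have [Dl _] := Dc.
have [l [Hl El]] := wpart_omon n u; rewrite -(ordr_fix gO Hu) El (lin_sum Dl).
apply: (@big_In_ind _ _ (fun u => QO (n + r)%N u)); [exact: QO0|exact: QOD|].
move=> t /Hl[d [p Ht]]; rewrite (linZ Dl); apply: QOZ.
elim: Ht => [d1 n1 y Hy|d1 n1 y Hy|d1 n1 p1 u1 d2 n2 p2 u2 H1 IH1 H2 IH2].
- by apply: Hi; exact: pure_ordr Hy.
- by apply: Hd; exact: pure_ordr Hy.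
rewrite (Db d1) ?(omon_homog H1) //; last exact: omon_homog H1.
apply: QOD; first by rewrite addnAC; apply: QOl => //; exact: omon_ordr H2.
by apply: QOZ; rewrite -addnA; apply: QOr => //; exact: omon_ordr H1.
Qed.

Lemma leib_order k r D E : leib k D E -> (forall n u, ordr n u -> QO (n + r)%N (D u)) ->
  forall n u, ordr n u -> QR (n + r)%N (E u).
Proof.
move=> [Ec HE] HD n u Hu; have [El _] := Ec; rewrite -(ordr_fix gR Hu).
have [z Mz ->] := clsW u; rewrite wpart_cls_R // (lin_sum El).
apply: (@big_In_ind _ _ (fun u => QR (n + r)%N u)); [exact: QR0|exact: QRD|].
move=> q /FR_omon[c [d [m [p [u1 [d' [m' [p' [v1 [_ Hu1 Hv1 -> [_ <- _]]]]]]]]]]].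
rewrite !(linZ El); do 2 apply: QRZ; rewrite (HE d) //; last exact: omon_homog Hu1.
have h1 := omon_ordr Hu1; have h2 := omon_ordr Hv1.
apply: QRD; first by rewrite addnAC; apply: QRl => //; exact: HD.
by apply: QRZ; rewrite -addnA; apply: QRr => //; exact: HD.
Qed.
End Order.

Lemma der_shifts k r D : derO k D -> (forall n y, ordr n y -> ordr (n + r)%N (D (inO y))) ->
  (forall n y, ordr n y -> ordr (n + r)%N (D (dO y))) -> shifts r D.
Proof.
move=> HD Hi Hd; apply: (der_order (QO := fun n u => ordr n u)) HD Hi Hd => *.
- exact: ordrD.
- exact: ordrZ.
- exact: ordr0.
- exact: brkOm_ordr.
- exact: brkOm_ordr.
Qed.

Lemma der_raises k r D : derO k D -> (forall n y, ordr n y -> ordge (n + r)%N (D (inO y))) ->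
  (forall n y, ordr n y -> ordge (n + r)%N (D (dO y))) -> raises r D.
Proof.
move=> HD Hi Hd; have [Dc _ _] := HD; apply: (raisesP gO gO) => //.
apply: (der_order (QO := fun n u => ordge n u)) HD Hi Hd => *.
- exact: ordgeD.
- exact: ordgeZ.
- exact: ordge00.
- by apply: brkOm_ordge => //; exact: (ordr_ordge gO).
- by apply: brkOm_ordge => //; exact: (ordr_ordge gO).
Qed.

Lemma leib_shifts k r D E : leib k D E -> shifts r D -> shifts r E.
Proof.
move=> HE HD; apply: (leib_order (QO := fun n u => ordr n u) (QR := fun n u => ordr n u)) HE HD => *.
- exact: ordrD.
- exact: ordrZ.
- exact: ordr0.
- exact: tR_ordr.
- exact: tR_ordr.
Qed.

Lemma leib_raises k r D E : leib k D E -> raises r D -> raises r E.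
Proof.
move=> HE HD; have [Ec _] := HE; apply: (raisesP gR gR) => //.
apply: (leib_order (QO := fun n u => ordge n u) (QR := fun n u => ordge n u)) HE _ => *.
- exact: ordgeD.
- exact: ordgeZ.
- exact: ordge00.
- by apply: tR_ordge => //; exact: (ordr_ordge gO).
- by apply: tR_ordge => //; exact: (ordr_ordge gO).
- by apply: HD; exact: (ordr_ordge gO).
Qed.

Lemma dO_ordr n y : ordr n y -> ordr n (dO y).
Proof.
move=> [x [Mx -> Hx]]; exists (inr0 (dlet x)); split.
- exact/pmem_inr/pmem_dlet.
- by rewrite d_cls.
move=> [s|[|[u t] [|q s]]] //= h; rewrite /tens0 /one0 /=; case: u h => [|i u] h; last by rewrite mul0r.
by rewrite Hx ?mulr0 //; move: h; rewrite /wwt big_seq1 /= /wwt big_nil add0n.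
Qed.

Lemma dO_wpart n y : wpart n (dO y) = dO (wpart n y).
Proof.
have dc : clinear dO.
  apply: (raises_clinear (r := 0) gO); first exact: d_lin.
  apply: (shifts_raises (@lW_graded K V) gO) => [|i u Hu].
    split; first exact: d_lin.
    move=> m; exists m => u [x [Mx -> Hx]]; exists (inr0 (dlet x)); split.
    - exact/pmem_inr/pmem_dlet.
    - by rewrite d_cls.
    move=> [s|[|[w t] [|q s]]] //= h; rewrite /tens0 /one0 /=; case: w h => [|i w] h; last by rewrite mul0r.
    by rewrite Hx ?mulr0 //; move: h; rewrite /wwt big_seq1 /= /wwt big_nil add0n.
  by rewrite addn0; exact: dO_ordr.
have s0 : shifts 0 dO by move=> i u Hu; rewrite addn0; exact: dO_ordr.
by rewrite (shifts_comp (@lW_graded K V) gO dc s0) subn0.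
Qed.

End Derivations.

(** * Cartan calculus and Hamiltonians *)

Section Cartan.
Variables (K : evenRing) (V : fgmod).
Notation W := (susp_dual K V).
Notation lW := (lalg W).
Notation O := (Om W).
Notation R := (DR W).
Notation g := (pcar lW).
Notation inO := (@inOm K W).
Notation dO := (@dOm K W).
Notation gO := (@O_graded K V).
Notation gR := (@R_graded K V).
Notation gg := (@lW_graded K V).
Notation derO := (@derOm K W).
Notation pureO := (pure (@fdOm K W)).
Notation pureR := (pure (M := R) (@fdDR K W)).
Notation ddO := (@dd K W).
Notation cO := (@contrOm K W).
Notation lO := (@lieOm K W).
Notation rdR := (@dDR K W).
Notation rcR := (@contrDR K W).
Notation rlR := (@lieDR K W).
Notation form := (@Defs.form K W).
Notation euler := (@euler K V).
Variables (w : int) (om : pcar R).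
Hypothesis omS : symplectic_form w om.
Implicit Types (xi eta m : g -> g) (y : g).

Lemma double0 (U : lmodType K) (u : U) : u + u = 0 -> u = 0.
Proof.
move=> e; rewrite -[u]scale1r -(kinvK K (n := 2)) // -scalerA mulr2n scalerDl !scale1r e.
exact: scaler0.
Qed.

Lemma contrDR_inj k xi eta : vfield k xi -> vfield k eta -> rcR k xi om = rcR k eta om -> xi = eta.
Proof.
by move=> Hx He e; have [_ _ /(_ k)[_ inj _]] := omS; apply: inj e; apply/mem_set.
Qed.

Lemma leib_zero k E u : @leib K V k (fun=> 0) E -> E u = 0.
Proof. by move=> HE; rewrite (leib_ext HE (leib0 K V k)). Qed.

(** In weight n > 0 the Euler field is n times the identity, so its vanishing kills the Lie algebra
    and with it all generators. *)
Lemma trivial_O : (forall y, euler y = 0) -> forall u, u = 0 :> pcar O.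
Proof.
move=> euler0; have g0 y : y = 0.
  apply: (comp_sep gg) => -[|n]; first exact: wpart0_g.
  have := congr1 (wpart n.+1) (euler0 y); rewrite (wpart_wscale gg) (lin0 (comp_lin gg n.+1)).
  move=> /(congr1 (fun x => kinv K n.+1 *: x)).
  by rewrite scalerA kinvK // scale1r scaler0.
move=> u; apply: (O_ext gO (f := id) (h := fun=> 0)); [exact: clin_id|exact: clin0|].
move=> d n p v; elim=> [d1 n1 y _|d1 n1 y _|d1 n1 p1 u1 d2 n2 p2 u2 _ IH _ _].
- by rewrite [y]g0 (lin0 (@in_lin K V)).
- by rewrite [y]g0 (lin0 (@d_lin K V)).
- by rewrite IH (lin0 (brkOm_l _)).
Qed.

(** By contradiction, through default values. Without a differential, [dd] is zero; then no
    derivation can be a contraction with a nonzero field, such contractions default to zero, and so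
    does [Phi]. The Euler field and its double therefore coincide, everything vanishes, and the zero
    map is a differential after all. *)
Lemma dd_ex : exists D, [/\ derO 1 D, forall z, D (D z) = 0 & forall y, D (inO y) = dO y].
Proof.
have [//|N] := pselect (exists D, [/\ derO 1 D, forall z, D (D z) = 0 &
  forall y, D (inO y) = dO y]).
have dd0 : ddO = fun=> 0 by apply: xgetPN => D HD; apply: N; exists D.
have Phi0 xi : vfield 0 xi -> (exists y, xi y <> 0) -> rcR 0 xi om = 0.
  move=> Hx [y Hy]; have c0 : cO 0 xi = fun=> 0.
    apply: xgetPN => D [[[Dl _] _ _] _ /(_ y)]; rewrite dd0 (lin0 Dl) => /esym/in_inj.
    exact: Hy.
  rewrite /contrDR c0 /leibniz; case: xgetP => // E _ HE.
  exact: (@leib_zero (0 - 1) E om HE).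
have He := vfield_euler K V; have He2 := vfieldD He He.
have euler0 y : euler y = 0.
  have [//|Hy] := pselect (euler y = 0).
  have e : euler = fun y => euler y + euler y.
    apply: (contrDR_inj He He2); rewrite !Phi0 //; exists y => //.
    by move/double0.
  by apply: (addrI (euler y)); rewrite addr0 {3}e.
have O0 := trivial_O euler0; by exists (fun=> 0); split; [exact: der0| |move=> y; rewrite [RHS]O0].
Qed.

Lemma dd_spec : [/\ derO 1 ddO, forall z, ddO (ddO z) = 0 & forall y, ddO (inO y) = dO y].
Proof. exact: (xgetPex _ dd_ex). Qed.

Lemma dd_der : derO 1 ddO. Proof. by case: dd_spec. Qed.
Lemma dd_dd z : ddO (ddO z) = 0. Proof. by case: dd_spec. Qed.
Lemma dd_in y : ddO (inO y) = dO y. Proof. by case: dd_spec. Qed.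
Lemma dd_d y : ddO (dO y) = 0. Proof. by rewrite -dd_in dd_dd. Qed.

(** If no contraction with [xi] exists, [contrOm k xi] is zero by default and [Phi] takes the same
    value at [xi] and at 0. Injectivity gives xi = 0, for which the zero derivation is a
    contraction. *)
Lemma contr_specO k xi : vfield k xi ->
  [/\ derO (k - 1) (cO k xi), forall y, cO k xi (inO y) = 0
    & forall y, cO k xi (ddO (inO y)) = inO (xi y)].
Proof.
move=> Hx; have zero eta : (forall y, eta y = 0) -> [/\ derO (k - 1) (cO k eta),
    forall y, cO k eta (inO y) = 0 & forall y, cO k eta (ddO (inO y)) = inO (eta y)].
  move=> H0; apply: (@xgetPex _ _ [set D | [/\ derOm (k - 1) D,
    forall x, D (inOm x) = 0 & forall x, D (dd (inOm x)) = inOm (eta x)]]).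
  by exists (fun=> 0); split; [exact: der0| |move=> y; rewrite H0 (lin0 (@in_lin K V))].
have [|N] := pselect (exists D, [/\ derOm (k - 1) D,
    forall x, D (inO x) = 0 & forall x, D (ddO (inO x)) = inO (xi x)]).
  by move=> ex; exact: (xgetPex _ ex).
apply: (zero); have c0 : cO k xi = fun=> 0 by apply: xgetPN => D HD; apply: N; exists D.
have c1 eta : (forall y, eta y = 0) -> vfield k eta -> rcR k eta om = 0.
  move=> H0 He; have [D1 D2 D3] := zero eta H0; rewrite /contrDR /leibniz.
  case: xgetP => // E _ HE; apply: (@leib_zero (k - 1)); apply: leib_eq HE => u.
  apply: (der_ext D1 (der0 _ _ _)) => // y; rewrite -dd_in D3 H0; exact: (lin0 (@in_lin K V)).
have -> // : xi = fun=> 0.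
have e0 := c1 (fun=> 0) (fun=> erefl) (vfield0 K V k).
apply: (@contrDR_inj k xi (fun=> 0) Hx (vfield0 K V k)); rewrite e0.
by rewrite /contrDR c0 /leibniz; case: xgetP => // E _; exact: leib_zero.
Qed.

Lemma contr_der k xi : vfield k xi -> derO (k - 1) (cO k xi).
Proof. by case/contr_specO. Qed.
Lemma contr_in k xi y : vfield k xi -> cO k xi (inO y) = 0.
Proof. by case/contr_specO. Qed.
Lemma contr_d k xi y : vfield k xi -> cO k xi (dO y) = inO (xi y).
Proof. by case/contr_specO=> _ _; rewrite -dd_in. Qed.

(** The argument of [contr_specO], repeated for the operator on forms: a default value would again
    force xi = 0. *)
Lemma contrDR_leib k xi : vfield k xi -> leib (k - 1) (cO k xi) (rcR k xi).
Proof.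
move=> Hx; have zero eta : (forall y, eta y = 0) -> vfield k eta ->
    leib (k - 1) (cO k eta) (rcR k eta).
  move=> H0 He; apply: (xgetPex (fun=> 0) (P := [set E | leib (k - 1) (cO k eta) E])).
  exists (fun=> 0); apply: (leib_eq _ (leib0 K V (k - 1))) => u; apply/esym.
  apply: (der_ext (contr_der He) (der0 _ _ _)) => y; first exact: contr_in.
  by rewrite contr_d // H0; exact: (lin0 (@in_lin K V)).
have [|N] := pselect (exists E, leib (k - 1) (cO k xi) E).
  by move=> ex; exact: (xgetPex _ ex).
apply: (zero) => //; have -> // : xi = fun=> 0.
apply: (@contrDR_inj k xi (fun=> 0) Hx (vfield0 K V k)); have := zero (fun=> 0) (fun=> erefl) (vfield0 K V k).
have -> : rcR k xi = fun=> 0 by apply: xgetPN => E HE; apply: N; exists E.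
move=> HE; apply/esym/(@leib_zero (k - 1)); apply: leib_eq HE => u.
apply: (der_ext (contr_der (vfield0 K V k)) (der0 _ _ _)) => y; first exact: contr_in (vfield0 K V k).
by rewrite (contr_d _ (vfield0 K V k)); exact: (lin0 (@in_lin K V)).
Qed.

Lemma dd_shifts : shifts 0 ddO.
Proof.
apply: (der_shifts dd_der) => n y Hy; rewrite addn0.
  by rewrite dd_in; exact: dO_ordr.
by rewrite dd_d; exact: ordr0.
Qed.

Lemma dDR_leib : leib 1 ddO rdR.
Proof.
have [E [Ec HE]] := leibniz_ex dd_der dd_shifts.
apply: (xgetPex (fun=> 0) (P := [set E | leib 1 ddO E])); exists E; split=> // j x y Hx.
by rewrite HE /leibB (sgc_homog Hx) (linZ (tR_l _)) mul1r.
Qed.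

Lemma lie_derO k xi : vfield k xi ->
  [/\ derO k (lO k xi), forall y, lO k xi (inO y) = inO (xi y)
    & forall y, lO k xi (dO y) = ksgn K k *: dO (xi y)].
Proof.
move=> Hx; have [H1 H2 H3] : [/\ derOm k (lO k xi),
    forall x, lO k xi (inOm x) = inOm (xi x)
  & forall x, lO k xi (dd (inOm x)) = ksgn K k *: dd (inOm (xi x))].
  apply: (xgetPex (fun=> 0) (P := [set D | [/\ derOm k D,
    forall x, D (inOm x) = inOm (xi x)
  & forall x, D (dd (inOm x)) = ksgn K k *: dd (inOm (xi x))]])).
  (* The contraction has degree k - 1 and d has degree 1, so their graded commutator is i d + (-1)^k
     d i, of degree k. *)
  have := der_sbr (contr_der Hx) dd_der; rewrite subrK => D1.
  have s : ksgn K ((k - 1) * 1) = - ksgn K k by rewrite mulr1 ksgnD ksgnN ksgn1 mulrN1.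
  have [[Dl _] _ _] := dd_der; have [[Cl _] _ _] := contr_der Hx.
  exists (sbr (k - 1) 1 (cO k xi) ddO); split=> // x; rewrite /sbr s scaleNr opprK.
    by rewrite dd_in contr_d // contr_in // (lin0 Dl) scaler0 addr0.
  by rewrite dd_dd (lin0 Cl) add0r dd_in contr_d.
by split=> // y; rewrite -!dd_in.
Qed.

Lemma lieDR_leib k xi : vfield k xi -> leib k (lO k xi) (rlR k xi) /\
  forall u, rlR k xi u = rcR k xi (rdR u) + ksgn K k *: rdR (rcR k xi u).
Proof.
move=> Hx; have s : ksgn K ((k - 1) * 1) = - ksgn K k by rewrite mulr1 ksgnD ksgnN ksgn1 mulrN1.
have [L1 L2 L3] := lie_derO Hx; have [[Dl _] _ _] := dd_der.
have [[Cl _] _ _] := contr_der Hx.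
have := der_sbr (contr_der Hx) dd_der; rewrite subrK => D1.
have := leib_sbr (contr_der Hx) dd_der (contrDR_leib Hx) dDR_leib; rewrite subrK => E1.
have E2 : leib k (lO k xi) (sbr (k - 1) 1 (rcR k xi) rdR).
  apply: leib_eq E1 => u; apply: (der_ext D1 L1) => y; rewrite /sbr s scaleNr opprK.
    by rewrite dd_in contr_d // contr_in // (lin0 Dl) scaler0 addr0 L2.
  by rewrite dd_d (lin0 Cl) add0r contr_d // dd_in L3.
have E3 : leib k (lO k xi) (rlR k xi).
  by apply: (xgetPex (fun=> 0) (P := [set E | leib k (lO k xi) E])); exists (sbr (k - 1) 1 (rcR k xi) rdR).
split=> // u; rewrite (leib_ext E3 E2) //; by rewrite /sbr s scaleNr opprK.
Qed.

Definition dR := sval (seal rdR).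
Definition cR := sval (seal rcR).
Definition lR := sval (seal rlR).

Lemma dRE : rdR = dR. Proof. by rewrite /dR sealE. Qed.
Lemma cRE : rcR = cR. Proof. by rewrite /cR sealE. Qed.
Lemma lRE : rlR = lR. Proof. by rewrite /lR sealE. Qed.

Lemma Phi_inj k xi eta : vfield k xi -> vfield k eta -> cR k xi om = cR k eta om -> xi = eta.
Proof. by rewrite -cRE; exact: contrDR_inj. Qed.
Lemma dR_leib : leib 1 ddO dR.
Proof. by rewrite -dRE; exact: dDR_leib. Qed.
Lemma contr_leib k xi : vfield k xi -> leib (k - 1) (cO k xi) (cR k xi).
Proof. by rewrite -cRE; exact: contrDR_leib. Qed.
Lemma lR_leib k xi : vfield k xi -> leib k (lO k xi) (lR k xi) /\
  forall u, lR k xi u = cR k xi (dR u) + ksgn K k *: dR (cR k xi u).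
Proof. by rewrite -cRE -lRE -dRE; exact: lieDR_leib. Qed.

Lemma dR_lin : linear dR. Proof. by have [[]] := dR_leib. Qed.
Lemma cR_lin k xi : vfield k xi -> linear (cR k xi).
Proof. by move/contr_leib => [[]]. Qed.
Lemma lR_lin k xi : vfield k xi -> linear (lR k xi).
Proof. by move/lR_leib => [[[]]]. Qed.
Lemma dR_clin : clinear dR. Proof. by have [] := dR_leib. Qed.

(** The differential is odd, so its graded commutator with itself is twice its square; this operator
    is induced by the zero derivation. *)
Lemma dR_dR u : dR (dR u) = 0.
Proof.
apply: double0; have H := leib_sbr dd_der dd_der dR_leib dR_leib.
have [[Dl _] _ _] := dd_der.
have := @leib_zero (1 + 1) (sbr 1 1 dR dR) u; rewrite /sbr mulr1 ksgn1 scaleN1r opprK; apply.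
apply: leib_eq H => v; by rewrite /sbr !dd_dd scaler0 subrr.
Qed.

Lemma dR_shifts : shifts 0 dR.
Proof. exact: (leib_shifts dR_leib dd_shifts). Qed.

Lemma dR_wpart n u : wpart n (dR u) = dR (wpart n u).
Proof. by rewrite (shifts_comp gR gR dR_clin dR_shifts) subn0. Qed.

Lemma lR_dR k xi u : vfield k xi -> lR k xi (dR u) = ksgn K k *: dR (lR k xi u).
Proof.
move=> Hx; have [_ H] := lR_leib Hx; rewrite (H (dR u)) (H u).
move: (dR_dR u) (dR_dR (cR k xi u)) dR_lin (cR_lin Hx).
move: (dR) (cR k xi) => D C Du Dc Dl Cl.
by rewrite Du (lin0 Cl) add0r (linD Dl) (linZ Dl) Dc scaler0 addr0.
Qed.

(** The Cartan relation [L_m, i_xi] = i_[m,xi]: both sides are induced by derivations, which agree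
    on y and dy. *)
Lemma lR_cR l k m xi u : vfield l m -> vfield k xi ->
  lR l m (cR k xi u) - ksgn K (l * (k - 1)) *: cR k xi (lR l m u) =
  cR (l + k) (ebrk l k m xi) u.
Proof.
move=> Hm Hx; have Hb := vfield_ebrk Hm Hx.
have [L1 L2 L3] := lie_derO Hm; have [[Ll _] _ _] := L1.
have [[Cl _] _ _] := contr_der Hx; have [E1 _] := lR_leib Hm.
have := der_sbr L1 (contr_der Hx); have := leib_sbr L1 (contr_der Hx) E1 (contr_leib Hx).
rewrite addrA => H1 H2; apply: (leib_ext H1 (contr_leib Hb)) => v.
apply: (der_ext H2 (contr_der Hb)) => y; rewrite /sbr.
  by rewrite L2 !contr_in // (lin0 Ll) scaler0 subr0.
rewrite L3 (linZ Cl) !contr_d // L2 scalerA -(linZ (@in_lin K V)) -(linB (@in_lin K V)).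
by rewrite -ksgnD mulrBr mulr1 subrK.
Qed.

Lemma lR_lR l k m xi u : vfield l m -> vfield k xi ->
  lR l m (lR k xi u) - ksgn K (l * k) *: lR k xi (lR l m u) = lR (l + k) (ebrk l k m xi) u.
Proof.
move=> Hm Hx; have Hb := vfield_ebrk Hm Hx.
have [L1 L2 L3] := lie_derO Hm; have [[Ll _] _ _] := L1; have [E1 _] := lR_leib Hm.
have [C1 C2 C3] := lie_derO Hx; have [[Cl _] _ _] := C1; have [F1 _] := lR_leib Hx.
have [B1 B2 B3] := lie_derO Hb; have [G1 _] := lR_leib Hb.
have H1 := leib_sbr L1 C1 E1 F1; have H2 := der_sbr L1 C1.
apply: (leib_ext H1 G1) => v; apply: (der_ext H2 B1) => y; rewrite /sbr.
  by rewrite C2 !L2 C2 B2 /ebrk -(linZ (@in_lin K V)) -(linB (@in_lin K V)).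
rewrite C3 L3 (linZ Ll) (linZ Cl) L3 C3 B3 !scalerA /ebrk (linB (@d_lin K V)) (linZ (@d_lin K V)).
rewrite scalerBr !scalerA ksgnD [ksgn K k * ksgn K l]mulrC.
have -> : ksgn K (l * k) * ksgn K l * ksgn K k = ksgn K l * ksgn K k * ksgn K (l * k) by ring.
by [].
Qed.

Lemma cR_ZD k c xi eta u : gpart 0 c -> vfield k xi -> vfield k eta ->
  cR k (fun x => c *: xi x + eta x) u = c *: cR k xi u + cR k eta u.
Proof.
move=> gc Hx He; have Hs := vfieldZD gc Hx He.
apply: (leib_ext (contr_leib Hs) (leibZD c (contr_leib Hx) (contr_leib He))) => v.
apply: (der_ext (contr_der Hs) (derZD gc (contr_der Hx) (contr_der He))) => y.
  by rewrite !contr_in // scaler0 addr0.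
by rewrite !contr_d // (@in_lin K V).
Qed.

Lemma cR_B k xi eta u : vfield k xi -> vfield k eta ->
  cR k (fun x => xi x - eta x) u = cR k xi u - cR k eta u.
Proof.
move=> Hx He; have -> : (fun x => xi x - eta x) = fun x => -1 *: eta x + xi x.
  by apply: funext => x; rewrite scaleN1r addrC.
by rewrite (cR_ZD u _ He Hx) ?scaleN1r 1?addrC //; exact/gpartN/gpart1.
Qed.

Lemma cR_Z k c xi u : gpart 0 c -> vfield k xi -> cR k (fun x => c *: xi x) u = c *: cR k xi u.
Proof.
move=> gc Hx; have e : (fun x => c *: xi x) = fun x => c *: xi x + (fun=> 0 : g) x.
  by apply: funext => x; rewrite addr0.
rewrite e (cR_ZD u gc Hx (vfield0 K V k)).
have -> : cR k (fun=> 0) u = 0; last by rewrite addr0.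
have -> : (fun=> 0) = (fun x => xi x - xi x) by apply: funext => x; rewrite subrr.
by rewrite (cR_B u Hx Hx) subrr.
Qed.

Lemma lR_B k xi eta u : vfield k xi -> vfield k eta ->
  lR k (fun x => xi x - eta x) u = lR k xi u - lR k eta u.
Proof.
move=> Hx He; have [_ H1] := lR_leib Hx; have [_ H2] := lR_leib He.
have [_ ->] := lR_leib (vfieldB Hx He).
rewrite H1 H2 (cR_B (dR u) Hx He) (cR_B u Hx He).
have -> : dR (cR k xi u - cR k eta u) = dR (cR k xi u) - dR (cR k eta u) by exact: (linB dR_lin).
move: (dR (cR k xi u)) (dR (cR k eta u)) (cR k xi (dR u)) (cR k eta (dR u)) => a b c d.
by rewrite scalerBr opprD addrACA.
Qed.

Lemma cR_shifts k r xi : vfield k xi -> shifts r xi -> shifts r (cR k xi).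
Proof.
move=> Hx Hr; apply: (leib_shifts (contr_leib Hx)); apply: (der_shifts (contr_der Hx)) => n y Hy.
  by rewrite contr_in //; exact: ordr0.
by rewrite contr_d //; apply: in_ordr; exact: Hr.
Qed.

Lemma in_ordge n y : ordge n y -> ordge n (inO y).
Proof.
move=> Hy; apply/(ordgeP gO) => k kn; rewrite in_wpart (ordge_comp0 gg Hy) //.
exact: (lin0 (@in_lin K V)).
Qed.

Lemma dO_ordge n y : ordge n y -> ordge n (dO y).
Proof.
move=> Hy; apply/(ordgeP gO) => k kn; rewrite dO_wpart (ordge_comp0 gg Hy) //.
exact: (lin0 (@d_lin K V)).
Qed.

Lemma cR_raises k r xi : vfield k xi -> raises r xi -> raises r (cR k xi).
Proof.
move=> Hx Hr; apply: (leib_raises (contr_leib Hx)); apply: (der_raises (contr_der Hx)) => n y Hy.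
  by rewrite contr_in //; exact: ordge00.
by rewrite contr_d //; apply: in_ordge; apply: Hr; exact: (ordr_ordge gg).
Qed.

Lemma lO_shifts k r xi : vfield k xi -> shifts r xi -> shifts r (lO k xi).
Proof.
move=> Hx Hr; have [L1 L2 L3] := lie_derO Hx; apply: (der_shifts L1) => n y Hy.
  by rewrite L2; apply: in_ordr; exact: Hr.
by rewrite L3; apply: ordrZ; apply: dO_ordr; exact: Hr.
Qed.

Lemma lO_raises k r xi : vfield k xi -> raises r xi -> raises r (lO k xi).
Proof.
move=> Hx Hr; have [L1 L2 L3] := lie_derO Hx; apply: (der_raises L1) => n y Hy.
  by rewrite L2; apply: in_ordge; apply: Hr; exact: (ordr_ordge gg).
by rewrite L3; apply: ordgeZ; apply: dO_ordge; apply: Hr; exact: (ordr_ordge gg).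
Qed.

Lemma lR_shifts k r xi : vfield k xi -> shifts r xi -> shifts r (lR k xi).
Proof. by move=> Hx Hr; have [E _] := lR_leib Hx; exact: (leib_shifts E (lO_shifts Hx Hr)). Qed.

Lemma lR_raises k r xi : vfield k xi -> raises r xi -> raises r (lR k xi).
Proof. by move=> Hx Hr; have [E _] := lR_leib Hx; exact: (leib_raises E (lO_raises Hx Hr)). Qed.

Lemma lR_euler u : lR 0 euler u = wscale (fun n => n%:R) u.
Proof.
have He := vfield_euler K V; have [L1 L2 L3] := lie_derO He; have [E1 _] := lR_leib He.
have [Ec HE] := E1; have [_ _ Lb] := L1.
have LO d n p v : omon d n p v -> lO 0 euler v = n%:R *: v.
  elim=> [d1 n1 y Hy|d1 n1 y Hy|d1 n1 p1 u1 d2 n2 p2 u2 H1 IH1 H2 IH2].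
  - by rewrite L2 /euler (wscale_ordr gg _ (pure_ordr Hy)) (linZ (@in_lin K V)).
  - by rewrite L3 ksgn0 scale1r /euler (wscale_ordr gg _ (pure_ordr Hy)) (linZ (@d_lin K V)).
  - rewrite (Lb d1); last exact: omon_homog H1.
    rewrite mul0r ksgn0 scale1r IH1 IH2 (linZ (brkOm_l _)) (linZ (@brkOm_r K V _)).
    by rewrite natrD scalerDl.
apply: (R_ext gR Ec (wscale_clin gR _)) => d n p v d' n' p' v' Hv Hv'.
rewrite (HE d); last exact: omon_homog Hv.
rewrite mul0r ksgn0 scale1r (LO _ _ _ _ Hv) (LO _ _ _ _ Hv').
rewrite (wscale_ordr gR _ (tR_ordr (omon_ordr Hv) (omon_ordr Hv'))).
by rewrite (linZ (tR_l _)) (linZ (@tR_r K V _)) natrD scalerDl.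
Qed.

Lemma cO_omon0 k xi d n u : vfield k xi -> omon d n 0 u -> cO k xi u = 0.
Proof.
move=> Hx Hu; have [_ _ Cb] := contr_der Hx; move: Hu; move e : 0%N => p Hu.
elim: Hu e => [d1 n1 y Hy _|//|d1 n1 p1 u1 d2 n2 p2 u2 H1 IH1 H2 IH2 e]; first exact: contr_in.
rewrite (Cb d1) ?IH1 ?IH2 //; try by move: e; lia.
  by rewrite (lin0 (brkOm_l _)) (lin0 (@brkOm_r K V _)) scaler0 addr0.
exact: omon_homog H1.
Qed.

Lemma cR_form0 k xi a u : vfield k xi -> form 0 a u -> cR k xi u = 0.
Proof.
move=> Hx Hu; have [[Cl Cc] HC] := contr_leib Hx.
apply: (clin_ext_at gR gR (f := cR k xi) (g := fun=> 0)) => [||n].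
- by split.
- exact: clin0.
apply: (form_wpart (f := cR k xi) (S := fun x => x = 0) _ _ _ Hu) => //.
  by move=> x y -> ->; rewrite addr0.
move=> c d m q v d' m' q' v' _ Hv Hv' _ eq0; rewrite (HC d); last exact: omon_homog Hv.
have [q0 q0'] : q = 0%N /\ q' = 0%N by move: eq0; lia.
rewrite q0 in Hv; rewrite q0' in Hv'.
rewrite (cO_omon0 Hx Hv) (cO_omon0 Hx Hv') (lin0 (tR_l _)) (lin0 (@tR_r K V _)).
by rewrite scaler0 addr0 scaler0.
Qed.

Lemma form_glue p a u : (forall n, form p a (wpart n u)) -> form p a u.
Proof. by move=> H; apply: (supp_glue gR) => // i; split=> //; exact: gpart0. Qed.

Lemma pureR_form n p a u : pureR (a + p%:Z) n p u -> form p a u.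
Proof. by apply: supp_sub => i c [H1 H2 H3]; split. Qed.

Lemma dd_pure d n p u : omon d n p u -> pureO (d + 1) n p.+1 (ddO u).
Proof.
have [_ _ Db] := dd_der.
elim=> [d1 n1 y Hy|d1 n1 y Hy|d1 n1 p1 u1 d2 n2 p2 u2 H1 IH1 H2 IH2].
- by rewrite dd_in; exact: d_pure.
- by rewrite dd_d; exact: pure0.
rewrite (Db d1); last exact: omon_homog H1.
apply: pureD; first by rewrite addrAC -addSn; exact: brkOm_pure IH1 (omon_pure H2).
by apply: pure_sgn; rewrite -addrA -addnS; exact: brkOm_pure (omon_pure H1) IH2.
Qed.

Lemma contr_pure d n p u : omon d n p.+1 u -> pureO (d - 1) n p (cO 0 euler u).
Proof.
have He := vfield_euler K V; have [_ _ Db] := contr_der He.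
move=> Hu; move: Hu; move e : p.+1 => q Hu.
elim: Hu p e => [//|d1 n1 y Hy p [->]|d1 n1 p1 u1 d2 n2 p2 u2 H1 IH1 H2 IH2 p e].
  rewrite contr_d // addrK; apply: in_pure; rewrite /euler (wscale_ordr gg _ (pure_ordr Hy)).
  by rewrite -[d1]add0r; apply: pureZ => //; exact: gpart_nat.
rewrite (Db d1); last exact: omon_homog H1.
apply: pureD; last apply: pure_sgn.
  case: p1 H1 IH1 e => [|p1] H1 IH1 e.
    by rewrite (cO_omon0 He H1) (lin0 (brkOm_l _)); exact: pure0.
  have -> : p = (p1 + p2)%N by move: e; rewrite addSn => -[].
  by rewrite addrAC; apply: brkOm_pure (omon_pure H2); exact: IH1.
case: p2 H2 IH2 e => [|p2] H2 IH2 e.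
  by rewrite (cO_omon0 He H2) (lin0 (@brkOm_r K V _)); exact: pure0.
have -> : p = (p1 + p2)%N by move: e; rewrite addnS => -[].
by rewrite -addrA; apply: brkOm_pure (omon_pure H1) _; exact: IH2.
Qed.

Lemma dR_form a u : form 0 a u -> form 1 a (dR u).
Proof.
move=> Hu; have [_ HD] := dR_leib; apply: form_glue => n; rewrite dR_wpart.
apply: (@pureR_form n).
apply: (form_wpart (f := dR) (S := fun x => pureR (a + 1) n 1 x) _ _ _ Hu).
- exact: dR_lin.
- exact: pure0.
- by move=> x y; exact: pureD.
move=> c d m q v d' m' q' v' gc Hv Hv' <- eq0; rewrite (HD d); last exact: omon_homog Hv.
have [q0 q0'] : q = 0%N /\ q' = 0%N by move: eq0; lia.
rewrite q0 in Hv; rewrite q0' in Hv'; rewrite addr0 in gc.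
have -> : a + 1 = a - (d + d') + (d + d' + 1) by rewrite addrA subrK.
apply: pureZ => //; apply: pureD.
  by rewrite addrAC; exact: tR_pure (dd_pure Hv) (omon_pure Hv').
by apply: pure_sgn; rewrite -addrA; exact: tR_pure (omon_pure Hv) (dd_pure Hv').
Qed.

Lemma cR_euler_shifts : shifts 0 (cR 0 euler).
Proof.
apply: cR_shifts; first exact: vfield_euler.
by move=> n y Hy; rewrite /euler (wscale_ordr gg _ Hy) addn0; exact: ordrZ.
Qed.

Lemma cR_euler_wpart n u : wpart n (cR 0 euler u) = cR 0 euler (wpart n u).
Proof.
have [Ec _] := contr_leib (vfield_euler K V).
by rewrite (shifts_comp gR gR Ec cR_euler_shifts) subn0.
Qed.

Lemma cR_form1 a u : form 1 a u -> form 0 a (cR 0 euler u).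
Proof.
have He := vfield_euler K V.
move=> Hu; have [_ HD] := contr_leib He; apply: form_glue => n; rewrite cR_euler_wpart.
apply: (@pureR_form n); rewrite addr0.
apply: (form_wpart (f := cR 0 euler) (S := fun x => pureR a n 0 x) _ _ _ Hu).
- exact: cR_lin.
- exact: pure0.
- by move=> x y; exact: pureD.
move=> c d m q v d' m' q' v' gc Hv Hv' <- eq1; rewrite (HD d); last exact: omon_homog Hv.
have -> : a = a + 1 - (d + d') + (d + d' - 1) by rewrite addrA subrK addrK.
apply: pureZ => //; case: q Hv eq1 => [|q] Hv eq1.
  have q1 : q' = 1%N by []. rewrite q1 in Hv'.
  rewrite (cO_omon0 He Hv) (lin0 (tR_l _)) add0r; apply: pure_sgn; rewrite -addrA.
  exact: tR_pure (omon_pure Hv) (contr_pure Hv').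
have [q0 q0'] : q = 0%N /\ q' = 0%N by move: eq1; lia.
rewrite q0 in Hv; rewrite q0' in Hv'.
rewrite (cO_omon0 He Hv') (lin0 (@tR_r K V _)) scaler0 addr0 addrAC.
exact: tR_pure (contr_pure Hv) (omon_pure Hv').
Qed.

Lemma wscale_inv u : wscale (kinv K) (wscale (fun n => n%:R) u) = u :> pcar R.
Proof.
apply: (comp_inj gR) => -[|n]; rewrite !(wpart_wscale gR).
  by rewrite wpart0_R !scaler0.
by rewrite scalerA kinvK // scale1r.
Qed.

(** Cartan's formula makes the Euler Lie derivative of such a form vanish, but that operator
    multiplies by a positive weight. *)
Lemma poincare0 u : dR u = 0 -> cR 0 euler u = 0 -> u = 0.
Proof.
move=> du cu; rewrite -(wscale_inv u) -lR_euler.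
have [_ ->] := lR_leib (vfield_euler K V).
have He := vfield_euler K V.
by rewrite du cu (lin0 (cR_lin He)) (lin0 dR_lin) scaler0 addr0 (lin0 (wscale_lin gR _)).
Qed.

Lemma dR_wscale c u : dR (wscale c u) = wscale c (dR u).
Proof.
apply: (comp_inj gR) => n; rewrite (dR_wpart n (wscale c u)) (wpart_wscale gR c n u).
by rewrite (wpart_wscale gR c n (dR u)) (dR_wpart n u) (linZ dR_lin).
Qed.

Lemma poincare1 u : dR u = 0 -> dR (wscale (kinv K) (cR 0 euler u)) = u.
Proof.
move=> du; have He := vfield_euler K V.
rewrite dR_wscale -[RHS]wscale_inv; congr wscale; rewrite -lR_euler.
by have [_ ->] := lR_leib He; rewrite du (lin0 (cR_lin He)) add0r ksgn0 scale1r.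
Qed.

(* The 0-form [al] of degree [k + w] with [d al = (-1)^(k + w) i_xi om]. *)
Definition hamil k xi : pcar R :=
  ksgn K (k + w) *: wscale (kinv K) (cR 0 euler (cR k xi om)).

Lemma om_closed : dR om = 0. Proof. by rewrite -dRE; have [] := omS. Qed.

Lemma contr_closed k xi : vfield k xi -> lR k xi om = 0 <-> dR (cR k xi om) = 0.
Proof.
move=> Hx; have [_ ->] := lR_leib Hx; rewrite om_closed (lin0 (cR_lin Hx)) add0r.
split=> [e|->]; last by rewrite scaler0.
by rewrite -[LHS]scale1r -(ksgn_sq K k) -scalerA e scaler0.
Qed.

Lemma contr_form k xi : vfield k xi -> form 1 (k + w) (cR k xi om).
Proof. by move=> Hx; rewrite -cRE; have [_ _ /(_ k)[H _ _]] := omS; exact: H. Qed.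

Lemma hamil_form k xi : vfield k xi -> form 0 (k + w) (hamil k xi).
Proof.
move=> Hx; have := cR_form1 (contr_form Hx) => H.
apply: (suppZ (R := fun i c => (fdDR i != 0%N -> c = 0) /\ gpart (k + w + 0%:Z - dg i) c)).
  move=> i a [H1 H2]; split; first by move=> h; rewrite H1 ?mulr0.
  by apply: gpart0M => //; exact: gpart_ksgn.
apply: (wscale_supp gR) H => [i|n i a [H1 H2]]; first by split=> //; exact: gpart0.
split; first by move=> h; rewrite H1 ?mulr0.
have [->|n0] := posnP n; first by rewrite /kinv invr0 scale0r mul0r; exact: gpart0.
exact: gpart_kinv.
Qed.

Lemma dR_hamil k xi : vfield k xi -> lR k xi om = 0 ->
  dR (hamil k xi) = ksgn K (k + w) *: cR k xi om.
Proof.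
move=> Hx /(contr_closed Hx) H; rewrite (linZ dR_lin) poincare1 //.
Qed.

(** A difference of two solutions is closed and, being a 0-form, is killed by contractions, so it is
    zero: there are no constants, as weight zero is empty. *)
Lemma hamil_eq k xi al : vfield k xi -> lR k xi om = 0 -> form 0 (k + w) al ->
  dR al = ksgn K (k + w) *: cR k xi om -> al = hamil k xi.
Proof.
move=> Hx Lx Fal e; apply/eqP; rewrite -subr_eq0; apply/eqP/poincare0.
  by rewrite (linB dR_lin) dR_hamil // e subrr.
rewrite (linB (cR_lin (vfield_euler K V))) (cR_form0 (vfield_euler K V) Fal).
by rewrite (cR_form0 (vfield_euler K V) (hamil_form Hx)) subr0.
Qed.

Lemma ksgnK s (U : lmodType K) (u v : U) : u = ksgn K s *: v -> v = ksgn K s *: u.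
Proof. by move=> ->; rewrite scalerA ksgn_sq scale1r. Qed.

Lemma Phi_invE k xi b : vfield k xi -> cR k xi om = b -> Phi_inv om k b = xi.
Proof.
move=> Hx e; rewrite /Phi_inv /Phi cRE; case: xgetP => [eta _ [He Pe]|/(_ xi)[]]; last by split.
by apply: (Phi_inj He Hx); rewrite e.
Qed.

(** The condition defining the chosen preimage amounts to d al = (-1)^(k+w) i_xi om, which [hamil]
    satisfies and which has only one solution. *)
Lemma Upsilon_invE k xi : symplectic_vfield om k xi -> Upsilon_inv w om k xi = hamil k xi.
Proof.
rewrite /symplectic_vfield lRE => -[Hx Lx].
have U al : form 0 (k + w) al -> Upsilon w om k al = xi <->
    dR al = ksgn K (k + w) *: cR k xi om.
  move=> Fal; split=> [e|e].
    have [eta [He Pe]] : exists eta, vfield k eta /\ cR k eta om = dR al.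
      have [_ _ /(_ k)[_ _]] := omS; rewrite /Phi cRE => sur; have [eta He Pe] := sur _ (dR_form Fal).
      by exists eta.
    rewrite -Pe; apply: ksgnK; rewrite -e /Upsilon dRE -cR_Z //; last exact: gpart_ksgn.
    have -> // : (fun x => ksgn K (k + w) *: Phi_inv om k (dR al) x) =
      (fun x => ksgn K (k + w) *: eta x).
    by apply: funext => x; rewrite (Phi_invE He Pe).
  rewrite /Upsilon dRE e; apply: funext => x.
  rewrite (Phi_invE (xi := fun x => ksgn K (k + w) *: xi x)).
  - by rewrite scalerA ksgn_sq scale1r.
  - have := vfieldZD (gpart_ksgn K (k + w)) Hx (vfield0 K V k); congr vfield.
    by apply: funext => y; rewrite addr0.
  - by rewrite cR_Z //; exact: gpart_ksgn.
rewrite /Upsilon_inv; case: xgetP => [al _ [Fal Ual]|/(_ (hamil k xi))[]].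
  by apply: hamil_eq => //; apply/(U _ Fal).
split; first exact: hamil_form.
by apply/(U _ (hamil_form Hx)); exact: dR_hamil.
Qed.

Lemma hamil_B k xi eta : vfield k xi -> vfield k eta ->
  hamil k (fun x => xi x - eta x) = hamil k xi - hamil k eta.
Proof.
move=> Hx He; rewrite /hamil cR_B // (linB (cR_lin (vfield_euler K V))).
by rewrite (linB (wscale_lin gR _)) scalerBr.
Qed.

Lemma hamil_inj k xi eta : vfield k xi -> lR k xi om = 0 -> vfield k eta -> lR k eta om = 0 ->
  hamil k xi = hamil k eta -> xi = eta.
Proof.
move=> Hx Lx He Le e; apply: (Phi_inj Hx He).
by have := congr1 dR e; rewrite !dR_hamil // => /ksgnK ->; rewrite scalerA ksgn_sq scale1r.
Qed.

(** Hamiltonians translate the bracket with m into the Lie derivative along m, that is, into the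
    Harrison differential when m is [m2]. The difference of the two sides is closed and killed by
    the Euler contraction. *)
Lemma hamil_ebrk m xi k : vfield 1 m -> lR 1 m om = 0 -> vfield k xi -> lR k xi om = 0 ->
  lR 1 m (hamil k xi) = hamil (1 + k) (ebrk 1 k m xi).
Proof.
move=> Hm Lm Hx Lx; have Hb := vfield_ebrk Hm Hx; have He := vfield_euler K V.
have Lb : lR (1 + k) (ebrk 1 k m xi) om = 0.
  by rewrite -lR_lR // Lm Lx (lin0 (lR_lin Hm)) (lin0 (lR_lin Hx)) scaler0 subr0.
apply/eqP; rewrite -subr_eq0; apply/eqP/poincare0.
  have -> : dR (lR 1 m (hamil k xi)  - hamil (1 + k) (ebrk 1 k m xi)) =
     dR (lR 1 m (hamil k xi)) - dR (hamil (1 + k) (ebrk 1 k m xi)) by exact: (linB dR_lin).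
  rewrite (dR_hamil Hb Lb) -(lR_cR om Hm Hx) Lm (lin0 (cR_lin Hx)) scaler0 subr0.
  have -> : dR (lR 1 m (hamil k xi)) = - lR 1 m (dR (hamil k xi)).
    by rewrite lR_dR // ksgn1 scaleN1r opprK.
  rewrite dR_hamil // (linZ (lR_lin Hm)) -(addrA 1 k w) (ksgnD K 1 (k + w)) ksgn1.
  by rewrite mulN1r scaleNr opprK addNr.
have -> : cR 0 euler (lR 1 m (hamil k xi) - hamil (1 + k) (ebrk 1 k m xi)) =
   cR 0 euler (lR 1 m (hamil k xi)) - cR 0 euler (hamil (1 + k) (ebrk 1 k m xi)).
  exact: (linB (cR_lin He)).
rewrite (cR_form0 He (hamil_form Hb)) subr0.
(* The Euler contraction of the Lie derivative is obtained from the Cartan relation, in which all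
   other terms contract a 0-form. *)
have := lR_cR (hamil k xi) Hm He.
rewrite (cR_form0 He (hamil_form Hx)) (lin0 (lR_lin Hm)) (cR_form0 (vfield_ebrk Hm He) (hamil_form Hx)).
by rewrite sub0r mul1r sub0r ksgnN ksgn1 scaleN1r opprK.
Qed.

(** If om = 0 then [Phi] is zero, and its injectivity identifies the Euler field with its double.
    This settles the case in which invariance of om carries no information about a pullback. *)
Lemma om0_trivial : om = 0 -> forall u : pcar R, u = 0.
Proof.
move=> om0 u; have He := vfield_euler K V; have He2 := vfieldD He He.
have e : euler = fun y => euler y + euler y.
  by apply: (Phi_inj He He2); rewrite om0 (lin0 (cR_lin He)) (lin0 (cR_lin He2)).
have O0 : forall z : pcar O, z = 0.
  by apply: trivial_O => y; apply: (addrI (euler y)); rewrite addr0 {3}e.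
apply: (R_ext gR (f := id) (h := fun=> 0)); [exact: clin_id|exact: clin0|].
by move=> d n p z d' n' p' z' _ _; rewrite [z]O0 (lin0 (tR_l _)).
Qed.

Lemma lO_dd k xi z : vfield k xi -> lO k xi (ddO z) = ksgn K k *: ddO (lO k xi z).
Proof.
move=> Hx; have [L1 L2 L3] := lie_derO Hx; have [[Dl _] _ _] := dd_der; have [[Ll _] _ _] := L1.
have H := der_ext (der_sbr L1 dd_der) (der0 K V (k + 1)).
apply/eqP; rewrite -subr_eq0 -[X in ksgn K X]mulr1; apply/eqP; apply: H => y; rewrite /sbr mulr1.
  by rewrite dd_in L3 L2 dd_in subrr.
by rewrite dd_d (lin0 Ll) L3 (linZ Dl) dd_d !scaler0 subrr.
Qed.

Lemma in_homog j y : homog j y -> homog j (inO y).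
Proof.
move=> [x [Mx -> Hx]]; rewrite in_cls //; exists (inl0 x); split=> //; first exact: pmem_inl.
by case=> s /=; [exact: Hx|exact: gpart0].
Qed.

Lemma dO_homog j y : homog j y -> homog (j + 1) (dO y).
Proof. by move=> /in_homog Hy; rewrite -dd_in; have [_ Dh _] := dd_der; exact: Dh. Qed.

(** The 2 is the weight of a 2-form of order zero; contractions with fields only add the weight that
    the field raises. *)
Lemma hamil_raises k r xi : ordge 2 om -> vfield k xi -> raises r xi -> ordge (2 + r)%N (hamil k xi).
Proof.
move=> o2 Hx Hr; have := cR_raises Hx Hr o2; rewrite /hamil; move: (cR k xi om) => u Hu.
apply: ordgeZ; apply/(ordgeP gR) => n nr; rewrite (wpart_wscale gR) cR_euler_wpart.
by rewrite (ordge_comp0 gR Hu n nr) (lin0 (cR_lin (vfield_euler K V))) scaler0.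
Qed.

Lemma hamil_shifts k r xi : ordr 2 om -> vfield k xi -> shifts r xi -> ordr (2 + r)%N (hamil k xi).
Proof.
move=> o2 Hx Hr; have Hu := cR_euler_shifts (cR_shifts Hx Hr o2); rewrite addn0 in Hu.
by apply: ordrZ; rewrite (wscale_ordr gR _ Hu); exact: ordrZ.
Qed.

(** [eta] is the leading component of [xi], so L_eta om is the component of weight 2 + r of L_xi
    om. *)
Lemma lie_lead k r xi eta : ordr 2 om -> vfield k xi -> vfield k eta -> shifts r eta ->
  raises r.+1 (fun x => xi x - eta x) -> lR k xi om = 0 -> lR k eta om = 0.
Proof.
move=> o2 Hx He Hs Hr Lx; have Hd := vfieldB Hx He.
have H1 := lR_raises Hd Hr (ordr_ordge gR o2); have H2 := lR_shifts He Hs o2.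
rewrite (lR_B om Hx He) Lx sub0r in H1.
have := ordge_comp0 gR H1 (2 + r)%N; rewrite (linN (comp_lin gR _)) (ordr_fix gR H2).
by move=> h; apply: oppr_inj; rewrite oppr0 h //; lia.
Qed.

End Cartan.

Lemma telescope7 (U : zmodType) (t1 t2 t3 t4 t5 t6 t7 : U) :
  t1 - t5 - (t4 + t7) = t1 - t2 - t3 + (t3 - t4) + (t2 - t5 - t6 + (t6 - t7)).
Proof.
rewrite -[t1 - t2 - t3]addrA.
have -> : t1 + (- t2 - t3) + (t3 - t4) = t1 - t2 - t4.
  by rewrite addrA -[t1 + (- t2 - t3) + t3]addrA subrK.
have -> : t2 - t5 - t6 + (t6 - t7) = t2 - t5 - t7 by rewrite addrA subrK.
by rewrite opprD !addrA [t1 - t2 - t4]addrAC subrK [t1 - t5 - t4]addrAC.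
Qed.

(** * Homomorphisms of the de Rham algebra and their leading terms *)

Section Morphisms.
Variables (K : evenRing) (V : fgmod).
Notation W := (susp_dual K V).
Notation lW := (lalg W).
Notation O := (Om W).
Notation R := (DR W).
Notation g := (pcar lW).
Notation brkg := (@brk K W).
Notation brkO := (@brkOm K W).
Notation inO := (@inOm K W).
Notation dO := (@dOm K W).
Notation tR := (@tensDR K W).
Notation gO := (@O_graded K V).
Notation gR := (@R_graded K V).
Notation derO := (@derOm K W).
Implicit Types (F G : pcar O -> pcar O) (xi : g -> g) (x y : g).

Lemma in_brk x y : inO (brkg x y) = brkO (inO x) (inO y).
Proof.
have [a Ma ->] := clsW x; have [b Mb ->] := clsW y.
have Mab := lalg_brk Ma Mb; rewrite (brk_cls Ma Mb) (in_cls Mab) (in_cls Ma) (in_cls Mb).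
rewrite brkOm_cls; [|exact: pmem_inl|exact: pmem_inl].
have f (z : seq (sym W) -> K) : (inl0 z : sym O -> K) \o inr = fun=> 0 by apply: funext => i.
congr cls; apply: funext => -[s|s] //=; rewrite !f (split_0r (@act_split K V)).
rewrite (split_0l (brk0_split (fun=> 1%N))) (kswapE (@wdg K (sOm1 W)) (@wdg K W) (@act K W)).
have par0 c : par (@wdg K (sOm1 W)) c (fun=> 0) = fun=> 0.
  by apply: funext => i; rewrite /par; case: ifP.
by rewrite !par0 !(split_0r (@act_split K V)) !addr0 subr0.
Qed.

Lemma O_raises (f : pcar O -> pcar O) r : clinear f ->
  (forall d n p u, omon d n p u -> ordge (n + r)%N (f u)) -> raises r f.
Proof.
move=> fc H; apply: (raisesP gO gO fc) => n u Hu; have [fl _] := fc.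
have [l [Hl El]] := wpart_omon n u; rewrite -(ordr_fix gO Hu) El (lin_sum fl).
apply: ordge_sum => t /Hl[d [p Ht]]; rewrite (linZ fl); apply: ordgeZ; exact: H Ht.
Qed.

Lemma R_raises (f : pcar R -> pcar R) r : clinear f ->
  (forall d n p u d' n' p' v, omon d n p u -> omon d' n' p' v ->
    ordge (n + n' + r)%N (f (tR u v))) -> raises r f.
Proof.
move=> fc H; apply: (raisesP gR gR fc) => n u Hu; have [fl _] := fc.
rewrite -(ordr_fix gR Hu); have [z Mz ->] := clsW u; rewrite wpart_cls_R // (lin_sum fl).
apply: ordge_sum => q /FR_omon[c [d [m [p [u1 [d' [m' [p' [v1 [_ Hu1 Hv1 -> [_ <- _]]]]]]]]]]].
by rewrite !(linZ fl); do 2 apply: ordgeZ; exact: H Hu1 Hv1.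
Qed.

Lemma der0_brk D u v : derO 0 D -> D (brkO u v) = brkO (D u) v + brkO u (D v).
Proof.
move=> [Dc _ Db]; apply: (O_ext gO (f := fun u => D (brkO u v))
  (h := fun u => brkO (D u) v + brkO u (D v))) => [||d n p {}u Hu].
- exact: clin_comp Dc (brkO_clinl v).
- by apply: clinD; [exact: clin_comp (brkO_clinl v) Dc|exact: brkO_clinl].
by rewrite (Db d) ?mul0r ?ksgn0 ?scale1r //; exact: omon_homog Hu.
Qed.

Lemma leib0_tR D E u v : derO 0 D -> leib 0 D E -> E (tR u v) = tR (D u) v + tR u (D v).
Proof.
move=> [Dc _ _] [Ec HE]; apply: (O_ext gR (f := fun u => E (tR u v))
  (h := fun u => tR (D u) v + tR u (D v))) => [||d n p {}u Hu].
- exact: clin_comp Ec (tR_clinl v).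
- by apply: clinD; [exact: clin_comp (tR_clinl v) Dc|exact: tR_clinl].
by rewrite (HE d) ?mul0r ?ksgn0 ?scale1r //; exact: omon_homog Hu.
Qed.

Definition ohom F := clinear F /\ forall u v, F (brkO u v) = brkO (F u) (F v).

Lemma ohom_homog F : ohom F -> (forall j y, homog j y -> homog j (F (inO y))) ->
  (forall j y, homog j y -> homog (j + 1) (F (dO y))) ->
  forall d n p u, omon d n p u -> homog d (F u).
Proof.
move=> [_ Fb] Hi Hd d n p u; elim=> [d1 n1 y Hy|d1 n1 y Hy|d1 n1 p1 u1 d2 n2 p2 u2 _ H1 _ H2].
- by apply: Hi; exact: pure_homog Hy.
- by apply: Hd; exact: pure_homog Hy.
- by rewrite Fb; exact: brkOm_homog.
Qed.

Lemma ohom_raises1 F : ohom F -> (forall n y, ordr n y -> ordge n.+1 (F (inO y) - inO y)) ->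
  (forall n y, ordr n y -> ordge n.+1 (F (dO y) - dO y)) -> raises 1 (fun u => F u - u).
Proof.
move=> [Fc Fb] Hi Hd; apply: O_raises; first exact: clinB Fc (clin_id _).
move=> d n p u; elim=> [d1 n1 y Hy|d1 n1 y Hy|d1 n1 p1 u1 d2 n2 p2 u2 H1 IH1 H2 IH2].
- by rewrite addn1; apply: Hi; exact: pure_ordr Hy.
- by rewrite addn1; apply: Hd; exact: pure_ordr Hy.
have -> : F (brkO u1 u2) - brkO u1 u2 =
    brkO (F u1 - u1) (F u2 - u2) + brkO (F u1 - u1) u2 + brkO u1 (F u2 - u2).
  rewrite Fb (linB (@brkOm_r K V (F u1 - u1)) (F u2) u2) subrK.
  rewrite (linB (brkOm_l (F u2)) (F u1) u1) (linB (@brkOm_r K V u1) (F u2) u2).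
  by rewrite addrA subrK.
apply: ordgeD; first apply: ordgeD.
- by apply: (ordge_le gO _ (brkOm_ordge IH1 IH2)); lia.
- by apply: (ordge_le gO _ (brkOm_ordge IH1 (ordr_ordge gO (omon_ordr H2)))); lia.
- by apply: (ordge_le gO _ (brkOm_ordge (ordr_ordge gO (omon_ordr H1)) IH2)); lia.
Qed.

(* [D] is the leading term of [F - G]. As [F] and [G] are the identity to leading
   order, [F u * F v - G u * G v] agrees to leading order with the Leibniz rule. *)
Section Difference.
Variables (r : nat) (F G D : pcar O -> pcar O) (E E' L : pcar R -> pcar R).
Hypothesis FH : ohom F.
Hypothesis GH : ohom G.
Hypothesis F1 : raises 1 (fun u => F u - u).
Hypothesis G1 : raises 1 (fun u => G u - u).
Hypothesis DH : derO 0 D.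
Hypothesis Ds : shifts r D.

Let bil_diff (P : pmod K) (b : pcar O -> pcar O -> pcar P) u v n m (gP : graded P) :
  (forall v, linear (b^~ v)) -> (forall u, linear (b u)) ->
  (forall i j u v, ordge i u -> ordge j v -> ordge (i + j)%N (b u v)) ->
  ordr n u -> ordr m v ->
  ordge (n + r.+1)%N (F u - G u - D u) -> ordge (m + r.+1)%N (F v - G v - D v) ->
  ordge (n + m + r.+1)%N (b (F u) (F v) - b (G u) (G v) - (b (D u) v + b u (D v))).
Proof.
move=> bl br bo Hu Hv Eu Ev.
have gu := ordr_ordge gO Hu; have gv := ordr_ordge gO Hv.
have F1v := F1 gv; have G1u := G1 gu.
(* Four error terms, each with one factor of excess weight: a remainder of F - G - D, or F v - v, or
   G u - u. *)
have -> : b (F u) (F v) - b (G u) (G v) - (b (D u) v + b u (D v)) =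
   b (F u - G u - D u) (F v) + b (D u) (F v - v) +
   (b (G u) (F v - G v - D v) + b (G u - u) (D v)).
  rewrite !(linB (bl _)) !(linB (br _)).
  move: (b (F u) (F v)) (b (G u) (F v)) (b (D u) (F v)) (b (D u) v) (b (G u) (G v))
    (b (G u) (D v)) (b u (D v)) => t1 t2 t3 t4 t5 t6 t7.
  exact: telescope7.
have FV : ordge m (F v) by rewrite -[F v](subrK v); apply: ordgeD => //; apply: (ordge_le gO _ F1v); lia.
have GU : ordge n (G u) by rewrite -[G u](subrK u); apply: ordgeD => //; apply: (ordge_le gO _ G1u); lia.
have DU : ordge (n + r)%N (D u) by apply: (ordr_ordge gO); exact: Ds.
have DV : ordge (m + r)%N (D v) by apply: (ordr_ordge gO); exact: Ds.
apply: ordgeD; apply: ordgeD.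
- by apply: (ordge_le gP _ (bo _ _ _ _ Eu FV)); lia.
- by apply: (ordge_le gP _ (bo _ _ _ _ DU F1v)); lia.
- by apply: (ordge_le gP _ (bo _ _ _ _ GU Ev)); lia.
- by apply: (ordge_le gP _ (bo _ _ _ _ G1u DV)); lia.
Qed.

Lemma diff_raises : (forall n y, ordr n y -> ordge (n + r.+1)%N (F (inO y) - G (inO y) - D (inO y))) ->
  (forall n y, ordr n y -> ordge (n + r.+1)%N (F (dO y) - G (dO y) - D (dO y))) ->
  raises r.+1 (fun u => F u - G u - D u).
Proof.
move=> Hi Hd; have [Fc Fb] := FH; have [Gc Gb] := GH; have [Dc _ _] := DH.
apply: O_raises; first exact: clinB (clinB Fc Gc) Dc.
move=> d n p u; elim=> [d1 n1 y Hy|d1 n1 y Hy|d1 n1 p1 u1 d2 n2 p2 u2 H1 IH1 H2 IH2].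
- by apply: Hi; exact: pure_ordr Hy.
- by apply: Hd; exact: pure_ordr Hy.
rewrite Fb Gb (der0_brk _ _ DH).
apply: (bil_diff gO _ _ _ (omon_ordr H1) (omon_ordr H2) IH1 IH2).
- exact: brkOm_l.
- exact: brkOm_r.
- by move=> *; exact: brkOm_ordge.
Qed.

Lemma diff_raisesR : clinear E -> clinear E' -> (forall u v, E (tR u v) = tR (F u) (F v)) ->
  (forall u v, E' (tR u v) = tR (G u) (G v)) -> leib 0 D L ->
  raises r.+1 (fun u => F u - G u - D u) -> raises r.+1 (fun u => E u - E' u - L u).
Proof.
move=> Ec Ec' HE HE' LH H; have [Lc _] := LH.
apply: R_raises; first exact: clinB (clinB Ec Ec') Lc.
move=> d n p u d' n' p' v Hu Hv; rewrite HE HE' (leib0_tR _ _ DH LH).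
apply: (bil_diff gR _ _ _ (omon_ordr Hu) (omon_ordr Hv)).
- exact: tR_l.
- exact: tR_r.
- by move=> *; exact: tR_ordge.
- by apply: (H n); exact: (ordr_ordge gO (omon_ordr Hu)).
- by apply: (H n'); exact: (ordr_ordge gO (omon_ordr Hv)).
Qed.
End Difference.
End Morphisms.

(** * Diffeomorphisms and pullbacks *)

Section Diffeomorphisms.
Variables (K : evenRing) (V : fgmod).
Notation W := (susp_dual K V).
Notation lW := (lalg W).
Notation g := (pcar lW).
Notation gg := (@lW_graded K V).
Notation finv := (@Defs.finv K W).
Implicit Types (f h xi : g -> g) (x y : g).

Lemma finvP f : diffeo f -> [/\ lie_hom (finv f), cancel f (finv f) & cancel (finv f) f].
Proof.
move=> [fH [h hH [fh hf]]].
have [c1 c2] : cancel f (finv f) /\ cancel (finv f) f.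
  by apply: (xgetPex (fun=> 0) (P := [set h | cancel f h /\ cancel h f])); exists h.
have -> : finv f = h by apply: funext => x; rewrite -{1}[x]hf c1.
by split=> //; exact: hH.
Qed.

Lemma pointed_raises f : pointed f -> raises 1 (fun x => f x - x).
Proof.
move=> [f_ [Hf cv]] i u Hu; apply/(ordgeP gg) => k ki.
have [N HN] := proj1 (convergesP gg _ _) (cv u) k.
rewrite (linB (comp_lin gg k)) -(HN N (leqnn N)) -(linB (comp_lin gg k)) addrAC subrr add0r.
move: k ki {HN}; apply: (ordge_comp0 gg); rewrite big_nat_cond.
apply: (big_ind (fun v => ordge (i + 1)%N v)) => [|v v' Hv Hv'|t /andP[/andP[t2 _] _]].
- exact: ordge00.
- exact: ordgeD.
have [fc fo] := Hf t t2.
apply: (raises_le gg (_ : (1 <= t.-1)%N) _ Hu); first by lia.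
apply: (shifts_raises gg gg fc) => j v Hv; have := fo j v Hv.
by have -> : (j + t).-1 = (j + t.-1)%N by lia.
Qed.

Section Inverse.
Variables (f h : g -> g).
Hypothesis fh : cancel h f.
Hypothesis f1 : raises 1 (fun x => f x - x).

(** The inverse as a fixed point: the correction involves only components of [h x] of smaller
    weight, so [h x] is controlled by induction on the weight. *)
Let subl x : h x = x - (f (h x) - h x).
Proof. by rewrite fh opprB addrC subrK. Qed.

Lemma inv_raises0 : raises 0 h.
Proof.
move=> i x Hx; rewrite addn0; have H j : (j <= i)%N -> ordge j (h x).
  elim: j => [_|j IH ji]; first exact: (ordge0 gg).
  rewrite subl; apply: ordgeB; first exact: (ordge_le gg ji Hx).
  by rewrite -addn1; apply: f1; apply: IH; exact: ltnW.
exact: H.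
Qed.

Lemma inv_homog : linear f -> (forall j x, homog j x -> homog j (f x)) ->
  forall j x, homog j x -> homog j (h x).
Proof.
move=> fl fhm j x Hx; apply: homog_glue => n.
elim/ltn_ind: n => n IH; rewrite subl (linB (comp_lin gg n)).
apply: homogB; first exact: homog_wpart.
set t := trunc n (h x).
have Ht : homog j t by apply: supp_sum => [i|i a b Ha Hb|k _]; [exact: gpart0|exact: gpartB|exact: IH].
have -> : wpart n (f (h x) - h x) = wpart n (f t - t).
  have := f1 (trunc_ordge gg n (h x)); rewrite -/t addn1 (linB fl) => /(ordge_comp0 gg) /(_ n (ltnSn n)) H.
  apply/eqP; rewrite -subr_eq0 -(linB (comp_lin gg n)); apply/eqP; rewrite -[RHS]H; congr wpart.
  by rewrite !opprB addrACA [in RHS]addrACA; congr (_ + _); rewrite addrC.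
by apply: homog_wpart; apply: homogB => //; exact: fhm.
Qed.
End Inverse.

Lemma vfield_conj k f h xi : lie_hom f -> lie_hom h -> cancel h f ->
  (forall j x, homog j x -> homog j (f x)) -> (forall j x, homog j x -> homog j (h x)) ->
  vfield k xi -> vfield k (fun x => f (xi (h x))).
Proof.
move=> [fc fb] [hc hb] fh fhm hhm [xc xh xd]; split=> [|j x Hx|j x y Hx].
- exact: clin_comp fc (clin_comp xc hc).
- by apply: fhm; apply: xh; exact: hhm.
have [fl _] := fc; rewrite hb (xd j _ _ (hhm _ _ Hx)) (linD fl) (linZ fl) !fb.
by rewrite !fh.
Qed.
End Diffeomorphisms.

Section Pullbacks.
Variables (K : evenRing) (V : fgmod).
Notation W := (susp_dual K V).
Notation lW := (lalg W).
Notation O := (Om W).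
Notation R := (DR W).
Notation g := (pcar lW).
Notation brkg := (@brk K W).
Notation brkO := (@brkOm K W).
Notation inO := (@inOm K W).
Notation dO := (@dOm K W).
Notation tR := (@tensDR K W).
Notation gO := (@O_graded K V).
Notation gR := (@R_graded K V).
Notation gg := (@lW_graded K V).
Notation ddO := (@dd K W).
Notation lO := (@lieOm K W).
Notation pO := (@pullOm K W).
Notation pR := (@pullDR K W).
Variables (w : int) (om : pcar R).
Hypothesis omS : symplectic_form w om.
Implicit Types (f phi xi gam : g -> g) (x y : g).

Definition pullback f F := [/\ clinear F, forall z z', F (brkO z z') = brkO (F z) (F z'),
    forall x, F (inO x) = inO (f x) & forall z, F (ddO z) = ddO (F z)].

Lemma pullback_d f F y : pullback f F -> F (dO y) = dO (f y).
Proof. by case=> _ _ Fi Fd; rewrite -!(dd_in omS) Fd Fi. Qed.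

Lemma pullback_uniq f F F' : pullback f F -> pullback f F' -> F = F'.
Proof.
move=> HF HF'; have [Fc Fb Fi _] := HF; have [Fc' Fb' Fi' _] := HF'.
apply: funext; apply: (O_ext gO Fc Fc') => d n p u; elim=> [d1 n1 y _|d1 n1 y _|*].
- by rewrite Fi Fi'.
- by rewrite (pullback_d _ HF) (pullback_d _ HF').
- by rewrite Fb Fb'; congr brkO.
Qed.

Lemma pullOmE f F : pullback f F -> pO f = F.
Proof.
move=> HF; have H : pullback f (pO f).
  by apply: (xgetPex (fun=> 0) (P := [set F | pullback f F])); exists F; exact: HF.
exact: pullback_uniq H HF.
Qed.

Lemma pullDRE f F (E : pcar R -> pcar R) : pullback f F -> clinear E ->
  (forall u v, E (tR u v) = tR (F u) (F v)) -> pR f = E.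
Proof.
move=> HF Ec HE; have eF := pullOmE HF.
have [Ec' HE'] : clinear (pR f) /\ forall u v, pR f (tR u v) = tR (pO f u) (pO f v).
  apply: (xgetPex (fun=> 0) (P := [set E | clinear E /\ forall u v,
    E (tR u v) = tR (pO f u) (pO f v)])).
  by exists E; rewrite eF.
by apply: funext; apply: (R_ext gR Ec' Ec) => d n p u d' n' p' v _ _; rewrite HE' eF HE.
Qed.

(** If either pullback operator were the default zero map, invariance of om would read 0 = om. *)
Lemma symplecto_spec phi : symplecto om phi -> om <> 0 ->
  [/\ pullback phi (pO phi), clinear (pR phi) & forall u v, pR phi (tR u v) = tR (pO phi u) (pO phi v)].
Proof.
move=> [_ _ po] om0.
have [Ec HE] : clinear (pR phi) /\ forall u v, pR phi (tR u v) = tR (pO phi u) (pO phi v).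
  move: po; rewrite /pullDR; case: xgetP => [E _ HE _|_ e]; first exact: HE.
  by case: om0; rewrite -e.
have [[F HF]|N] := pselect (exists F, pullback phi F); first by split=> //; rewrite (pullOmE HF).
have p0 : pO phi = fun=> 0 by apply: xgetPN => F HF; apply: N; exists F; exact: HF.
case: om0; rewrite -po; apply: (R_ext gR Ec (clin0 _ _)) => d n p u d' n' p' v _ _.
by rewrite HE p0 (lin0 (tR_l _)).
Qed.

Lemma pullback_homog phi F : pullback phi F -> (forall j x, homog j x -> homog j (phi x)) ->
  forall d n p u, omon d n p u -> homog d (F u).
Proof.
move=> HF hm; have [Fc Fb Fi Fd] := HF; apply: (ohom_homog (conj Fc Fb)) => j y Hy.
  by rewrite Fi; apply: in_homog; exact: hm.
by rewrite (pullback_d _ HF); apply: (dO_homog omS); exact: hm.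
Qed.

(** The pullback along phi intertwines the Lie derivatives along m and along its conjugate, as is
    seen on generators; evaluating at the invariant form om gives the claim. *)
Lemma symplectic_conj phi h k m : symplecto om phi -> cancel phi h ->
  vfield k m -> lR k m om = 0 -> vfield k (fun x => phi (m (h x))) ->
  lR k (fun x => phi (m (h x))) om = 0.
Proof.
move=> Hphi hphi Hm Lm HN; have [om0|om0] := pselect (om = 0).
  by rewrite om0 (lin0 (lR_lin omS HN)).
have [HF Ec HE] := symplecto_spec Hphi om0; have [Fc Fb Fi Fd] := HF.
have [_ hm po] := Hphi; have Fh := pullback_homog HF hm; have [El _] := Ec.
have [[Lc Lh Lb] L2 L3] := lie_derO omS Hm; have [[Nc Nh Nb] N2 N3] := lie_derO omS HN.
have [Fl _] := Fc.
have comm : forall z, pO phi (lO k m z) = lO k (fun x => phi (m (h x))) (pO phi z).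
  apply: (O_ext gO (clin_comp Fc Lc) (clin_comp Nc Fc)) => d n p u.
  elim=> [d1 n1 y _|d1 n1 y _|d1 n1 p1 u1 d2 n2 p2 u2 H1 IH1 H2 IH2].
  - by rewrite L2 !Fi N2 hphi.
  - by rewrite L3 (linZ Fl) !(pullback_d _ HF) N3 hphi.
  rewrite (Lb d1) ?(linD Fl) ?(linZ Fl) ?Fb; last exact: omon_homog H1.
  by rewrite (Nb d1) ?IH1 ?IH2 //; exact: Fh H1.
have [[Mc HM] _] := lR_leib omS Hm; have [[Pc HP] _] := lR_leib omS HN.
have := R_ext gR (clin_comp Ec Mc) (clin_comp Pc Ec) _ om => /= H.
rewrite -[in LHS]po -H ?Lm ?(lin0 El) // => d n p u d' n' p' v Hu Hv.
rewrite (HM d); last exact: omon_homog Hu.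
rewrite (linD El) (linZ El) !HE (HP d); last exact: Fh Hu.
by rewrite !comm.
Qed.

Section Exponential.
Variable gam : g -> g.
Hypothesis Hg : vfield 0 gam.
Hypothesis g1 : raises 1 gam.

Let gl : linear gam. Proof. by have [[]] := Hg. Qed.
Let Lspec := lie_derO omS Hg.
Let Ll : linear (lO 0 gam). Proof. by have [[[]]] := Lspec. Qed.
Let L1 : raises 1 (lO 0 gam). Proof. exact: (lO_raises omS Hg g1). Qed.

Lemma expo_in y : expo (lO 0 gam) (inO y) = inO (expo gam y).
Proof.
have [_ Li _] := Lspec.
rewrite (@expo_inter K lW O gam (lO 0 gam) inO y) //; try exact: lW_graded; try exact: O_graded.
- exact: in_lin.
- by move=> n v; rewrite in_wpart.
Qed.

Lemma expo_dd z : expo (lO 0 gam) (ddO z) = ddO (expo (lO 0 gam) z).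
Proof.
have [[Dc _] _ _] := dd_der omS.
rewrite (@expo_inter K O O (lO 0 gam) (lO 0 gam) ddO z) //; try exact: O_graded.
- move=> n v; have [Dc' _ _] := dd_der omS.
  by rewrite (shifts_comp gO gO Dc' (dd_shifts omS)) subn0.
- by move=> v; rewrite (lO_dd omS _ Hg) ksgn0 scale1r.
Qed.

Lemma expo_brkO u v : expo (lO 0 gam) (brkO u v) = brkO (expo (lO 0 gam) u) (expo (lO 0 gam) v).
Proof.
have [LD _ _] := Lspec.
apply: (@expo_bil K O O O) => //; try exact: O_graded.
- exact: brkOm_l.
- exact: brkOm_r.
- by move=> *; exact: brkOm_ordge.
- by move=> *; exact: der0_brk.
Qed.

Lemma expo_tR u v : expo (lR 0 gam) (tR u v) = tR (expo (lO 0 gam) u) (expo (lO 0 gam) v).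
Proof.
have [LD _ _] := Lspec; have [E1 _] := lR_leib omS Hg.
apply: (@expo_bil K O O R) => //; try exact: O_graded; try exact: R_graded.
- exact: lR_lin omS _ _ Hg.
- exact: lR_raises omS _ _ _ Hg g1.
- exact: tR_l.
- exact: tR_r.
- by move=> *; exact: tR_ordge.
- by move=> *; exact: leib0_tR.
Qed.

(** Transported from the de Rham algebra, where it holds for the exponential of the Lie derivative,
    along the injection of the Lie algebra. *)
Lemma expo_brk x y : expo gam (brkg x y) = brkg (expo gam x) (expo gam y).
Proof.
apply/eqP; rewrite -subr_eq0; apply/eqP/in_inj.
by rewrite (linB (@in_lin K V)) -expo_in !in_brk expo_brkO !expo_in subrr.
Qed.

Lemma expo_lie_hom : lie_hom (expo gam).
Proof. by split; [exact: expo_clin gg gl g1|exact: expo_brk]. Qed.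

Lemma expo_homog j x : homog j x -> homog j (expo gam x).
Proof.
have [_ gh _] := Hg; apply: (expo_supp gg g1) => [i|i a b|i c a|v Hv].
- exact: gpart0.
- exact: gpartB.
- exact: gpart0M.
- by have := gh j v Hv; rewrite addr0.
Qed.

Lemma pullback_expo phi F : pullback phi F -> pullback (fun x => expo gam (phi x))
  (fun z => expo (lO 0 gam) (F z)).
Proof.
move=> [Fc Fb Fi Fd]; split=> [|z z'|x|z].
- exact: clin_comp (expo_clin gO Ll L1) Fc.
- by rewrite Fb expo_brkO.
- by rewrite Fi expo_in.
- by rewrite Fd expo_dd.
Qed.

Lemma pullback_expor phi F : pullback phi F -> pullback (fun x => phi (expo gam x))
  (fun z => F (expo (lO 0 gam) z)).
Proof.
move=> [Fc Fb Fi Fd]; split=> [|z z'|x|z].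
- exact: clin_comp Fc (expo_clin gO Ll L1).
- by rewrite expo_brkO Fb.
- by rewrite expo_in Fi.
- by rewrite expo_dd Fd.
Qed.
End Exponential.

(** The pullback along exp(gam) is the exponential of L_gam, which fixes om because L_gam om = 0;
    exp(-gam) supplies the inverse. *)
Lemma symplecto_expo gam phi : vfield 0 gam -> raises 1 gam -> lR 0 gam om = 0 ->
  symplecto om phi -> symplecto om (fun x => expo gam (phi x)).
Proof.
move=> Hg g1 Lg Hphi; have [df hm po] := Hphi; have [gl _] : clinear gam by have [] := Hg.
split.
- have [[hc hb] c1 c2] := finvP df; have [[fc fb] _] := df.
  have [ec eb] := expo_lie_hom Hg g1.
  have Hg' : vfield 0 (fun x => - gam x).
    have := vfieldB (vfield0 K V 0) Hg; congr vfield; apply: funext => x; exact: sub0r.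
  have g1' : raises 1 (fun x => - gam x).
    by move=> i u Hu; rewrite -sub0r; apply: ordgeB; [exact: ordge00|exact: g1].
  have [ec' eb'] := expo_lie_hom Hg' g1'.
  split; first by split=> [|x y]; [exact: clin_comp ec fc|rewrite fb eb].
  exists (fun x => Defs.finv phi (expo (fun x => - gam x) x)).
    by split=> [|x y]; [exact: clin_comp hc ec'|rewrite eb' hb].
  split=> x; first by rewrite (expo_inv (phi x) gg gl g1) c1.
  rewrite c2; have [gl' _] : clinear (fun x => - gam x) by have [] := Hg'.
  have := expo_inv x gg gl' g1'; congr (expo _ _ = _); apply: funext => y; exact: opprK.
- by move=> j x Hx; apply: (expo_homog Hg g1); exact: hm.
have [om0|om0] := pselect (om = 0).
  by rewrite [LHS](om0_trivial omS om0) om0.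
have [HF Ec HE] := symplecto_spec Hphi om0.
have Rl := lR_lin omS Hg; have R1 := lR_raises omS Hg g1.
rewrite (pullDRE (E := fun u => expo (lR 0 gam) (pR phi u)) (pullback_expo Hg g1 HF)).
- by rewrite po (expo_fix gR Rl R1).
- exact: clin_comp (expo_clin gR Rl R1) Ec.
- by move=> u v; rewrite HE (expo_tR Hg g1).
Qed.

(** Both phi and phi' exp(f) preserve om, while the difference of their pullbacks is L_del to
    leading order. In weight 2 + r this leaves L_del om = 0. *)
Lemma symplectic_diff r phi phi' f del : ordr 2 om -> symplecto om phi -> symplecto om phi' ->
  raises 1 (fun x => phi x - x) -> raises 1 (fun x => phi' x - x) ->
  vfield 0 f -> raises 1 f -> lR 0 f om = 0 -> vfield 0 del -> shifts r del ->
  raises r.+1 (fun x => phi x - phi' (expo f x) - del x) -> lR 0 del om = 0.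
Proof.
move=> o2 Hphi Hphi' p1 p1' Hf f1 Lf Hd ds dr.
have [om0|om0] := pselect (om = 0); first by rewrite om0 (lin0 (lR_lin omS Hd)).
have [fl _] : clinear f by have [] := Hf.
have [HF Ec HE] := symplecto_spec Hphi om0; have [HG Ec' HE'] := symplecto_spec Hphi' om0.
have HG' := pullback_expor Hf f1 HG.
have [Fc Fb Fi _] := HF; have [Gc Gb Gi _] := HG'.
have [DD D2 D3] := lie_derO omS Hd.
have [_ _ po] := Hphi; have [_ _ po'] := Hphi'.
have e1 : raises 1 (fun x => phi' (expo f x) - x).
  move=> i x Hx; have := p1' _ _ (expo_raises0 gg f1 Hx); have := expo_raises1 gg f1 Hx.
  rewrite addn0 => H1 H2; have := ordgeD H2 H1; by rewrite addrA subrK.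
have hom1 psi P : pullback psi P -> raises 1 (fun x => psi x - x) -> raises 1 (fun z => P z - z).
  move=> HP q1; have [Pc Pb Pi _] := HP; apply: (ohom_raises1 (conj Pc Pb)) => n y Hy.
    rewrite Pi -(linB (@in_lin K V)) -addn1; apply: in_ordge; apply: q1; exact: (ordr_ordge gg).
  rewrite (pullback_d _ HP) -(linB (@d_lin K V)) -addn1; apply: dO_ordge; apply: q1; exact: (ordr_ordge gg).
have F1 := hom1 phi (pO phi) HF p1.
have G1 : raises 1 (fun z => pO phi' (expo (lO 0 f) z) - z) by exact: (hom1 _ _ HG' e1).
have H := diff_raises (F := pO phi) (G := fun z => pO phi' (expo (lO 0 f) z)) (conj Fc Fb) (conj Gc Gb)
  F1 G1 DD (lO_shifts omS Hd ds).
have {}H : raises r.+1 (fun u => pO phi u - pO phi' (expo (lO 0 f) u) - lO 0 del u).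
  apply: H => n y Hy.
    rewrite Fi Gi D2 -!(linB (@in_lin K V)); apply: in_ordge; apply: dr; exact: (ordr_ordge gg).
  rewrite (pullback_d _ HF) (pullback_d _ HG') D3 ksgn0 scale1r -!(linB (@d_lin K V)).
  by apply: dO_ordge; apply: dr; exact: (ordr_ordge gg).
have Rl := lR_lin omS Hf; have R1 := lR_raises omS Hf f1; have [L1 _] := lR_leib omS Hd.
have HR := diff_raisesR (F := pO phi) (G := fun z => pO phi' (expo (lO 0 f) z)) F1 G1 DD
  (lO_shifts omS Hd ds) Ec (clin_comp Ec' (expo_clin gR Rl R1)) HE _ L1 H.
have {}HR : raises r.+1 (fun u => pR phi u - pR phi' (expo (lR 0 f) u) - lR 0 del u).
  by apply: HR => u v; rewrite (expo_tR Hf f1) HE'.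
have := HR _ _ (ordr_ordge gR o2); rewrite po (expo_fix gR Rl R1 Lf) po' subrr sub0r => H1.
have H2 := lR_shifts omS Hd ds o2.
have := ordge_comp0 gR H1 (2 + r)%N; rewrite (linN (comp_lin gR _)) (ordr_fix gR H2).
by move=> h; apply: oppr_inj; rewrite oppr0 h //; lia.
Qed.
End Pullbacks.

(** * Congruences modulo an order *)

Section Congruences.
Variables (K : evenRing) (M : pmod K).
Hypothesis gM : graded M.
Implicit Types (f h : pcar M -> pcar M) (u : pcar M) (r s : nat).

(* In the notation of the paper, [f = h mod (r + 1)]. *)
Definition mo r f h := raises r (fun u => f u - h u).

Lemma mo_refl r f : mo r f f.
Proof. by move=> i u _; rewrite subrr; exact: ordge00. Qed.

Lemma mo_sym r f h : mo r f h -> mo r h f.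
Proof. by move=> H i u /H Hu; rewrite -opprB -sub0r; apply: ordgeB => //; exact: ordge00. Qed.

Lemma mo_trans r f1 f2 f3 : mo r f1 f2 -> mo r f2 f3 -> mo r f1 f3.
Proof. by move=> H1 H2 i u Hu; have := ordgeD (H1 i u Hu) (H2 i u Hu); rewrite addrA subrK. Qed.

Lemma moD r f1 h1 f2 h2 : mo r f1 h1 -> mo r f2 h2 -> mo r (fun u => f1 u + f2 u) (fun u => h1 u + h2 u).
Proof. by move=> H1 H2 i u Hu; have := ordgeD (H1 i u Hu) (H2 i u Hu); rewrite addrACA opprD. Qed.

Lemma moB r f1 h1 f2 h2 : mo r f1 h1 -> mo r f2 h2 -> mo r (fun u => f1 u - f2 u) (fun u => h1 u - h2 u).
Proof.
move=> H1 H2 i u Hu; have := ordgeB (H1 i u Hu) (H2 i u Hu).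
by rewrite opprD addrACA -opprD.
Qed.

Lemma mo_raises r f h : mo r f h -> raises r h -> raises r f.
Proof. by move=> H1 H2 i u Hu; have := ordgeD (H1 i u Hu) (H2 i u Hu); rewrite subrK. Qed.

Lemma mo0 r f : mo r f (fun=> 0) <-> raises r f.
Proof. by split=> H i u /H; rewrite subr0. Qed.

Lemma raisesD r f h : raises r f -> raises r h -> raises r (fun u => f u + h u).
Proof. by move=> H1 H2 i u Hu; apply: ordgeD; [exact: H1|exact: H2]. Qed.

Lemma raisesB r f h : raises r f -> raises r h -> raises r (fun u => f u - h u).
Proof. by move=> H1 H2 i u Hu; apply: ordgeB; [exact: H1|exact: H2]. Qed.

Lemma raises_cmp a b r f h : (r <= a + b)%N -> raises a f -> raises b h -> raises r (fun u => f (h u)).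
Proof. by move=> rab Hf Hh; apply: (raises_le gM _ (raises_comp Hf Hh)); rewrite addnC. Qed.

Lemma mo_cmp a b c d r f f' h h' : linear f' -> (r <= a + b)%N -> (r <= c + d)%N ->
  mo a f f' -> raises b h -> raises c f' -> mo d h h' -> mo r (fun u => f (h u)) (fun u => f' (h' u)).
Proof.
move=> fl rab rcd H1 Hh Hf H2 i u Hu.
have := ordgeD (raises_cmp rab H1 Hh Hu) (raises_cmp rcd Hf H2 Hu).
by rewrite (linB fl (h u) (h' u)) addrA subrK.
Qed.

Lemma iter_raises_mul s f k : raises s f -> raises (k * s) (iter k f).
Proof.
move=> Hf; elim: k => [|k IH] i u Hu; first by rewrite mul0n addn0.
by have := Hf _ _ (IH i u Hu); rewrite -addnA -mulSnr.
Qed.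

(** From the quadratic term on, powers of [f] raise weights by at least 2s. *)
Lemma expo_mo s f : (0 < s)%N -> raises s f -> mo (2 * s) (expo f) (fun u => u + f u).
Proof.
move=> s0 Hf i u Hu; apply/(ordgeP gM) => k ki.
have f1 : raises 1 f by exact: raises_le Hf.
rewrite (linB (comp_lin gM k)) (@wpart_expo _ _ _ gM f1 k k.+2) // -(linB (comp_lin gM k)).
rewrite /expS !big_ord_recl /= fact0 -[1`!]/1%N; set S := \sum_(_ < k) _.
have -> : kinv K 1 = 1 by rewrite /kinv invr1 scale1r.
rewrite !scale1r. rewrite [u + (f u + S)]addrA [u + f u + S - _]addrAC subrr add0r; apply: (ordge_comp0 gM _ _ ki).
apply: ordge_sum => t _; apply: ordgeZ.
apply: (ordge_le gM _ (iter_raises_mul t.+2 Hf Hu)); rewrite leq_add2l leq_mul2r.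
by rewrite orbT.
Qed.

Lemma expo_comm r f h : linear f -> linear h -> raises 1 f -> raises 0 h ->
  mo r (fun u => f (h u)) (fun u => h (f u)) -> mo r (fun u => expo f (h u)) (fun u => h (expo f u)).
Proof.
move=> fl hl f1 h0 H.
have Hk k : mo r (fun u => iter k f (h u)) (fun u => h (iter k f u)).
  elim: k => [|k IH]; first exact: mo_refl.
  apply: (mo_trans (f2 := fun u => f (h (iter k f u)))).
    have c0 : raises 0 (fun u => iter k f (h u)).
      by apply: raises_cmp (leq0n _) (iter_raises f1 k) h0.
    exact: (mo_cmp fl (leq_addr _ _) (leq_addl _ _) (@mo_refl r f) c0 f1 IH).
  have hfl : linear (fun u => h (f u)) by move=> a u v; rewrite fl hl.
  have hf0 : raises 0 (fun u => h (f u)) by exact: raises_cmp (leq0n _) h0 f1.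
  exact: (mo_cmp hfl (leq_addr _ _) (leq_addl _ _) H (iter_raises f1 k) hf0 (@mo_refl r (iter k f))).
move=> i u Hu; apply/(ordgeP gM) => k ki.
have E v : ordge k.+1 (expo f v - expS f k.+1 v).
  apply/(ordgeP gM) => j jk; rewrite (linB (comp_lin gM j)) (wpart_expo gM f1 _ jk) subrr //.
rewrite (linB (comp_lin gM k)) (wpart_expo gM f1 _ (ltnSn k)).
have -> : wpart k (h (expo f u)) = wpart k (h (expS f k.+1 u)).
  apply/eqP; rewrite -subr_eq0 -(linB (comp_lin gM k)) -(linB hl); apply/eqP.
  by apply: (ordge_comp0 gM (h0 _ _ (E u))); rewrite addn0.
rewrite -(linB (comp_lin gM k)); apply: (ordge_comp0 gM _ _ ki).
rewrite /expS (lin_sum hl) -sumrB; apply: ordge_sum => t _.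
rewrite (linZ hl) -scalerBr; apply: ordgeZ; exact: Hk.
Qed.

End Congruences.

(** * Comparison of leading terms, for linear maps on a graded module *)

Section Obstruction.
Variables (K : evenRing) (M : pmod K) (n : nat).
Hypotheses (gM : graded M) (n3 : (3 <= n)%N).
Variables (m2 m m' : pcar M -> pcar M).
Hypotheses (ml : linear m) (ml' : linear m') (m2l : linear m2).
Hypotheses (m_1 : raises 1 m) (m_1' : raises 1 m') (m2_1 : raises 1 m2).
Hypotheses (m_2 : mo 2 m m2) (m_2' : mo 2 m' m2).
Implicit Types (f h phi psi gam e : pcar M -> pcar M) (u : pcar M).

Let perturb_raises0 f : raises 1 (fun u => f u - u) -> raises 0 f.
Proof.
move=> H; apply: (mo_raises (h := id)); first exact: raises_le H.
by move=> i u; rewrite addn0.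
Qed.

Lemma obs_cocycle phi h psi psin : linear phi -> linear h -> linear psi -> linear psin ->
  cancel phi h -> raises 0 phi -> raises 0 h ->
  (forall u, psi u = phi (m (h u)) - m' u) -> raises n.-1 psi -> mo n psi psin ->
  raises n.+1 (fun u => m (m u)) -> raises n.+1 (fun u => m' (m' u)) ->
  raises n.+1 (fun u => m2 (psin u) + psin (m2 u)).
Proof.
move=> pl hl sl tl ph p0 h0 sE sr st mm mm'.
pose N u := phi (m (h u)).
have NN : raises n.+1 (fun u => N (N u)).
  have -> : (fun u => N (N u)) = fun u => phi (m (m (h u))).
    by apply: funext => u; rewrite /N ph.
  apply: (raises_cmp gM (a := 0) (b := n.+1) (f := phi)) => //.
  by apply: (raises_cmp gM (a := n.+1) (b := 0) (f := fun u => m (m u))) => //; rewrite addn0.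
have Es : raises n.+1 (fun u => m' (psi u) + psi (m' u)).
  (* The expansion of N^2 with N = m' + psi. *)
  have -> : (fun u => m' (psi u) + psi (m' u)) = fun u => N (N u) - m' (m' u) - psi (psi u).
    apply: funext => u; have -> : m' u = N u - psi u by rewrite sE opprB addrC subrK.
    rewrite (linB sl) [psi (N u)]sE (linB ml') -/(N (N u)).
    move: (m' (N u)) (m' (psi u)) (N (N u)) (psi (psi u)) => a b c d.
    by rewrite opprB !addrA [b + c]addrC.
  apply: raisesB; first exact: raisesB NN mm'.
  (* psi^2 raises weights by 2(n - 1), and 2(n - 1) >= n + 1 is the bound n >= 3. *)
  by apply: (raises_cmp gM _ sr sr); lia.
apply: mo_raises Es; apply: mo_sym; apply: moD.
  by apply: (mo_cmp gM m2l _ _ m_2' sr m2_1 st); lia.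
have tr : raises n.-1 psin.
  apply: (mo_raises (h := psi)) => //; apply: mo_sym; apply: (raises_le gM _ st); lia.
by apply: (mo_cmp gM tl _ _ st m_1' tr m_2'); lia.
Qed.

(** With d = phi - phi' th, the equations for psi and psi' give psi phi - psi' phi' th = d m - m' d
    + phi'(th m - m th). The last term is negligible, d, m and m' may be replaced by del and m2, and
    precomposing psi and psi' with maps close to the identity does not change their leading
    terms. *)
Lemma obs_homotopy phi phi' th psi psi' del : linear phi -> linear phi' -> linear th ->
  linear psi -> linear psi' -> linear del ->
  (forall u, psi (phi u) = phi (m u) - m' (phi u)) ->
  (forall u, psi' (phi' u) = phi' (m u) - m' (phi' u)) ->
  raises n.-1 psi -> raises n.-1 psi' ->
  raises 1 (fun u => phi u - u) -> raises 1 (fun u => phi' u - u) -> raises 1 (fun u => th u - u) ->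
  mo n (fun u => th (m u)) (fun u => m (th u)) ->
  raises n.-2 (fun u => phi u - phi' (th u)) -> mo n.-1 (fun u => phi u - phi' (th u)) del ->
  mo n (fun u => psi u - psi' u) (fun u => del (m2 u) - m2 (del u)).
Proof.
move=> pl pl' tl sl sl' dl sE sE' sr sr' p1 p1' t1 tm dr dE.
pose d u := phi u - phi' (th u).
have p0' := perturb_raises0 p1'; have t0 := perturb_raises0 t1.
apply: (mo_trans (f2 := fun u => psi (phi u) - psi' (phi' (th u)))).
  apply: moB; apply: mo_sym.
    have h : mo n (fun u => psi (phi u)) (fun u => psi u).
      by apply: (mo_cmp gM sl _ _ (@mo_refl _ _ n psi) (perturb_raises0 p1) sr p1); lia.
    exact: h.
  have pt : raises 1 (fun u => phi' (th u) - u).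
    apply: (mo_trans (f2 := fun u => phi' u)); last exact: p1'.
    by apply: (mo_cmp gM pl' _ _ (@mo_refl _ _ 1 phi') t0 p0' t1); lia.
  by apply: (mo_cmp gM sl' _ _ (@mo_refl _ _ n psi') (perturb_raises0 pt) sr' pt); lia.
apply: (mo_trans (f2 := fun u => d (m u) - m' (d u))).
  have H : raises n (fun u => phi' (th (m u) - m (th u))) by exact: (raises_cmp gM (leqnn n : (n <= 0 + n)%N) p0' tm).
  apply: (mo_trans (f2 := fun u => d (m u) - m' (d u) + phi' (th (m u) - m (th u)))).
    move=> i u Hu.
    have -> : psi (phi u) - psi' (phi' (th u)) =
      d (m u) - m' (d u) + phi' (th (m u) - m (th u)); last by rewrite subrr; exact: ordge00.
    rewrite sE sE' /d (linB pl') (linB ml').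
    move: (phi (m u)) (m' (phi u)) (phi' (m (th u))) (m' (phi' (th u))) (phi' (th (m u))) => a b c e f.
    by rewrite [a - f - _]addrAC addrA subrK !opprB !addrA [a - b + e]addrAC.
  by move=> i u Hu; rewrite [_ + phi' _ - _]addrAC subrr add0r; exact: H.
have dlr : raises n.-2 del.
  by apply: mo_raises (mo_sym _) dr; apply: (raises_le gM _ dE); lia.
apply: moB.
  by apply: (mo_cmp gM dl _ _ dE m_1 dlr m_2); lia.
by apply: (mo_cmp gM m2l _ _ m_2' dr m2_1 dE); lia.
Qed.

(** The failure of e phi to intertwine m and m' is z phi with z = e m' - m' e + e psi. Composition
    with the invertible phi does not affect orders, and inserting e = 1 + gam up to higher order
    reduces z to psin - [m2, gam]. *)
Lemma obs_extension phi h psi psin e gam : linear phi -> linear e -> linear gam -> linear psin ->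
  cancel h phi -> raises 0 phi -> raises 0 h ->
  (forall u, psi (phi u) = phi (m u) - m' (phi u)) -> raises n.-1 psi -> mo n psi psin ->
  raises n.-2 gam -> mo n.-1 e (fun u => u + gam u) ->
  raises n (fun u => e (phi (m u)) - m' (e (phi u))) <->
  raises n (fun u => psin u - (m2 (gam u) - gam (m2 u))).
Proof.
move=> pl el gl tl hp p0 h0 sE sr st gr eE.
pose z u := e (m' u) - m' (e u) + e (psi u).
have zx : mo n z (fun u => psin u - (m2 (gam u) - gam (m2 u))).
  have g0 : raises 0 gam by exact: raises_le gr.
  have e_id : mo 1 e id.
    apply: (mo_trans (f2 := fun u => u + gam u)); first by apply: (raises_le gM _ eE); lia.
    by move=> i u Hu; rewrite addrAC subrr add0r; apply: (raises_le gM _ gr Hu); lia.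
  have gl1 : linear (fun u => u + gam u) by move=> a u v; rewrite gl scalerDr addrACA.
  apply: (mo_trans (f2 := fun u => (m' u + gam (m' u)) - m' (u + gam u) + psin u)).
    apply: moD; first apply: moB.
    - have i0 : raises 0 (fun u => u + gam u).
        by apply: raisesD => // i u; rewrite addn0.
      by apply: (mo_cmp (a := n.-1) (b := 1) (c := 0) (d := n) gM gl1 _ _ eE m_1' i0 (@mo_refl _ _ n m')); lia.
    - have e0 : raises 0 e by apply: (mo_raises (h := id)); [exact: raises_le e_id|move=> i u; rewrite addn0].
      by apply: (mo_cmp (a := n) (b := 0) (c := 1) (d := n.-1) gM ml' _ _ (@mo_refl _ _ n m') e0 m_1' eE); lia.
    - have idl : linear (@id (pcar M)) by [].
      have i0 : raises 0 (@id (pcar M)) by move=> i u; rewrite addn0.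
      by apply: (mo_cmp (a := 1) (b := n.-1) (c := 0) (d := n) gM idl _ _ e_id sr i0 st); lia.
  have H : mo n (fun u => gam (m' u) - m' (gam u)) (fun u => gam (m2 u) - m2 (gam u)).
    apply: moB.
      by apply: (mo_cmp (a := n) (b := 1) (c := n.-2) (d := 2) gM gl _ _ (@mo_refl _ _ n gam) m_1' gr m_2'); lia.
    by apply: (mo_cmp (a := 2) (b := n.-2) (c := 1) (d := n) gM m2l _ _ m_2' gr m2_1 (@mo_refl _ _ n gam)); lia.
  move=> i u Hu; have := H i u Hu.
  have -> : m' u + gam (m' u) - m' (u + gam u) = gam (m' u) - m' (gam u).
    by rewrite (linD ml' u (gam u)) opprD addrACA subrr add0r.
  rewrite -[m2 (gam u) - gam (m2 u)]opprB.
  move: (gam (m' u) - m' (gam u)) (gam (m2 u) - m2 (gam u)) (psin u) => a b c.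
  by rewrite opprK [c + b]addrC opprD addrACA subrr addr0.
have ze u : e (phi (m u)) - m' (e (phi u)) = z (phi u).
  by rewrite /z sE (linB el) [RHS]addrC [RHS]addrA subrK.
have -> : (fun u => e (phi (m u)) - m' (e (phi u))) = fun u => z (phi u) by exact: funext.
split=> H; last first.
  exact: (raises_cmp gM (leq_addr _ _ : (n <= n + 0)%N) (mo_raises zx H) p0).
apply: (mo_raises (mo_sym zx)).
have -> : z = fun u => z (phi (h u)) by apply: funext => u; rewrite hp.
exact: (raises_cmp gM (leq_addr _ _) H h0).
Qed.
End Obstruction.

Section Endomorphisms.
Variables (K : evenRing) (V : fgmod).
Notation W := (susp_dual K V).
Notation lW := (lalg W).
Notation g := (pcar lW).
Notation brkg := (@brk K W).
Notation gg := (@lW_graded K V).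
Implicit Types (f h xi eta : g -> g) (x y : g).

Lemma endo_ord_shifts i f : (0 < i)%N -> endo_ord i f <-> shifts i.-1 f.
Proof.
move=> i0; split=> H j x Hx; have := H j x Hx.
  by have -> : (j + i).-1 = (j + i.-1)%N by lia.
by have -> : (j + i).-1 = (j + i.-1)%N by lia.
Qed.

Lemma endo_geP i f : (0 < i)%N -> endo_ge i f <-> clinear f /\ raises i.-1 f.
Proof.
move=> i0; have e j : (j + i).-1 = (j + i.-1)%N by lia.
split=> -[fc H]; (split; first exact: fc).
  by apply: (raisesP gg gg fc) => j x Hx; have := H j x Hx; rewrite e.
move=> j x Hx; rewrite e; apply: H; exact: (ordr_ordge gg).
Qed.

Lemma vfield_sum k a b (f_ : nat -> g -> g) : (forall i, (a <= i < b)%N -> vfield k (f_ i)) ->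
  vfield k (fun x => \sum_(a <= i < b) f_ i x).
Proof.
elim: b => [|b IH] H.
  have -> : (fun x => \sum_(a <= i < 0) f_ i x) = fun=> 0; last exact: vfield0.
  by apply: funext => x; rewrite big_geq.
have [ba|ab] := ltnP b a.
  have -> : (fun x => \sum_(a <= i < b.+1) f_ i x) = fun=> 0; last exact: vfield0.
  by apply: funext => x; rewrite big_geq.
have -> : (fun x => \sum_(a <= i < b.+1) f_ i x) = fun x => \sum_(a <= i < b) f_ i x + f_ b x.
  by apply: funext => x; rewrite big_nat_recr.
apply: vfieldD; last by apply: H; rewrite ab ltnSn.
by apply: IH => i /andP[ai ib]; apply: H; rewrite ai ltnS ltnW.
Qed.

Lemma raises_sum r a b (f_ : nat -> g -> g) : (forall i, (a <= i < b)%N -> raises r (f_ i)) ->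
  raises r (fun x => \sum_(a <= i < b) f_ i x).
Proof.
move=> H j x Hx; rewrite big_nat_cond.
apply: (big_ind (fun v => ordge (j + r)%N v)) => [|v v'|i /andP[Hi _]].
- exact: ordge00.
- exact: ordgeD.
- exact: H.
Qed.

(** With d = f - h one has d[x,y] = [dx,y] + [x,dy] + [dx, fy - y] + [hx - x, dy], and the last two
    terms have excess weight. *)
Lemma vfield_diff r f h : lie_hom f -> lie_hom h ->
  raises 1 (fun x => f x - x) -> raises 1 (fun x => h x - x) ->
  (forall j x, homog j x -> homog j (f x)) -> (forall j x, homog j x -> homog j (h x)) ->
  raises r (fun x => f x - h x) -> vfield 0 (scomp r (fun x => f x - h x)).
Proof.
move=> [fc fb] [hc hb] f1 h1 fh hh dr; have dc := clinB fc hc.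
have [dl _] := dc; have sc := scomp_clin gg gg r dl.
split; [exact: sc|move=> j x Hx|move=> j x y _].
  rewrite addr0; apply: homog_glue => n; rewrite (comp_scomp gg); case: ifP => _; last exact: homog0.
  by apply: homog_wpart; apply: homogB; [apply: fh|apply: hh]; exact: homog_wpart.
rewrite mul0r ksgn0 scale1r; pose d x := f x - h x; rewrite -/d in sc dl dr *.
apply: (brk_ext (f := fun x y => scomp r d (brkg x y))
    (h := fun x y => brkg (scomp r d x) y + brkg x (scomp r d y))) => [y1|y1|x1|x1|a b].
- exact: clin_comp sc (brk_clinl _).
- by apply: clinD; [exact: clin_comp (brk_clinl _) sc|exact: brk_clinl].
- exact: clin_comp sc (brk_clinr _).
- by apply: clinD; [exact: brk_clinr|exact: clin_comp (brk_clinr _) sc].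
have Ha := ordr_comp gg a x; have Hb := ordr_comp gg b y.
move: (wpart a x) (wpart b y) Ha Hb => {}x {}y Ha Hb.
have ga := ordr_ordge gg Ha; have gb := ordr_ordge gg Hb.
rewrite (scomp_ordr _ dl (brk_ordr Ha Hb)) (scomp_ordr _ dl Ha) (scomp_ordr _ dl Hb).
have -> : d (brkg x y) = brkg (d x) y + brkg x (d y) + (brkg (d x) (f y - y) + brkg (h x - x) (d y)).
  have e1 : brkg (f x) (f y) - brkg (h x) (h y) = brkg (d x) (f y) + brkg (h x) (d y).
    by rewrite (linB (brk_l (f y)) (f x) (h x)) (linB (@brk_r K V (h x)) (f y) (h y)) addrA subrK.
  have e2 : brkg (d x) (f y) = brkg (d x) y + brkg (d x) (f y - y).
    by rewrite -(linD (@brk_r K V (d x)) y (f y - y)) addrC subrK.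
  have e3 : brkg (h x) (d y) = brkg x (d y) + brkg (h x - x) (d y).
    by rewrite -(linD (brk_l (d y)) x (h x - x)) addrC subrK.
  have -> : d (brkg x y) = brkg (f x) (f y) - brkg (h x) (h y) by rewrite /d fb hb.
  by rewrite e1 e2 e3; exact: addrACA.
rewrite (linD (comp_lin gg _)) [X in _ + X](ordge_comp0 gg _ (a + b + r)%N (ltnSn _)); last first.
  apply: ordgeD.
    by apply: (ordge_le gg _ (brk_ordge (dr _ _ ga) (f1 _ _ gb))); lia.
  by apply: (ordge_le gg _ (brk_ordge (h1 _ _ ga) (dr _ _ gb))); lia.
rewrite addr0 (linD (comp_lin gg _)) addnAC (wpart_brkl _ _ Hb) addnAC -addnA (wpart_brkr _ _ Ha).
by [].
Qed.
End Endomorphisms.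

(** * The obstruction class *)

Section Structures.
Variables (K : evenRing) (A : frobenius K).
Notation V := (frob_mod A).
Notation W := (susp_dual K V).
Notation lW := (lalg W).
Notation R := (DR W).
Notation g := (pcar lW).
Notation gg := (@lW_graded K V).
Notation gR := (@R_graded K V).
Notation om := (frob_form A).
Notation w := (frob_deg A).
Notation m2 := (frob_m2 A).
Notation total := (@Defs.total K A).
Notation finv := (@Defs.finv K W).
Notation form := (@Defs.form K W).
Implicit Types (m : nat -> g -> g) (phi xi eta gam : g -> g).

Let omS : symplectic_form w om := frob_symplectic A.

Let om2 : ordr 2 om.
Proof. by have := frob_order A; apply: supp_sub => i c []. Qed.

Let m2v : vfield 1 m2. Proof. by case: (frob_m2_symplectic A). Qed.
Let m2L : lR 1 m2 om = 0. Proof. by rewrite -lRE; case: (frob_m2_symplectic A). Qed.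
Let m2s : shifts 1 m2. Proof. by apply/(endo_ord_shifts _ (isT : (0 < 2)%N)); exact: frob_m2_order. Qed.
Let m2c : clinear m2. Proof. by case: m2v. Qed.
Let m2l : linear m2. Proof. by case: m2c. Qed.
Let m2r : raises 1 m2. Proof. exact: (shifts_raises gg gg m2c m2s). Qed.

(** A structure is symplectic as a sum of its components. The tails [T j] are peeled off from below:
    m_j is the leading component of [T j], so it is symplectic by [lie_lead], and then so is the
    next tail. In particular the truncation is symplectic. *)
Lemma CnP n m : (3 <= n)%N -> Cn_structure n.+1 m ->
  [/\ vfield 1 (total n.+1 m), lR 1 (total n.+1 m) om = 0, raises 1 (total n.+1 m),
      mo 2 (total n.+1 m) m2 & raises n.+1 (fun x => total n.+1 m (total n.+1 m x))] /\
  [/\ forall x, total n.+1 m x = total n m x + m n x, vfield 1 (total n m),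
      lR 1 (total n m) om = 0 & raises n.-1 (m n)].
Proof.
move=> n3 [Hm [_ L0] sq m2E].
have mv i : (2 <= i < n.+1)%N -> vfield 1 (m i) by move=> /Hm[].
have ms i : (2 <= i < n.+1)%N -> shifts i.-1 (m i).
  by move=> Hi; have [_ /endo_ord_shifts] := Hm i Hi; apply; lia.
have mr i : (2 <= i < n.+1)%N -> raises i.-1 (m i).
  by move=> Hi; have [mc _ _] := mv i Hi; exact: (shifts_raises gg gg mc (ms i Hi)).
pose T j x := \sum_(j <= i < n.+1) m i x.
have Tv j : (2 <= j)%N -> vfield 1 (T j).
  by move=> j2; apply: vfield_sum => i /andP[ji iN]; apply: mv; rewrite iN (leq_trans j2).
have Tr j : (2 <= j)%N -> raises j.-1 (T j).
  move=> j2; apply: raises_sum => i /andP[ji iN].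
  by apply: (raises_le gg _ (mr i _)); lia.
have TS j : (j < n.+1)%N -> T j = fun x => m j x + T j.+1 x.
  by move=> jn; apply: funext => x; rewrite /T big_ltn.
have L2 : lR 1 (T 2) om = 0 by rewrite -lRE.
have TL j : (2 <= j <= n)%N -> lR 1 (T j) om = 0.
  elim: j => // j IH /andP[j2 jn]; have [->|j1] := eqVneq j.+1 2%N; first exact: L2.
  have j2' : (2 <= j)%N by lia.
  have Hj : lR 1 (m j) om = 0.
    apply: (lie_lead omS om2 (Tv j j2') (mv j _) (ms j _) _ (IH _)); try lia.
    rewrite (TS j); last by lia.
    move=> i x Hx; rewrite addrAC subrr add0r.
    by apply: (raises_le gg _ (Tr j.+1 _) Hx); lia.
  have -> : T j.+1 = fun x => T j x - m j x.
    by apply: funext => x; rewrite (TS j) ?[_ + T _ _ - _]addrAC ?subrr ?add0r //; lia.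
  rewrite (lR_B omS om (Tv j j2') (mv j _)); last by lia.
  by rewrite Hj IH ?subr0 //; lia.
have eM x : total n.+1 m x = total n m x + m n x by rewrite /total big_nat_recr //=; lia.
have Tn : T n = m n by apply: funext => x; rewrite /T big_nat1.
have eT : total n m = fun x => T 2 x - m n x.
  by apply: funext => x; rewrite -[T 2 x]/(total n.+1 m x) eM addrK.
split; split.
- exact: (Tv 2).
- exact: L2.
- exact: (Tr 2).
- rewrite -[total _ _]/(T 2) (TS 2) ?m2E; last by lia.
  by move=> i x Hx; rewrite addrAC subrr add0r; exact: (Tr 3).
- by have [_] := proj1 (endo_geP _ (isT : (0 < n.+2)%N)) sq.
- exact: eM.
- by rewrite eT; apply: vfieldB; [exact: (Tv 2)|apply: mv; lia].
- rewrite eT (lR_B omS om (Tv 2 _) (mv n _)) //; last by lia.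
  by rewrite L2 -Tn TL ?subr0 //; lia.
- by apply: mr; lia.
Qed.

Section Structure.
Variables (n : nat) (m m' : nat -> g -> g).
Hypothesis n3 : (3 <= n)%N.
Hypothesis Hm : Cn_structure n.+1 m.
Hypothesis Hm' : Cn_structure n.+1 m'.
Notation M := (total n.+1 m).
Notation M' := (total n.+1 m').
Notation pmor := (@pointed_Cn_morphism K A n m m').

Definition psi phi : g -> g := fun x => phi (M (finv phi x)) - M' x.
Definition psin phi : g -> g := scomp n.-1 (psi phi).

Lemma pmorP phi : pmor phi ->
  [/\ lie_hom phi, raises 1 (fun x => phi x - x), forall j x, homog j x -> homog j (phi x),
      cancel phi (finv phi) & cancel (finv phi) phi] /\
  [/\ lie_hom (finv phi), raises 0 phi, raises 0 (finv phi),
      forall j x, homog j x -> homog j (finv phi x) & symplecto om phi].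
Proof.
move=> [pp [sp _]]; have [dp hp _] := sp; have [lh c1 c2] := finvP dp; have [lp _] := dp.
have p1 := pointed_raises pp; have [[pl _] _] := lp.
split; split; [exact: lp|exact: p1|exact: hp|exact: c1|exact: c2|exact: lh| | | |exact: sp].
- apply: (mo_raises (h := id)); first exact: (raises_le gg _ p1).
  by move=> i x; rewrite addn0.
- exact: inv_raises0 c2 p1.
- exact: inv_homog c2 p1 pl hp.
Qed.

Lemma psiP phi : pmor phi ->
  [/\ vfield 1 (psi phi), lR 1 (psi phi) om = 0, raises n.-1 (psi phi)
    & forall x, psi phi (phi x) = phi (M x) - M' (phi x)].
Proof.
move=> Hp; have [[lp p1 hp c1 c2] [lh p0 h0 hh sp]] := pmorP Hp.
have [[Mv ML M1 M2 MM] [eM mbv mbL mr]] := CnP n3 Hm.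
have [[Mv' ML' M1' M2' MM'] [eM' mbv' mbL' mr']] := CnP n3 Hm'.
have cv := vfield_conj lp lh c2 hp hh Mv.
have sE x : psi phi (phi x) = phi (M x) - M' (phi x) by rewrite /psi c1.
split; [exact: (vfieldB cv Mv')| | |exact: sE].
  rewrite (lR_B omS om cv Mv') ML' subr0; exact: (symplectic_conj omS sp c1 Mv ML cv).
have [_ [_ ge]] := Hp; have [_ er] := proj1 (endo_geP _ (leq_trans (isT : 0 < 3)%N n3)) ge.
have [[pl _] _] := lp.
have E : raises n.-1 (fun x => psi phi (phi x)).
  (* phi intertwines the truncated structures up to order n, and the extra components m_n and m'_n
     have order n themselves. *)
  have -> : (fun x => psi phi (phi x)) =
     fun x => (phi (total n m x) - total n m' (phi x)) + (phi (m n x) - m' n (phi x)).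
    by apply: funext => x; rewrite sE eM eM' (linD pl) opprD addrACA.
  apply: raisesD => //; apply: raisesB.
    by apply: (raises_cmp gg _ p0 mr); lia.
  by apply: (raises_cmp gg _ mr' p0); lia.
have -> : psi phi = fun x => psi phi (phi (finv phi x)) by apply: funext => x; rewrite c2.
by apply: (raises_cmp gg _ E h0); lia.
Qed.

Lemma psinP phi : pmor phi ->
  [/\ vfield 1 (psin phi), lR 1 (psin phi) om = 0, shifts n.-1 (psin phi) & mo n (psi phi) (psin phi)].
Proof.
move=> /psiP[sv sL sr _]; have [sc _ _] := sv; have [sl _] := sc.
have tv : vfield 1 (psin phi) by exact: vfield_scomp.
have ts : shifts n.-1 (psin phi) by exact: (scomp_shifts gg gg).
have st : mo n.-1.+1 (psi phi) (psin phi) by exact: (scomp_raises gg gg).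
split; [exact: tv|exact: (lie_lead omS om2 sv tv ts st sL)|exact: ts|].
have e : n.-1.+1 = n by lia.
rewrite e in st; exact: st.
Qed.

(** psi - psin has order at least n + 1, so its Hamiltonian starts in weight n + 2; that of psin
    sits in weight 2 + (n - 1) = n + 1, the component extracted by [obs]. *)
Lemma obsE phi : pmor phi -> obs n m m' phi = hamil w om 1 (psin phi).
Proof.
move=> Hp; have [sv sL sr _] := psiP Hp; have [tv tL ts st] := psinP Hp.
have -> : obs n m m' phi = wpart n.+1 (Upsilon_inv w om 1 (psi phi)) by rewrite wpartE.
rewrite (Upsilon_invE omS); last by split; [exact: sv|rewrite lRE].
have H1 := hamil_raises omS (ordr_ordge gR om2) (vfieldB sv tv) st.
have H2 := hamil_shifts omS om2 tv ts.
rewrite (hamil_B omS sv tv) in H1.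
have e : (2 + n.-1)%N = n.+1 by lia. rewrite e in H2.
have := ordge_comp0 gR H1 n.+1; rewrite (linB (comp_lin gR _)) (ordr_fix gR H2) => h.
by apply: subr0_eq; apply: h; lia.
Qed.

Lemma formo_order p a k (u : pcar R) : form p a u -> ordr (k + p)%N u -> formo p a k u.
Proof.
move=> Fu Hu; rewrite -(ordr_fix gR Hu).
apply: supp_sub (supp_comp gR (k + p)%N _ Fu) => [i c [[H1 H2] H3]|i]; first by split.
by split=> //; exact: gpart0.
Qed.

Lemma obs_CC phi : pmor phi -> @CCHarr K A n.+1 w (obs n m m' phi).
Proof.
move=> Hp; have [tv tL ts st] := psinP Hp; rewrite obsE //.
apply: formo_order; first by rewrite addrC; exact: (hamil_form omS tv).
by rewrite addn0; have := hamil_shifts omS om2 tv ts; have -> : (2 + n.-1)%N = n.+1 by lia.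
Qed.

Lemma hamil0 k : hamil w om k (fun=> 0) = 0.
Proof.
have -> : (fun=> 0) = (fun x => (0 : g) - 0) :> (g -> g) by apply: funext => x; rewrite subrr.
by rewrite (hamil_B omS (vfield0 K V k) (vfield0 K V k)) subrr.
Qed.

Lemma obs_Z phi : pmor phi -> @ZHarr K A n.+1 w (obs n m m' phi).
Proof.
move=> Hp; split; first exact: obs_CC.
have [[lp p1 hp c1 c2] [lh p0 h0 hh sp]] := pmorP Hp.
have [tv tL ts st] := psinP Hp; have [sv sL sr _] := psiP Hp.
have [[Mv ML M1 M2 MM] _] := CnP n3 Hm; have [[Mv' ML' M1' M2' MM'] _] := CnP n3 Hm'.
rewrite obsE // lRE (hamil_ebrk omS m2v m2L tv tL).
have -> : ebrk 1 1 m2 (psin phi) = fun=> 0; last exact: hamil0.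
have [tc _ _] := tv; have [tl _] := tc.
have e x : ebrk 1 1 m2 (psin phi) x = m2 (psin phi x) + psin phi (m2 x).
  by rewrite /ebrk mulr1 ksgn1 scaleN1r opprK.
have ec : clinear (fun x => m2 (psin phi x) + psin phi (m2 x)).
  by apply: clinD; [exact: clin_comp m2c tc|exact: clin_comp tc m2c].
(* m2 psin + psin m2 shifts weights by exactly n, whereas [obs_cocycle] says that it raises them by
   n + 1. *)
apply: funext => x; rewrite e; apply: (shifts_raises0 gg gg (r := n) x ec).
  move=> i y Hy; apply: ordrD.
    by have := m2s (ts _ _ Hy); have -> : (i + n.-1 + 1)%N = (i + n)%N by lia.
  by have := ts _ _ (m2s Hy); have -> : (i + 1 + n.-1)%N = (i + n)%N by lia.
have [[pl _] _] := lp; have [[hl _] _] := lh; have [[[sl _] _ _] [[Ml' _] _ _]] := (sv, Mv').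
exact: (obs_cocycle gg n3 Ml' m2l M1' m2r M2' pl hl sl tl c1 p0 h0 (fun=> erefl) sr st MM MM').
Qed.

(** f is formed with the truncated structure but has to commute with the full one. Writing mbar for
    the truncation, both f M and M f agree with mbar eta mbar up to the order considered, because
    mbar M and M mbar are negligible. *)
Lemma gauge_field eta (f := ebrk 1 (-1) (total n m) eta) : symplectic_vfield om (-1) eta ->
  [/\ vfield 0 f, raises 1 f, lR 0 f om = 0 & mo n (fun x => f (M x)) (fun x => M (f x))].
Proof.
rewrite /symplectic_vfield lRE => -[ev eL].
have [[Mv ML M1 M2 MM] [eM mbv mbL mr]] := CnP n3 Hm.
have fv : vfield 0 f by exact: (vfield_ebrk mbv ev).
have fE x : f x = total n m (eta x) + eta (total n m x).
  by rewrite /f /ebrk mul1r ksgnN ksgn1 scaleN1r opprK.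
have [[Ml _] _ _] := Mv; have [[el _] _ _] := ev; have [[ml _] _ _] := mbv.
have e0 := vfield_raises ev.
have mE : total n m = fun x => M x - m n x by apply: funext => x; rewrite eM addrK.
have m1 : raises 1 (total n m).
  rewrite mE; apply: raisesB => //; apply: (raises_le gg _ mr); lia.
have mM : mo n.-1 M (total n m) by move=> i x Hx; rewrite eM addrAC subrr add0r; exact: mr.
split; first exact: fv.
- have -> : f = fun x => total n m (eta x) + eta (total n m x) by exact: funext.
  apply: raisesD; first exact: (raises_cmp gg _ m1 e0).
  exact: (raises_cmp gg _ e0 m1).
- rewrite -(lR_lR omS om mbv ev) mbL eL (lin0 (lR_lin omS mbv)) (lin0 (lR_lin omS ev)).
  by rewrite scaler0 subr0.
have mo_mm : mo n (fun x => total n m (M x)) (fun=> 0).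
  apply: (mo_trans (f2 := fun x => M (M x))); last first.
    by apply/mo0; apply: (raises_le gg _ MM); lia.
  by apply: mo_sym; apply: (mo_cmp gg ml _ _ mM M1 m1 (@mo_refl _ _ n M)); lia.
have mo_mm' : mo n (fun x => M (total n m x)) (fun=> 0).
  apply: (mo_trans (f2 := fun x => M (M x))); last first.
    by apply/mo0; apply: (raises_le gg _ MM); lia.
  by apply: mo_sym; apply: (mo_cmp gg Ml _ _ (@mo_refl _ _ n M) M1 M1 mM); lia.
have em1 : raises 1 (fun x => eta (total n m x)) by exact: (raises_cmp gg _ e0 m1).
have me1 : raises 1 (fun x => total n m (eta x)) by exact: (raises_cmp gg _ m1 e0).
have mel : linear (fun x => total n m (eta x)) by move=> a u v; rewrite el ml.
pose mid x := total n m (eta (total n m x)).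
apply: (mo_trans (f2 := mid)).
  have H : mo n (fun x => total n m (eta (M x)) + eta (total n m (M x))) (fun x => mid x + 0).
    apply: moD.
      by apply: (mo_cmp gg mel _ _ (@mo_refl _ _ n _) M1 me1 mM); lia.
    apply/mo0; exact: (raises_cmp gg (leqnn n : (n <= 0 + n)%N) e0 (proj1 (mo0 _ _) mo_mm)).
  by move=> i x Hx; have := H i x Hx; rewrite fE addr0.
apply: mo_sym.
have H : mo n (fun x => M (total n m (eta x)) + M (eta (total n m x))) (fun x => 0 + mid x).
  apply: moD.
    apply/mo0; exact: (raises_cmp gg (leq_addr _ _ : (n <= n + 0)%N) (proj1 (mo0 _ _) mo_mm') e0).
  by apply: (mo_cmp gg ml _ _ mM em1 m1 (@mo_refl _ _ n _)); lia.
by move=> i x Hx; have := H i x Hx; rewrite fE add0r (linD Ml).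
Qed.

Lemma CCHarr_lin i j c (a b : pcar R) : gpart 0 c -> @CCHarr K A i j a -> @CCHarr K A i j b ->
  @CCHarr K A i j (c *: a + b).
Proof.
move=> gc Ha Hb; apply: suppD Hb => [k|k x y [x1 x2 x3] [y1 y2 y3]|].
- by split=> //; exact: gpart0.
- split=> [h|//|h]; [by rewrite x1 ?y1 ?subrr|exact: gpartB|by rewrite x3 ?y3 ?subrr].
- apply: suppZ Ha => k x [x1 x2 x3]; split=> [h||h]; [by rewrite x1 ?mulr0|exact: gpart0M|by rewrite x3 ?mulr0].
Qed.

Lemma hamil_CC r k xi : vfield k xi -> shifts r xi -> @CCHarr K A (2 + r)%N (k + w - 1) (hamil w om k xi).
Proof.
move=> Hx Hs; apply: formo_order; first by rewrite subrK; exact: (hamil_form omS Hx).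
by rewrite addn0; exact: (hamil_shifts omS om2 Hx Hs).
Qed.

Lemma obs_homotopic phi phi' : pmor phi -> pmor phi' -> homotopic n (total n m) phi phi' ->
  @BHarr K A n.+1 w (obs n m m' phi - obs n m m' phi').
Proof.
move=> Hp Hp' [eta Heta ge].
have [fv f1 fL fM] := gauge_field Heta; set f := ebrk 1 (-1) (total n m) eta in fv f1 fL fM ge.
have [[lp p1 hp c1 c2] [lh p0 h0 hh sp]] := pmorP Hp.
have [[lp' p1' hp' c1' c2'] [lh' p0' h0' hh' sp']] := pmorP Hp'.
have [sv sL sr sE] := psiP Hp; have [tv tL ts st] := psinP Hp.
have [sv' sL' sr' sE'] := psiP Hp'; have [tv' tL' ts' st'] := psinP Hp'.
have [[Mv ML M1 M2 MM] _] := CnP n3 Hm; have [[Mv' ML' M1' M2' MM'] _] := CnP n3 Hm'.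
have [[fl _] _ _] := fv; have [[Ml _] _ _] := Mv; have [[Ml' _] _ _] := Mv'.
have [[sl _] _ _] := sv; have [[sl' _] _ _] := sv'.
have [[pl _] _] := lp; have [[pl' _] _] := lp'.
have thl := expo_lin gg fl f1; have th1 := expo_raises1 gg f1; have th0 := expo_raises0 gg f1.
have [thc thb] := expo_lie_hom omS fv f1.
have ge' : endo_ge n.-1 (fun x => phi x - phi' (expo f x)).
  have -> : (fun x => phi x - phi' (expo f x)) = fun x => phi x - phi' (fexp f x).
    by apply: funext => x; rewrite (fexp_expo x fl f1).
  exact: ge.
have [dc dr] := proj1 (endo_geP _ (ltac:(lia) : (0 < n.-1)%N)) ge'.
have [dl _] := dc.
pose del := scomp n.-2 (fun x => phi x - phi' (expo f x)).
have delr : mo n.-1 (fun x => phi x - phi' (expo f x)) del.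
  by have := scomp_raises gg gg dc dr; have -> : n.-2.+1 = n.-1 by lia.
have dels : shifts n.-2 del by exact: (scomp_shifts gg gg).
have p1th : raises 1 (fun x => phi' (expo f x) - x).
  apply: (mo_trans (f2 := phi')); last exact: p1'.
  by apply: (mo_cmp gg pl' _ _ (@mo_refl _ _ 1 phi') th0 p0' th1).
have lth : lie_hom (fun x => phi' (expo f x)).
  have [pc' pb'] := lp'; split; first exact: clin_comp pc' thc.
  by move=> x y; rewrite thb pb'.
have delv : vfield 0 del.
  apply: (vfield_diff lp lth p1 p1th hp _ dr) => j x Hx.
  by apply: hp'; exact: (expo_homog fv f1).
have delL : lR 0 del om = 0.
  apply: (symplectic_diff omS om2 sp sp' p1 p1' fv f1 fL delv dels).
  by have -> : n.-2.+1 = n.-1 by lia.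
have [delc _ _] := delv; have [dell _] := delc.
have H := obs_homotopy gg n3 Ml' m2l M1 m2r M2 M2' pl pl' thl sl sl' dell sE sE' sr sr' p1 p1' th1
  (expo_comm gg fl Ml f1 (vfield_raises Mv) fM) dr delr.
have bv : vfield 1 (ebrk 1 0 m2 del) by have := vfield_ebrk m2v delv; rewrite addr0.
have bE x : ebrk 1 0 m2 del x = m2 (del x) - del (m2 x) by rewrite /ebrk mulr0 ksgn0 scale1r.
have E : (fun x => psin phi' x - psin phi x) = ebrk 1 0 m2 del.
  have dv := vfieldB (vfieldB tv' tv) bv.
  apply: funext => x; apply: subr0_eq.
  apply: (shifts_raises0 gg gg (r := n.-1) (f := fun x => psin phi' x - psin phi x - ebrk 1 0 m2 del x)).
  - by have [] := dv.
  - move=> i y Hy; apply: ordrB; first by apply: ordrB; [exact: ts'|exact: ts].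
    rewrite bE; apply: ordrB.
      by have := m2s (dels _ _ Hy); have -> : (i + n.-2 + 1)%N = (i + n.-1)%N by lia.
    by have := dels _ _ (m2s Hy); have -> : (i + 1 + n.-2)%N = (i + n.-1)%N by lia.
  have -> : n.-1.+1 = n by lia.
  apply: (mo_trans (f2 := fun x => psi phi' x - psi phi x)).
    by apply: moB; exact: mo_sym.
  move=> i y Hy; have Hiy := mo_sym H Hy.
  by rewrite bE -[psi phi' y - _]opprB -[m2 _ - _]opprB opprK addrC.
(* The sign arises because [m_2, del] equals psi'_n - psi_n, while the difference of cocycles is
   taken in the opposite order; the summand 0 fits the form of [CCHarr_lin]. *)
exists (-1 *: hamil w om 0 del + 0).
  apply: CCHarr_lin; first exact/gpartN/gpart1.
    have := hamil_CC delv dels; rewrite add0r; have -> : (2 + n.-2)%N = n.+1.-1 by lia.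
    by [].
  by apply: supp0 => k; split=> //; exact: gpart0.
rewrite lRE addr0 scaleN1r (linN (lR_lin omS m2v)) (hamil_ebrk omS m2v m2L delv delL) addr0 -E.
by rewrite (hamil_B omS tv' tv) opprB !obsE.
Qed.

Lemma cR0 k (u : pcar R) : cR k (fun=> 0 : g) u = 0.
Proof.
have -> : (fun=> 0) = (fun x => (0 : g) - 0) :> (g -> g) by apply: funext => x; rewrite subrr.
by rewrite (cR_B omS u (vfield0 K V k) (vfield0 K V k)) subrr.
Qed.

(** A converse to [cR_raises]: if i_xi om starts later than expected, the leading component of [xi]
    contracts om to zero and vanishes by injectivity of [Phi]. *)
Lemma raises_Phi k r xi : vfield k xi -> raises r xi -> ordge (2 + r.+1)%N (cR k xi om) ->
  raises r.+1 xi.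
Proof.
move=> Hx Hr Ho; have [xc _ _] := Hx; have [xl _] := xc.
have Hs := vfield_scomp r Hx; have ss := scomp_shifts gg gg r xl.
have st := scomp_raises gg gg xc Hr.
have H1 := cR_raises omS (vfieldB Hx Hs) st (ordr_ordge gR om2).
have H2 := cR_shifts omS Hs ss om2.
rewrite (cR_B omS om Hx Hs) in H1.
have e : scomp r xi = fun=> 0.
  apply: (Phi_inj omS Hs (vfield0 K V k)); rewrite cR0.
  have := ordge_comp0 gR (ordgeB Ho H1) (2 + r)%N; rewrite opprB addrC subrK (ordr_fix gR H2).
  by apply; lia.
by move=> i x Hi; have := st i x Hi; rewrite e subr0.
Qed.

(** [raises_Phi] removes the lower components one at a time, starting from [vfield_raises]; then
    [xi] and its component of order r + 1 have the same image under [Phi]. *)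
Lemma shifts_Phi k r xi : vfield k xi -> ordr (2 + r)%N (cR k xi om) -> shifts r xi.
Proof.
move=> Hx Ho; have [xc _ _] := Hx; have [xl _] := xc.
have Hr s : (s <= r)%N -> raises s xi.
  elim: s => [_|s IH sr]; first exact: (vfield_raises Hx).
  apply: (raises_Phi Hx (IH (ltnW sr))).
  by apply: (ordge_le gR _ (ordr_ordge gR Ho)); rewrite leq_add2l.
have Hs := vfield_scomp r Hx; have ss := scomp_shifts gg gg r xl.
have st := scomp_raises gg gg xc (Hr r (leqnn r)).
have H1 := cR_raises omS (vfieldB Hx Hs) st (ordr_ordge gR om2).
rewrite (cR_B omS om Hx Hs) in H1.
have H2 := ordrB Ho (cR_shifts omS Hs ss om2).
have -> // : xi = scomp r xi.
apply: (Phi_inj omS Hx Hs); apply: subr0_eq.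
have := ordge_comp0 gR H1 (2 + r)%N; rewrite (ordr_fix gR H2).
by apply; lia.
Qed.

(** The field is the preimage under [Phi] of (-1)^w d be; it is symplectic since that 1-form is
    closed, and it inherits a pure order by [shifts_Phi]. *)
Lemma hamil_preimage i (be : pcar R) : (2 <= i)%N -> @CCHarr K A i (w - 1) be ->
  exists gam, [/\ vfield 0 gam, lR 0 gam om = 0, shifts (i - 2) gam & be = hamil w om 0 gam].
Proof.
move=> i2; rewrite /CCHarr subrK => Hb.
have Fb : form 0 w be by apply: supp_sub Hb => k c [].
have Ob : ordr i be by apply: supp_sub Hb => k c [_ _]; rewrite addn0.
have Fd : form 1 (0 + w) (ksgn K w *: dR be).
  rewrite add0r; apply: suppZ (dR_form omS Fb) => k c [h1 h2].
  by split=> [h|]; [rewrite h1 ?mulr0|apply: gpart0M => //; exact: gpart_ksgn].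
have [_ _ /(_ 0)[_ _]] := omS; rewrite /Phi cRE => /(_ _ Fd)[gam Hg eg].
have e : dR be = ksgn K (0 + w) *: cR 0 gam om.
  by rewrite eg add0r scalerA ksgn_sq scale1r.
have gL : lR 0 gam om = 0.
  by apply/(contr_closed omS Hg); rewrite eg (linZ (dR_lin omS)) (dR_dR omS) scaler0.
exists gam; split=> //.
  apply: (shifts_Phi Hg); rewrite eg; have -> : (2 + (i - 2))%N = i by lia.
  by apply: ordrZ; have := dR_shifts omS Ob; rewrite addn0.
by apply: (hamil_eq omS Hg gL _ e); rewrite add0r.
Qed.

(** [obs_extension] yields a congruence; it is an equality because [psin phi] and [m2, gam] both
    have pure order n. *)
Lemma extension_eq phi gam : pmor phi -> vfield 0 gam -> lR 0 gam om = 0 -> shifts n.-2 gam ->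
  Cn_morphism n.+1 M M' (fexp gam \o phi) <-> psin phi = ebrk 1 0 m2 gam.
Proof.
move=> Hp Hg gL gs; have [gc _ _] := Hg; have [gl _] := gc.
have gr : raises n.-2 gam by exact: (shifts_raises gg gg).
have g1 : raises 1 gam by apply: (raises_le gg _ gr); lia.
have [[lp p1 hp c1 c2] [lh p0 h0 hh sp]] := pmorP Hp.
have [sv sL sr sE] := psiP Hp; have [tv tL ts st] := psinP Hp.
have [[Mv ML M1 M2 MM] _] := CnP n3 Hm; have [[Mv' ML' M1' M2' MM'] _] := CnP n3 Hm'.
have [pc pb] := lp; have [pl _] := pc; have [tc _ _] := tv; have [tl _] := tc.
have [Mc _ _] := Mv; have [Mc' _ _] := Mv'; have [Ml' _] := Mc'; have [sc _ _] := sv; have [sl _] := sc.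
have ec := expo_clin gg gl g1; have [el _] := ec.
have eE : mo n.-1 (expo gam) (fun x => x + gam x).
  have n2 : (0 < n.-2)%N by lia.
  by apply: (raises_le gg _ (expo_mo gg n2 gr)); lia.
have -> : fexp gam \o phi = fun x => expo gam (phi x).
  by apply: funext => x /=; rewrite (fexp_expo (phi x) gl g1).
have key := obs_extension gg n3 Ml' m2l M1' m2r M2' pl el gl tl c2 p0 h0 sE sr st gr eE.
have bE x : ebrk 1 0 m2 gam x = m2 (gam x) - gam (m2 x) by rewrite /ebrk mulr0 ksgn0 scale1r.
have se := symplecto_expo omS Hg g1 gL sp.
split=> [[_ /(endo_geP _ (ltn0Sn n))[_ /key H]]|e].
  apply: funext => x; apply: subr0_eq; rewrite bE.
  apply: (shifts_raises0 gg gg (r := n.-1) (f := fun x => psin phi x - (m2 (gam x) - gam (m2 x)))).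
  - by apply: clinB tc (clinB (clin_comp m2c gc) (clin_comp gc m2c)).
  - move=> i y Hy; apply: ordrB; first exact: ts.
    apply: ordrB.
      by have := m2s (gs _ _ Hy); have -> : (i + n.-2 + 1)%N = (i + n.-1)%N by lia.
    by have := gs _ _ (m2s Hy); have -> : (i + 1 + n.-2)%N = (i + n.-1)%N by lia.
  by have -> : n.-1.+1 = n by lia.
split; first exact: se.
apply/(endo_geP _ (ltn0Sn n)); split.
  by apply: clinB; [exact: clin_comp ec (clin_comp pc Mc)|exact: clin_comp Mc' (clin_comp ec pc)].
apply/key => i x _; rewrite e bE subrr; exact: ordge00.
Qed.

(** An extension by gam exhibits obs(phi) as the coboundary of the Hamiltonian of gam. Conversely, a
    bounding cochain is the Hamiltonian of some gam, and [hamil_inj] recovers the equation between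
    fields. *)
Lemma extendableP phi : pmor phi ->
  extendable n m m' phi <-> @BHarr K A n.+1 w (obs n m m' phi).
Proof.
move=> Hp; have [tv tL ts st] := psinP Hp; rewrite (obsE Hp).
have n1 : (0 < n.-1)%N by lia.
split=> [[gam [[Hg gL] go hC]]|[be Hb]].
  rewrite lRE in gL; have gs := proj1 (endo_ord_shifts gam n1) go.
  have e := proj1 (extension_eq Hp Hg gL gs) hC.
  exists (hamil w om 0 gam).
    have := hamil_CC Hg gs; rewrite add0r; have -> : (2 + n.-2)%N = n.+1.-1 by lia.
    by [].
  by rewrite lRE (hamil_ebrk omS m2v m2L Hg gL) addr0 e.
have [gam [Hg gL gs ->]] := hamil_preimage (ltac:(lia) : (2 <= n.+1.-1)%N) Hb.
rewrite lRE (hamil_ebrk omS m2v m2L Hg gL) addr0 => e.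
have gs' : shifts n.-2 gam by move: gs; rewrite subn2.
have bv : vfield 1 (ebrk 1 0 m2 gam) by have := vfield_ebrk m2v Hg; rewrite addr0.
have bL : lR 1 (ebrk 1 0 m2 gam) om = 0.
  rewrite -[1]addr0 -(lR_lR omS om m2v Hg) m2L gL (lin0 (lR_lin omS m2v)) (lin0 (lR_lin omS Hg)).
  by rewrite scaler0 subr0.
exists gam; split.
- by split; [exact: Hg|rewrite lRE].
- exact/(endo_ord_shifts gam n1).
- by apply/(extension_eq Hp Hg gL gs'); apply/esym/(hamil_inj omS bv bL tv tL).
Qed.

Lemma BHarr_lin i j c (a b : pcar R) : gpart 0 c -> @BHarr K A i j a -> @BHarr K A i j b ->
  @BHarr K A i j (c *: a + b).
Proof.
move=> gc [x Hx <-] [y Hy <-]; exists (c *: x + y); first exact: CCHarr_lin.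
by rewrite lRE (lR_lin omS m2v).
Qed.

Lemma BHarr0 i j : @BHarr K A i j 0.
Proof.
exists 0; last by rewrite lRE (lin0 (lR_lin omS m2v)).
by apply: supp0 => k; split=> //; exact: gpart0.
Qed.

Lemma classes_inj (T : Type) (S : set T) (r : T -> T -> Prop) (C D : classes S r) :
  sval C = sval D -> C = D.
Proof.
case: C D => [C pC] [D pD] /= e; case: _ / e in pD *.
by congr exist; exact: Prop_irrelevance.
Qed.

Lemma HCclass_eq i j (a b : pcar R) (ha : @ZHarr K A i j a) (hb : @ZHarr K A i j b) :
  HCclass ha = HCclass hb <-> @BHarr K A i j (a - b).
Proof.
have g1 : gpart 0 (1 : K) by exact: gpart1.
have gN : gpart 0 (-1 : K) by exact/gpartN/gpart1.
split=> [e|H].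
  have : sval (HCclass ha) a by split=> //; rewrite /cohomologous subrr; exact: BHarr0.
  by rewrite e => -[].
apply: classes_inj => /=; apply/seteqP; split=> y [Zy By]; split=> //; rewrite /cohomologous in By *.
  by have := BHarr_lin g1 By H; rewrite scale1r addrA subrK.
have := BHarr_lin gN H By; rewrite scaleN1r opprB addrC addrA subrK.
by [].
Qed.

(** [classes] accepts an arbitrary relation, so reflexivity is needed to place a morphism in its own
    class; the zero field serves as eta. *)
Lemma homotopic_refl phi : pmor phi -> homotopic n (total n m) phi phi.
Proof.
move=> Hp; have [[[pc _] p1 _ _ _] _] := pmorP Hp.
have H0 : symplectic_vfield om (-1) (fun=> 0 : g).
  split; first exact: vfield0.
  rewrite lRE; have [_ ->] := lR_leib omS (vfield0 K V (-1)).
  by rewrite !cR0 (lin0 (dR_lin omS)) scaler0 addr0.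
have [fv f1 fL fM] := gauge_field H0; have [[fl _] _ _] := fv.
exists (fun=> 0) => //.
have -> : (fun x => phi x - phi (fexp (ebrk 1 (-1) (total n m) (fun=> 0)) x)) = fun=> 0.
  apply: funext => x; rewrite (fexp_expo x fl f1) (expo_fix gg fl f1) ?subrr //.
  have [_ [_ [[ml _] _ _] _ _]] := CnP n3 Hm.
  by rewrite /ebrk (lin0 ml) scaler0 subrr.
by split=> [|i x _]; [exact: clin0|exact: ordge00].
Qed.

Definition obs_class (c : SM n m m') : HCHarr A n.+1 w :=
  let: exist2 phi hphi _ := cid2 (proj2_sig c) in HCclass (obs_Z hphi).

(** The chosen representative lies in its own class, which is the class of [phi]; hence it is
    homotopic to [phi], and homotopic morphisms have cohomologous obstructions. *)
Lemma obs_classE phi (hphi : pmor phi) : obs_class (SMclass hphi) = HCclass (obs_Z hphi).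
Proof.
rewrite /obs_class; case: cid2 => psi hpsi /= e; apply/HCclass_eq.
apply: (obs_homotopic hpsi hphi).
have : [set y | pmor y /\ homotopic n (total n m) y psi] psi by split=> //; exact: homotopic_refl.
by rewrite -e => -[].
Qed.

End Structure.
End Structures.

Theorem theorem12p14 (K : evenRing) (A : frobenius K) (n : nat) (hn : (3 <= n)%N)
    (m m' : nat -> pcar (lalg (frob_W A)) -> pcar (lalg (frob_W A)))
    (hm : Cn_structure n.+1 m) (hm' : Cn_structure n.+1 m') :
  exists obs_n : SM n m m' -> HCHarr A n.+1 (frob_deg A),
    [/\ forall phi (hphi : pointed_Cn_morphism n m m' phi),
          exists hobs : ZHarr n.+1 (frob_deg A) (obs n m m' phi),
            obs_n (SMclass hphi) = HCclass hobs,
        forall phi (hphi : pointed_Cn_morphism n m m' phi),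
          extendable n m m' phi <->
          obs_n (SMclass hphi) = HCclass (ZHarr0 A n.+1 (frob_deg A))
      & [set c | exists phi (hphi : pointed_Cn_morphism n m m' phi),
                   c = SMclass hphi /\ extendable n m m' phi] =
        [set c | obs_n c = HCclass (ZHarr0 A n.+1 (frob_deg A))]].
Proof.
exists (obs_class hn hm hm').
have ext phi (hphi : pointed_Cn_morphism n m m' phi) : extendable n m m' phi <->
    obs_class hn hm hm' (SMclass hphi) = HCclass (ZHarr0 A n.+1 (frob_deg A)).
  by rewrite obs_classE HCclass_eq subr0; exact: (extendableP hn hm hm' hphi).
split; [|exact: ext|].
  by move=> phi hphi; exists (obs_Z hn hm hm' hphi); exact: obs_classE.
apply/seteqP; split=> c /=.
  by move=> [phi [hphi [-> /(proj1 (ext phi hphi))]]].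
move=> e; have [phi hphi ec] := proj2_sig c.
have ec' : c = SMclass hphi by exact: classes_inj.
by exists phi, hphi; split=> //; apply/(ext phi hphi); rewrite -ec'.
Qed.
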